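(* Let $\Omega \subset \mathbb{R}^2$ be an open convex set. Let the anisotropy be given by the function $\phi(x, \xi) = \|\xi\|_p$, where $1 < p < \infty$. Let $E$ be a $\phi$-minimal set with respect to $\Omega$, i.e. $\chi_E$ is a function of $\phi$-least gradient in $\Omega$. Then every connected component of $\partial E$ is a line segment.
   Context: $\|(x,y)\|_p = (|x|^p + |y|^p)^{1/p}$. For $u \in BV(\Omega)$ the $\phi$-total variation is $\int_\Omega |Du|_\phi = \int_\Omega \phi(x, \nu^u(x))\, d|Du|$, where $\nu^u = \frac{dDu}{d|Du|}$ is the Radon–Nikodym derivative. A function $u \in BV(\Omega)$ is of $\phi$-least gradient in $\Omega$ if $\int_\Omega |Du|_\phi \leq \int_\Omega |D(u+v)|_\phi$ for every $v \in BV(\Omega)$ with compact support in $\Omega$. The boundary $\partial E$ is the topological boundary in $\Omega$, where $E$ is represented (after modification on a Lebesgue-null set) so that $\partial E = \{x \in \Omega : 0 < |E \cap B(x,r)| < |B(x,r)| \text{ for all sufficiently small } r > 0\}$. *)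

(* Defs.v *)
From HB Require Import structures.
From mathcomp Require Import all_boot all_order all_algebra.
From mathcomp Require Import all_classical all_reals all_analysis.
From mathcomp Require Import ring.

Set Implicit Arguments.
Unset Strict Implicit.
Unset Printing Implicit Defensive.

Import Order.TTheory GRing.Theory Num.Theory numFieldNormedType.Exports.

Local Open Scope classical_set_scope.
Local Open Scope ring_scope.

Definition pnorm (R : realType) (p : R) (z : R * R) : R :=
  (`|z.1| `^ p + `|z.2| `^ p) `^ p^-1.

Definition enorm (R : realType) (z : R * R) : R :=
  Num.sqrt (z.1 ^+ 2 + z.2 ^+ 2).

Section enorm_theory.
Context (R : realType).
Implicit Types x y z : R * R.

Lemma enorm_ge0 z : 0 <= enorm z.
Proof. exact: sqrtr_ge0. Qed.

Lemma enorm0 : enorm (0 : R * R) = 0.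
Proof. by rewrite /enorm /= !expr0n /= addr0 sqrtr0. Qed.

Lemma enormD x y : enorm (x + y) <= enorm x + enorm y.
Proof.
case: x y => a b [c e]; rewrite /enorm /=.
have sqD0 (s t : R) : 0 <= s ^+ 2 + t ^+ 2 by rewrite addr_ge0 ?sqr_ge0.
set S := Num.sqrt (a ^+ 2 + b ^+ 2); set T := Num.sqrt (c ^+ 2 + e ^+ 2).
have ST : 0 <= S + T by rewrite addr_ge0 ?sqrtr_ge0.
rewrite -[leRHS]ger0_norm// -sqrtr_sqr ler_sqrt ?sqr_ge0//.
have -> : (S + T) ^+ 2 = S ^+ 2 + T ^+ 2 + (S * T) *+ 2 by rewrite sqrrD addrAC.
rewrite !sqr_sqrtr//.
have cs : a * c + b * e <= S * T.
  rewrite /S /T -sqrtrM// (le_trans (ler_norm _))// -sqrtr_sqr ler_sqrt ?mulr_ge0//.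
  rewrite -subr_ge0.
  have -> : (a ^+ 2 + b ^+ 2) * (c ^+ 2 + e ^+ 2) - (a * c + b * e) ^+ 2 =
    (a * e - b * c) ^+ 2 by ring.
  exact: sqr_ge0.
have -> : (a + c) ^+ 2 + (b + e) ^+ 2 =
  a ^+ 2 + b ^+ 2 + (c ^+ 2 + e ^+ 2) + (a * c + b * e) *+ 2 by ring.
by rewrite lerD2l lerMn2r.
Qed.

Lemma enorm_le_abs z : enorm z <= `|z.1| + `|z.2|.
Proof.
rewrite /enorm -[leRHS]ger0_norm ?addr_ge0// -sqrtr_sqr ler_sqrt ?sqr_ge0//.
by rewrite sqrrD !real_normK ?num_real// addrAC lerDl mulrn_wge0// mulr_ge0.
Qed.

End enorm_theory.

(* The variation |D|(A) = sup { sum_k |D(F k)| : (F k) a countable measurable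
   partition of A } of a vector measure D = (D1, D2). The maximum with 0 only
   gives a value to non-measurable A, which have no such partition. *)
Section vector_variation.
Local Open Scope ereal_scope.
Context d (T : measurableType d) (R : realType).
Variables D1 D2 : {charge set T -> \bar R}.

Definition vnorm (A : set T) : \bar R :=
  (enorm (fine (D1 A), fine (D2 A)))%:E.

Definition measurable_partition (A : set T) (F : (set T)^nat) :=
  [/\ forall k, measurable (F k), trivIset setT F & \bigcup_k F k = A].

Definition vector_variation (A : set T) : \bar R :=
  maxe 0 (ereal_sup
    [set \sum_(0 <= k <oo) vnorm (F k) | F in measurable_partition A]).

Local Notation tv := vector_variation.

Let vnorm_ge0 A : 0 <= vnorm A.
Proof. by rewrite lee_fin enorm_ge0. Qed.

Let vnorm0 : vnorm set0 = 0.
Proof. by rewrite /vnorm !charge0 /= -/(0%R : R * R)%type enorm0. Qed.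

Let tv_ge0 A : 0 <= tv A.
Proof. by rewrite /tv le_max lexx. Qed.

Let tv_ub A F : measurable_partition A F -> \sum_(0 <= k <oo) vnorm (F k) <= tv A.
Proof.
by move=> AF; rewrite /tv le_max; apply/orP; right; apply: ereal_sup_ubound; exists F.
Qed.

Let tv_le A y : 0 <= y ->
  (forall F, measurable_partition A F -> \sum_(0 <= k <oo) vnorm (F k) <= y) ->
  tv A <= y.
Proof.
move=> y0 Fy; rewrite /tv ge_max y0/=; apply: ge_ereal_sup => _ [F AF <-].
exact: Fy.
Qed.

Let tv0 : tv set0 = 0.
Proof.
apply/eqP; rewrite eq_le tv_ge0 andbT; apply: tv_le => // F [_ _ F0].
rewrite eseries0// => k _ _; suff -> : F k = set0 by exact: vnorm0.
by apply/seteqP; split => // x Fx; rewrite -F0; exists k.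
Qed.

Let vnorm_cover A F : measurable A -> measurable_partition A F ->
  vnorm A <= \sum_(0 <= k <oo) vnorm (F k).
Proof.
move=> mA [mF tF FA].
have mU : measurable (\bigcup_k F k) by rewrite FA.
have fD (D : {charge set T -> \bar R}) n :
    fine (\sum_(0 <= k < n) D (F k)) = (\sum_(0 <= k < n) fine (D (F k)))%R.
  elim: n => [|n ih]; first by rewrite !big_geq.
  rewrite !big_nat_recr//= fineD ?ih// ?sum_fin_num//.
    by apply/allP => x /mapP[k _ ->]; exact: fin_num_measure.
  exact: fin_num_measure.
have cD (D : {charge set T -> \bar R}) :
    (\sum_(0 <= k < n) fine (D (F k)))%R @[n --> \oo] --> fine (D A).
  under eq_fun do rewrite -fD.
  apply: fine_cvg; rewrite fineK ?fin_num_measure// -FA.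
  exact: charge_semi_sigma_additive.
have cE : (enorm (\sum_(0 <= k < n) fine (D1 (F k)),
                  \sum_(0 <= k < n) fine (D2 (F k))))%R @[n --> \oo] -->
          enorm (fine (D1 A), fine (D2 A)).
  rewrite /enorm /=; apply: continuous_cvg; first exact: sqrt_continuous.
  by apply: cvgD; rewrite expr2; under eq_fun do rewrite expr2; apply: cvgM; exact: cD.
have cE' : (enorm (\sum_(0 <= k < n) fine (D1 (F k)),
                  \sum_(0 <= k < n) fine (D2 (F k))))%:E @[n --> \oo] --> vnorm A.
  by apply: cvg_EFin => //; exact: nearW.
rewrite -(cvg_lim _ cE')//; apply: lee_lim.
- by apply/cvg_ex; exists (vnorm A).
- exact: is_cvg_nneseries.
- apply: nearW => n; elim: n => [|n ih].
    by rewrite !big_geq// -/(0%R : R * R)%type enorm0.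
  rewrite !big_nat_recr//=; apply: le_trans (leeD2r _ ih).
  by rewrite -EFinD lee_fin (enormD (_, _) (_, _)).
Qed.

Let tv_super A B : A `&` B = set0 -> measurable A -> measurable B ->
  tv A + tv B <= tv (A `|` B).
Proof.
move=> AB0 mA mB.
have key F G : measurable_partition A F -> measurable_partition B G ->
    \sum_(0 <= k <oo) vnorm (F k) + \sum_(0 <= k <oo) vnorm (G k) <= tv (A `|` B).
  move=> [mF tF FA] [mG tG GB].
  pose H k := if odd k then G k./2 else F k./2.
  have HAB : measurable_partition (A `|` B) H.
    split.
    - by move=> k; rewrite /H; case: ifP.
    - have FG i j x : F i x -> G j x -> False.
        move=> Fx Gx; suff : (A `&` B) x by rewrite AB0.
        by split; [rewrite -FA; exists i|rewrite -GB; exists j].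
      have oh i j : odd i = odd j -> i./2 = j./2 -> i = j.
        by move=> oij hij; rewrite -(odd_double_half i) oij hij odd_double_half.
      move=> i j _ _ [x []]; rewrite /H.
      case: ifPn => oi; case: ifPn => oj Hi Hj.
      + by apply: oh; [rewrite oi oj|apply: tG => //; exists x].
      + by case: (FG _ _ _ Hj Hi).
      + by case: (FG _ _ _ Hi Hj).
      + by apply: oh; [rewrite (negbTE oi) (negbTE oj)|apply: tF => //; exists x].
    - apply/seteqP; split => x.
        move=> [k _]; rewrite /H; case: ifP => _ Hx.
          by right; rewrite -GB; exists k./2.
        by left; rewrite -FA; exists k./2.
      move=> [|]; rewrite -?FA -?GB => -[k _ Hx].
        by exists k.*2 => //; rewrite /H odd_double doubleK.
      by exists k.*2.+1 => //; rewrite /H /= odd_double /= uphalf_double.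
  apply: le_trans (tv_ub HAB); rewrite -nneseriesD//.
  apply: lime_le; first by apply: is_cvg_nneseries => *; rewrite adde_ge0.
  apply: nearW => n.
  have -> : \sum_(0 <= k < n) (vnorm (F k) + vnorm (G k)) =
            \sum_(0 <= k < n.*2) vnorm (H k).
    elim: n => [|n ih]; first by rewrite !big_geq.
    rewrite big_nat_recr// ih doubleS !big_nat_recr//= addeA.
    by rewrite /H /= odd_double /= doubleK uphalf_double.
  exact: nneseries_lim_ge.
have sgl C : measurable C ->
    measurable_partition C (fun k => if k == 0%N then C else set0).
  move=> mC; split; first by case=> [|k] /=.
  - by move=> [|i] [|j] _ _ [x []].
  - by apply/seteqP; split => [x [[|k] _]//|x Cx]; exists 0%N.
have [->|fAB] := eqVneq (tv (A `|` B)) +oo; first exact: leey.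
have sA F : measurable_partition A F ->
    \sum_(0 <= k <oo) vnorm (F k) <= tv (A `|` B).
  move=> AF; apply: le_trans (key _ _ AF (sgl _ mB)).
  by rewrite leeDl// nneseries_ge0.
have sB G : measurable_partition B G ->
    \sum_(0 <= k <oo) vnorm (G k) <= tv (A `|` B).
  move=> BG; apply: le_trans (key _ _ (sgl _ mA) BG).
  by rewrite leeDr// nneseries_ge0.
have fin x : 0 <= x -> x <= tv (A `|` B) -> x \is a fin_num.
  by move=> x0 xAB; rewrite ge0_fin_numE// (le_lt_trans xAB)// ltey.
have fA : tv A \is a fin_num by apply: fin => //; exact: tv_le.
rewrite addeC -leeBrDr//; apply: tv_le => [|G BG].
  by rewrite leeBrDr// add0e; exact: tv_le.
have fG : \sum_(0 <= k <oo) vnorm (G k) \is a fin_num.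
  by apply: fin; [exact: nneseries_ge0|exact: sB].
rewrite leeBrDr// addeC -leeBrDr//; apply: tv_le => [|F AF].
  by rewrite leeBrDr// add0e; exact: sB.
by rewrite leeBrDr//; exact: key.
Qed.

Let tv_le_setU A B : A `&` B = set0 -> measurable A -> measurable B ->
  tv A <= tv (A `|` B).
Proof. by move=> *; apply: le_trans (tv_super _ _ _) => //; rewrite leeDl. Qed.

Let tv_sigma_additive : semi_sigma_additive tv.
Proof.
move=> F mF tF mUF.
have cvgF : cvgn (fun n => \sum_(0 <= i < n) tv (F i)) by exact: is_cvg_nneseries.
suff <- : \sum_(0 <= i <oo) tv (F i) = tv (\bigcup_n F n) by [].
apply/eqP; rewrite eq_le; apply/andP; split.
  apply: lime_le => //; apply: nearW => n.
  have mU m : measurable (\big[setU/set0]_(0 <= i < m) F i).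
    by apply: bigsetU_measurable => *; exact: mF.
  apply: (@le_trans _ _ (tv (\big[setU/set0]_(0 <= i < n) F i))).
    elim: n => [|n ih]; first by rewrite !big_geq.
    rewrite !big_nat_recr//=; apply: (le_trans (leeD2r _ ih)).
    apply: tv_super => //; rewrite big_mkord.
    apply/seteqP; split => // x []; rewrite -bigcup_mkord => -[i /= ltin Fix] Fnx.
    by move: ltin; rewrite (tF i n _ _ (ex_intro _ x (conj Fix Fnx)))// ltnn.
  have -> : \bigcup_n F n = \big[setU/set0]_(0 <= i < n) F i `|`
      (\bigcup_n F n `\` \big[setU/set0]_(0 <= i < n) F i).
    rewrite setDUK// big_mkord -bigcup_mkord.
    by move=> x [i _ Fx]; exists i.
  by apply: tv_le_setU => //; [rewrite setDIK|exact: measurableD].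
apply: tv_le => [|G [mG tG GU]]; first exact: nneseries_ge0.
have GF k : vnorm (G k) <= \sum_(0 <= i <oo) vnorm (G k `&` F i).
  apply: vnorm_cover => //; split.
  - by move=> i; exact: measurableI.
  - exact: trivIset_setIl.
  - by rewrite -setI_bigcupr -GU; apply/setIidl => x Gx; exists k.
apply: (@le_trans _ _ (\sum_(0 <= k <oo) \sum_(0 <= i <oo) vnorm (G k `&` F i))).
  by apply: lee_nneseries => *; [|exact: GF].
rewrite nneseries_interchange//; apply: lee_nneseries => [*|i _].
  exact: nneseries_ge0.
apply: tv_ub; split.
- by move=> k; exact: measurableI.
- exact: trivIset_setIr.
- by rewrite -setI_bigcupl GU; apply/setIidr => x Fx; exists i.
Qed.

HB.instance Definition _ := isMeasure.Build _ _ _ vector_variation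
  tv0 tv_ge0 tv_sigma_additive.

Let tv_fin : fin_num_fun vector_variation.
Proof.
move=> A mA; have [P1 [N1 h1]] := Hahn_decomposition D1.
have [P2 [N2 h2]] := Hahn_decomposition D2.
set m1 := charge_variation h1; set m2 := charge_variation h2.
rewrite ge0_fin_numE//; apply: (@le_lt_trans _ _ (m1 A + m2 A)); last first.
  by rewrite ltey_eq fin_numD !fin_num_measure.
apply: tv_le => [|F [mF tF FA]]; first by rewrite adde_ge0.
have mE (m : {measure set T -> \bar R}) : m A = \sum_(0 <= k <oo) m (F k).
  by rewrite -FA measure_bigcup//; apply: eq_eseriesl => k; rewrite in_setT.
have -> : m1 A + m2 A = \sum_(0 <= k <oo) m1 (F k) + \sum_(0 <= k <oo) m2 (F k).
  by congr (_ + _); exact: mE.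
rewrite -nneseriesD//.
apply: lee_nneseries => [//|k _].
apply: (@le_trans _ _ (`|D1 (F k)| + `|D2 (F k)|)); last first.
  by apply: leeD; exact: abse_charge_variation.
rewrite -(fineK (fin_num_measure D1 _ (mF k))) -(fineK (fin_num_measure D2 _ (mF k))).
by rewrite -EFinD lee_fin; exact: enorm_le_abs.
Qed.

HB.instance Definition _ := Measure_isFinite.Build _ _ _ vector_variation tv_fin.

End vector_variation.

(* int f d nu for a signed measure nu, through a Hahn decomposition; the value
   does not depend on which one is picked. *)
Definition charge_integral d (T : measurableType d) (R : realType)
    (nu : {charge set T -> \bar R}) (f : T -> R) : \bar R :=
  let hP := cid (Hahn_decomposition nu) in
  let hN := cid (svalP hP) in
  (\int[jordan_pos (svalP hN)]_x (f x)%:E -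
   \int[jordan_neg (svalP hN)]_x (f x)%:E)%E.

Section bounded_variation.
Context (R : realType).
Local Notation plane := (R * R)%type.
(* The carrier on which product measures of lebesgue_measure live; it is
   convertible to the plane, with convertible measurable sets. *)
Local Notation mplane := (measurableTypeR R * measurableTypeR R)%type.
Implicit Types (Omega E K : set plane) (u v psi : plane -> R).

Definition lebesgue2 : {measure set mplane -> \bar R} :=
  (@lebesgue_measure R \x @lebesgue_measure R)%E.

Definition e1 : plane := (1, 0).
Definition e2 : plane := (0, 1).

Definition C1c Omega psi :=
  [/\ forall x e, e = e1 \/ e = e2 -> derivable psi x e,
      forall e, e = e1 \/ e = e2 -> continuous (fun x => 'D_e psi x) &
      exists K, [/\ compact K, K `<=` Omega & forall x, ~ K x -> psi x = 0]].

(* Measures on Omega are seen as measures on the plane that vanish outside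
   Omega, so that the distributional derivative is unique. *)
Definition is_weak_derivative Omega u (e : plane)
    (D : {charge set mplane -> \bar R}) :=
  (forall A, measurable A -> A `&` Omega = set0 -> D A = 0%E) /\
  (forall psi, C1c Omega psi ->
    (\int[lebesgue2]_(x in Omega) (u x * 'D_e psi x)%:E =
     - charge_integral D psi)%E).

Definition is_gradient Omega u
    (D : {charge set mplane -> \bar R} * {charge set mplane -> \bar R}) :=
  is_weak_derivative Omega u e1 D.1 /\ is_weak_derivative Omega u e2 D.2.

Definition BV Omega u :=
  lebesgue2.-integrable Omega (EFin \o u) /\ exists D, is_gradient Omega u D.

Definition gradient Omega u :
    {charge set mplane -> \bar R} * {charge set mplane -> \bar R} :=
  match pselect (exists D, is_gradient Omega u D) with
  | left uD => sval (cid uD)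
  | right _ => (czero : {charge set mplane -> \bar R},
                czero : {charge set mplane -> \bar R})
  end.

Definition gradient_variation Omega u :
    {finite_measure set mplane -> \bar R} :=
  vector_variation (gradient Omega u).1 (gradient Omega u).2.

Definition gradient_direction Omega u (x : plane) : plane :=
  (fine (Radon_Nikodym (gradient Omega u).1 (gradient_variation Omega u) x),
   fine (Radon_Nikodym (gradient Omega u).2 (gradient_variation Omega u) x)).

Definition phi_variation (phi : plane -> plane -> R) Omega u : \bar R :=
  (\int[gradient_variation Omega u]_(x in Omega)
     (phi x (gradient_direction Omega u x))%:E)%E.

(* Compact support of an a.e.-class of functions. *)
Definition compact_support_in Omega v :=
  exists K, [/\ compact K, K `<=` Omega &
    {ae lebesgue2, forall x, Omega x -> ~ K x -> v x = 0}].

Definition least_gradient (phi : plane -> plane -> R) Omega u :=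
  BV Omega u /\
  forall v, BV Omega v -> compact_support_in Omega v ->
    (phi_variation phi Omega u <= phi_variation phi Omega (u \+ v)%R)%E.

Definition minimal_set (phi : plane -> plane -> R) Omega E :=
  least_gradient phi Omega (\1_E : plane -> R).

(* Euclidean, unlike the library's ball on a product, which is a square. *)
Definition eball (x : plane) (r : R) : set plane :=
  [set y | enorm (y - x) < r].

Definition boundary_in Omega E : set plane :=
  Omega `&` closure (Omega `&` E) `&` closure (Omega `\` E).

Definition measure_boundary_in Omega E : set plane :=
  [set x | Omega x /\
    \forall r \near 0^'+, (0 < lebesgue2 (E `&` eball x r))%E /\
      (lebesgue2 (E `&` eball x r) < lebesgue2 (eball x r))%E].

(* A nondegenerate segment, with or without its endpoints: a segment of the
   boundary relative to an open set has its endpoints outside that set. *)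
Definition line_segment (S : set plane) :=
  exists a b : plane, [/\ a != b,
    [set (1 - t) *: a + t *: b | t in `]0, 1[%classic] `<=` S &
    S `<=` [set (1 - t) *: a + t *: b | t in `[0, 1]%classic]].

End bounded_variation.

(* Main.v *)
(** Competitors u + eta (g - u), with eta a cutoff and g of class C1 with values in
[0, 1], turn the minimality of u = 1_E into
<<
  int eta |Du|_p <= int eta |grad g|_p + |u - g| |grad eta|_p
>>
and letting g tend to the indicator of a half plane H, calibrated by the dual vector
of its normal n0, bounds the defect of Du from being positively parallel to n0 by the
distance between the traces of E and H. The balls used here are homothetic copies of
a pentagon circumscribed about the unit ball of the p-norm. Its perimeter is less than
8, so that the comparison with g = 0 and g = 1 gives an energy less than 4 R on the
pentagon of size R. Hence for many radii the trace of E on the boundary of the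
pentagon jumps fewer than four times: it is the indicator of an arc, that is, the trace
of the half plane cut off by a chord. By strict convexity of the p-norm Du is then
positively parallel to n0 inside, E is monotone under translations, and its boundary
there is a straight line.

An energy less than 2 R leaves no jump at all and hence no boundary. This lower density
bound excludes rays in the boundary, since the distance to the complement of the convex
set Omega does not decrease along such a ray. A component of the boundary is therefore
a bounded chord of Omega. *)
Require Import Defs.
From HB Require Import structures.
From mathcomp Require Import all_boot all_order all_algebra.
From mathcomp Require Import all_classical all_reals all_analysis.
From mathcomp Require Import measurable_realfun ring lra.

Set Implicit Arguments.
Unset Strict Implicit.
Unset Printing Implicit Defensive.

Import Order.TTheory GRing.Theory Num.Theory numFieldNormedType.Exports.

Local Open Scope classical_set_scope.
Local Open Scope ring_scope.

(** Traces are made pointwise, without a trace theorem or the coarea formula. For a direction [e],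
    the averages of [|1_E(x + t e) - 1_E(x)|] over [0 < t < 2^-(k+1)] have local integrals bounded
    by a multiple of [2^-(k+1)]. Their sum over [k] is therefore finite at almost every [x], and
    there the averages tend to 0. By Fubini this happens on almost every pentagon, whose boundary
    can then carry the plain restriction of [1_E] as a trace. The corners are a null set for a fixed
    centre; for their sake the centre is moved as well.

    Jumps are counted by difference quotients at the same scales. The flat sides provide affine
    coordinates, size and position along the side, in which the mean of the count over the sizes is
    at most the energy. The constant is exactly 1 because the pentagon contains the unit ball; the
    price is a longer perimeter. Four is the threshold because a closed curve is crossed an even
    number of times.

    A half plane whose boundary line contains a side of the pentagon has no useful trace there, but
    then the flux through that side vanishes identically. *)

Section plane_topology.
Context {R : realType}.
Local Notation plane := (R * R)%type.
Local Notation mplane := (measurableTypeR R * measurableTypeR R)%type.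

Lemma open_plane_box (U : set plane) (x : plane) : open U -> U x ->
  exists2 e : R, 0 < e & forall y : plane,
    `|y.1 - x.1| < e -> `|y.2 - x.2| < e -> U y.
Proof.
move=> oU Ux; have /nbhs_ballP[e /= e0 He] : nbhs x U by exact: open_nbhs_nbhs.
exists e => // y h1 h2; apply: He; rewrite /ball/= /prod_ball /ball/=.
by split; rewrite -opprB normrN.
Qed.

Definition cbox (c : plane) (r : R) : set plane :=
  [set y | `|y.1 - c.1| <= r /\ `|y.2 - c.2| <= r].

Lemma cboxE c r : cbox c r = `[c.1 - r, c.1 + r]%classic `*` `[c.2 - r, c.2 + r]%classic.
Proof.
by apply/seteqP; split => [[x y]|[x y]] /=; rewrite /cbox/= !in_itv/= !ler_distl.
Qed.

Lemma compact_cbox c r : compact (cbox c r).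
Proof. by rewrite cboxE; apply: compact_setX; exact: segment_compact. Qed.

Lemma measurable_cbox c r : measurable (cbox c r : set mplane).
Proof. by rewrite cboxE; apply: measurableX. Qed.

(** Boxes with rational centre and radius [1/(n+1)] are enumerated by [unpickle]; [P] selects those
    whose closed box lies in [U]. The covering is by open boxes, on which the bumps below are
    positive. *)
Lemma open_box_cover (U : set plane) : open U ->
  exists (c : nat -> plane) (r : nat -> R) (P : nat -> bool),
    (forall k, P k -> 0 < r k /\ cbox (c k) (r k) `<=` U) /\
    (forall x, U x -> exists k, [/\ P k, `|x.1 - (c k).1| < r k & `|x.2 - (c k).2| < r k]).
Proof.
move=> oU.
pose d (k : nat) : rat * rat * nat := odflt (0, 0, 0%N) (unpickle k).
pose c k : plane := (ratr (d k).1.1, ratr (d k).1.2).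
pose r k : R := (d k).2.+1%:R^-1.
exists c, r, (fun k => `[< cbox (c k) (r k) `<=` U >]); split.
  by move=> k /asboolP; split => //; rewrite /r invr_gt0.
move=> x Ux; have [e e0 He] := open_plane_box oU Ux.
(* Half of [e]: the rational centre is within [1/(n+1)] of [x], and the box adds the same amount
   once more. *)
have [n hn] : exists n : nat, n.+1%:R^-1 < e / 2.
  exists (Num.truncn (e / 2)^-1); rewrite invf_plt ?posrE ?divr_gt0//.
  by apply: Num.Theory.truncnS_gt.
have n0 : 0 < n.+1%:R^-1 :> R by rewrite invr_gt0.
have rat_near (a : R) : exists q : rat, `|a - ratr q| < n.+1%:R^-1.
  move: n0; set dl : R := n.+1%:R^-1 => n0.
  have [q] := @rat_in_itvoo R (a - dl) (a + dl) ltac:(lra).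
  rewrite in_itv/= => /andP[h1 h2]; exists q; rewrite ltr_distl; apply/andP; split; lra.
have [q1 h1] := rat_near x.1; have [q2 h2] := rat_near x.2.
exists (pickle (q1, q2, n)).
have -> : c (pickle (q1, q2, n)) = (ratr q1, ratr q2) by rewrite /c /d pickleK.
have -> : r (pickle (q1, q2, n)) = n.+1%:R^-1 by rewrite /r /d pickleK.
split => //=; apply/asboolP => y [/=]; move: hn h1 h2; set dl : R := n.+1%:R^-1 => hn h1 h2 k1 k2; apply: He.
  have := ler_distD (ratr q1) y.1 x.1; rewrite [`|ratr q1 - _|]distrC => ?; lra.
have := ler_distD (ratr q2) y.2 x.2; rewrite [`|ratr q2 - _|]distrC => ?; lra.
Qed.

Lemma open_plane_measurable (U : set plane) : open U -> measurable (U : set mplane).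
Proof.
move=> oU; have [c [r [P [H1 H2]]]] := open_box_cover oU.
have -> : U = \bigcup_(k in [set k | P k]) cbox (c k) (r k).
  apply/seteqP; split => [x Ux|x [k Pk]]; last by apply: (H1 k Pk).2.
  by have [k [Pk h1 h2]] := H2 x Ux; exists k => //; split; exact: ltW.
by apply: bigcup_measurable => k _; exact: measurable_cbox.
Qed.

Lemma continuous_plane_measurable (f : plane -> R) : continuous f ->
  measurable_fun [set: mplane] (f : mplane -> R).
Proof.
move=> cf; apply: (measurability _ (RGenOpens.measurableE R)) => _ [_ [a [b ->] <-]].
rewrite setTI; apply: open_plane_measurable.
by move/continuousP : cf; apply; exact: interval_open.
Qed.

End plane_topology.

(** * Functions of class C1 on the plane *)

Section quadratic_error.
Context {R : realType}.

(** A quadratic Taylor error determines the directional derivative. For piecewise quadratic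
    functions this avoids a discussion at the breakpoints. *)
Lemma is_derive_quad (V : normedModType R) (f : V -> R) (x v : V) (d C : R) :
  (forall h : R, `|f (h *: v + x) - f x - h * d| <= C * h ^+ 2) ->
  is_derive x v f d.
Proof.
move=> H.
have C0 : 0 <= C.
  by have := H 1; rewrite expr1n mulr1 => /(le_trans _); apply; exact: normr_ge0.
have cv : (fun h : R => h^-1 *: (f (h *: v + x) - f x)) @ 0^' --> d.
  apply/cvgrPdist_le => e e0; near=> h.
  have h0 : h != 0 by near: h; exact: nbhs_dnbhs_neq.
  have -> : d - h^-1 *: (f (h *: v + x) - f x) = - (h^-1 * (f (h *: v + x) - f x - h * d)).
    by rewrite /GRing.scale/=; field.
  rewrite normrN normrM normfV.
  apply: (@le_trans _ _ (C * `|h|)).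
    rewrite ler_pdivrMl ?normr_gt0//.
    by apply: (le_trans (H h)); rewrite -real_normK ?num_real//; rewrite le_eqVlt; apply/orP; left; apply/eqP; ring.
  apply: (@le_trans _ _ ((C + 1) * `|h|)); first by rewrite ler_wpM2r// lerDl.
  rewrite mulrC -ler_pdivlMr; last by rewrite ltr_wpDl.
  near: h; apply: dnbhs0_le; rewrite divr_gt0//; first by rewrite ltr_wpDl.
by split; [apply/cvg_ex; exists d|exact/cvg_lim].
Unshelve. all: by end_near. Qed.

(** The square of the positive part, a C1 function vanishing on a half line. All bumps, steps and
    cutoffs below are built from it by affine substitution, sums and products. *)
Definition possq (t : R) : R := (Num.max t 0) ^+ 2.

Lemma possq_quad (t h : R) :
  `|possq (t + h) - possq t - h * (2 * Num.max t 0)| <= h ^+ 2.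
Proof.
rewrite /possq ler_norml.
case: (leP (t + h) 0) => h1; case: (leP t 0) => h2; apply/andP; split; nra.
Qed.

Lemma possq_ge0 t : 0 <= possq t. Proof. exact: sqr_ge0. Qed.

Lemma continuous_possq : continuous possq.
Proof.
move=> t; have c : continuous (fun t : R => Num.max t 0).
  by move=> x; apply: continuous_max; [exact: cvg_id|exact: cvg_cst].
have -> : possq = (fun t : R => Num.max t 0 * Num.max t 0).
  by apply/funext => x; rewrite /possq expr2.
by apply: cvgM; exact: c.
Qed.

End quadratic_error.

Section smooth_functions.
Context {R : realType}.
Local Notation plane := (R * R)%type.
Local Notation mplane := (measurableTypeR R * measurableTypeR R)%type.

(** The partial derivatives are explicit functions, and the derivative exists in every direction,
    not only along the axes: translations along arbitrary vectors will be differentiated. *)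
Definition C1 (f fx fy : plane -> R) :=
  [/\ continuous f, continuous fx, continuous fy &
    forall x v : plane, is_derive x v f (v.1 * fx x + v.2 * fy x)].

Lemma C1_cst c : C1 (fun=> c) (fun=> 0) (fun=> 0).
Proof.
split; try by move=> x; exact: cvg_cst.
by move=> x v; rewrite !mulr0 addr0; exact: is_derive_cst.
Qed.

Lemma C1D f fx fy g gx gy : C1 f fx fy -> C1 g gx gy ->
  C1 (fun x => f x + g x) (fun x => fx x + gx x) (fun x => fy x + gy x).
Proof.
move=> [f0 f1 f2 fd] [g0 g1 g2 gd]; split.
- by move=> x; apply: cvgD; [exact: f0|exact: g0].
- by move=> x; apply: cvgD; [exact: f1|exact: g1].
- by move=> x; apply: cvgD; [exact: f2|exact: g2].
move=> x v; have -> : v.1 * (fx x + gx x) + v.2 * (fy x + gy x) =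
  (v.1 * fx x + v.2 * fy x) + (v.1 * gx x + v.2 * gy x) by ring.
by have := @is_deriveD _ _ _ f g x v _ _ (fd x v) (gd x v).
Qed.

Lemma C1M f fx fy g gx gy : C1 f fx fy -> C1 g gx gy ->
  C1 (fun x => f x * g x) (fun x => fx x * g x + f x * gx x)
     (fun x => fy x * g x + f x * gy x).
Proof.
move=> [f0 f1 f2 fd] [g0 g1 g2 gd]; split.
- by move=> x; apply: cvgM; [exact: f0|exact: g0].
- by move=> x; apply: cvgD; apply: cvgM; [exact: f1|exact: g0|exact: f0|exact: g1].
- by move=> x; apply: cvgD; apply: cvgM; [exact: f2|exact: g0|exact: f0|exact: g2].
move=> x v; have H := @is_deriveM _ _ f g x v _ _ (fd x v) (gd x v).
rewrite [X in is_derive _ _ _ X](_ : _ = f x * (v.1 * gx x + v.2 * gy x) + g x * (v.1 * fx x + v.2 * fy x)); last by ring.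
exact: H.
Qed.

Lemma C1Z c f fx fy : C1 f fx fy ->
  C1 (fun x => c * f x) (fun x => c * fx x) (fun x => c * fy x).
Proof.
move=> H; have := C1M (C1_cst c) H.
by under [X in C1 _ X]eq_fun do rewrite mul0r add0r;
   under [X in C1 _ _ X]eq_fun do rewrite mul0r add0r.
Qed.

Lemma C1B f fx fy g gx gy : C1 f fx fy -> C1 g gx gy ->
  C1 (fun x => f x - g x) (fun x => fx x - gx x) (fun x => fy x - gy x).
Proof.
move=> H1 /(C1Z (-1)) H2; have := C1D H1 H2.
by under eq_fun do rewrite mulN1r; under [X in C1 _ X]eq_fun do rewrite mulN1r;
   under [X in C1 _ _ X]eq_fun do rewrite mulN1r.
Qed.

Lemma continuous_affine2 (a b c : R) : continuous (fun x : plane => a * x.1 + b * x.2 + c).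
Proof.
move=> x; apply: cvgD; last exact: cvg_cst.
apply: cvgD; apply: cvgM; try exact: cvg_cst; [exact: cvg_fst|exact: cvg_snd].
Qed.

Lemma C1_possq (a b c : R) :
  let l (x : plane) := a * x.1 + b * x.2 + c in
  C1 (fun x => possq (l x)) (fun x => a * (2 * Num.max (l x) 0))
    (fun x => b * (2 * Num.max (l x) 0)).
Proof.
move=> l.
have cl : continuous l by exact: continuous_affine2.
have cm : continuous (fun x => Num.max (l x) 0).
  by move=> x; apply: (@continuous_max _ _ l (fun=> 0)); [exact: cl|exact: cvg_cst].
split.
- by move=> x; apply: (@continuous_comp _ _ _ l possq); [exact: cl|exact: continuous_possq].
- by move=> x; do ?[apply: cvgM; first exact: cvg_cst]; exact: cm.
- by move=> x; do ?[apply: cvgM; first exact: cvg_cst]; exact: cm.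
move=> x v; apply: (@is_derive_quad _ _ _ _ _ _ ((a * v.1 + b * v.2) ^+ 2)) => h.
have -> : l (h *: v + x) = l x + h * (a * v.1 + b * v.2).
  by rewrite /l /= /GRing.scale/=; ring.
have := possq_quad (l x) (h * (a * v.1 + b * v.2)).
have -> : (h * (a * v.1 + b * v.2)) ^+ 2 = (a * v.1 + b * v.2) ^+ 2 * h ^+ 2 by ring.
by congr (`|_| <= _); ring.
Qed.

End smooth_functions.

(** * Integrals of real-valued functions *)

Section real_integrals.
Context d {T : measurableType d} {R : realType} (m : {measure set T -> \bar R}).
Implicit Types f g : T -> R.

Definition intg f := m.-integrable setT (EFin \o f).

Lemma intg_meas f : intg f -> measurable_fun setT f.
Proof. by move/measurable_int/measurable_EFinP. Qed.

Lemma intg_le f g : measurable_fun setT f -> (forall x, `|f x| <= g x) -> intg g -> intg f.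
Proof.
move=> mf fg; apply: le_integrable => //; first exact/measurable_EFinP.
by move=> x _ /=; rewrite lee_fin (le_trans (fg x))// ler_norm.
Qed.

Lemma intgD f g : intg f -> intg g -> intg (fun x => f x + g x).
Proof.
move=> hf hg; rewrite /intg /comp; under eq_fun do rewrite EFinD.
exact: (integrableD measurableT hf hg).
Qed.

Lemma intgZ c f : intg f -> intg (fun x => c * f x).
Proof.
move=> hf; rewrite /intg /comp; under eq_fun do rewrite EFinM.
exact: (integrableZl measurableT c hf).
Qed.

Lemma intgB f g : intg f -> intg g -> intg (fun x => f x - g x).
Proof.
move=> hf /(intgZ (-1)) hg; have := intgD hf hg.
by under eq_fun do rewrite mulN1r.
Qed.

Lemma intg_norm f : intg f -> intg (fun x => `|f x|).
Proof. by move=> /integrable_norm. Qed.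

Lemma intgM C f g : measurable_fun setT g -> (forall x, `|g x| <= C) -> intg f ->
  intg (fun x => g x * f x).
Proof.
move=> mg gC hf; apply: (@intg_le _ (fun x => C * `|f x|)).
- by apply: measurable_funM => //; exact: intg_meas.
- by move=> x; rewrite normrM ler_wpM2r.
- by apply: intgZ; exact: intg_norm.
Qed.

Lemma RintD f g : intg f -> intg g ->
  \int[m]_x (f x + g x) = \int[m]_x f x + \int[m]_x g x.
Proof. exact: RintegralD. Qed.

Lemma RintB f g : intg f -> intg g ->
  \int[m]_x (f x - g x) = \int[m]_x f x - \int[m]_x g x.
Proof. exact: RintegralB. Qed.

Lemma RintZ c f : intg f -> \int[m]_x (c * f x) = c * \int[m]_x f x.
Proof. exact: RintegralZl. Qed.

Lemma RintN f : intg f -> \int[m]_x (- f x) = - \int[m]_x f x.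
Proof.
by move=> hf; rewrite -mulN1r -RintZ//; apply: eq_Rintegral => x _; rewrite mulN1r.
Qed.

Lemma Rint_le f g : intg f -> intg g -> (forall x, f x <= g x) ->
  \int[m]_x f x <= \int[m]_x g x.
Proof. by move=> *; apply: le_Rintegral. Qed.

Lemma Rint_EFin f : intg f -> (\int[m]_x (f x)%:E)%E = (\int[m]_x f x)%:E.
Proof. by move=> hf; rewrite /Rintegral fineK//; exact: integrable_fin_num. Qed.

Lemma intg_ge0 f : measurable_fun setT f -> (forall x, 0 <= f x) ->
  (\int[m]_x (f x)%:E < +oo)%E -> intg f.
Proof.
move=> mf f0 fy; apply/integrableP; split; first exact/measurable_EFinP.
by under eq_integral do rewrite /= ger0_norm//.
Qed.

Lemma Rint_dct (f_ : nat -> T -> R) f g :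
  (forall n, measurable_fun setT (f_ n)) -> measurable_fun setT f ->
  {ae m, forall x, f_ ^~ x @ \oo --> f x} ->
  intg g -> (forall n x, `|f_ n x| <= g x) ->
  intg f /\ (fun n => \int[m]_x f_ n x) @ \oo --> \int[m]_x f x.
Proof.
move=> mf_ mf cf ig fg.
have H n x : (`|(EFin \o f_ n) x| <= (EFin \o g) x)%E by rewrite lee_fin.
have [h1 _ h3] := @dominated_convergence _ _ _ m _ measurableT (fun n => EFin \o f_ n)
  (EFin \o f) (EFin \o g)
  (fun n => (measurable_EFinP _ _).2 (mf_ n)) ((measurable_EFinP _ _).2 mf)
  ltac:(move: cf; apply: filterS => x h _; apply: cvg_EFin => //; exact: nearW) ig
  (aeW _ (fun x n _ => H n x)).
split => //.
apply: fine_cvg; rewrite fineK//; exact: integrable_fin_num.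
Qed.

End real_integrals.

Lemma Rint_small d (T : measurableType d) (R : realType) (M : {finite_measure set T -> \bar R})
    (f : nat -> T -> R) (C e : R) :
  (forall n, measurable_fun setT (f n)) -> (forall n x, `|f n x| <= C) ->
  (forall x, f ^~ x @ \oo --> 0) -> 0 < e -> \forall n \near \oo, \int[M]_x f n x < e.
Proof.
move=> mf fC f0 e0.
have h := @Rint_dct _ _ _ M f (fun=> 0) (cst C) mf (measurable_cst _) (aeW _ f0)
  (finite_measure_integrable_cst M C measurableT) fC.
have [_] := h; rewrite /Rintegral integral0/= => /cvgr0_norm_lt/(_ _ e0).
by apply: filterS => n; apply: le_lt_trans; exact: ler_norm.
Qed.

(** * Approximation of indicators by test functions *)

Section density.
Context {R : realType}.
Local Notation plane := (R * R)%type.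
Local Notation mplane := (measurableTypeR R * measurableTypeR R)%type.

Definition smooth (f : plane -> R) := exists fx fy, C1 f fx fy.

Lemma smooth_cst c : smooth (fun=> c).
Proof. by exists (fun=> 0), (fun=> 0); exact: C1_cst. Qed.

Lemma smoothM f g : smooth f -> smooth g -> smooth (fun x => f x * g x).
Proof. by move=> [fx [fy H1]] [gx [gy H2]]; do 2 eexists; exact: (C1M H1 H2). Qed.

Lemma smoothB f g : smooth f -> smooth g -> smooth (fun x => f x - g x).
Proof. by move=> [fx [fy H1]] [gx [gy H2]]; do 2 eexists; exact: (C1B H1 H2). Qed.

Lemma smoothD f g : smooth f -> smooth g -> smooth (fun x => f x + g x).
Proof. by move=> [fx [fy H1]] [gx [gy H2]]; do 2 eexists; exact: (C1D H1 H2). Qed.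

Lemma smooth_possq (a b c : R) : smooth (fun x => possq (a * x.1 + b * x.2 + c)).
Proof. by do 2 eexists; exact: C1_possq. Qed.

Lemma smooth_continuous f : smooth f -> continuous f.
Proof. by move=> [? [? []]]. Qed.

Lemma smooth_measurable f : smooth f -> measurable_fun [set: mplane] (f : mplane -> R).
Proof. by move=> /smooth_continuous; exact: continuous_plane_measurable. Qed.

Definition compact_supp (U : set plane) (f : plane -> R) :=
  exists K, [/\ compact K, K `<=` U & forall x, ~ K x -> f x = 0].

Definition testfun U f := smooth f /\ compact_supp U f.

Lemma bump_exists (c : plane) (r : R) : 0 < r -> exists f : plane -> R,
  [/\ smooth f, (forall x, 0 <= f x <= 1), (forall x, ~ cbox c r x -> f x = 0)
    & forall x, `|x.1 - c.1| < r -> `|x.2 - c.2| < r -> 0 < f x].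
Proof.
move=> r0.
have [g [sg0 g01 gz gp]] : exists g : R -> R,
  [/\ (forall i (c : R), smooth (fun x : plane => g ((if i then x.1 else x.2) - c))),
    (forall t, 0 <= g t <= 1), (forall t, ~ (`|t| <= r) -> g t = 0) & forall t, `|t| < r -> 0 < g t].
  (* This is [(1 - (t / r)^2)^2] on [[-r, r]]; outside, one of the two factors vanishes. *)
  exists (fun t => possq (1 + t / r) * possq (1 - t / r)); split.
  - move=> i a; apply: smoothM.
      case: i.
        have := smooth_possq r^-1 0 (1 - a / r).
        by congr smooth; apply/funext => x; congr possq; field; rewrite gt_eqF.
      have := smooth_possq 0 r^-1 (1 - a / r).
      by congr smooth; apply/funext => x; congr possq; field; rewrite gt_eqF.
    case: i.
      have := smooth_possq (- r^-1) 0 (1 + a / r).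
      by congr smooth; apply/funext => x; congr possq; field; rewrite gt_eqF.
    have := smooth_possq 0 (- r^-1) (1 + a / r).
    by congr smooth; apply/funext => x; congr possq; field; rewrite gt_eqF.
  - move=> t; set s := t / r; rewrite mulr_ge0 ?possq_ge0//= /possq -exprMn.
    rewrite expr_le1//; last by rewrite mulr_ge0// le_max lexx orbT.
    by case: (leP (1 + s) 0) => h1; case: (leP (1 - s) 0) => h2; nra.
  - move=> t /negP; rewrite -ltNge lter_normr => /orP[] ht.
      have : 1 < t / r by rewrite ltr_pdivlMr// mul1r.
      set s := t / r => hs; rewrite [X in _ * X]/possq max_r; last lra.
      by rewrite expr0n/= mulr0.
    have : t / r < -1 by rewrite ltr_pdivrMr// mulN1r; lra.
    set s := t / r => hs; rewrite [X in X * _]/possq max_r; last lra.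
    by rewrite expr0n/= mul0r.
  - move=> t; rewrite ltr_norml => /andP[h1 h2].
    have k1 : t / r < 1 by rewrite ltr_pdivrMr// mul1r.
    have k2 : -1 < t / r by rewrite ltr_pdivlMr// mulN1r.
    by rewrite /possq !max_l; [rewrite mulr_gt0// exprn_gt0//; lra|lra|lra].
exists (fun x => g (x.1 - c.1) * g (x.2 - c.2)); split.
- by apply: smoothM; [exact: (sg0 true)|exact: (sg0 false)].
- move=> x; have /andP[a1 a2] := g01 (x.1 - c.1); have /andP[b1 b2] := g01 (x.2 - c.2).
  by rewrite mulr_ge0//= mulr_ile1.
- move=> x; have [h1|h1] := pselect (`|x.1 - c.1| <= r); last by rewrite gz// mul0r.
  have [h2|h2] := pselect (`|x.2 - c.2| <= r); last by rewrite [X in _ * X]gz// mulr0.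
  by move=> h; exfalso; apply: h.
- by move=> x h1 h2; rewrite mulr_gt0// gp.
Qed.

(** With [h k] equal to 1 minus a bump on box [k], the function [1 - prod_(k < n) (h k)^n] is
    supported in finitely many boxes. At a point of [U] some [h k] is below 1, and its powers drive
    the product to 0. *)
Lemma open_approx (U : set plane) : open U -> exists f : nat -> plane -> R,
  (forall n, testfun U (f n) /\ forall x, 0 <= f n x <= 1) /\
  forall x, f ^~ x @ \oo --> (\1_U x : R).
Proof.
move=> oU.
pose G (g : plane -> R) := [/\ smooth g, (forall x, 0 <= g x <= 1) &
  exists K, [/\ compact K, K `<=` U & forall x, ~ K x -> g x = 1]].
have GM g h : G g -> G h -> G (fun x => g x * h x).
  move=> [g1 g2 [K [k1 k2 k3]]] [h1 h2 [L [l1 l2 l3]]]; split; first exact: smoothM.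
    move=> x; have /andP[a1 a2] := g2 x; have /andP[b1 b2] := h2 x.
    by rewrite mulr_ge0//= mulr_ile1.
  exists (K `|` L); split; first exact: compactU.
    by move=> x [/k2|/l2].
  by move=> x /not_orP[a b]; rewrite k3// l3// mulr1.
have G1 : G (fun=> 1).
  split; [exact: smooth_cst|by move=> x; rewrite ler01 lexx|].
  by exists set0; split => //; exact: compact0.
have [c [r [P [H1 H2]]]] := open_box_cover oU.
have /choice[h hP] : forall k, exists h : plane -> R, G h /\
    forall x, P k -> `|x.1 - (c k).1| < r k -> `|x.2 - (c k).2| < r k -> h x < 1.
  move=> k; case Pk : (P k); last by exists (fun=> 1); split.
  have [r0 sub] := H1 k Pk.
  have [f [f1 f2 f3 f4]] := bump_exists (c k) r0.
  exists (fun x => 1 - f x); split; last first.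
    by move=> x _ a b; have := f4 x a b; rewrite ltrBlDr ltrDl.
  split; first by apply: smoothB => //; exact: smooth_cst.
    by move=> x; have := f2 x; lra.
  exists (cbox (c k) (r k)); split => //; first exact: compact_cbox.
  by move=> x /f3 ->; rewrite subr0.
have GX g n : G g -> G (fun x => g x ^+ n).
  move=> Gg; elim: n => [|n ih]; first by under eq_fun do rewrite expr0.
  by under eq_fun do rewrite exprS; exact: GM.
pose g n m x := \prod_(0 <= k < m) h k x ^+ n.
have Gg n m : G (g n m).
  elim: m => [|m ih]; first by rewrite /g; under eq_fun do rewrite big_geq//.
  rewrite /g; under eq_fun do rewrite big_nat_recr//=.
  by apply: GM => //; apply: GX; have [] := hP m.
exists (fun n x => 1 - g n n x); split.
  move=> n; have [g1 g2 [K [k1 k2 k3]]] := Gg n n; split.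
    split; first by apply: smoothB => //; exact: smooth_cst.
    by exists K; split => // x /k3 ->; rewrite subrr.
  by move=> x; have := g2 x; lra.
move=> x; rewrite indicE.
have [/set_mem Ux|/negP nUx] := boolP (x \in U); last first.
  have gE n : g n n x = 1.
    have [_ _ [K [_ k2 k3]]] := Gg n n; apply: k3 => /k2 Ux; apply: nUx; exact/mem_set.
  by under eq_fun do rewrite gE subrr; exact: cvg_cst.
have [k [Pk a b]] := H2 x Ux.
have [[_ h01 _] /(_ x Pk a b) hlt] := hP k.
rewrite -[X in _ --> X]subr0; apply: cvgB; first exact: cvg_cst.
apply: (@squeeze_cvgr _ _ _ _ (fun=> 0) (fun n => h k x ^+ n)).
- near=> n; have [_ /(_ x)/andP[-> _] _] /= := Gg n n.
  have kn : (k < n)%N by near: n; exists k.+1.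
  rewrite /g big_mkord (bigD1 (Ordinal kn))//=.
  have hx i : 0 <= h i x ^+ n <= 1.
    have [[_ /(_ x)/andP[u1 u2] _] _] := hP i.
    by rewrite exprn_ge0//= exprn_ile1.
  rewrite ler_piMr//; first by have /andP[] := hx k.
  apply: (@le_trans _ _ (\prod_(i < n | i != Ordinal kn) 1)).
    by apply: ler_prod => i _; exact: hx.
  by rewrite big1.
- exact: cvg_cst.
- apply: cvg_expr; rewrite ger0_norm//; by have /andP[] := h01 x.
Unshelve. all: by end_near. Qed.

Lemma indic_bound (A : set plane) x : 0 <= (\1_A x : R) <= 1.
Proof. by rewrite indicE; case: (_ \in _); rewrite /= ?lexx ?ler01. Qed.

(* Sets whose indicator is approximable form a sigma-algebra containing the open sets. *)
Lemma testfun_density (M : {finite_measure set mplane -> \bar R}) (U A : set plane) (e : R) :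
  open U -> measurable (A : set mplane) -> 0 < e ->
  exists f : plane -> R, [/\ testfun U f, (forall x, 0 <= f x <= 1) &
    \int[M]_x `|f x - \1_(A `&` U) x| < e].
Proof.
move=> oU mA; move: e.
pose P (A : set plane) := forall e, 0 < e -> exists f : plane -> R,
  [/\ testfun U f, (forall x, 0 <= f x <= 1) &
    \int[M]_x `|f x - \1_(A `&` U) x| < e].
pose Q (A : set plane) := measurable (A : set mplane) /\ P A.
suff : Q A by case.
have mU : measurable (U : set mplane) by exact: open_plane_measurable.
have mind (B : set plane) : measurable (B : set mplane) ->
    measurable_fun [set: mplane] (\1_(B `&` U) : mplane -> R).
  by move=> mB; apply: measurable_indic; exact: measurableI.
have intd (f : plane -> R) (B : set plane) C : measurable_fun [set: mplane] (f : mplane -> R) ->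
    measurable (B : set mplane) -> (forall x, `|f x| <= C) ->
    intg M (fun x : mplane => `|f x - \1_(B `&` U) x|).
  move=> mf mB fC; apply: (@intg_le _ _ _ _ _ (cst (C + 1))).
  - by apply: measurableT_comp => //; apply: measurable_funB => //; exact: mind.
  - move=> x /=; rewrite normr_id (le_trans (ler_normB _ _))// lerD//.
    by have /andP[h1 h2] := indic_bound (B `&` U) x; rewrite ger0_norm.
  - exact: finite_measure_integrable_cst.
have itest (f : plane -> R) (B : set plane) : testfun U f -> (forall x, 0 <= f x <= 1) ->
    measurable (B : set mplane) -> intg M (fun x : mplane => `|f x - \1_(B `&` U) x|).
  move=> [sf _] f01 mB; apply: (intd _ _ 1) => //; first exact: smooth_measurable.
  by move=> x; have /andP[h1 h2] := f01 x; rewrite ger0_norm.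
have Qopen V : open V -> Q V.
  move=> oV; split; first exact: open_plane_measurable.
  have oVU : open (V `&` U) by exact: openI.
  move=> e e0; have [f [f1 f2]] := open_approx oVU.
  have mVU : measurable ((V `&` U) : set mplane) by exact: open_plane_measurable.
  have [] := @Rint_small _ _ _ M (fun n x => `|f n x - \1_(V `&` U) x|) 1 e _ _ _ e0.
  - move=> n; apply: measurableT_comp => //; apply: measurable_funB => //.
      by apply: smooth_measurable; have [[]] := f1 n.
  - move=> n x; rewrite normr_id; have [_ /(_ x)] := f1 n; have := indic_bound (V `&` U) x.
    by move=> ? ? /=; rewrite ler_norml; lra.
  - move=> x; rewrite -[X in _ --> X](normr0 R) -[X in `|X|](subrr (\1_(V `&` U) x)).
    by apply: cvg_norm; apply: cvgB; [exact: f2|exact: cvg_cst].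
  move=> N _ /(_ N (leqnn N))/= hN.
  exists (f N); have [[sf [K [k1 k2 k3]]] f01] := f1 N; split => //.
    by split => //; exists K; split => //; move=> x /k2[].
have QC B : Q B -> Q (~` B).
  move=> [mB PB]; split; first exact: measurableC.
  move=> e e0.
  have [f [tf f01 fe]] := PB _ (divr_gt0 e0 (ltr0n _ 2)).
  have [_ PT] := Qopen _ openT.
  have [g [tg g01 ge]] := PT _ (divr_gt0 e0 (ltr0n _ 2)).
  (* [1 - f] has no compact support in [U]; the factor [g], close to the indicator of [U], restores
     it. *)
  exists (fun x => g x * (1 - f x)); split.
  - split; first by apply: smoothM; [exact: tg.1|apply: smoothB; [exact: smooth_cst|exact: tf.1]].
    have [_ [K [k1 k2 k3]]] := tg; exists K; split => // x /k3 ->; by rewrite mul0r.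
  - by move=> x; have := f01 x; have := g01 x; nra.
  rewrite [ltRHS]splitr.
  have mT : measurable ([set: plane] : set mplane) by exact: measurableT.
  apply: le_lt_trans (ltrD ge fe); rewrite -RintD; [|exact: itest|exact: itest].
  have mCB : measurable ((~` B) : set mplane) by exact: measurableC.
  apply: Rint_le.
  - apply: (intd _ _ 1) => //.
      apply: measurable_funM; first by apply: smooth_measurable; exact: tg.1.
      by apply: measurable_funB => //; apply: smooth_measurable; exact: tf.1.
    by move=> x; have := f01 x; have := g01 x; move=> ? ?; rewrite ler_norml; nra.
  - by apply: intgD; exact: itest.
  move=> x; rewrite setTI !indicE !in_setI in_setC.
  have := f01 x; have := g01 x => g0 f0.
  case: (x \in U); case: (x \in B) => /=; clear - f0 g0; rewrite ler_norml;
    do ?[rewrite subr0]; have := ler_norm (g x - 1); have := ler_norm (1 - g x);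
    have := ler_norm (f x - 1); have := ler_norm (1 - f x); have := ler_norm (f x);
    have := ler_norm (g x); rewrite !(distrC 1); move=> *; nra.
have QU B D : Q B -> Q D -> Q (B `|` D).
  move=> [mB PB] [mD PD]; split; first exact: measurableU.
  move=> e e0.
  have [f [tf f01 fe]] := PB _ (divr_gt0 e0 (ltr0n _ 2)).
  have [g [tg g01 ge]] := PD _ (divr_gt0 e0 (ltr0n _ 2)).
  exists (fun x => f x + g x - f x * g x); split.
  - split; first by apply: smoothB; [apply: smoothD; [exact: tf.1|exact: tg.1]
      |apply: smoothM; [exact: tf.1|exact: tg.1]].
    have [_ [K [k1 k2 k3]]] := tg; have [_ [L [l1 l2 l3]]] := tf.
    exists (K `|` L); split; first exact: compactU.
      by move=> x [/k2|/l2].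
    by move=> x /not_orP[a b]; rewrite k3// l3// mulr0 addr0 subr0.
  - by move=> x; have := f01 x; have := g01 x; nra.
  rewrite [ltRHS]splitr.
  apply: le_lt_trans (ltrD fe ge); rewrite -RintD; [|exact: itest|exact: itest].
  have mBD : measurable ((B `|` D) : set mplane) by exact: measurableU.
  apply: Rint_le.
  - apply: (intd _ _ 1) => //.
      have m1 : measurable_fun [set: mplane] (f : mplane -> R) by apply: smooth_measurable; exact: tf.1.
      have m2 : measurable_fun [set: mplane] (g : mplane -> R) by apply: smooth_measurable; exact: tg.1.
      by apply: measurable_funB; [exact: measurable_funD|exact: measurable_funM].
    by move=> x; have := f01 x; have := g01 x; move=> ? ?; rewrite ler_norml; nra.
  - by apply: intgD; exact: itest.
  move=> x; rewrite !indicE !in_setI in_setU.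
  have := f01 x; have := g01 x => g0 f0.
  case: (x \in U); case: (x \in B); case: (x \in D) => /=; clear - f0 g0; rewrite ler_norml;
    do ?[rewrite subr0]; have := ler_norm (g x - 1); have := ler_norm (1 - g x);
    have := ler_norm (f x - 1); have := ler_norm (1 - f x); have := ler_norm (f x);
    have := ler_norm (g x); rewrite !(distrC 1); move=> *; nra.
have Qsig : sigma_algebra setT Q.
  split; first exact: (Qopen _ open0).
    by move=> B QB; rewrite setTD; exact: QC.
  move=> F QF.
  have mF n : measurable (F n : set mplane) by have [] := QF n.
  have mUF : measurable (\bigcup_k F k : set mplane) by exact: bigcup_measurable.
  split => // e e0.
  pose S n := \big[setU/set0]_(i < n) F i.
  have QS n : Q (S n).
    rewrite /S; elim: n => [|n ih]; first by rewrite big_ord0; exact: (Qopen _ open0).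
    by rewrite big_ord_recr/=; exact: QU.
  have mS n : measurable (S n : set mplane) by have [] := QS n.
  have [] := @Rint_small _ _ _ M (fun n x => `|\1_(S n `&` U) x - \1_(\bigcup_k F k `&` U) x|)
    1 _ _ _ _ (divr_gt0 e0 (ltr0n _ 2)).
  - move=> n; apply: measurableT_comp => //; apply: measurable_funB => //; exact: mind.
  - move=> n x; rewrite normr_id; have := indic_bound (S n `&` U) x.
    have := indic_bound (\bigcup_k F k `&` U) x.
    by move=> ? ? /=; rewrite ler_norml; lra.
  - move=> x; apply: cvg_near_cst.
    have [[k _ Fkx]|nF] := pselect ((\bigcup_k F k) x); last first.
      near=> n; rewrite !indicE !in_setI (memNset nF) (_ : (x \in S n) = false) ?subrr ?normr0//.
      apply: memNset; rewrite /S -bigcup_mkord => -[i _ Fi]; apply: nF; exists i => //.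
    near=> n; have inU : (\bigcup_k F k) x by exists k.
    rewrite !indicE !in_setI (mem_set inU) (_ : (x \in S n) = true) ?subrr ?normr0//.
    by apply: mem_set; rewrite /S -bigcup_mkord; exists k => //=; near: n; exists k.+1.
  move=> N _ /(_ N (leqnn N))/= hN.
  have [f [tf f01 fe]] := (QS N).2 _ (divr_gt0 e0 (ltr0n _ 2)).
  exists f; split => //; rewrite [ltRHS]splitr.
  have i1 : intg M (fun x => `|\1_(S N `&` U) x - \1_(\bigcup_k F k `&` U) x|).
    apply: (intd _ _ 1) => //; first exact: mind.
    by move=> x; have := indic_bound (S N `&` U) x; move=> ?; rewrite ler_norml; lra.
  apply: le_lt_trans (ltrD fe hN); rewrite -RintD//; last exact: itest.
  apply: Rint_le; [exact: itest|by apply: intgD => //; exact: itest|].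
  by move=> x; exact: ler_distD.
have : (measurable : set (set mplane)) `<=` Q.
  rewrite measurable_prod_measurableType; apply: smallest_sub => //.
  have pre (p : plane -> R) : continuous p -> forall B : set R, measurable B -> Q (p @^-1` B).
    move=> cp.
    have sp : sigma_algebra setT [set B : set R | Q (p @^-1` B)].
      case: Qsig => q1 q2 q3; split => /=; first by rewrite preimage_set0.
        by move=> B QB; rewrite setTD preimage_setC -setTD; exact: q2.
      by move=> F QF; rewrite preimage_bigcup; apply: q3.
    move=> B mB.
    have mB' := eq_ind _ (fun S : set (set R) => S B) mB _ (RGenOpens.measurableE R).
    apply: (smallest_sub sp _ mB') => _ [a [b ->]] /=; apply: Qopen.
    by move/continuousP : cp; apply; exact: interval_open.
  move=> _ [B mB [D mD <-]].
  have -> : B `*` D = ~` (~` (fst @^-1` B) `|` ~` (snd @^-1` D)).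
    by rewrite setCU !setCK; apply/seteqP; split => -[x y].
  apply: (QC _ (QU _ _ (QC _ (pre _ _ _ mB)) (QC _ (pre _ _ _ mD)))).
    by move=> x; exact: cvg_fst.
  by move=> x; exact: cvg_snd.
exact.
Unshelve. all: by end_near. Qed.

End density.

(** * Lebesgue measure of the plane under affine maps *)

Section sigma_finite_pack.
Context d (T : measurableType d) (R : realType) (m : {measure set T -> \bar R}).
Hypothesis sf : sigma_finite setT m.
(** A copy under a new name to which the sigma-finite structure can be attached: Fubini's theorem
    asks for it, while [lebesgue2] is typed as a mere measure. *)
Definition sigma_finite_copy : set T -> \bar R := m.
HB.instance Definition _ := Measure.on sigma_finite_copy.
HB.instance Definition _ := Measure_isSigmaFinite.Build _ _ _ sigma_finite_copy sf.
Definition sigma_finite_pack : {sigma_finite_measure set T -> \bar R} := sigma_finite_copy.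
End sigma_finite_pack.

Section lebesgue2_sigma_finite.
Context {R : realType}.
Local Notation plane := (R * R)%type.
Local Notation mplane := (measurableTypeR R * measurableTypeR R)%type.

Lemma lebesgue2_cbox (c : plane) (r : R) : 0 <= r -> @lebesgue2 R (cbox c r) = ((2 * r) ^+ 2)%:E.
Proof.
move=> r0; rewrite cboxE; apply: etrans.
  exact: (@product_measure1E _ _ _ _ _ (@lebesgue_measure R) (@lebesgue_measure R) `[c.1 - r, c.1 + r]%classic `[c.2 - r, c.2 + r]%classic (measurable_itv _) (measurable_itv _)).
have I (a : R) : @lebesgue_measure R `[a - r, a + r]%classic = (2 * r)%:E.
  rewrite lebesgue_measure_itv/= lte_fin.
  by case: ifPn => h; rewrite -?EFinB; congr EFin; lra.
by rewrite expr2 EFinM; congr (_ * _)%E; exact: I.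
Qed.
Lemma lebesgue2_sigma_finite : sigma_finite [set: mplane] (@lebesgue2 R).
Proof.
exists (fun n => cbox (0, 0) n%:R).
  apply/esym/seteqP; split => // x _.
  exists (Num.truncn (Num.max `|x.1| `|x.2|)).+1 => //; split; rewrite /= subr0.
    by rewrite ltW//; apply: le_lt_trans (Num.Theory.truncnS_gt _); rewrite le_max lexx.
  by rewrite ltW//; apply: le_lt_trans (Num.Theory.truncnS_gt _); rewrite le_max lexx orbT.
by move=> n; split; [exact: measurable_cbox|rewrite lebesgue2_cbox// ltry].
Qed.

Definition sfleb2 : {sigma_finite_measure set mplane -> \bar R} :=
  sigma_finite_pack lebesgue2_sigma_finite.

End lebesgue2_sigma_finite.

Section affine_change_of_variables.
Context {R : realType}.
Local Notation plane := (R * R)%type.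
Local Notation mplane := (measurableTypeR R * measurableTypeR R)%type.
Local Notation leb := (@lebesgue_measure R).
Local Notation L2 := (@lebesgue2 R).
Local Open Scope ereal_scope.

(** On half-open intervals Lebesgue measure agrees with [|a|] times its image under [t -> a t + b],
    hence everywhere by uniqueness. *)
Lemma ge0_integral_affine1 (a b : R) (f : R -> \bar R) : (a != 0)%R ->
  measurable_fun setT f -> (forall t, 0 <= f t) ->
  \int[leb]_t f (a * t + b)%R = (`|a|^-1)%:E * \int[leb]_t f t.
Proof.
move=> a0 mf f0.
pose phi (t : measurableTypeR R) : measurableTypeR R := (a * t + b)%R.
have mphi : measurable_fun [set: measurableTypeR R] phi.
  by apply: measurable_funD => //; apply: measurable_funM.
pose k : {nonneg R} := NngNum (normr_ge0 a).
pose psh : {measure set (measurableTypeR R) -> \bar R} := pushforward leb phi.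
pose mu' : {measure set (measurableTypeR R) -> \bar R} := mscale k (psh mphi).
have E X : ocitv X -> leb X = mu' X.
  move=> [[x y] _ <-] /=.
  rewrite /mu' /= /mscale /= /psh /= /pushforward.
  rewrite lebesgue_measure_itv/=.
  have [ap|an|a00] := ltgtP a 0%R; last by rewrite a00 eqxx in a0.
  - have -> : phi @^-1` `]x, y]%classic = `[((y - b) / a)%R, ((x - b) / a)%R[%classic.
      apply/seteqP; split => t /=; rewrite !in_itv/= /phi ler_ndivrMr// ltr_ndivlMr// mulrC => /andP[? ?]; apply/andP; split; lra.
    rewrite lebesgue_measure_itv/= !lte_fin ltr_ndivlMr// divfK ?lt_eqF//.
    rewrite ltrD2r; case: ifPn => xy; last by rewrite mule0.
    rewrite ltr0_norm// -!EFinB -EFinM; congr EFin; field; by rewrite lt_eqF.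
  - have -> : phi @^-1` `]x, y]%classic = `]((x - b) / a)%R, ((y - b) / a)%R]%classic.
      apply/seteqP; split => t /=; rewrite !in_itv/= /phi ler_pdivlMr// ltr_pdivrMr// mulrC => /andP[? ?]; apply/andP; split; lra.
    rewrite lebesgue_measure_itv/= !lte_fin ltr_pdivrMr// divfK ?gt_eqF//.
    rewrite ltrD2r; case: ifPn => xy; last by rewrite mule0.
    rewrite gtr0_norm// -!EFinB -EFinM; congr EFin; field; by rewrite gt_eqF.
have -> : \int[leb]_t f t = `|a|%:E * \int[leb]_t f (a * t + b)%R.
  rewrite (@eq_measure_integral _ _ _ _ mu'); last first.
    by move=> A mA _; exact: (lebesgue_measure_unique E).
  rewrite ge0_integral_mscale//; congr (_ * _).
  by rewrite ge0_integral_pushforward.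
by rewrite muleA -EFinM mulVf ?mul1e// normr_eq0.
Qed.

Definition det (x y : plane) : R := (x.1 * y.2 - x.2 * y.1)%R.

(** Oblique coordinates at [x0]. With a vertex [P] of a polygon and [v] the side issuing from it,
    [r] is the size of the polygon and [y] runs along the side. *)
Definition aff (x0 P v : plane) (r y : R) : plane :=
  (x0.1 + r * P.1 + y * v.1, x0.2 + r * P.2 + y * v.2)%R.

Lemma measurable_pair_plane d (T : measurableType d) (f g : T -> R) :
  measurable_fun setT f -> measurable_fun setT g ->
  measurable_fun setT (fun z => (f z, g z) : mplane).
Proof. by move=> mf mg; exact: measurable_fun_pair. Qed.

Lemma measurable_affine (a b c : R) :
  measurable_fun [set: mplane] (fun z : mplane => (a + z.1 * b + z.2 * c)%R).
Proof.
apply: measurable_funD; last exact: measurable_funM measurable_snd (measurable_cst c).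
apply: measurable_funD; first exact: measurable_cst.
exact: measurable_funM measurable_fst (measurable_cst b).
Qed.

Lemma measurable_aff (x0 P v : plane) :
  measurable_fun [set: mplane] (fun z : mplane => aff x0 P v z.1 z.2 : mplane).
Proof. by apply: measurable_pair_plane; exact: measurable_affine. Qed.

(** Two one-dimensional substitutions. The one in [r] turns the first coordinate into the variable,
    which is where [P.1 != 0] enters; the one in [y] then has slope [det P v / P.1]. *)
Lemma ge0_integral_aff (x0 P v : plane) (f : mplane -> \bar R) :
  (P.1 != 0)%R -> det P v != 0%R ->
  measurable_fun setT f -> (forall z, 0 <= f z) ->
  \int[leb]_r \int[leb]_y f (aff x0 P v r y) = (`|det P v|^-1)%:E * \int[L2]_z f z.
Proof.
move=> P0 d0 mf f0.
have d'0 : (v.2 - P.2 / P.1 * v.1 != 0)%R.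
  apply: contra d0 => /eqP h; apply/eqP; rewrite /det.
  have -> : (P.1 * v.2 - P.2 * v.1 = P.1 * (v.2 - P.2 / P.1 * v.1))%R by field.
  by rewrite h mulr0.
rewrite (@fubini_tonelli _ _ _ _ _ leb leb (fun z => f (aff x0 P v z.1 z.2)))/=; last 2 first.
- exact: (measurableT_comp mf (measurable_aff x0 P v)).
- by move=> z; exact: f0.
pose G (z : mplane) := f (z.1, (P.2 / P.1 * (z.1 - x0.1 - z.2 * v.1) + x0.2 + z.2 * v.2)%R).
have mG : measurable_fun [set: mplane] G.
  apply: (measurableT_comp mf); apply: measurable_pair_plane => //.
  have := measurable_affine (x0.2 - P.2 / P.1 * x0.1) (P.2 / P.1) (v.2 - P.2 / P.1 * v.1).
  by congr (measurable_fun _ _); apply/funext => z; ring.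
have step1 y : \int[leb]_r f (aff x0 P v r y) = (`|P.1|^-1)%:E *
    \int[leb]_t f (t, (P.2 / P.1 * (t - x0.1 - y * v.1) + x0.2 + y * v.2)%R).
  rewrite -(@ge0_integral_affine1 P.1 (x0.1 + y * v.1)%R (fun t => f (t, _)))//; last first.
    have mp : measurable_fun [set: measurableTypeR R] (fun t : measurableTypeR R => (t, y) : mplane).
      exact: measurable_pair_plane.
    exact: (measurableT_comp mG mp).
  apply: eq_integral => r _; congr (f (_, _)); first by ring.
  by field.
under eq_integral do rewrite step1.
rewrite ge0_integralZl//; last 2 first.
- have hG := @measurable_fun_fubini_tonelli_G _ _ _ _ _ leb G mG (fun=> f0 _).
  exact: hG.
- by move=> y _; exact: integral_ge0.
rewrite -(@fubini_tonelli _ _ _ _ _ leb leb G mG (fun=> f0 _)).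
have step2 t : \int[leb]_y f (t, (P.2 / P.1 * (t - x0.1 - y * v.1) + x0.2 + y * v.2)%R) =
   (`|v.2 - P.2 / P.1 * v.1|^-1)%:E * \int[leb]_s f (t, s).
  rewrite -(@ge0_integral_affine1 (v.2 - P.2 / P.1 * v.1) (P.2 / P.1 * (t - x0.1) + x0.2)%R (fun s => f (t, s)))//; last first.
    have mp : measurable_fun [set: measurableTypeR R] (fun s : measurableTypeR R => (t, s) : mplane).
      exact: measurable_pair_plane.
    exact: (measurableT_comp mf mp).
  by apply: eq_integral => r _; congr (f (_, _)); ring.
under [X in _ * X]eq_integral do rewrite step2.
rewrite ge0_integralZl//; last 2 first.
- have hF := @measurable_fun_fubini_tonelli_F _ _ _ _ _ leb f mf f0.
  exact: hF.
- by move=> y _; exact: integral_ge0.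
rewrite muleA -EFinM -invfM -normrM; congr (_%:E * _).
  by congr (`|_|^-1)%R; rewrite /det; field.
by rewrite /lebesgue2 (fubini_tonelli1 (m1 := leb) (m2 := leb)).
Qed.

Lemma ge0_integral_shift (v : plane) (f : mplane -> \bar R) :
  measurable_fun setT f -> (forall z, 0 <= f z) ->
  \int[L2]_z f (v + z)%R = \int[L2]_z f z.
Proof.
move=> mf f0.
have d1 : det (1, 0)%R (0, 1)%R = 1%R by rewrite /det/=; ring.
have := @ge0_integral_aff v (1, 0)%R (0, 1)%R f (oner_neq0 _).
rewrite d1 normr1 invr1 mul1e => /(_ (oner_neq0 _) mf f0) <-.
rewrite /lebesgue2 (fubini_tonelli1 (m1 := leb) (m2 := leb))//; last first.
  apply: (measurableT_comp mf); apply: measurable_pair_plane; exact: measurable_funD.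
rewrite /fubini_F; apply: eq_integral => x _; apply: eq_integral => y _; congr f.
by rewrite /aff /= !mulr1 !mulr0 !addr0.
Qed.

(** The measure of [A] intersected with [B - v], integrated over all [v], is the product of the two
    measures by Fubini, so it cannot vanish for every [v]. *)
Lemma pos_shift (A B : set plane) : measurable (A : set mplane) -> measurable (B : set mplane) ->
  0 < L2 A -> 0 < L2 B ->
  exists v : plane, 0 < L2 (A `&` [set x | B (v + x)%R]).
Proof.
move=> mA mB A0 B0; apply: contrapT => /forallNP H.
have : \int[L2]_x \int[L2]_v ((\1_A x)%:E * (\1_B (x + v)%R)%:E) = 0 :> \bar R.
  have mAB : measurable_fun [set: (mplane * mplane)%type]
     (fun z : mplane * mplane => (\1_A z.1)%:E * (\1_B (z.1 + z.2)%R)%:E : \bar R).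
    apply: emeasurable_funM; apply/measurable_EFinP.
      by apply: (measurableT_comp (measurable_indic mA)).
    apply: (measurableT_comp (measurable_indic mB)).
    have m1 : measurable_fun [set: (mplane * mplane)%type] (fun z : mplane * mplane => z.1.1).
      exact: measurableT_comp.
    have m2 : measurable_fun [set: (mplane * mplane)%type] (fun z : mplane * mplane => z.1.2).
      exact: measurableT_comp.
    have m3 : measurable_fun [set: (mplane * mplane)%type] (fun z : mplane * mplane => z.2.1).
      exact: measurableT_comp.
    have m4 : measurable_fun [set: (mplane * mplane)%type] (fun z : mplane * mplane => z.2.2).
      exact: measurableT_comp.
    by apply: measurable_pair_plane; exact: measurable_funD.
  have ge0 (z : mplane * mplane) : 0 <= (\1_A z.1)%:E * (\1_B (z.1 + z.2)%R)%:E :> \bar R.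
    by rewrite mule_ge0// lee_fin.
  apply: etrans; first exact: (@fubini_tonelli _ _ _ _ _ sfleb2 sfleb2 _ mAB ge0).
  apply: integral0_eq => v _.
  have mS : measurable ([set x | B (v + x)%R] : set mplane).
    rewrite -[X in measurable X]setTI; apply: (_ : measurable_fun setT (fun x : mplane => (v + x)%R : mplane)) => //.
    by apply: measurable_pair_plane; exact: measurable_funD.
  have := H v; rewrite lt0e measure_ge0 andbT => /negP; rewrite negbK => /eqP <-.
  rewrite -[X in L2 X]setIT -integral_indic//; last exact: measurableI.
  apply: eq_integral => x _; rewrite -EFinM; congr EFin.
  rewrite !indicE in_setI -mulnb natrM; congr (_ * (_ : bool)%:R)%R.
  by rewrite addrC; apply/idP/idP => /set_mem h; apply/mem_set.
have inner (x : mplane) : \int[L2]_v ((\1_A x)%:E * (\1_B (x + v)%R)%:E) = (\1_A x)%:E * L2 B.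
  have mBx : measurable_fun [set: mplane] (fun v : mplane => (\1_B (x + v)%R)%:E : \bar R).
    apply/measurable_EFinP; apply: (measurableT_comp (measurable_indic mB)).
    by apply: measurable_pair_plane; exact: measurable_funD.
  rewrite (@ge0_integralZl _ _ _ _ _ measurableT _ mBx)//.
  congr (_ * _); apply: etrans.
    apply: (@ge0_integral_shift x (fun z => (\1_B z)%:E)); first exact/measurable_EFinP.
    by move=> z; rewrite lee_fin.
  by rewrite integral_indic// setIT.
under eq_integral do rewrite inner.
have f0 : {in setT, forall x : mplane, 0 <= (\1_A x)%:E :> \bar R} by move=> x _; rewrite lee_fin.
rewrite ge0_integralZr//=; last exact/measurable_EFinP.
rewrite integral_indic// setIT => /eqP.
by rewrite mule_eq0 gt_eqF//= gt_eqF.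
Qed.

End affine_change_of_variables.

(** * Compactly supported functions and translations *)

Section bounded_support.
Context {R : realType}.
Local Notation plane := (R * R)%type.
Local Notation mplane := (measurableTypeR R * measurableTypeR R)%type.
Local Notation L2 := (@lebesgue2 R).

Lemma intg_cbox (f : mplane -> R) (c : plane) (r C : R) : 0 <= r ->
  measurable_fun setT f -> (forall x, `|f x| <= C) ->
  (forall x, ~ cbox c r x -> f x = 0) -> intg L2 f.
Proof.
move=> r0 mf fC f0.
have -> : f = (fun x => f x * \1_(cbox c r) x).
  apply/funext => x; rewrite indicE.
  have [/set_mem h|/negP h] := boolP (x \in cbox c r); first by rewrite mulr1.
  by rewrite f0 ?mul0r// => k; apply: h; exact/mem_set.
apply: (intgM mf fC); apply: intg_ge0 => //.
  by apply: measurable_indic; exact: measurable_cbox.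
rewrite integral_indic//; last exact: measurable_cbox.
by rewrite setIT lebesgue2_cbox// ltry.
Qed.

Lemma compact_in_cbox (K : set plane) : compact K ->
  exists2 r : R, 0 <= r & K `<=` cbox (0, 0) r.
Proof.
move=> /compact_bounded [M [_ hM]]; exists (Num.max 0 (M + 1)); first by rewrite le_max lexx.
move=> x Kx; have : `|x| <= M + 1 by apply: hM => //; rewrite ltrDl.
rewrite prod_normE ge_max => /andP[h1 h2].
by split => /=; rewrite subr0 le_max ?h1 ?h2 orbT.
Qed.

Lemma supp_bounded (f : plane -> R) (K : set plane) : compact K -> continuous f ->
  (forall x, ~ K x -> f x = 0) -> exists2 C : R, 0 <= C & forall x, `|f x| <= C.
Proof.
move=> cK cf f0.
have : compact (f @` K) by apply: continuous_compact => //; exact: continuous_subspaceT.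
move=> /compact_bounded [M [_ hM]]; exists (Num.max 0 (M + 1)); first by rewrite le_max lexx.
move=> x; have [Kx|nKx] := pselect (K x); last by rewrite f0// normr0 le_max lexx.
have h : `|f x| <= M + 1 by apply: (hM (M + 1)); [rewrite ltrDl|exists x].
by rewrite le_max h orbT.
Qed.

Lemma C1_supp0 (f fx fy : plane -> R) (K : set plane) : compact K -> C1 f fx fy ->
  (forall x, ~ K x -> f x = 0) -> forall x, ~ K x -> fx x = 0 /\ fy x = 0.
Proof.
move=> cK [_ _ _ df] f0 x nK.
have oK : open (~` K) by apply: closed_openC; apply: compact_closed => //; exact: norm_hausdorff.
have nf : \near x, f x = 0.
  by near=> y; apply: f0; near: y; exact: (open_nbhs_nbhs (conj oK nK)).
have E v : v.1 * fx x + v.2 * fy x = 0.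
  have [_ <-] := df x v.
  by rewrite (@near_eq_derive _ _ _ _ (fun=> 0) x v nf) derive_cst.
by split; [have := E (1, 0)|have := E (0, 1)]; rewrite /= mul1r mul0r ?addr0 ?add0r.
Unshelve. all: by end_near. Qed.

Lemma is_derive_line (f : plane -> R) (a w : plane) (s d : R) :
  is_derive (a + s *: w) w f d -> is_derive s 1 (fun s : R => f (a + s *: w)) d.
Proof.
move=> [h1 h2].
have E : (fun h : R => h^-1 *: (((fun s : R => f (a + s *: w)) \o shift s) (h *: 1) - f (a + s *: w)))
   = (fun h : R => h^-1 *: ((f \o shift (a + s *: w)) (h *: w) - f (a + s *: w))).
  apply/funext => h /=; congr (_ *: (f _ - _)).
  have -> : h *: (1 : R) = h by exact: mulr1.
  by rewrite scalerDl addrCA.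
by split; rewrite /derivable /derive ?E.
Qed.

Lemma is_derive_shift (f : plane -> R) (w x v : plane) (d : R) :
  is_derive (x + w) v f d -> is_derive x v (fun x => f (x + w)) d.
Proof.
move=> [h1 h2].
have E : (fun h : R => h^-1 *: (((fun x => f (x + w)) \o shift x) (h *: v) - f (x + w)))
   = (fun h : R => h^-1 *: ((f \o shift (x + w)) (h *: v) - f (x + w))).
  by apply/funext => h /=; congr (_ *: (f _ - _)); rewrite addrA.
by split; rewrite /derivable /derive ?E.
Qed.

Lemma continuous_shift (f : plane -> R) (w : plane) : continuous f -> continuous (fun x : plane => f (x + w)).
Proof.
move=> cf; have cs : continuous (fun x : plane => (x + w : plane)).
  by move=> x; apply: cvgD; [exact: cvg_id|exact: cvg_cst].
by move=> x; exact: (continuous_comp (cs x) (cf _)).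
Qed.

Lemma C1_shift (f fx fy : plane -> R) (w : plane) : C1 f fx fy ->
  C1 (fun x => f (x + w)) (fun x => fx (x + w)) (fun x => fy (x + w)).
Proof.
move=> [f0 f1 f2 fd]; split; [exact: continuous_shift..|].
by move=> x v; apply: is_derive_shift; exact: fd.
Qed.

Lemma Rintegral_shift (v : plane) (f : mplane -> R) : measurable_fun setT f ->
  \int[L2]_z f (v + z) = \int[L2]_z f z.
Proof.
move=> mf; congr fine; rewrite integralE [RHS]integralE; congr (_ - _)%E.
- apply: etrans; last first.
    apply: (@ge0_integral_shift _ v (fun z : mplane => ((EFin \o f)^\+ z)%E)).
      by apply: measurable_funepos; exact/measurable_EFinP.
    by move=> z; exact: funepos_ge0.
  by apply: eq_integral => z _; rewrite ?funeposE ?funenegE.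
- apply: etrans; last first.
    apply: (@ge0_integral_shift _ v (fun z : mplane => ((EFin \o f)^\- z)%E)).
      by apply: measurable_funeneg; exact/measurable_EFinP.
    by move=> z; exact: funeneg_ge0.
  by apply: eq_integral => z _; rewrite ?funeposE ?funenegE.
Qed.

Lemma measurable_shift (v : plane) (f : mplane -> R) : measurable_fun setT f ->
  measurable_fun setT (fun z : mplane => f (z + v)).
Proof.
by move=> mf; apply: (measurableT_comp mf); apply: measurable_pair_plane; exact: measurable_funD.
Qed.

Lemma intg_shift (v : plane) (f : mplane -> R) : intg L2 f -> intg L2 (fun z : mplane => f (z + v)).
Proof.
move=> hf; have mf := intg_meas hf.
apply/integrableP; split; first by apply/measurable_EFinP; exact: measurable_shift.
have := hf => /integrableP[_]; congr (_ < _)%E; apply: esym.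
apply: etrans; first last.
  apply: (@ge0_integral_shift _ v (fun z : mplane => `|(EFin \o f) z|%E)) => //.
  by apply: measurableT_comp => //; exact/measurable_EFinP.
by apply: eq_integral => z _ /=; rewrite addrC.
Qed.

Lemma eq_measure_Rintegral d (T : measurableType d) (m1 m2 : {measure set T -> \bar R}) (D : set T)
  (f : T -> R) : (forall x, ~ D x -> f x = 0) ->
  (forall A, measurable A -> A `<=` D -> m1 A = m2 A) -> \int[m1]_x f x = \int[m2]_x f x.
Proof.
move=> f0 m12; rewrite /Rintegral.
have E (m : {measure set T -> \bar R}) : (\int[m]_x (f x)%:E = \int[m]_(x in D) (f x)%:E)%E.
  rewrite [RHS]integral_mkcond; apply: eq_integral => x _; rewrite patchE.
  by case: ifPn => // /negP nD; rewrite f0// => Dx; apply: nD; exact/mem_set.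
by rewrite !E (eq_measure_integral m2).
Qed.

Lemma Rint_restr (D : set plane) (mD : measurable (D : set mplane)) (h : (L2 D < +oo)%E) (f : mplane -> R) :
  (forall x, ~ D x -> f x = 0) ->
  Rintegral (mfrestr mD h : {measure set mplane -> \bar R}) setT f = \int[L2]_x f x.
Proof.
move=> f0; apply: (@eq_measure_Rintegral _ _ (mfrestr mD h : {measure set mplane -> \bar R}) L2 D f f0) => A mA AD.
by rewrite /= /mfrestr /mrestr setIidl.
Qed.

(** The density result above concerns finite measures; Lebesgue measure restricted to a box is
    one. *)
Lemma testfun_density_leb (U A : set plane) (c : plane) (r e : R) : 0 <= r ->
  open U -> U `<=` cbox c r -> measurable (A : set mplane) -> 0 < e ->
  exists f : plane -> R, [/\ testfun U f, (forall x, 0 <= f x <= 1) &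
    \int[L2]_x `|f x - \1_(A `&` U) x| < e].
Proof.
move=> r0 oU UB mA e0.
have fin : (L2 (cbox c r) < +oo)%E by rewrite lebesgue2_cbox// ltry.
have [f [f1 f2 f3]] := testfun_density (mfrestr (measurable_cbox c r) fin) oU mA e0.
have z x : ~ cbox c r x -> `|f x - \1_(A `&` U) x| = 0.
  move=> nB; have nU : ~ U x by move=> /UB.
  have [_ [K [_ KU ->]]] := f1; last by move=> /KU.
  by rewrite indicE memNset ?subr0 ?normr0//; move=> [].
have E := Rint_restr (measurable_cbox c r) fin z.
by exists f; split; [exact: f1|exact: f2|rewrite -E; exact: f3].
Qed.

End bounded_support.

(** * Weak gradients and finite translations *)

Lemma unit_in_itv (R : realDomainType) (s : R) : 0 <= s <= 1 -> `]-1, 2[%classic s.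
Proof. by move=> ?; rewrite /= in_itv/=; lra. Qed.

Section weak_gradient.
Context {R : realType}.
Local Notation plane := (R * R)%type.
Local Notation mplane := (measurableTypeR R * measurableTypeR R)%type.
Local Notation L2 := (@lebesgue2 R).

(** The gradient is the vector measure with density [(n1, n2)] with respect to [mu]. The density is
    not normalised: energies are integrals of [pnorm p (n1, n2)] against [mu]. *)
Definition weak_grad (Omega : set plane) (u : plane -> R)
    (mu : {finite_measure set mplane -> \bar R}) (n1 n2 : mplane -> R) :=
  [/\ intg mu n1, intg mu n2 & forall f fx fy : plane -> R, C1 f fx fy ->
    compact_supp Omega f ->
    (\int[L2]_x (u x * fx x)%R = - \int[mu]_x (f x * n1 x)%R) /\
    (\int[L2]_x (u x * fy x)%R = - \int[mu]_x (f x * n2 x)%R)].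

Lemma C1_meas (f fx fy : plane -> R) : C1 f fx fy ->
  [/\ measurable_fun [set: mplane] (f : mplane -> R),
    measurable_fun [set: mplane] (fx : mplane -> R) &
    measurable_fun [set: mplane] (fy : mplane -> R)].
Proof. by move=> [? ? ? _]; split; exact: continuous_plane_measurable. Qed.

(** The mean value theorem for [F s], the integral of [u x * f (x - s v)], whose derivative is a
    pairing of the weak gradient with a translate of [f]. It handles the discontinuous [u] without
    mollification, at the price of an unknown [s]. *)
Lemma weak_grad_diff Omega u mu n1 n2 (f fx fy : plane -> R) (K : set plane) (v : plane) :
  weak_grad Omega u mu n1 n2 ->
  measurable_fun [set: mplane] (u : mplane -> R) -> (forall x, `|u x| <= 1) ->
  C1 f fx fy -> compact K -> (forall x, ~ K x -> f x = 0) ->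
  (forall x (s : R), K x -> 0 <= s <= 1 -> Omega (x + s *: v)) ->
  exists s : R, 0 <= s <= 1 /\
  \int[L2]_x (f x * (u (x + v) - u x)) =
    \int[mu]_x (f (x + s *: - v) * (v.1 * n1 x + v.2 * n2 x)).
Proof.
move=> [in1 in2 W] mu_ u1 Cf cK f0 KO.
have [mf mfx mfy] := C1_meas Cf.
have [cf cfx cfy df] := Cf.
pose g x := v.1 * fx x + v.2 * fy x.
have g0 x : ~ K x -> g x = 0.
  by move=> /(C1_supp0 cK Cf f0)[h1 h2]; rewrite /g h1 h2 !mulr0 addr0.
have cg : continuous g.
  move=> x; apply: cvgD; apply: cvgM; try exact: cvg_cst; [exact: cfx|exact: cfy].
have [C C0 gC] := supp_bounded cK cg g0.
have [Cf' _ fC] := supp_bounded cK cf f0.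
have [r r0 Kr] := compact_in_cbox cK.
pose M : R := `|v.1| + `|v.2|.
pose r' := r + 2 * M.
have M0 : 0 <= M by rewrite addr_ge0.
have r'0 : 0 <= r' by rewrite addr_ge0// mulr_ge0.
(* An open interval around [[0, 1]], as differentiation under the integral needs, on which the
   translated support stays in one box. *)
have box (x : plane) (s : R) : `]-1, 2[%classic s -> K (x + s *: - v) -> cbox (0, 0) r' x.
  rewrite /= in_itv/= => /andP[s1 s2] /Kr [/=]; rewrite !subr0 => h1 h2.
  have s3 : `|s| <= 2 by rewrite ler_norml; lra.
  have b1 : `|s * v.1| <= 2 * M.
    rewrite normrM ler_pM// ?normr_ge0//; by rewrite lerDl.
  have b2 : `|s * v.2| <= 2 * M.
    rewrite normrM ler_pM// ?normr_ge0//; by rewrite lerDr.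
  have e1 : x.1 = (x + s *: - v).1 + s * v.1 by rewrite /= /GRing.scale/=; ring.
  have e2 : x.2 = (x + s *: - v).2 + s * v.2 by rewrite /= /GRing.scale/=; ring.
  split; rewrite /= subr0.
    by rewrite e1 (le_trans (ler_normD _ _))// lerD.
  by rewrite e2 (le_trans (ler_normD _ _))// lerD.
pose phi (s : R) (x : mplane) := u x * f (x + s *: - v).
have dphi (s : R) (x : mplane) : is_derive s 1 (phi^~ x) (u x * - g (x + s *: - v)).
  have H := @is_derive_line _ f x (- v) s _ (df (x + s *: - v) (- v)).
  have := @is_deriveZ _ _ _ (fun s : R => f (x + s *: - v)) (u x) s 1 _ H.
  have -> : u x *: ((- v).1 * fx (x + s *: - v) + (- v).2 * fy (x + s *: - v)) =
     u x * - g (x + s *: - v) by rewrite /GRing.scale/= /g; ring.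
  exact.
have mphi (s : R) : measurable_fun setT (phi s).
  by apply: measurable_funM => //; exact: measurable_shift.
have iphi (s : R) : `]-1, 2[%classic s -> L2.-integrable setT (EFin \o phi s).
  move=> hs; apply: (@intg_cbox _ _ (0, 0) r' (1 * Cf')) => //.
    by move=> x; rewrite normrM ler_pM.
  by move=> x nb; rewrite /phi f0 ?mulr0// => /(box _ _ hs).
have dphi1 (s : R) (x : mplane) : `]-1, 2[%classic s -> setT x -> derivable (phi^~ x) s 1.
  by move=> _ _; have [] := dphi s x.
pose G (x : mplane) := C * \1_(cbox (0, 0) r') x.
have G0 x : 0 <= G x by rewrite mulr_ge0.
have iG : L2.-integrable setT (EFin \o G).
  apply: (@intg_cbox _ _ (0, 0) r' C) => //.
  - by apply: measurable_funM => //; apply: measurable_indic; exact: measurable_cbox.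
  - move=> x; rewrite ger0_norm// /G indicE; case: (_ \in _); by rewrite ?mulr1 ?mulr0.
  - by move=> x nb; rewrite /G indicE memNset// mulr0.
have Gub (s : R) (x : mplane) : `]-1, 2[%classic s -> setT x -> `|partial1of2 phi s x| <= G x.
  move=> hs _; rewrite partial1of2E; have [_ ->] := dphi s x.
  have [bx|nb] := pselect (cbox (0, 0) r' x); last first.
    by rewrite g0 ?oppr0 ?mulr0 ?normr0// => /(box _ _ hs).
  by rewrite normrM normrN /G indicE mem_set// mulr1 -[leRHS]mul1r ler_pM.
pose F (s : R) := \int[L2]_x phi s x.
have dF (s : R) : `]-1, 2[%classic s -> is_derive s 1 F (\int[L2]_x (u x * - g (x + s *: - v))).
  move=> hs; split.
    exact: (derivable_under_integral measurableT hs iphi dphi1 G0 iG Gub).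
  rewrite -derive1E.
  have := differentiation_under_integral measurableT hs iphi dphi1 G0 iG Gub.
  rewrite -/F => ->; apply: eq_Rintegral => x _; rewrite partial1of2E.
  by have [_ ->] := dphi s x.
have dF' (s : R) : s \in `]0, 1[ -> is_derive s 1 F (\int[L2]_x (u x * - g (x + s *: - v))).
  by rewrite in_itv/= => /andP[h1 h2]; apply: dF; rewrite /= in_itv/=; lra.
have cF : {within `[0, 1], continuous F}.
  apply: derivable_within_continuous => s; rewrite in_itv/= => /andP[h1 h2].
  by have [|] := dF s; rewrite //= in_itv/=; lra.
have [s] := MVT ltr01 dF' cF; rewrite in_itv/= => /andP[/ltW s0 /ltW s1].
rewrite subr0 mulr1 => FE; exists s; split; first by rewrite s0.
have hs0 : `]-1, 2[%classic (0 : R) by apply: unit_in_itv; rewrite lexx ler01.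
have hs1 : `]-1, 2[%classic (1 : R) by apply: unit_in_itv; rewrite lexx ler01.
have hss : `]-1, 2[%classic s by apply: unit_in_itv; rewrite s0.
transitivity (F 1 - F 0).
  have -> : F 1 = \int[L2]_x (f x * u (x + v)).
    rewrite /F -(@Rintegral_shift _ v)//; apply: eq_Rintegral => x _.
    rewrite /phi mulrC scale1r addrAC subrr add0r; congr (_ * u _); exact: addrC.
  have -> : F 0 = \int[L2]_x (f x * u x).
    by apply: eq_Rintegral => x _; rewrite /phi scale0r addr0 mulrC.
  rewrite -RintB.
  - by apply: eq_Rintegral => x _; rewrite mulrBr.
  - have := intg_shift v (iphi 1 hs1); congr (intg _ _); apply/funext => x.
    by rewrite /phi scale1r addrK mulrC.
  - have := iphi 0 hs0; congr (intg _ _); apply/funext => x.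
    by rewrite /phi scale0r addr0 mulrC.
rewrite FE.
have Cfs := C1_shift (s *: - v) Cf.
have supp : compact_supp Omega (fun x => f (x + s *: - v)).
  exists ((fun x : plane => x + s *: v) @` K); split.
  - apply: continuous_compact => //; apply: continuous_subspaceT => x.
    by apply: cvgD; [exact: cvg_id|exact: cvg_cst].
  - by move=> _ [x Kx <-]; apply: KO => //; rewrite s0.
  - move=> x nK; apply: f0 => Kx; apply: nK; exists (x + s *: - v) => //.
    by rewrite scalerN subrK.
have [W1 W2] := W _ _ _ Cfs supp.
have [mfs mfxs mfys] := C1_meas Cfs.
have bnd (h : plane -> R) : continuous h -> (forall x, ~ K x -> h x = 0) ->
    intg L2 (fun x => u x * h (x + s *: - v)).
  move=> ch h0; have [D D0 hD] := supp_bounded cK ch h0.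
  apply: (@intg_cbox _ _ (0, 0) r' (1 * D)) => //.
  - apply: measurable_funM => //; apply: (@measurable_shift _ _ h).
    exact: continuous_plane_measurable.
  - by move=> x; rewrite normrM ler_pM.
  - by move=> x nb; rewrite h0 ?mulr0// => /(box _ _ hss).
have ifx := bnd _ cfx (fun x nK => (C1_supp0 cK Cf f0 nK).1).
have ify := bnd _ cfy (fun x nK => (C1_supp0 cK Cf f0 nK).2).
transitivity (- (v.1 * \int[L2]_x (u x * fx (x + s *: - v)) + v.2 * \int[L2]_x (u x * fy (x + s *: - v)))).
  rewrite -!RintZ// -RintD; [|exact: intgZ..].
  rewrite -RintN; last by apply: intgD; exact: intgZ.
  by apply: eq_Rintegral => x _; rewrite /g; ring.
rewrite W1 W2 !mulrN -opprD opprK.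
have jn1 : intg mu (fun x => f (x + s *: - v) * n1 x) by apply: (@intgM _ _ _ _ Cf').
have jn2 : intg mu (fun x => f (x + s *: - v) * n2 x) by apply: (@intgM _ _ _ _ Cf').
rewrite -!RintZ// -RintD; [|exact: intgZ..].
by apply: eq_Rintegral => x _; ring.
Qed.

End weak_gradient.

Section difference_quotients.
Context {R : realType}.
Local Notation plane := (R * R)%type.
Local Notation mplane := (measurableTypeR R * measurableTypeR R)%type.
Local Notation L2 := (@lebesgue2 R).

Lemma ae_Rint_ge0 d (T : measurableType d) (m : {measure set T -> \bar R}) (f : T -> R) :
  intg m f -> {ae m, forall x, 0 <= f x} -> 0 <= \int[m]_x f x.
Proof.
move=> hf f0; rewrite /Rintegral fine_ge0//.
have mf : measurable_fun setT (EFin \o f) by apply/measurable_EFinP; exact: (intg_meas hf).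
have -> : (\int[m]_x (f x)%:E = \int[m]_x `|f x|%:E)%E.
  apply: ae_eq_integral => //.
    by apply/measurable_EFinP; apply: measurableT_comp => //; exact: (intg_meas hf).
  by move: f0; apply: filterS => x fx _; rewrite /= ger0_norm.
by apply: integral_ge0 => x _; rewrite lee_fin.
Qed.

Lemma eps_le (a b : R) (c : R) : 0 <= c -> (forall e, 0 < e -> a <= b + c * e) -> a <= b.
Proof.
move=> c0 H; rewrite leNgt; apply/negP => ba.
have := H ((a - b) / (c + 1) / 2) ltac:(by rewrite !divr_gt0// ?subr_gt0//; lra).
have : c * ((a - b) / (c + 1) / 2) <= (a - b) / 2.
  rewrite mulrA ler_pM2r ?invr_gt0// mulrA ler_pdivrMr; last lra.
  by rewrite mulrC ler_wpM2l; lra.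
lra.
Qed.

Definition convex_region (S : set plane) :=
  forall (x y : plane) (t : R), S x -> S y -> 0 <= t <= 1 -> S (x + t *: (y - x)).

Variables (Omega S : set plane) (E : set plane) (mu : {finite_measure set mplane -> \bar R}).
Variables (n1 n2 : mplane -> R) (v c : plane) (r : R).
Hypotheses (W : weak_grad Omega (\1_E) mu n1 n2) (mE : measurable (E : set mplane)).
Hypotheses (oS : open S) (cS : convex_region S) (SO : S `<=` Omega).
Hypotheses (r0 : 0 <= r) (SB : S `<=` cbox c r).

Let u : plane -> R := \1_E.
Let P := S `&` [set x | S (x + v)].
Let D (x : plane) := u (x + v) - u x.

Let mu_ : measurable_fun [set: mplane] (u : mplane -> R).
Proof. exact: measurable_indic. Qed.

Let mS : measurable (S : set mplane).
Proof. exact: open_plane_measurable. Qed.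

Let oP : open P.
Proof.
apply: openI => //.
have cs : continuous (fun x : plane => (x + v : plane)).
  by move=> x; apply: cvgD; [exact: cvg_id|exact: cvg_cst].
by move/continuousP : cs; apply.
Qed.

Let mP : measurable (P : set mplane).
Proof. exact: open_plane_measurable. Qed.

Let PB : P `<=` cbox c r.
Proof. by move=> x [/SB]. Qed.

Let Pseg x (s : R) : P x -> 0 <= s <= 1 -> S (x + s *: v).
Proof.
move=> [Sx Sxv] hs; have := cS Sx Sxv hs.
by rewrite addrAC subrr add0r.
Qed.

Let mshift (A : set plane) : measurable (A : set mplane) ->
  measurable ([set x | A (x + v)] : set mplane).
Proof.
move=> mA; rewrite -[X in measurable X]setTI.
apply: (_ : measurable_fun setT (fun x : mplane => (x + v : mplane))) => //.
by apply: measurable_pair_plane; exact: measurable_funD.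
Qed.

(** The points from which the translation by [v] enters [E], and, in [B], those from which it leaves
    [E]. *)
Let A := [set x | E (x + v)] `&` ~` E.
Let B := ~` [set x | E (x + v)] `&` E.

Let mA : measurable (A : set mplane).
Proof. by apply: measurableI; [exact: mshift|exact: measurableC]. Qed.

Let mB : measurable (B : set mplane).
Proof. by apply: measurableI => //; apply: measurableC; exact: mshift. Qed.

Let u_val x : u x = (x \in E)%:R. Proof. by rewrite /u indicE. Qed.

Let D_bound x : `|D x| <= 1.
Proof.
rewrite /D !u_val; case: (_ \in E); case: (_ \in E) => /=;
  by rewrite ?subrr ?subr0 ?sub0r ?normrN ?normr0 ?normr1 ?ler01.
Qed.

Let mD : measurable_fun [set: mplane] (D : mplane -> R).
Proof. by apply: measurable_funB => //; exact: (@measurable_shift _ v u). Qed.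

Let Dval x : D x = \1_A x - \1_B x.
Proof.
rewrite /D !u_val !indicE !in_setI !in_setC.
have -> : (x \in [set x | E (x + v)]) = (x + v \in E) by apply/idP/idP => /set_mem h; apply/mem_set.
by case: (_ \in E); case: (_ \in E) => /=; rewrite ?subrr ?subr0 ?sub0r.
Qed.

Let ivn : intg mu (fun x => v.1 * n1 x + v.2 * n2 x).
Proof. by case: W => h1 h2 _; apply: intgD; exact: intgZ. Qed.

Let intP (f : mplane -> R) : measurable_fun setT f -> (forall x, `|f x| <= 2) ->
  (forall x, ~ P x -> f x = 0) -> intg L2 f.
Proof.
move=> mf f2 f0; apply: (@intg_cbox _ _ c r 2) => // x nB.
by apply: f0 => /PB.
Qed.

Lemma weak_grad_diff_sup (f fx fy : plane -> R) : C1 f fx fy -> compact_supp P f ->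
  (forall x, `|f x| <= 1) ->
  exists s : R, 0 <= s <= 1 /\
  \int[L2]_x (f x * D x) =
    \int[mu]_x (f (x + s *: - v) * (v.1 * n1 x + v.2 * n2 x)) /\
  (forall x, ~ S x -> f (x + s *: - v) = 0).
Proof.
move=> Cf [K [cK KP f0]] f1.
have u1 x : `|u x| <= 1 by rewrite u_val ger0_norm// lern1; case: (_ \in _).
have [|s [hs Hs]] := @weak_grad_diff _ Omega u mu n1 n2 f fx fy K v W mu_ u1 Cf cK f0.
  by move=> x s Kx hs; apply: SO; apply: Pseg => //; exact: KP.
exists s; split => //; split => // x nS; apply: f0 => /KP PK; apply: nS.
by have := Pseg PK hs; rewrite scalerN subrK.
Qed.

(** A test function close to [1_A - 1_B], the sign of [D], is put into the mean value identity.
    Convexity of [S] keeps its translates inside [S], which bounds the right-hand side. *)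
Lemma bv_difference_le :
  \int[L2]_x (\1_P x * `|\1_E (x + v) - \1_E x|) <=
  \int[mu]_x (\1_S x * `|v.1 * n1 x + v.2 * n2 x|).
Proof.
apply: (@eps_le _ _ 2) => // e e0.
have [fA [[sA [KA [cKA KAP fA0]]] fA01 hA]] := testfun_density_leb r0 oP PB mA e0.
have [fB [[sB [KB [cKB KBP fB0]]] fB01 hB]] := testfun_density_leb r0 oP PB mB e0.
have [fx [fy Cf]] := smoothB sA sB.
pose f x := fA x - fB x.
have fsupp : compact_supp P f.
  exists (KA `|` KB); split; first exact: compactU.
    by move=> x [/KAP|/KBP].
  by move=> x /not_orP[a b]; rewrite /f fA0// fB0// subrr.
have f1 x : `|f x| <= 1.
  by have := fA01 x; have := fB01 x => ? ?; rewrite ler_norml /f; lra.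
have [s [hs [Hs sS]]] := weak_grad_diff_sup Cf fsupp f1.
have msA := smooth_measurable sA; have msB := smooth_measurable sB.
have mf : measurable_fun [set: mplane] (f : mplane -> R) by exact: measurable_funB.
have fnP x : ~ P x -> f x = 0 by case: fsupp => K [_ KP k] nP; apply: k => /KP.
have mnB : measurable_fun [set: mplane] (\1_(B `&` P) : mplane -> R).
  by apply: measurable_indic; exact: measurableI.
have mnA : measurable_fun [set: mplane] (\1_(A `&` P) : mplane -> R).
  by apply: measurable_indic; exact: measurableI.
have i1 : intg L2 (fun x => f x * D x).
  apply: intP => [||x nP]; [exact: measurable_funM| |by rewrite fnP// mul0r].
  by move=> x; rewrite normrM (le_trans (ler_pM _ _ (f1 x) (D_bound x)))// mulr1 ler1n.
have nAP x : ~ P x -> \1_(A `&` P) x = 0 :> R by move=> nP; rewrite indicE memNset// => -[].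
have nBP x : ~ P x -> \1_(B `&` P) x = 0 :> R by move=> nP; rewrite indicE memNset// => -[].
have fAnP x : ~ P x -> fA x = 0 by move=> nP; apply: fA0 => /KAP.
have fBnP x : ~ P x -> fB x = 0 by move=> nP; apply: fB0 => /KBP.
have i2 : intg L2 (fun x : mplane => `|fA x - \1_(A `&` P) x|).
  apply: intP => [||x nP]; last by rewrite fAnP// nAP// subrr normr0.
    by apply: measurableT_comp => //; exact: measurable_funB.
  move=> x; have := fA01 x; have := indic_bound (A `&` P) x => ? ?; rewrite normr_id ler_norml; lra.
have i3 : intg L2 (fun x : mplane => `|fB x - \1_(B `&` P) x|).
  apply: intP => [||x nP]; last by rewrite fBnP// nBP// subrr normr0.
    by apply: measurableT_comp => //; exact: measurable_funB.
  move=> x; have := fB01 x; have := indic_bound (B `&` P) x => ? ?; rewrite normr_id ler_norml; lra.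
(* On [P], the values [|D|] and [f * D] differ by at most the two approximation errors. *)
apply: (@le_trans _ _ (\int[L2]_x (f x * D x + (`|fA x - \1_(A `&` P) x| + `|fB x - \1_(B `&` P) x|)))).
  apply: Rint_le.
  - apply: intP => [||x nP]; last by rewrite indicE memNset// mul0r.
      apply: measurable_funM; first exact: measurable_indic.
      by apply: measurableT_comp => //; exact: mD.
    move=> x; rewrite normrM normr_id; have := D_bound x; have := normr_ge0 (D x).
    by have := indic_bound P x => /andP[p0 p1] *; rewrite ger0_norm//; nra.
  - by apply: intgD => //; exact: intgD.
  move=> x; have := Dval x; have := D_bound x; rewrite -/(D x) /f !indicE (@in_setI _ x A P) (@in_setI _ x B P).
  have := ler_norm (fA x - 1); have := ler_norm (1 - fA x); have := ler_norm (fA x).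
  have := ler_norm (fB x - 1); have := ler_norm (1 - fB x); have := ler_norm (fB x).
  rewrite ![`|1 - _|]distrC; have := fA01 x; have := fB01 x.
  case: (boolP (x \in P)) => Px.
    case: (boolP (x \in A)); case: (boolP (x \in B)) => /= xB xA; rewrite ?subr0 => *.
    + by move: xA xB => /set_mem[_ h1] /set_mem[_ h2].
    + have -> : D x = 1 by lra.
      rewrite normr1; lra.
    + have -> : D x = -1 by lra.
      rewrite normrN1; lra.
    + have -> : D x = 0 by lra.
      rewrite normr0; lra.
  rewrite !andbF /= fAnP ?fBnP; [|by move=> h; move/negP : Px; apply; exact/mem_set..].
  by rewrite !subrr !normr0 !mul0r !addr0.
rewrite RintD//; last exact: intgD.
rewrite RintD// lerD//; last by rewrite mulrDl mul1r lerD// ltW.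
rewrite Hs; apply: Rint_le.
- apply: (@intgM _ _ _ _ 1) => //; last by move=> x; exact: f1.
  by apply: (@measurable_shift _ (s *: - v) f).
- apply: (@intgM _ _ _ mu 1 (fun x => `|v.1 * n1 x + v.2 * n2 x|) (\1_S : mplane -> R)) => //.
  - by move=> x; have := indic_bound S x => /andP[? ?]; rewrite ger0_norm.
  - exact: intg_norm.
move=> x; have [Sx|nS] := pselect (S x).
  rewrite indicE mem_set// mul1r (le_trans (ler_norm _))// normrM.
  by rewrite -[leRHS]mul1r; apply: ler_pM => //; exact: f1.
have E0 : f (x + s *: - v) = 0 by exact: sS.
rewrite -[X in X * _]/(f (x + s *: - v)) E0.
by rewrite mul0r mulr_ge0//; have /andP[] := indic_bound S x.
Qed.

(** A test function close to the indicator of [B] in [P] makes the integral of [f * D] close to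
    minus the measure of that set, whereas the mean value identity makes it nonnegative. *)
Lemma bv_monotone : {ae mu, forall x, S x -> 0 <= v.1 * n1 x + v.2 * n2 x} ->
  L2 (E `&` S `&` [set x | S (x + v) /\ ~ E (x + v)]) = 0%E.
Proof.
move=> ge0.
have -> : E `&` S `&` [set x | S (x + v) /\ ~ E (x + v)] = B `&` P.
  by apply/seteqP; split => x; [move=> [[? ?] [? ?]]|move=> [[? ?] [? ?]]]; do !split.
have mBP : measurable (B `&` P : set mplane) by exact: measurableI.
have iBP : intg L2 (\1_(B `&` P) : mplane -> R).
  apply: intP => [||x nP]; last by rewrite indicE memNset// => -[].
    exact: measurable_indic.
  by move=> x; have := indic_bound (B `&` P) x => ?; rewrite ler_norml; lra.
suff : \int[L2]_x \1_(B `&` P) x <= 0.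
  rewrite -lee_fin -(Rint_EFin iBP) integral_indic// setIT => h.
  by apply/eqP; rewrite eq_le h measure_ge0.
apply: (@eps_le _ _ 1) => // e e0; rewrite add0r mul1r.
have [fB [[sB [KB [cKB KBP fB0]]] fB01 hB]] := testfun_density_leb r0 oP PB mB e0.
have [fx [fy Cf]] := sB.
have f1 x : `|fB x| <= 1.
  by have := fB01 x => ?; rewrite ler_norml; lra.
have fsupp : compact_supp P fB by exists KB.
have [s [hs [Hs sS]]] := weak_grad_diff_sup Cf fsupp f1.
have msB := smooth_measurable sB.
have fBnP x : ~ P x -> fB x = 0 by move=> nP; apply: fB0 => /KBP.
have mnB : measurable_fun [set: mplane] (\1_(B `&` P) : mplane -> R).
  exact: measurable_indic.
have nBP x : ~ P x -> \1_(B `&` P) x = 0 :> R by move=> nP; rewrite indicE memNset// => -[].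
have i3 : intg L2 (fun x : mplane => `|fB x - \1_(B `&` P) x|).
  apply: intP => [||x nP]; last by rewrite fBnP// nBP// subrr normr0.
    by apply: measurableT_comp => //; exact: measurable_funB.
  move=> x; have := fB01 x; have := indic_bound (B `&` P) x => ? ?; rewrite normr_id ler_norml; lra.
have i1 : intg L2 (fun x => fB x * D x).
  apply: intP => [||x nP]; [exact: measurable_funM| |by rewrite fBnP// mul0r].
  by move=> x; rewrite normrM (le_trans (ler_pM _ _ (f1 x) (D_bound x)))// mulr1 ler1n.
have pos : 0 <= \int[L2]_x (fB x * D x).
  rewrite Hs; apply: ae_Rint_ge0.
    apply: (@intgM _ _ _ _ 1) => //; exact: (@measurable_shift _ (s *: - v) fB).
  case: ge0 => N [mN N0 HN]; exists N; split => // x /= nx; apply: HN => /= h; apply: nx.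
  have [Sx|nS] := pselect (S x); last by rewrite sS// mul0r.
  by apply: mulr_ge0; [have /andP[] := fB01 (x + s *: - v)|exact: h].
apply: (@le_trans _ _ (\int[L2]_x (`|fB x - \1_(B `&` P) x| - fB x * D x))).
  apply: Rint_le => //; first exact: intgB.
  move=> x; have := Dval x; have := D_bound x; rewrite -/(D x) !indicE (@in_setI _ x B P).
  have := ler_norm (fB x - 1); have := ler_norm (1 - fB x); have := ler_norm (fB x).
  rewrite ![`|1 - _|]distrC; have := fB01 x.
  case: (boolP (x \in P)) => Px.
    case: (boolP (x \in A)); case: (boolP (x \in B)) => /= xB xA; rewrite ?subr0 => *.
    + by move: xA xB => /set_mem[_ h1] /set_mem[_ h2].
    + have -> : D x = 1 by lra.
      lra.
    + have -> : D x = -1 by lra.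
      lra.
    + have -> : D x = 0 by lra.
      lra.
  rewrite !andbF /= fBnP; last by move=> h; move/negP : Px; apply; exact/mem_set.
  by rewrite !subrr !normr0 !mul0r !subr0.
rewrite RintB//; lra.
Qed.

End difference_quotients.

(** * The p-norm, duality and strict convexity *)

Section pnorm_theory.
Context {R : realType} (p : R).
Hypothesis p1 : 1 < p.
Local Notation plane := (R * R)%type.
Implicit Types x n : plane.

Let p0 : 0 < p. Proof. exact: lt_trans p1. Qed.
Let pn0 : p != 0. Proof. by rewrite gt_eqF. Qed.
Let pm0 : 0 < p - 1. Proof. by rewrite subr_gt0. Qed.

Lemma pnorm_ge0 x : 0 <= pnorm p x. Proof. exact: powR_ge0. Qed.

Lemma pnorm_powR x : pnorm p x `^ p = `|x.1| `^ p + `|x.2| `^ p.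
Proof. by rewrite /pnorm -powRrM mulVf// powRr1// addr_ge0// powR_ge0. Qed.

Lemma powRK (a : R) : 0 <= a -> (a `^ p) `^ p^-1 = a.
Proof. by move=> a0; rewrite -powRrM mulfV// powRr1. Qed.

Lemma pnormZ (c : R) x : pnorm p (c *: x) = `|c| * pnorm p x.
Proof.
rewrite /pnorm /= /GRing.scale/= !normrM !powRM// -mulrDr powRM ?powR_ge0//.
  by rewrite powRK.
Qed.

Lemma pnorm_ge1 x : `|x.1| <= pnorm p x.
Proof.
rewrite -[leLHS]powRK// ge0_ler_powR ?nnegrE ?powR_ge0 ?addr_ge0 ?powR_ge0 ?invr_ge0 ?(ltW p0)//.
by rewrite lerDl powR_ge0.
Qed.

Lemma pnorm_ge2 x : `|x.2| <= pnorm p x.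
Proof.
rewrite -[leLHS]powRK// ge0_ler_powR ?nnegrE ?powR_ge0 ?addr_ge0 ?powR_ge0 ?invr_ge0 ?(ltW p0)//.
by rewrite lerDr powR_ge0.
Qed.

Lemma pnorm_eq0 x : pnorm p x = 0 -> x = 0.
Proof.
move=> h; have := pnorm_ge1 x; have := pnorm_ge2 x; rewrite h !normr_le0.
by case: x {h} => a b /= /eqP -> /eqP ->.
Qed.

Lemma pnorm0 : pnorm p 0 = 0.
Proof. by rewrite -(scale0r (0 : plane)) pnormZ normr0 mul0r. Qed.

(** With [b = a * expR y], Young's inequality and its equality case reduce to [1 + t < expR t] at
    [t = - y] and [t = (p - 1) y], combined with weights [1 - 1/p] and [1/p]; the terms linear in
    [y] cancel. *)
Lemma young_strict (a b : R) : 0 <= a -> 0 <= b ->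
  a `^ (p - 1) * b <= (1 - p^-1) * a `^ p + p^-1 * b `^ p ?= iff (a == b).
Proof.
move=> a0 b0.
have ip1 : p^-1 < 1 by rewrite invf_lt1.
have ip0 : 0 < p^-1 by rewrite invr_gt0.
have [->|an0] := eqVneq a 0.
  rewrite !powR0 ?mul0r ?mulr0 ?add0r ?(gt_eqF pm0)//; split.
    by rewrite mulr_ge0// ?powR_ge0// ltW.
  have [<-|bn0] := eqVneq 0 b; first by rewrite powR0// mulr0 eqxx.
  by rewrite lt_eqF// mulr_gt0// powR_gt0// lt_neqAle bn0.
have ap : 0 < a by rewrite lt_neqAle eq_sym an0.
have -> : a `^ p = a * a `^ (p - 1) by rewrite mulr_powRB1.
have [<-|ab] := eqVneq a b.
  split; last by apply/eqP; rewrite -[a `^ p](@mulr_powRB1 _ a p)//; ring.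
  by rewrite -[a `^ p](@mulr_powRB1 _ a p)// le_eqVlt; apply/orP; left; apply/eqP; ring.
suff h : a `^ (p - 1) * b < (1 - p^-1) * (a * a `^ (p - 1)) + p^-1 * b `^ p.
  by split; [exact: ltW|rewrite lt_eqF].
have A0 : 0 < a `^ (p - 1) by exact: powR_gt0.
have [->|bn0] := eqVneq b 0.
  rewrite mulr0 powR0// mulr0 addr0 !mulr_gt0// subr_gt0//.
have bp : 0 < b by rewrite lt_neqAle eq_sym bn0.
pose y := ln b - ln a.
have yn0 : y != 0 by rewrite subr_eq0 eq_sym; apply: contra ab => /eqP/ln_inj ->//.
have bE : b = a * expR y.
  by rewrite /y expRB !lnK ?posrE// mulrC divfK.
have bpE : b `^ p = a * a `^ (p - 1) * (expR y * expR ((p - 1) * y)).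
  rewrite mulr_powRB1// bE powRM ?expR_ge0//; congr (_ * _).
  by rewrite -expRD -expRM; congr expR; ring.
rewrite bpE bE; set m := expR y.
have m0 : 0 < m by exact: expR_gt0.
have h1 : m * (1 - y) < 1.
  have := @expR_gt1Dx R (- y) ltac:(by rewrite oppr_eq0).
  by rewrite expRN -/m => h; rewrite -(@ltr_pM2l _ m)// mulfV ?gt_eqF// in h.
have h2 : 1 + (p - 1) * y < expR ((p - 1) * y).
  by apply: expR_gt1Dx; rewrite mulf_neq0// gt_eqF.
have key : m < (1 - p^-1) + p^-1 * (m * expR ((p - 1) * y)).
  have k1 : (1 - p^-1) * (m * (1 - y)) < 1 - p^-1.
    by rewrite -[ltRHS]mulr1 ltr_pM2l// subr_gt0.
  have k2 : p^-1 * (m * (1 + (p - 1) * y)) < p^-1 * (m * expR ((p - 1) * y)).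
    by rewrite ltr_pM2l// ltr_pM2l.
  have k3 : m = (1 - p^-1) * (m * (1 - y)) + p^-1 * (m * (1 + (p - 1) * y)) by field.
  by rewrite {1}k3 ltrD.
have -> : a `^ (p - 1) * (a * m) = a * a `^ (p - 1) * m by ring.
have -> : (1 - p^-1) * (a * a `^ (p - 1)) + p^-1 * (a * a `^ (p - 1) * (m * expR ((p - 1) * y))) =
  a * a `^ (p - 1) * ((1 - p^-1) + p^-1 * (m * expR ((p - 1) * y))) by ring.
by rewrite ltr_pM2l// mulr_gt0.
Qed.

(* Gradient of the norm at n; it is 0 at n = 0 since x / 0 = 0. *)
Definition pdual n : plane :=
  (Num.sg n.1 * (`|n.1| / pnorm p n) `^ (p - 1), Num.sg n.2 * (`|n.2| / pnorm p n) `^ (p - 1)).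

Definition dot x n : R := x.1 * n.1 + x.2 * n.2.

Lemma pdual0 : pdual 0 = 0.
Proof. by rewrite /pdual /= sgr0 !mul0r. Qed.

Lemma pdual_dot_self n : dot (pdual n) n = pnorm p n.
Proof.
have [->|n0] := eqVneq n 0; first by rewrite pdual0 /dot /= pnorm0 !mul0r addr0.
have N0 : 0 < pnorm p n.
  by rewrite lt_neqAle pnorm_ge0 andbT eq_sym; apply: contra n0 => /eqP/pnorm_eq0 ->.
have E (a : R) : Num.sg a * (`|a| / pnorm p n) `^ (p - 1) * a = pnorm p n * (`|a| / pnorm p n) `^ p.
  rewrite -[in RHS](@mulr_powRB1 _ (`|a| / pnorm p n) p)//; last by rewrite divr_ge0// ltW.
  rewrite mulrAC -normrEsg; field; by rewrite gt_eqF.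
rewrite /dot /= !E -mulrDr !powRM ?invr_ge0 ?(ltW N0)//.
rewrite -mulrDl -pnorm_powR -powRM ?invr_ge0 ?(ltW N0)// mulfV ?gt_eqF//.
by rewrite powR1 mulr1.
Qed.

Lemma pdual_le1 n : `|(pdual n).1| <= 1 /\ `|(pdual n).2| <= 1.
Proof.
have E (a : R) : `|a| <= pnorm p n -> `|Num.sg a * (`|a| / pnorm p n) `^ (p - 1)| <= 1.
  move=> h; rewrite normrM normr_sg; case: (a != 0); last by rewrite mul0r.
  rewrite mul1r ger0_norm ?powR_ge0//.
  have [->|N0] := eqVneq (pnorm p n) 0.
    by rewrite invr0 mulr0 powR0// gt_eqF.
  have N0' : 0 < pnorm p n by rewrite lt_neqAle pnorm_ge0 eq_sym N0.
  have E1 : 1 `^ (p - 1) = 1 :> R by rewrite powR1.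
  rewrite -[leRHS]E1.
  rewrite ge0_ler_powR ?nnegrE ?ler01 ?(ltW pm0) ?divr_ge0 ?(ltW N0')//.
  by rewrite ler_pdivrMr// mul1r.
by split; apply: E; [exact: pnorm_ge1|exact: pnorm_ge2].
Qed.

(** Hoelder's inequality with its equality case, summed from Young's inequality in each coordinate.
    The equality case is the strict convexity that later fixes the direction of the gradient. *)
Lemma pdual_dot n x :
  dot (pdual n) x <= pnorm p x /\
  (n != 0 -> dot (pdual n) x = pnorm p x -> exists2 c : R, 0 <= c & x = c *: n).
Proof.
have [->|x0] := eqVneq x 0.
  rewrite /dot /= !mulr0 addr0 pnorm0; split => // _ _.
  by exists 0; rewrite ?scale0r.
have M0 : 0 < pnorm p x.
  by rewrite lt_neqAle pnorm_ge0 andbT eq_sym; apply: contra x0 => /eqP/pnorm_eq0 ->.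
have [->|n0] := eqVneq n 0.
  by rewrite pdual0 /dot /= !mul0r addr0; split => //; exact: pnorm_ge0.
have N0 : 0 < pnorm p n.
  by rewrite lt_neqAle pnorm_ge0 andbT eq_sym; apply: contra n0 => /eqP/pnorm_eq0 ->.
set N := pnorm p n in N0 *; set M := pnorm p x in M0 *.
have nn (y : plane) K : K = pnorm p y -> 0 < K -> (`|y.1| / K) `^ p + (`|y.2| / K) `^ p = 1.
  move=> -> K0; rewrite !powRM ?invr_ge0 ?(ltW K0)// -mulrDl -pnorm_powR.
  by rewrite -powRM ?invr_ge0 ?(ltW K0)// mulfV ?gt_eqF// powR1.
have an := nn n N erefl N0; have bn := nn x M erefl M0.
rewrite /dot /pdual /= -/N; clear nn; clearbody N M.
have step (a b : R) :
    Num.sg a * (`|a| / N) `^ (p - 1) * b <= M * ((1 - p^-1) * (`|a| / N) `^ p + p^-1 * (`|b| / M) `^ p) /\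
    (Num.sg a * (`|a| / N) `^ (p - 1) * b = M * ((1 - p^-1) * (`|a| / N) `^ p + p^-1 * (`|b| / M) `^ p) ->
     b = M / N * a).
  have a0 : 0 <= `|a| / N := divr_ge0 (normr_ge0 a) (ltW N0).
  have b0 : 0 <= `|b| / M := divr_ge0 (normr_ge0 b) (ltW M0).
  have [h1 h2] := young_strict a0 b0.
  have pw0 := powR_ge0 (`|a| / N) (p - 1).
  have h3 : Num.sg a * (`|a| / N) `^ (p - 1) * b <= M * ((`|a| / N) `^ (p - 1) * (`|b| / M)).
    have -> : M * ((`|a| / N) `^ (p - 1) * (`|b| / M)) = (`|a| / N) `^ (p - 1) * `|b|.
      by field; rewrite gt_eqF.
    rewrite mulrAC mulrC ler_wpM2l//; apply: le_trans (ler_norm _) _.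
    by rewrite normrM normr_sg; case: (a != 0); rewrite ?mul1r ?mul0r.
  split; first by apply: (le_trans h3); rewrite ler_pM2l.
  move=> eq; have h4 : (`|a| / N) `^ (p - 1) * (`|b| / M) = (1 - p^-1) * (`|a| / N) `^ p + p^-1 * (`|b| / M) `^ p.
    apply/eqP; rewrite eq_le h1/= -(@ler_pM2l _ M)//.
    by rewrite -eq.
  move: h2; rewrite h4 eqxx => /esym/eqP abE.
  have bE : `|b| = M / N * `|a|.
    have -> : `|b| = M * (`|b| / M) by field; rewrite gt_eqF.
    by rewrite -abE; field; rewrite gt_eqF.
  have [a00|an0] := eqVneq a 0.
    by move: bE; rewrite a00 normr0 mulr0 => /normr0_eq0.
  (* Young's inequality only fixes absolute values; equality in the signed product makes the signs
     agree. *)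
  have sgE : Num.sg a * b = `|b|.
    have A0 : 0 < (`|a| / N) `^ (p - 1) by rewrite powR_gt0// divr_gt0// normr_gt0.
    apply: (mulfI (lt0r_neq0 A0)); rewrite mulrCA mulrA eq -h4.
    by field; rewrite gt_eqF.
  have : Num.sg a * (Num.sg a * b) = Num.sg a * `|b| by rewrite sgE.
  by rewrite mulrA -expr2 sqr_sg an0 mul1r bE mulrCA -numEsg.
have [s1 e1] := step n.1 x.1; have [s2 e2] := step n.2 x.2.
have tot : M * ((1 - p^-1) * (`|n.1| / N) `^ p + p^-1 * (`|x.1| / M) `^ p) +
    M * ((1 - p^-1) * (`|n.2| / N) `^ p + p^-1 * (`|x.2| / M) `^ p) = M.
  rewrite -mulrDr addrACA -!mulrDr an bn !mulr1 subrK mulr1//.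
split; first by rewrite -tot lerD.
move=> _; rewrite -{1}tot => eq.
exists (M / N); first exact: (divr_ge0 (ltW M0) (ltW N0)).
have q1 : x.1 = M / N * n.1 by apply: e1; lra.
have q2 : x.2 = M / N * n.2 by apply: e2; lra.
by rewrite [LHS]surjective_pairing q1 q2.
Qed.

Lemma pdual_dot_le n x : dot (pdual n) x <= pnorm p x.
Proof. by have [] := pdual_dot n x. Qed.

(** The norm of the sum is attained on its own dual vector, and duality bounds each summand. *)
Lemma pnormD x n : pnorm p (x + n) <= pnorm p x + pnorm p n.
Proof.
rewrite -[leLHS]pdual_dot_self.
have -> : dot (pdual (x + n)) (x + n) = dot (pdual (x + n)) x + dot (pdual (x + n)) n.
  by rewrite /dot /=; ring.
by apply: lerD; exact: pdual_dot_le.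
Qed.

Lemma pnorm_le_abs x : pnorm p x <= `|x.1| + `|x.2|.
Proof.
rewrite -[leLHS]pdual_dot_self /dot.
have [h1 h2] := pdual_le1 x.
apply: lerD; (apply: le_trans (ler_norm _) _); rewrite normrM -[leRHS]mul1r ler_wpM2r//.
Qed.

(** The maximum of [|x.1| + |x.2|] over the unit ball of the p-norm, attained on the diagonal. *)
Definition pcorner : R := 2 `^ (1 - p^-1).

Lemma pcorner_bounds : 1 < pcorner < 2.
Proof.
have ip1 : p^-1 < 1 by rewrite invf_lt1.
have ip0 : 0 < p^-1 by rewrite invr_gt0.
have lt1 (a : R) : 0 < a -> 1 < 2 `^ a.
  move=> a0; have := @gt0_ltr_powR R a a0 1 2.
  by rewrite powR1; apply; rewrite ?nnegrE//; lra.
have h1 : 1 < 2 `^ (1 - p^-1) by apply: lt1; lra.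
have h2 := lt1 _ ip0.
have h3 : 2 `^ (1 - p^-1) * 2 `^ p^-1 = 2 :> R.
  by rewrite -powRD ?subrK ?powRr1//; apply/implyP => _.
by rewrite /pcorner h1/=; nra.
Qed.

End pnorm_theory.

(** * Integration against signed measures *)

Section charge_integrals.
Context d {T : measurableType d} {R : realType}.

Definition bmeas (f : T -> R) := measurable_fun setT f /\ exists B : R, forall x, `|f x| <= B.

Lemma bmeas_cst c : bmeas (fun=> c).
Proof. by split => //; exists `|c|. Qed.

Lemma bmeasD f g : bmeas f -> bmeas g -> bmeas (fun x => f x + g x).
Proof.
move=> [mf [B fB]] [mg [C gC]]; split; first exact: measurable_funD.
by exists (B + C) => x; rewrite (le_trans (ler_normD _ _))// lerD.
Qed.

Lemma bmeasZ c f : bmeas f -> bmeas (fun x => c * f x).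
Proof.
move=> [mf [B fB]]; split; first exact: measurable_funM.
by exists (`|c| * B) => x; rewrite normrM ler_wpM2l.
Qed.

Lemma bmeas_indic A : measurable A -> bmeas (\1_A).
Proof.
move=> mA; split; first exact: measurable_indic.
by exists 1 => x; rewrite indicE; case: (_ \in _); rewrite /= ?normr0 ?normr1.
Qed.

(** The sum is the integer part of [t] truncated at [N]: the step function behind the uniform
    approximation below. *)
Lemma staircase (N : nat) (t : R) : 0 <= t ->
  let S := \sum_(0 <= k < N) ((k.+1%:R <= t)%R : nat)%:R in
  [/\ S <= N%:R :> R, S <= t & Num.min N%:R (t - 1) <= S].
Proof.
move=> t0; elim: N => [|N [h1 h2 h3]] /=.
  by rewrite big_geq//; split; rewrite ?lexx// ge_min lexx.
rewrite big_nat_recr//=; set S := \sum_(0 <= k < N) _ in h1 h2 h3 *.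
move: h3; rewrite !ge_min -!natr1 => h3.
case: (leP (N%:R + 1) t) => hN /=.
  have NS : N%:R <= S by case/orP: h3 => h; lra.
  split; [lra|lra|]; apply/orP; left; lra.
split; [lra|lra|]; apply/orP; right.
by case/orP: h3 => h; lra.
Qed.

(* Uniform approximation by step functions reduces an identity between
   integrals to indicator functions. *)
Lemma bounded_linear_ext (Phi : (T -> R) -> R) (C : R) : 0 <= C ->
  (forall f g, bmeas f -> bmeas g -> Phi (fun x => f x + g x) = Phi f + Phi g) ->
  (forall c f, bmeas f -> Phi (fun x => c * f x) = c * Phi f) ->
  (forall (f : T -> R) (B : R), measurable_fun setT f -> (forall x, `|f x| <= B) -> `|Phi f| <= C * B) ->
  (forall A, measurable A -> Phi (\1_A) = 0) ->
  forall f, bmeas f -> Phi f = 0.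
Proof.
move=> C0 PD PZ PC P0.
have H01 (f : T -> R) : measurable_fun setT f -> (forall x, 0 <= f x <= 1) -> Phi f = 0.
  move=> mf f01.
  have bf : bmeas f by split => //; exists 1 => x; rewrite ger0_norm; have /andP[] := f01 x.
  apply/normr0_eq0/eqP; rewrite eq_le normr_ge0 andbT.
  apply: (@eps_le _ _ _ C) => // e e0; rewrite add0r.
  pose N := (Num.truncn e^-1).+1.
  have N0 : 0 < N%:R :> R by [].
  have Ne : N%:R^-1 <= e.
    rewrite invf_ple ?posrE//; apply: ltW; exact: Num.Theory.truncnS_gt.
  pose A k := [set x | k.+1%:R <= N%:R * f x].
  have mA k : measurable (A k).
    have -> : A k = (fun x => N%:R * f x) @^-1` `[k.+1%:R, +oo[%classic.
      by apply/seteqP; split => x /=; rewrite /A in_itv/= andbT.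
    by rewrite -[X in measurable X]setTI; apply: measurable_funM.
  pose g m x := \sum_(0 <= k < m) \1_(A k) x : R.
  have gE m : bmeas (g m) /\ Phi (g m) = 0.
    elim: m => [|m [ih1 ih2]].
      have -> : g 0%N = (fun=> 0) by apply/funext => x; rewrite /g big_geq.
      split; first exact: bmeas_cst.
      have := PZ 0 _ (bmeas_cst 0); rewrite [RHS]mul0r => h0; rewrite -[RHS]h0.
      by congr Phi; apply/funext => x; rewrite mul0r.
    have -> : g m.+1 = (fun x => g m x + \1_(A m) x).
      by apply/funext => x; rewrite /g big_nat_recr.
    split; first by apply: bmeasD => //; exact: bmeas_indic.
    by rewrite PD//; [rewrite ih2 P0// addr0|exact: bmeas_indic].
  have [bg Pg] := gE N.
  have -> : f = (fun x => (f x + - N%:R^-1 * g N x) + N%:R^-1 * g N x).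
    by apply/funext => x; rewrite mulNr subrK.
  rewrite PD; [|apply: bmeasD => //; exact: bmeasZ|exact: bmeasZ].
  rewrite [X in _ + X]PZ// Pg mulr0 addr0.
  apply: (@le_trans _ _ (C * N%:R^-1)); last by rewrite ler_wpM2l.
  apply: PC; first by apply: measurable_funD => //; apply: measurable_funM => //; exact: bg.1.
  move=> x; have /andP[fx0 fx1] := f01 x.
  have Nf0 : 0 <= N%:R * f x by rewrite mulr_ge0.
  have [h1 h2 h3] := staircase N Nf0.
  have gx : g N x = \sum_(0 <= k < N) ((k.+1%:R <= N%:R * f x)%R : nat)%:R.
    apply: eq_bigr => k _; rewrite indicE; congr ((_ : bool)%:R).
    by apply/idP/idP => [/set_mem//|h]; exact/mem_set.
  rewrite -gx in h1 h2 h3.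
  have h4 : N%:R * f x - 1 <= g N x.
    move: h3; rewrite ge_min => /orP[h|//]; apply: le_trans h; rewrite lerBlDr.
    by rewrite (le_trans (ler_wpM2l _ fx1))// mulr1 lerDl.
  have -> : f x + - N%:R^-1 * g N x = N%:R^-1 * (N%:R * f x - g N x).
    by field; rewrite gt_eqF.
  rewrite normrM ger0_norm ?invr_ge0// -[leRHS]mulr1 ler_wpM2l ?invr_ge0//.
  by rewrite ler_norml; lra.
move=> f [mf [B fB]].
pose b := `|B| + 1.
have b0 : 0 < b by rewrite ltr_wpDl.
have fb x : `|f x| <= b by rewrite (le_trans (fB x))// /b (le_trans (ler_norm _))// lerDl.
pose h x := (2 * b)^-1 * (f x + b).
have mh : measurable_fun setT h by apply: measurable_funM => //; exact: measurable_funD.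
have h01 x : 0 <= h x <= 1.
  have := fb x; rewrite ler_norml /h => /andP[h1 h2].
  by rewrite mulr_ge0 ?invr_ge0/= ?ler_pdivrMl ?mulr1; lra.
have bh : bmeas h by split => //; exists 1 => x; rewrite ger0_norm; have /andP[] := h01 x.
have -> : f = (fun x => 2 * b * h x + (- b) * \1_setT x).
  apply/funext => x; rewrite /h indicE in_setT mulr1; field; lra.
rewrite PD; [|exact: bmeasZ|apply: bmeasZ; exact: bmeas_indic].
have P1 : Phi (fun x => \1_setT x) = 0 by exact: P0.
have b1 : bmeas (fun x : T => \1_setT x : R) by exact: bmeas_indic.
by rewrite (PZ _ _ b1) (PZ _ _ bh) P1 H01// !mulr0 addr0.
Qed.

Variable (nu : {charge set T -> \bar R}).

Lemma bmeas_intg (m : {finite_measure set T -> \bar R}) f : bmeas f -> intg m f.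
Proof.
move=> [mf [B fB]]; apply: (intg_le mf fB).
exact: finite_measure_integrable_cst.
Qed.

(** This hides the Hahn decomposition chosen by [charge_integral]; later arguments only see a
    difference of two finite measures. *)
Lemma charge_integral_jordan : exists jp jn : {finite_measure set T -> \bar R},
  (forall A, measurable A -> nu A = (jp A - jn A)%E) /\
  forall f, bmeas f -> charge_integral nu f = (\int[jp]_x f x - \int[jn]_x f x)%:E.
Proof.
rewrite /charge_integral.
set hP := cid (Hahn_decomposition nu); set hN := cid (svalP hP).
exists (jordan_pos (svalP hN)), (jordan_neg (svalP hN)); split.
  move=> A mA; rewrite {1}(jordan_decomp (svalP hN) mA) /cadd /=.
  by rewrite cscaleN1.
move=> f bf; rewrite EFinB; congr (_ - _)%E.
  by apply: Rint_EFin; exact: bmeas_intg.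
by apply: Rint_EFin; exact: bmeas_intg.
Qed.

End charge_integrals.

Section finite_pack.
Context d (T : measurableType d) (R : realType) (m : {measure set T -> \bar R}).
Hypothesis sf : fin_num_fun m.
Definition finite_copy : set T -> \bar R := m.
HB.instance Definition _ := Measure.on finite_copy.
HB.instance Definition _ := Measure_isFinite.Build _ _ _ finite_copy sf.
Definition finite_pack : {finite_measure set T -> \bar R} := finite_copy.
End finite_pack.

Section linear_functionals.
Context d {T : measurableType d} {R : realType}.

Lemma Rint_functional (m : {measure set T -> \bar R}) (a : T -> R) : intg m a ->
  let Phi f := \int[m]_x (f x * a x) in
  [/\ (forall f g, bmeas f -> bmeas g -> Phi (fun x => f x + g x) = Phi f + Phi g),
  (forall c f, bmeas f -> Phi (fun x => c * f x) = c * Phi f) &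
  (forall (f : T -> R) (B : R), measurable_fun setT f -> (forall x, `|f x| <= B) ->
     `|Phi f| <= \int[m]_x `|a x| * B)].
Proof.
move=> ia Phi.
have im f : bmeas f -> intg m (fun x => f x * a x).
  by move=> [mf [B fB]]; exact: (intgM mf fB).
split.
- move=> f g bf bg; rewrite /Phi -RintD; [|exact: im..].
  by apply: eq_Rintegral => x _; rewrite mulrDl.
- move=> c f bf; rewrite /Phi -RintZ; [|exact: im].
  by apply: eq_Rintegral => x _; rewrite mulrA.
- move=> f B mf fB.
  have if_ : intg m (fun x => f x * a x) by exact: (intgM mf fB).
  apply: (le_trans (le_normr_Rintegral measurableT if_)).
  rewrite mulrC -RintZ; last exact: intg_norm.
  apply: Rint_le; [exact: intg_norm|by apply: intgZ; exact: intg_norm|].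
  by move=> x; rewrite normrM ler_wpM2r.
Qed.

Lemma two_densities (m m1 m2 : {measure set T -> \bar R}) (a a1 a2 : T -> R) :
  intg m a -> intg m1 a1 -> intg m2 a2 ->
  (forall A, measurable A ->
    \int[m]_x (\1_A x * a x) = \int[m1]_x (\1_A x * a1 x) + \int[m2]_x (\1_A x * a2 x)) ->
  forall f, bmeas f ->
    \int[m]_x (f x * a x) = \int[m1]_x (f x * a1 x) + \int[m2]_x (f x * a2 x).
Proof.
move=> i0 i1 i2 E f bf; apply/eqP; rewrite -subr_eq0; apply/eqP.
have [D0 Z0 B0] := Rint_functional i0; have [D1 Z1 B1] := Rint_functional i1.
have [D2 Z2 B2] := Rint_functional i2.
apply: (@bounded_linear_ext _ _ _ (fun f => \int[m]_x (f x * a x) -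
  (\int[m1]_x (f x * a1 x) + \int[m2]_x (f x * a2 x)))
  (\int[m]_x `|a x| + (\int[m1]_x `|a1 x| + \int[m2]_x `|a2 x|))) => //.
- by rewrite !addr_ge0// Rintegral_ge0.
- by move=> g h bg bh; rewrite D0// D1// D2//; ring.
- by move=> c g bg; rewrite Z0// Z1// Z2//; ring.
- move=> g B mg gB; rewrite (le_trans (ler_normB _ _))// mulrDl lerD ?B0//.
  by rewrite (le_trans (ler_normD _ _))// mulrDl lerD ?B1 ?B2.
- by move=> A mA; rewrite E// subrr.
Qed.

Lemma Rint_indic_mul (m : {measure set T -> \bar R}) (a : T -> R) (A : set T) : measurable A ->
  \int[m]_x (\1_A x * a x) = \int[m]_(x in A) a x.
Proof.
move=> mA; rewrite [RHS]Rintegral_mkcond; apply: eq_Rintegral => x _.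
by rewrite patchE indicE; case: (_ \in _); rewrite ?mul1r ?mul0r.
Qed.

Lemma charge_integral_density (nu : {charge set T -> \bar R}) (m1 m2 : {measure set T -> \bar R})
    (a1 a2 : T -> R) : intg m1 a1 -> intg m2 a2 ->
  (forall A, measurable A ->
    nu A = (\int[m1]_x (\1_A x * a1 x) + \int[m2]_x (\1_A x * a2 x))%:E) ->
  forall f, bmeas f ->
    charge_integral nu f = (\int[m1]_x (f x * a1 x) + \int[m2]_x (f x * a2 x))%:E.
Proof.
move=> i1 i2 E f bf.
have [jp [jn [nuE ->//]]] := charge_integral_jordan nu; congr EFin.
have c1 (j : {finite_measure set T -> \bar R}) : intg j (fun=> 1 : R).
  exact: finite_measure_integrable_cst.
have [D0 Z0 B0] := Rint_functional (c1 jp); have [D0' Z0' B0'] := Rint_functional (c1 jn).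
have [D1 Z1 B1] := Rint_functional i1.
have [D2 Z2 B2] := Rint_functional i2.
have one (j : {finite_measure set T -> \bar R}) g : \int[j]_x g x = \int[j]_x (g x * 1).
  by apply: eq_Rintegral => x _; rewrite mulr1.
rewrite (one jp) (one jn); apply/eqP; rewrite -subr_eq0; apply/eqP.
apply: (@bounded_linear_ext _ _ _ (fun f => \int[jp]_x (f x * 1) - \int[jn]_x (f x * 1) -
  (\int[m1]_x (f x * a1 x) + \int[m2]_x (f x * a2 x)))
  (\int[jp]_x `|1| + \int[jn]_x `|1| + (\int[m1]_x `|a1 x| + \int[m2]_x `|a2 x|))) => //.
- by rewrite !addr_ge0// Rintegral_ge0.
- by move=> g h bg bh; rewrite D0// D0'// D1// D2//; ring.
- by move=> c g bg; rewrite Z0// Z0'// Z1// Z2//; ring.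
- move=> g B mg gB; rewrite (le_trans (ler_normB _ _))// mulrDl lerD//.
    by rewrite (le_trans (ler_normB _ _))// mulrDl lerD ?B0 ?B0'.
  by rewrite (le_trans (ler_normD _ _))// mulrDl lerD ?B1 ?B2.
- move=> A mA; apply/eqP; rewrite subr_eq0; apply/eqP.
  have := E A mA; rewrite nuE// => h.
  have jE (j : {finite_measure set T -> \bar R}) : j A = (\int[j]_x (\1_A x * 1))%:E.
    rewrite -one -Rint_EFin; last by apply: bmeas_intg; exact: bmeas_indic.
    by rewrite integral_indic// setIT.
  by move: h; rewrite !jE -EFinB => -[].
Qed.

End linear_functionals.

(** * Test functions and uniqueness of the distributional derivative *)

Section test_functions.
Context {R : realType}.
Local Notation plane := (R * R)%type.
Local Notation mplane := (measurableTypeR R * measurableTypeR R)%type.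
Local Notation L2 := (@lebesgue2 R).
Local Notation ee1 := (@e1 R).
Local Notation ee2 := (@e2 R).

Lemma mvt_line (f d : plane -> R) (x e : plane) (k : R) :
  (forall y, is_derive y e f (d y)) ->
  exists t : R, `|t| <= `|k| /\ f (x + k *: e) - f x = k * d (x + t *: e).
Proof.
move=> df.
have dl (t : R) : is_derive t 1 (fun t : R => f (x + t *: e)) (d (x + t *: e)).
  by apply: is_derive_line; exact: df.
have cl (a b : R) : {within `[a, b], continuous (fun t : R => f (x + t *: e))}.
  by apply: derivable_within_continuous => t _; have [] := dl t.
have [k0|k0|->] := ltgtP k 0; last first.
- by exists 0; split; rewrite ?normr0// scale0r addr0 subrr mul0r.
- have [t] := MVT k0 (fun t _ => dl t) (cl 0 k); rewrite in_itv/= => /andP[t0 tk].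
  rewrite scale0r addr0 subr0 => ->; exists t; split; last by rewrite mulrC.
  by rewrite !gtr0_norm// ltW.
- have [t] := MVT k0 (fun t _ => dl t) (cl k 0); rewrite in_itv/= => /andP[t0 tk].
  rewrite scale0r addr0 sub0r => h; exists t; split; last first.
    by rewrite -[LHS]opprB h; ring.
  by rewrite !ltr0_norm// lerN2 ltW.
Qed.

(** [C1c] speaks of the two axes only. Going from [x] to [x + w] by one step along each axis, with
    the mean value theorem on each, gives continuity and, as the partial derivatives are continuous,
    the derivative in every direction. *)
Lemma C1c_C1 (Omega : set plane) (f : plane -> R) : C1c Omega f ->
  C1 f (fun x => 'D_ee1 f x) (fun x => 'D_ee2 f x) /\ compact_supp Omega f.
Proof.
move=> [df cf [K HK]]; split; last by exists K.
have d1 (y : plane) : is_derive y ee1 f ('D_ee1 f y) by split => //; apply: df; left.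
have d2 (y : plane) : is_derive y ee2 f ('D_ee2 f y) by split => //; apply: df; right.
have c1 := cf _ (or_introl (erefl ee1)); have c2 := cf _ (or_intror (erefl ee2)).
pose fx (x : plane) := 'D_ee1 f x; pose fy (x : plane) := 'D_ee2 f x.
have mv (x w : plane) : exists a b : plane, [/\ `|a.1 - x.1| <= `|w.1|, `|a.2 - x.2| <= `|w.2|,
     `|b.1 - x.1| <= `|w.1|, `|b.2 - x.2| <= `|w.2| & f (x + w) - f x = w.1 * fx a + w.2 * fy b].
  have [t [ht Ht]] := mvt_line (x + w.2 *: ee2) w.1 d1.
  have [s [hs Hs]] := mvt_line x w.2 d2.
  exists (x + w.2 *: ee2 + t *: ee1), (x + s *: ee2); split.
  - by rewrite /= /GRing.scale/= mulr0 mulr1 addr0 addrAC subrr add0r.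
  - by rewrite /= /GRing.scale/= mulr0 mulr1 addr0 addrAC subrr add0r.
  - by rewrite /= /GRing.scale/= mulr0 addr0 subrr normr0.
  - by rewrite /= /GRing.scale/= mulr1 addrAC subrr add0r.
  rewrite /fx /fy -Ht -Hs.
  have -> : x + w = x + w.2 *: ee2 + w.1 *: ee1.
    by apply: injective_projections; rewrite /= /GRing.scale/=; ring.
  by ring.
have loc (g : plane -> R) (x : plane) (e : R) : continuous g -> 0 < e ->
    exists2 dl : R, 0 < dl & forall a : plane, `|a.1 - x.1| <= dl -> `|a.2 - x.2| <= dl -> `|g a - g x| <= e.
  move=> cg e0; have /cvgrPdist_le/(_ _ e0)/nbhs_ballP[dl /= dl0 H] := cg x.
  exists (dl / 2); first by rewrite divr_gt0.
  move=> a h1 h2; rewrite distrC; apply: H; split => /=; rewrite /ball/= distrC; clear - h1 h2 dl0; lra.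
split; [move=> x|exact: c1|exact: c2|move=> x v].
  apply/cvgrPdist_le => e e0.
  have [dx dx0 Hx] := loc fx x 1 c1 ltr01; have [dy dy0 Hy] := loc fy x 1 c2 ltr01.
  pose C := 1 + `|fx x| + `|fy x|.
  have C0 : 0 < C by rewrite ltr_wpDr// ltr_wpDr.
  pose dl := Num.min (Num.min dx dy) (e / (2 * C)).
  have dl0 : 0 < dl by rewrite !lt_min dx0 dy0 divr_gt0// mulr_gt0.
  have := nbhsx_ballx x dl dl0; apply: filterS => y [/= h1 h2].
  have [a [b [a1 a2 b1 b2]]] := mv x (y - x).
  rewrite /ball/= in h1 h2; have yx : x + (y - x) = y by rewrite addrC subrK.
  rewrite yx => E.
  have w1 : `|(y - x).1| <= dl by rewrite distrC ltW.
  have w2 : `|(y - x).2| <= dl by rewrite distrC ltW.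
  have dlx : dl <= dx by rewrite !ge_min lexx.
  have dly : dl <= dy by rewrite !ge_min lexx orbT.
  have dle : dl <= e / (2 * C) by rewrite ge_min lexx orbT.
  have fa : `|fx a| <= C.
    have := Hx a (le_trans a1 (le_trans w1 dlx)) (le_trans a2 (le_trans w2 dlx)).
    have := ler_distD (fx x) (fx a) 0; rewrite !subr0 /C; have := normr_ge0 (fy x); clear; lra.
  have fb : `|fy b| <= C.
    have := Hy b (le_trans b1 (le_trans w1 dly)) (le_trans b2 (le_trans w2 dly)).
    have := ler_distD (fy x) (fy b) 0; rewrite !subr0 /C; have := normr_ge0 (fx x); clear; lra.
  rewrite distrC E (le_trans (ler_normD _ _))// !normrM.
  have p1 : `|(y - x).1| * `|fx a| <= e / (2 * C) * C by rewrite ler_pM// (le_trans w1).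
  have p2 : `|(y - x).2| * `|fy b| <= e / (2 * C) * C by rewrite ler_pM// (le_trans w2).
  have -> : e = e / (2 * C) * C + e / (2 * C) * C by field; rewrite gt_eqF.
  exact: (lerD p1 p2).
have cv : (fun h : R => h^-1 *: (f (h *: v + x) - f x)) @ 0^' --> v.1 * fx x + v.2 * fy x.
  apply/cvgrPdist_le => e e0.
  pose V := 1 + `|v.1| + `|v.2|.
  have V0 : 0 < V by rewrite ltr_wpDr// ltr_wpDr.
  have eV : 0 < e / (2 * V) by rewrite divr_gt0// mulr_gt0.
  have [dx dx0 Hx] := loc fx x _ c1 eV; have [dy dy0 Hy] := loc fy x _ c2 eV.
  near=> h.
  have h0 : h != 0 by near: h; exact: nbhs_dnbhs_neq.
  have [a [b [a1 a2 b1 b2]]] := mv x (h *: v).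
  rewrite [x + _]addrC => ->.
  have bd (z q : R) : 0 < q -> `|h| <= q / V -> `|z| <= V -> `|h * z| <= q.
    move=> q0 hq hz; rewrite normrM.
    have := ler_pM (normr_ge0 h) (normr_ge0 z) hq hz.
    by rewrite divfK ?gt_eqF.
  have v1V : `|v.1| <= V by rewrite /V; have := normr_ge0 v.1; have := normr_ge0 v.2; clear; lra.
  have v2V : `|v.2| <= V by rewrite /V; have := normr_ge0 v.1; have := normr_ge0 v.2; clear; lra.
  have hx : `|h| <= dx / V by near: h; apply: dnbhs0_le; rewrite divr_gt0.
  have hy : `|h| <= dy / V by near: h; apply: dnbhs0_le; rewrite divr_gt0.
  have A := Hx a (le_trans a1 (bd _ _ dx0 hx v1V)) (le_trans a2 (bd _ _ dx0 hx v2V)).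
  have B := Hy b (le_trans b1 (bd _ _ dy0 hy v1V)) (le_trans b2 (bd _ _ dy0 hy v2V)).
  have -> : v.1 * fx x + v.2 * fy x - h^-1 *: ((h *: v).1 * fx a + (h *: v).2 * fy b) =
     - (v.1 * (fx a - fx x) + v.2 * (fy b - fy x)).
    by rewrite /= /GRing.scale/=; field.
  rewrite normrN (le_trans (ler_normD _ _))// !normrM.
  have p1 : `|v.1| * `|fx a - fx x| <= V * (e / (2 * V)) by rewrite ler_pM.
  have p2 : `|v.2| * `|fy b - fy x| <= V * (e / (2 * V)) by rewrite ler_pM.
  have -> : e = V * (e / (2 * V)) + V * (e / (2 * V)) by field; rewrite gt_eqF.
  exact: (lerD p1 p2).
by split; [apply/cvg_ex; exists (v.1 * fx x + v.2 * fy x)|exact/cvg_lim].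
Unshelve. all: by end_near. Qed.

Lemma C1_C1c (Omega : set plane) (f fx fy : plane -> R) : C1 f fx fy -> compact_supp Omega f ->
  [/\ C1c Omega f, (fun x => 'D_ee1 f x) = fx & (fun x => 'D_ee2 f x) = fy].
Proof.
move=> [cf cx cy df] [K HK].
have E1 : (fun x => 'D_ee1 f x) = fx.
  by apply/funext => x; have [_ ->] := df x ee1; rewrite /= mul1r mul0r addr0.
have E2 : (fun x => 'D_ee2 f x) = fy.
  by apply/funext => x; have [_ ->] := df x ee2; rewrite /= mul1r mul0r add0r.
split => //; split; last by exists K.
- by move=> x e _; have [] := df x e.
- by move=> e [->|->]; rewrite ?E1 ?E2.
Qed.

(** Difference quotients have integral 0 by translation invariance of Lebesgue measure, and
    dominated convergence passes to the derivative. *)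
Lemma int_deriv0 (f fx fy : plane -> R) (U : set plane) : C1 f fx fy -> compact_supp U f ->
  \int[L2]_x fx x = 0 /\ \int[L2]_x fy x = 0.
Proof.
move=> Cf [K [cK _ f0]]; have [cf cfx cfy df] := Cf.
have [mf mfx mfy] := C1_meas Cf.
suff main (e : plane) : `|e.1| <= 1 -> `|e.2| <= 1 -> \int[L2]_x (e.1 * fx x + e.2 * fy x) = 0.
  split.
    rewrite -[RHS](main (1, 0)); rewrite /= ?normr1 ?normr0//.
    by apply: eq_Rintegral => x _; rewrite mul1r mul0r addr0.
  rewrite -[RHS](main (0, 1)); rewrite /= ?normr1 ?normr0//.
  by apply: eq_Rintegral => x _; rewrite mul1r mul0r add0r.
move=> e1' e2'.
pose g x := e.1 * fx x + e.2 * fy x.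
have g0 x : ~ K x -> g x = 0.
  by move=> /(C1_supp0 cK Cf f0)[h1 h2]; rewrite /g h1 h2 !mulr0 addr0.
have cg : continuous g.
  move=> x; apply: cvgD; apply: cvgM; try exact: cvg_cst; [exact: cfx|exact: cfy].
have [C C0 gC] := supp_bounded cK cg g0.
have [D D0 fD] := supp_bounded cK cf f0.
have [r r0 Kr] := compact_in_cbox cK.
have r1 : 0 <= r + 1 by rewrite addr_ge0.
pose h (n : nat) : R := n.+1%:R^-1.
have hp n : 0 < h n by rewrite invr_gt0.
have h1 n : h n <= 1 by rewrite invf_le1// ler1n.
pose q n (x : mplane) := (h n)^-1 * (f (x + h n *: e) - f x).
have if_ : intg L2 f.
  apply: (@intg_cbox _ _ (0, 0) r D) => // x nb; apply: f0 => /Kr; exact: nb.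
have q0 n : \int[L2]_x q n x = 0.
  have is_ := intg_shift (h n *: e) if_.
  rewrite RintZ; last exact: intgB.
  have E : \int[L2]_x f (x + h n *: e) = \int[L2]_x f x.
    rewrite -[RHS](@Rintegral_shift _ (h n *: e) f)//.
    by apply: eq_Rintegral => x _; rewrite addrC.
  by rewrite RintB// E subrr mulr0.
have mq n : measurable_fun setT (q n).
  by apply: measurable_funM => //; apply: measurable_funB => //; exact: measurable_shift.
have box n (x : plane) (t : R) : `|t| <= `|h n| -> K (x + t *: e) -> cbox (0, 0) (r + 1) x.
  move=> ht /Kr [/=]; rewrite !subr0 => k1 k2.
  have t1 : `|t| <= 1 by rewrite (le_trans ht)// gtr0_norm.
  have b1 : `|t * e.1| <= 1 by rewrite normrM mulr_ile1.
  have b2 : `|t * e.2| <= 1 by rewrite normrM mulr_ile1.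
  have E1 : x.1 = (x + t *: e).1 - t * e.1 by rewrite /= /GRing.scale/=; ring.
  have E2 : x.2 = (x + t *: e).2 - t * e.2 by rewrite /= /GRing.scale/=; ring.
  split; rewrite /= subr0.
    by rewrite E1 (le_trans (ler_normB _ _))// lerD.
  by rewrite E2 (le_trans (ler_normB _ _))// lerD.
have qC n x : `|q n x| <= C * \1_(cbox (0, 0) (r + 1)) x.
  have [t [ht]] := mvt_line x (h n) (fun y => df y e).
  rewrite /q => ->; rewrite mulrA mulVf ?mul1r ?gt_eqF// indicE.
  have [/set_mem bx|/negP nb] := boolP (x \in cbox (0, 0) (r + 1)).
    by rewrite mulr1; exact: gC.
  rewrite -/(g _) g0 ?normr0 ?mulr0// => /(box _ _ _ ht) bx.
  by apply: nb; exact/mem_set.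
have iG : intg L2 (fun x => C * \1_(cbox (0, 0) (r + 1)) x).
  apply: intgZ; apply: (@intg_cbox _ _ (0, 0) (r + 1) 1) => //.
  - by apply: measurable_indic; exact: measurable_cbox.
  - by move=> x; rewrite indicE; case: (_ \in _); rewrite /= ?normr0 ?normr1.
  - by move=> x nb; rewrite indicE memNset.
have hcv : h @ \oo --> 0 by exact: cvg_harmonic.
have qcv x : q ^~ x @ \oo --> g x.
  have [+ dE] := df x e; rewrite /derivable => cv.
  have cv' : h^-1 *: ((f \o shift x) (h *: e) - f x) @[h --> 0^'] --> g x by rewrite /g -dE; exact: cv.
  have /cvgr_dnbhsP/(_ h (conj (fun n => lt0r_neq0 (hp n)) hcv)) := cv'.
  have -> : (fun n => (h n)^-1 *: ((f \o shift x) (h n *: e) - f x)) = q ^~ x; last by [].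
  by apply/funext => n; rewrite /q /= addrC [h n *: e + x]addrC [- _ + _]addrC.
have mg : measurable_fun [set: mplane] (g : mplane -> R) by exact: continuous_plane_measurable.
have [_ lim] := Rint_dct mq mg (aeW _ qcv) iG qC.
have : (fun n => \int[L2]_x q n x) @ \oo --> 0.
  by under eq_fun do rewrite q0; exact: cvg_cst.
by move=> lim0; exact: (cvg_unique _ lim lim0).
Qed.

End test_functions.

Section charge_uniqueness.
Context {R : realType}.
Local Notation plane := (R * R)%type.
Local Notation mplane := (measurableTypeR R * measurableTypeR R)%type.
Local Notation L2 := (@lebesgue2 R).

Lemma smooth_bmeas (U : set plane) (f : plane -> R) : testfun U f -> bmeas (f : mplane -> R).
Proof.
move=> [sf [K [cK _ f0]]]; split; first exact: smooth_measurable.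
by have [C _ fC] := supp_bounded cK (smooth_continuous sf) f0; exists C.
Qed.

Lemma Rint_le_measure (m1 m : {measure set mplane -> \bar R}) (f : mplane -> R) :
  (forall A, measurable A -> m1 A <= m A)%E -> intg m f -> (forall x, 0 <= f x) ->
  \int[m1]_x f x <= \int[m]_x f x.
Proof.
move=> m1m mf f0.
have mfE : measurable_fun setT (EFin \o f) by apply/measurable_EFinP; exact: (intg_meas mf).
have i0 : (0 <= \int[m1]_x (f x)%:E)%E by apply: integral_ge0 => x _; rewrite lee_fin.
have le : (\int[m1]_x (f x)%:E <= \int[m]_x (f x)%:E)%E.
  by apply: ge0_le_measure_integral => // x; rewrite lee_fin.
rewrite /Rintegral fine_le//; last exact: integrable_fin_num.
rewrite ge0_fin_numE// (le_lt_trans le)// -ge0_fin_numE ?(le_trans i0)//.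
exact: integrable_fin_num.
Qed.

Lemma four_point_estimate (a b c d A B C D e : R) :
  `|a - A| <= e -> `|b - B| <= e -> `|c - C| <= e -> `|d - D| <= e -> a - b = c - d ->
  `|A - B - (C - D)| <= 4 * e.
Proof. rewrite !ler_norml; lra. Qed.

(** The sum [M] of the four Jordan parts is one finite measure that controls the approximation of an
    indicator by a test function for all of them at once; hence the error [4 * e]. *)
Lemma charge_unique (Omega : set plane) (D D' : {charge set mplane -> \bar R}) :
  open Omega ->
  (forall A, measurable A -> A `&` Omega = set0 -> D A = 0%E) ->
  (forall A, measurable A -> A `&` Omega = set0 -> D' A = 0%E) ->
  (forall f : plane -> R, testfun Omega f -> charge_integral D f = charge_integral D' f) ->
  forall A, measurable A -> D A = D' A.
Proof.
move=> oO D0 D0' E A mA.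
have mO : measurable (Omega : set mplane) by exact: open_plane_measurable.
have red (D1 : {charge set mplane -> \bar R}) :
    (forall A, measurable A -> A `&` Omega = set0 -> D1 A = 0%E) -> D1 A = D1 (A `&` Omega).
  move=> h; have hD : D1 (A `\` Omega) = 0%E.
    by apply: h; [exact: measurableD|apply/seteqP; split => x // [[]]].
  by rewrite [LHS](chargeDI D1 mA mO) hD add0e.
rewrite (red _ D0) (red _ D0').
have mAO : measurable (A `&` Omega : set mplane) by exact: measurableI.
have [jp [jn [DE IE]]] := charge_integral_jordan D.
have [jp' [jn' [DE' IE']]] := charge_integral_jordan D'.
pose m12 : {measure set mplane -> \bar R} := measure_add jp jn.
pose m34 : {measure set mplane -> \bar R} := measure_add jp' jn'.
pose m0 : {measure set mplane -> \bar R} := measure_add m12 m34.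
have m0E B : m0 B = (jp B + jn B + (jp' B + jn' B))%E.
  by apply: (etrans (measure_addE m12 m34 B)); congr (_ + _)%E; exact: measure_addE.
have fin0 : fin_num_fun m0.
  by move=> B mB; rewrite m0E !fin_numD !fin_num_measure.
pose M := finite_pack fin0.
have ME B : M B = (jp B + jn B + (jp' B + jn' B))%E by rewrite -m0E.
have approx (j : {finite_measure set mplane -> \bar R}) (f : plane -> R) e :
    (forall g : mplane -> R, intg M g -> (forall x, 0 <= g x) -> \int[j]_x g x <= \int[M]_x g x) ->
    testfun Omega f -> \int[M]_x `|f x - \1_(A `&` Omega) x| < e ->
    `|\int[j]_x f x - fine (j (A `&` Omega))| <= e.
  move=> jM tf fe.
  have bf := smooth_bmeas tf; have bA : bmeas (\1_(A `&` Omega) : mplane -> R) by exact: bmeas_indic.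
  have -> : fine (j (A `&` Omega)) = \int[j]_x \1_(A `&` Omega) x.
    by rewrite /Rintegral integral_indic// setIT.
  have bD : bmeas (fun x : mplane => f x - \1_(A `&` Omega) x).
    have := bmeasD bf (bmeasZ (-1) bA); congr bmeas; apply/funext => x.
    by rewrite mulN1r.
  rewrite -RintB; [|exact: bmeas_intg..].
  apply: (le_trans (le_normr_Rintegral measurableT _)); first exact: bmeas_intg.
  apply: (le_trans _ (ltW fe)); apply: jM => //.
  by apply: intg_norm; exact: bmeas_intg.
have le1 B : (jp B <= M B)%E by rewrite ME -addeA leeDl// !adde_ge0.
have le2 B : (jn B <= M B)%E by rewrite ME [X in (X + _)%E]addeC -addeA leeDl// !adde_ge0.
have le3 B : (jp' B <= M B)%E by rewrite ME addeC -addeA leeDl// !adde_ge0.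
have le4 B : (jn' B <= M B)%E by rewrite ME addeC [X in (X + _)%E]addeC -addeA leeDl// !adde_ge0.
have dom (j : {finite_measure set mplane -> \bar R}) : (forall B, j B <= M B)%E ->
  forall g : mplane -> R, intg M g -> (forall x, 0 <= g x) -> \int[j]_x g x <= \int[M]_x g x.
  by move=> jM g ig g0; apply: Rint_le_measure => // B _; exact: jM.
have fineE (j j' : {finite_measure set mplane -> \bar R}) : (j (A `&` Omega) - j' (A `&` Omega))%E =
    (fine (j (A `&` Omega)) - fine (j' (A `&` Omega)))%:E.
  by rewrite EFinB !fineK ?fin_num_measure.
rewrite DE// DE'// !fineE; congr EFin; apply/eqP; rewrite -subr_eq0 -normr_le0.
apply: (@eps_le _ _ _ 4) => // e e0; rewrite add0r.
have [f [tf f01 fe]] := testfun_density M oO mA e0.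
have bf := smooth_bmeas tf.
have := E f tf; rewrite IE// IE'// => -[eqI].
exact: (four_point_estimate (approx jp f e (dom jp le1) tf fe) (approx jn f e (dom jn le2) tf fe)
  (approx jp' f e (dom jp' le3) tf fe) (approx jn' f e (dom jn' le4) tf fe) eqI).
Qed.

End charge_uniqueness.

(** * Densities of the gradient and the anisotropic variation *)

Section vector_variation_domination.
Context d (T : measurableType d) (R : realType).
Variables D1 D2 : {charge set T -> \bar R}.

Lemma vector_variation_ge (A : set T) : measurable A ->
  (vnorm D1 D2 A <= vector_variation D1 D2 A)%E.
Proof.
move=> mA.
pose F k := if k == 0%N then A else set0.
have pF : measurable_partition A F.
  split.
  - by case=> [|k]; rewrite /F /=.
  - by move=> [|i] [|j] _ _ [x []].
  - by apply/seteqP; split => [x [[|k] _]//|x Ax]; exists 0%N.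
rewrite /vector_variation le_max; apply/orP; right.
apply: (@le_trans _ _ (\sum_(0 <= k <oo) vnorm D1 D2 (F k))%E); last first.
  by apply: ereal_sup_ubound; exists F.
have <- : (\sum_(0 <= k < 1) vnorm D1 D2 (F k) = vnorm D1 D2 A)%E by rewrite big_nat1.
by apply: nneseries_lim_ge => k _ _; rewrite lee_fin enorm_ge0.
Qed.

Lemma vector_variation_dominates :
  D1 `<< vector_variation D1 D2 /\ D2 `<< vector_variation D1 D2.
Proof.
have H A : measurable A -> vector_variation D1 D2 A = 0%E -> D1 A = 0%E /\ D2 A = 0%E.
  move=> mA v0; have := vector_variation_ge mA; rewrite v0 lee_fin => h.
  have /eqP : enorm (fine (D1 A), fine (D2 A)) = 0 by apply/eqP; rewrite eq_le h enorm_ge0.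
  rewrite /enorm sqrtr_eq0 /= => h'.
  have e1 : fine (D1 A) = 0 by apply/eqP; rewrite -sqrf_eq0; apply/eqP; move: (sqr_ge0 (fine (D1 A))) (sqr_ge0 (fine (D2 A))) => ? ?; lra.
  have e2 : fine (D2 A) = 0 by apply/eqP; rewrite -sqrf_eq0; apply/eqP; move: (sqr_ge0 (fine (D1 A))) (sqr_ge0 (fine (D2 A))) => ? ?; lra.
  by rewrite -(fineK (fin_num_measure D1 _ mA)) -(fineK (fin_num_measure D2 _ mA)) e1 e2.
by split; apply/null_content_dominatesP => A mA /(H A mA)[].
Qed.

End vector_variation_domination.

Section gradients.
Context {R : realType} (p : R).
Hypothesis p1 : 1 < p.
Local Notation plane := (R * R)%type.
Local Notation mplane := (measurableTypeR R * measurableTypeR R)%type.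
Local Notation L2 := (@lebesgue2 R).
Variable Omega : set plane.
Hypothesis oO : open Omega.

Let mO : measurable (Omega : set mplane).
Proof. exact: open_plane_measurable. Qed.

Lemma measurable_pnorm d (T : measurableType d) (f g : T -> R) :
  measurable_fun setT f -> measurable_fun setT g -> measurable_fun setT (fun x => pnorm p (f x, g x)).
Proof.
move=> mf mg; rewrite /pnorm /=.
apply: (measurableT_comp (measurable_powR p^-1)).
by apply: measurable_funD; apply: (measurableT_comp (measurable_powR p)); apply: measurableT_comp.
Qed.

Lemma intg_pnorm d (T : measurableType d) (m : {measure set T -> \bar R}) (f g : T -> R) :
  intg m f -> intg m g -> intg m (fun x => pnorm p (f x, g x)).
Proof.
move=> hf hg; apply: (@intg_le _ _ _ _ _ (fun x => `|f x| + `|g x|)).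
- by apply: measurable_pnorm; [exact: (intg_meas hf)|exact: (intg_meas hg)].
- move=> x; rewrite ger0_norm; [exact: (pnorm_le_abs p1 (f x, g x))|exact: pnorm_ge0].
- by apply: intgD; exact: intg_norm.
Qed.

(** The factor makes the density vanish outside [Omega], so that integrals over [Omega] become
    integrals over the plane. *)
Definition density1 (w : plane -> R) (x : mplane) : R :=
  \1_Omega x * fine (Radon_Nikodym (gradient Omega w).1 (gradient_variation Omega w) x).
Definition density2 (w : plane -> R) (x : mplane) : R :=
  \1_Omega x * fine (Radon_Nikodym (gradient Omega w).2 (gradient_variation Omega w) x).

Lemma density_spec (m : {finite_measure set mplane -> \bar R}) (D : {charge set mplane -> \bar R}) :
  D `<< m -> (forall A, measurable A -> A `&` Omega = set0 -> D A = 0%E) ->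
  let n x := \1_Omega x * fine (Radon_Nikodym D m x) in
  intg m n /\ forall A, measurable A -> D A = (\int[m]_x (\1_A x * n x))%:E.
Proof.
move=> Dm D0 n.
have inr : intg m (fun x => fine (Radon_Nikodym D m x)).
  have := Radon_Nikodym_integrable Dm; rewrite /intg; congr (_.-integrable _ _).
  by apply/funext => x /=; rewrite fineK// Radon_Nikodym_fin_num.
have i_n : intg m n.
  have mi : measurable_fun setT (\1_Omega : mplane -> R) by exact: measurable_indic.
  have bi x : `|\1_Omega x : R| <= 1.
    by have /andP[? ?] := indic_bound Omega x; rewrite ger0_norm.
  exact: (intgM mi bi inr).
split => // A mA.
have mAO : measurable (A `&` Omega : set mplane) by exact: measurableI.
have hD : D (A `\` Omega) = 0%E.
  by apply: D0; [exact: measurableD|apply/seteqP; split => x // [[]]].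
rewrite (chargeDI D mA mO) hD add0e (Radon_Nikodym_integral Dm mAO).
have -> : \int[m]_x (\1_A x * n x) = \int[m]_x (\1_(A `&` Omega) x * fine (Radon_Nikodym D m x)).
  apply: eq_Rintegral => x _; rewrite /n mulrA !indicE in_setI.
  by case: (_ \in A); case: (_ \in Omega); rewrite /= ?mul1r ?mul0r.
rewrite Rint_indic_mul// /Rintegral fineK.
  by apply: eq_integral => x _; rewrite fineK// Radon_Nikodym_fin_num.
by apply: integrable_fin_num => //; apply: integrableS inr.
Qed.

Lemma gradient_spec (w : plane -> R) : (exists D, is_gradient Omega w D) ->
  let m := gradient_variation Omega w in
  [/\ is_gradient Omega w (gradient Omega w), intg m (density1 w), intg m (density2 w),
    (forall A, measurable A -> (gradient Omega w).1 A = (\int[m]_x (\1_A x * density1 w x))%:E) /\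
    (forall A, measurable A -> (gradient Omega w).2 A = (\int[m]_x (\1_A x * density2 w x))%:E) &
    phi_variation (fun _ xi => pnorm p xi) Omega w =
      (\int[m]_x pnorm p (density1 w x, density2 w x))%:E].
Proof.
move=> ex m.
have G : is_gradient Omega w (gradient Omega w).
  by rewrite /gradient; case: pselect => // e; case: cid.
have [h1 h2] := vector_variation_dominates (gradient Omega w).1 (gradient Omega w).2.
have [[z1 _] [z2 _]] := G.
have [i1 e1] := @density_spec m _ h1 z1; have [i2 e2] := @density_spec m _ h2 z2.
split => //.
rewrite -Rint_EFin; last exact: intg_pnorm.
rewrite /phi_variation [LHS]integral_mkcond; apply: eq_integral => x _.
rewrite patchE /density1 /density2 indicE; case: ifPn => xO /=.
  by rewrite /gradient_direction !mul1r.
by rewrite !mul0r -[(0, 0)]/(0 : plane) pnorm0.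
Qed.

(** The gradient of [w] is [a m + h L2]. This is the shape of the gradient of a competitor: a part
    carried by the gradient measure of [u] and an absolutely continuous part. *)
Definition has_density (w : plane -> R) (m : {measure set mplane -> \bar R}) (a1 a2 h1 h2 : mplane -> R) :=
  forall f fx fy : plane -> R, C1 f fx fy -> compact_supp Omega f ->
    (\int[L2]_x (w x * fx x)%R = - (\int[m]_x (f x * a1 x)%R + \int[L2]_x (f x * h1 x)%R)) /\
    (\int[L2]_x (w x * fy x)%R = - (\int[m]_x (f x * a2 x)%R + \int[L2]_x (f x * h2 x)%R)).

Lemma int_restrict (w : mplane -> R) (f fx fy : plane -> R) (h : plane -> R) : bmeas w ->
  C1 f fx fy -> compact_supp Omega f -> (h = fx \/ h = fy) ->
  intg L2 (fun x => w x * h x) /\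
  (\int[L2]_(x in Omega) (w x * h x)%:E = (\int[L2]_x (w x * h x)%R)%:E)%E.
Proof.
move=> [mw [B wB]] Cf [K [cK KO f0]] hE.
have [cf cfx cfy _] := Cf.
have ch : continuous h by case: hE => ->.
have h0 x : ~ K x -> h x = 0 by move=> /(C1_supp0 cK Cf f0)[? ?]; case: hE => ->.
have [C C0 hC] := supp_bounded cK ch h0.
have [r r0 Kr] := compact_in_cbox cK.
have ih : intg L2 (fun x => w x * h x).
  apply: (@intg_cbox _ _ (0, 0) r (B * C)) => //.
  - by apply: measurable_funM => //; exact: continuous_plane_measurable.
  - by move=> x; rewrite normrM ler_pM.
  - by move=> x nb; rewrite h0 ?mulr0// => /Kr.
split => //; rewrite -Rint_EFin// [LHS]integral_mkcond; apply: eq_integral => x _.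
rewrite patchE; case: ifPn => // /negP nO; rewrite h0 ?mulr0// => /KO Ox.
by apply: nO; exact/mem_set.
Qed.

Definition density_charge (m : {measure set mplane -> \bar R}) (a h : mplane -> R)
  (ia : intg m a) (ih : intg L2 h) : {charge set mplane -> \bar R} :=
  cadd (induced_charge ia) (induced_charge ih).

Lemma density_chargeE (m : {measure set mplane -> \bar R}) (a h : mplane -> R) (ia : intg m a) (ih : intg L2 h) (A : set mplane) : measurable A ->
  density_charge ia ih A = (\int[m]_x (\1_A x * a x) + \int[L2]_x (\1_A x * h x))%:E.
Proof.
move=> mA; rewrite EFinD !Rint_indic_mul//; congr (_ + _)%E; rewrite /induced_charge /Rintegral fineK//.
  by apply: integrable_fin_num => //; exact: integrableS ia.
by apply: integrable_fin_num => //; exact: integrableS ih.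
Qed.

Lemma has_density_gradient (w : plane -> R) (m : {measure set mplane -> \bar R}) (a1 a2 h1 h2 : mplane -> R) (ia1 : intg m a1) (ia2 : intg m a2)
    (ih1 : intg L2 h1) (ih2 : intg L2 h2) : bmeas (w : mplane -> R) ->
  (forall x, ~ Omega x -> [/\ a1 x = 0, a2 x = 0, h1 x = 0 & h2 x = 0]) ->
  has_density w m a1 a2 h1 h2 ->
  is_gradient Omega w (density_charge ia1 ih1, density_charge ia2 ih2).
Proof.
move=> bw z hd.
have zero (a h : mplane -> R) (ia : intg m a) (ih : intg L2 h) :
    (forall x, ~ Omega x -> a x = 0 /\ h x = 0) -> forall A, measurable A -> A `&` Omega = set0 ->
    density_charge ia ih A = 0%E.
  move=> ah0 A mA AO; rewrite density_chargeE//.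
  have nO x : x \in A -> ~ Omega x.
    by move=> /set_mem Ax Ox; have : (A `&` Omega) x by []; rewrite AO.
  rewrite (@eq_Rintegral _ _ _ m _ (fun=> 0)); last first.
    move=> x _; rewrite indicE; case: (boolP (x \in A)) => xA; rewrite ?mul0r ?mul1r//.
    by have [] := ah0 x (nO x xA).
  rewrite (@eq_Rintegral _ _ _ L2 _ (fun=> 0)); last first.
    move=> x _; rewrite indicE; case: (boolP (x \in A)) => xA; rewrite ?mul0r ?mul1r//.
    by have [] := ah0 x (nO x xA).
  by rewrite /Rintegral !integral0 /= addr0.
have bm (f : plane -> R) : (exists fx fy, C1 f fx fy) -> compact_supp Omega f -> bmeas (f : mplane -> R).
  by move=> sf cf; apply: (@smooth_bmeas _ Omega).
split; split.
- by apply: zero => x /z[].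
- move=> f /C1c_C1[Cf sf]; have [_ ->] := int_restrict bw Cf sf (or_introl erefl).
  rewrite (charge_integral_density ia1 ih1); [|exact: density_chargeE|by apply: bm => //; do 2 eexists; exact: Cf].
  by rewrite (hd _ _ _ Cf sf).1 EFinN.
- by apply: zero => x /z[].
- move=> f /C1c_C1[Cf sf]; have [_ ->] := int_restrict bw Cf sf (or_intror erefl).
  rewrite (charge_integral_density ia2 ih2); [|exact: density_chargeE|by apply: bm => //; do 2 eexists; exact: Cf].
  by rewrite (hd _ _ _ Cf sf).2 EFinN.
Qed.

Lemma measurable_pdual d (T : measurableType d) (f g : T -> R) :
  measurable_fun setT f -> measurable_fun setT g ->
  bmeas (fun x => (pdual p (f x, g x)).1) /\ bmeas (fun x => (pdual p (f x, g x)).2).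
Proof.
move=> mf mg.
have mp := measurable_pnorm mf mg.
have msg (h : T -> R) : measurable_fun setT h -> measurable_fun setT (fun x => Num.sg (h x)).
  move=> mh; have -> : (fun x => Num.sg (h x)) =
      (fun x => \1_`]0, +oo[%classic (h x) - \1_`]-oo, 0[%classic (h x)).
    apply/funext => x; rewrite !indicE.
    have E1 : (h x \in `]0, +oo[%classic) = (0 < h x).
      by apply/idP/idP => [/set_mem|hx]; [rewrite /= in_itv/= andbT|apply/mem_set; rewrite /= in_itv/= andbT].
    have E2 : (h x \in `]-oo, 0[%classic) = (h x < 0).
      by apply/idP/idP => [/set_mem|hx]; [rewrite /= in_itv/=|apply/mem_set; rewrite /= in_itv/=].
    rewrite E1 E2; have [h0|h0|->] := ltgtP (h x) 0.
    - by rewrite ltr0_sg// sub0r.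
    - by rewrite gtr0_sg// subr0.
    - by rewrite sgr0 subr0.
  apply: measurable_funB.
  - by apply: (measurableT_comp _ mh); apply: measurable_indic.
  - by apply: (measurableT_comp _ mh); apply: measurable_indic.
have mq (h : T -> R) : measurable_fun setT h ->
    measurable_fun setT (fun x => Num.sg (h x) * (`|h x| / pnorm p (f x, g x)) `^ (p - 1)).
  move=> mh; apply: measurable_funM; first exact: msg.
  apply: (measurableT_comp (measurable_powR (p - 1))); apply: measurable_funM; first exact: measurableT_comp.
  have -> : (fun x => (pnorm p (f x, g x))^-1) = (fun x => pnorm p (f x, g x) `^ (-1)).
    by apply/funext => x; rewrite powR_inv1// pnorm_ge0.
  exact: (measurableT_comp (measurable_powR (-1)) mp).
split; (split; first exact: mq); exists 1 => x; by have [] := pdual_le1 p1 (f x, g x).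
Qed.

(** The dual vectors [q] of the true density of [w] form a bounded field whose pairing with the
    gradient is the variation. Uniqueness of the derivative allows computing this pairing in the
    other representation, where duality bounds it by the two norms. *)
Lemma phi_variation_le (w : plane -> R) (m : {measure set mplane -> \bar R}) (a1 a2 h1 h2 : mplane -> R) : bmeas (w : mplane -> R) ->
  intg m a1 -> intg m a2 -> intg L2 h1 -> intg L2 h2 ->
  (forall x, ~ Omega x -> [/\ a1 x = 0, a2 x = 0, h1 x = 0 & h2 x = 0]) ->
  has_density w m a1 a2 h1 h2 ->
  (phi_variation (fun _ xi => pnorm p xi) Omega w <=
   (\int[m]_x pnorm p (a1 x, a2 x) + \int[L2]_x pnorm p (h1 x, h2 x))%:E)%E.
Proof.
move=> bw ia1 ia2 ih1 ih2 z hd.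
have isG := has_density_gradient ia1 ia2 ih1 ih2 bw z hd.
have [G i1 i2 [E1 E2] ->] := gradient_spec (ex_intro _ _ isG).
rewrite lee_fin; set mw := gradient_variation Omega w in i1 i2 E1 E2 *.
have [[z1 g1] [z2 g2]] := G; have [[y1 k1] [y2 k2]] := isG.
have U1 := @charge_unique _ Omega _ _ oO z1 y1.
have U2 := @charge_unique _ Omega _ _ oO z2 y2.
have tC f : testfun Omega f -> C1c Omega f.
  by move=> [[fx [fy Cf]] sf]; have [] := C1_C1c Cf sf.
have F1 A : measurable A -> (gradient Omega w).1 A = density_charge ia1 ih1 A.
  apply: U1 => f /tC cf; apply: oppe_inj; by rewrite -g1// -k1.
have F2 A : measurable A -> (gradient Omega w).2 A = density_charge ia2 ih2 A.
  apply: U2 => f /tC cf; apply: oppe_inj; by rewrite -g2// -k2.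
have T1 := @two_densities _ _ _ mw m L2 (density1 w) a1 h1 i1 ia1 ih1.
have T2 := @two_densities _ _ _ mw m L2 (density2 w) a2 h2 i2 ia2 ih2.
have {}T1 f : bmeas f -> \int[mw]_x (f x * density1 w x) = \int[m]_x (f x * a1 x) + \int[L2]_x (f x * h1 x).
  by apply: T1 => A mA; apply: EFin_inj; rewrite -E1// F1// density_chargeE.
have {}T2 f : bmeas f -> \int[mw]_x (f x * density2 w x) = \int[m]_x (f x * a2 x) + \int[L2]_x (f x * h2 x).
  by apply: T2 => A mA; apply: EFin_inj; rewrite -E2// F2// density_chargeE.
have [b1 b2] := measurable_pdual (intg_meas i1) (intg_meas i2).
set q1 := (fun x => _) in b1; set q2 := (fun x => _) in b2.
have bi (f : mplane -> R) (m' : {measure set mplane -> \bar R}) (a : mplane -> R) : bmeas f -> intg m' a ->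
    intg m' (fun x => f x * a x).
  by move=> [mf [B fB]] ia; exact: (intgM mf fB).
have -> : \int[mw]_x pnorm p (density1 w x, density2 w x) =
    \int[mw]_x (q1 x * density1 w x) + \int[mw]_x (q2 x * density2 w x).
  rewrite -RintD; [|exact: bi|exact: bi].
  apply: eq_Rintegral => x _; rewrite -[LHS](pdual_dot_self p1); reflexivity.
rewrite T1// T2// addrACA.
rewrite -RintD; [|exact: bi|exact: bi]; rewrite -RintD; [|exact: bi|exact: bi].
apply: lerD; apply: Rint_le.
- by apply: intgD; exact: bi.
- exact: intg_pnorm.
- by move=> x; exact: (pdual_dot_le p1 (density1 w x, density2 w x) (a1 x, a2 x)).
- by apply: intgD; exact: bi.
- exact: intg_pnorm.
- by move=> x; exact: (pdual_dot_le p1 (density1 w x, density2 w x) (h1 x, h2 x)).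
Qed.

End gradients.

(** * Minimality tested against cutoff competitors *)

Lemma le_defect (R : numDomainType) (a b c e : R) : a = b - c -> b <= a + e -> c <= e.
Proof. by move=> ->; rewrite -addrA lerDl addrC subr_ge0. Qed.

Section minimality.
Context {R : realType} (p : R).
Hypothesis p1 : 1 < p.
Local Notation plane := (R * R)%type.
Local Notation mplane := (measurableTypeR R * measurableTypeR R)%type.
Local Notation L2 := (@lebesgue2 R).
Variables (Omega E : set plane).
Hypothesis oO : open Omega.
Hypothesis mE : measurable (E : set mplane).

Let mO : measurable (Omega : set mplane).
Proof. exact: open_plane_measurable. Qed.

Local Notation u := (\1_E : plane -> R).

Let bu : bmeas (u : mplane -> R).
Proof.
split; first exact: measurable_indic.
by exists 1 => x; have /andP[? ?] := indic_bound E x; rewrite ger0_norm.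
Qed.

Lemma intg_cont_supp (b q : mplane -> R) (K : set plane) : compact K -> bmeas b ->
  continuous (q : plane -> R) -> (forall x, ~ K x -> q x = 0) -> intg L2 (fun x => b x * q x).
Proof.
move=> cK [mb [B bB]] cq q0.
have [C C0 qC] := supp_bounded cK cq q0.
have [r r0 Kr] := compact_in_cbox cK.
apply: (@intg_cbox _ _ (0, 0) r (B * C)) => //.
- by apply: measurable_funM => //; exact: continuous_plane_measurable.
- by move=> x; rewrite normrM ler_pM.
- by move=> x nb; rewrite q0 ?mulr0// => /Kr.
Qed.

Lemma indic_weak_grad (mu := gradient_variation Omega u) : BV Omega u ->
  weak_grad Omega u mu (density1 Omega u) (density2 Omega u) /\
  phi_variation (fun _ xi => pnorm p xi) Omega u =
    (\int[mu]_x pnorm p (density1 Omega u x, density2 Omega u x))%:E.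
Proof.
move=> [_ ex]; have [G i1 i2 [E1 E2] ->] := gradient_spec p1 oO ex.
split=> //; split => // f fx fy Cf sf.
have [cf [D1 D2]] := C1_C1c Cf sf.
have bf : bmeas (f : mplane -> R) by apply: (@smooth_bmeas _ Omega); split => //; exists fx, fy.
have i0 : intg L2 (fun=> 0 : R) by exact: integrable0.
have z0 (A : set mplane) : \int[L2]_x (\1_A x * (fun=> 0 : R) x) = 0.
  by rewrite (@eq_Rintegral _ _ _ L2 _ (fun=> 0)); [rewrite /Rintegral integral0|move=> x _; rewrite mulr0].
have z1 : \int[L2]_x (f x * (fun=> 0 : R) x) = 0.
  by rewrite (@eq_Rintegral _ _ _ L2 _ (fun=> 0)); [rewrite /Rintegral integral0|move=> x _; rewrite mulr0].
have [[_ g1] [_ g2]] := G.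
split; apply: EFin_inj.
- have [_ <-] := int_restrict bu Cf sf (or_introl erefl).
  have := g1 f cf; rewrite (@charge_integral_density _ _ _ _ _ _ _ _ i1 i0 _ _ bf); last first.
    by move=> A mA; rewrite z0 addr0 E1.
  by rewrite z1 addr0 EFinN => <-; apply: eq_integral => x _; rewrite -D1.
- have [_ <-] := int_restrict bu Cf sf (or_intror erefl).
  have := g2 f cf; rewrite (@charge_integral_density _ _ _ _ _ _ _ _ i2 i0 _ _ bf); last first.
    by move=> A mA; rewrite z0 addr0 E2.
  by rewrite z1 addr0 EFinN => <-; apply: eq_integral => x _; rewrite -D2.
Qed.

(** The product rule for [t * (g - u)], tested with [f]: [H1] expresses that the derivative of
    [t * g * f] has integral 0, and [H2] is the weak gradient of [u] tested with [t * f]. *)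
Lemma product_density (K : set plane) (mu : {finite_measure set mplane -> \bar R}) (n : mplane -> R)
    (f f' t t' g g' : plane -> R) : compact K -> (forall x, ~ K x -> t x = 0) ->
  (forall x, ~ K x -> t' x = 0) ->
  continuous f -> continuous f' -> continuous t -> continuous t' -> continuous g -> continuous g' ->
  intg mu n ->
  (\int[L2]_x ((t' x * g x + t x * g' x) * f x + (t x * g x) * f' x)%R = 0) ->
  (\int[L2]_x (u x * (t' x * f x + t x * f' x))%R = - \int[mu]_x (t x * f x * n x)%R) ->
  \int[L2]_x (t x * (g x - u x) * f' x)%R =
    - (\int[mu]_x (f x * (- t x * n x))%R + \int[L2]_x (f x * (t x * g' x + (g x - u x) * t' x))%R).
Proof.
move=> cK t0 t'0 cf cf' ct ct' cg cg' i_n H1 H2.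
have b1 : bmeas ((fun=> 1) : mplane -> R) by exact: bmeas_cst.
have cM (f1 f2 : plane -> R) : continuous f1 -> continuous f2 -> continuous (fun x => f1 x * f2 x).
  by move=> h1 h2 x; apply: cvgM; [exact: h1|exact: h2].
have ic := intg_cont_supp cK.
have z (q r : plane -> R) : (forall x, ~ K x -> q x = 0) -> forall x, ~ K x -> q x * r x = 0.
  by move=> q0 x /q0 ->; rewrite mul0r.
have ia := ic _ _ b1 (cM _ _ (cM _ _ ct cg) cf') (z _ _ (z _ _ t0)).
have ib := ic _ _ b1 (cM _ _ (cM _ _ ct cg') cf) (z _ _ (z _ _ t0)).
have icc := ic _ _ b1 (cM _ _ (cM _ _ ct' cg) cf) (z _ _ (z _ _ t'0)).
have id := ic _ _ bu (cM _ _ ct cf') (z _ _ t0).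
have ie := ic _ _ bu (cM _ _ ct' cf) (z _ _ t'0).
set A := (fun x => _) in ia; set B := (fun x => _) in ib; set C := (fun x => _) in icc.
set D := (fun x => _) in id; set F := (fun x => _) in ie.
have e1 : \int[L2]_x (C x + B x + A x) = 0.
  by rewrite -[RHS]H1; apply: eq_Rintegral => x _; rewrite /A /B /C; ring.
have e2 : \int[L2]_x (F x + D x) = - \int[mu]_x (t x * f x * n x)%R.
  by rewrite -[RHS]H2; apply: eq_Rintegral => x _; rewrite /F /D; ring.
have -> : \int[L2]_x (t x * (g x - u x) * f' x)%R = \int[L2]_x (A x - D x).
  by apply: eq_Rintegral => x _; rewrite /A /D; ring.
have -> : \int[mu]_x (f x * (- t x * n x))%R = - \int[mu]_x (t x * f x * n x)%R.
  rewrite -[RHS]mulN1r -RintegralZl//; last first.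
    have [C1 _ hC1] := supp_bounded cK (cM _ _ ct cf) (z _ _ t0).
    apply: (@intgM _ _ _ mu C1 _ (fun x => t x * f x) _ hC1 i_n).
    by apply: continuous_plane_measurable; exact: cM.
  by apply: eq_Rintegral => x _; ring.
have -> : \int[L2]_x (f x * (t x * g' x + (g x - u x) * t' x))%R = \int[L2]_x (B x + C x - F x).
  by apply: eq_Rintegral => x _; rewrite /B /C /F; ring.
have r1 := RintB ia id; have r2 := RintB (intgD ib icc) ie; have r3 := RintD ib icc.
have r4 := RintD (intgD icc ib) ia; have r5 := RintD icc ib; have r6 := RintD ie id.
rewrite r1 r2 r3; move: e1 e2; rewrite r4 r5 r6.
move: (\int[L2]_x A x) (\int[L2]_x B x) (\int[L2]_x C x) (\int[L2]_x D x) (\int[L2]_x F x) (\int[mu]_x _).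
by move=> *; lra.
Qed.

Hypothesis minE : minimal_set (fun _ xi => pnorm p xi) Omega E.
Local Notation mu := (gradient_variation Omega u).
Local Notation n1 := (density1 Omega u).
Local Notation n2 := (density2 Omega u).

(** The competitor has gradient [(1 - t) Du + t grad g + (g - u) grad t]. The variation of the first
    term is [1 - t] integrated against that of [u], so it cancels all but the part weighted by
    [t]. *)
Lemma minimal_star (t tx ty g gx gy : plane -> R) : C1 t tx ty -> compact_supp Omega t ->
  (forall x, 0 <= t x <= 1) -> C1 g gx gy ->
  \int[mu]_x (t x * pnorm p (n1 x, n2 x))%R <=
    \int[L2]_x (t x * pnorm p (gx x, gy x) + `|u x - g x| * pnorm p (tx x, ty x))%R.
Proof.
move=> Ct [K [cK KO t0]] t01 Cg.
have [bvu min] := minE; have [[i1 i2 W] V] := indic_weak_grad bvu.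
have [ct ctx cty _] := Ct; have [cg cgx cgy _] := Cg.
have cM (f1 f2 : plane -> R) : continuous f1 -> continuous f2 -> continuous (fun x => f1 x * f2 x).
  by move=> h1 h2 x; apply: cvgM; [exact: h1|exact: h2].
have z0 x := C1_supp0 cK Ct t0 (x := x).
have tx0 x : ~ K x -> tx x = 0 by move=> /z0[].
have ty0 x : ~ K x -> ty x = 0 by move=> /z0[].
have z (q r : plane -> R) : (forall x, ~ K x -> q x = 0) -> forall x, ~ K x -> q x * r x = 0.
  by move=> q0 x /q0 ->; rewrite mul0r.
have b1 : bmeas ((fun=> 1) : mplane -> R) by exact: bmeas_cst.
have ic := intg_cont_supp cK.
have i1M (q : mplane -> R) : intg L2 (fun x => 1 * q x) -> intg L2 q.
  by under eq_fun do rewrite mul1r.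
pose v x := t x * (g x - u x).
pose h1 x := t x * gx x + (g x - u x) * tx x.
pose h2 x := t x * gy x + (g x - u x) * ty x.
have hd f fx fy : C1 f fx fy -> compact_supp Omega f ->
    (\int[L2]_x (v x * fx x)%R = - (\int[mu]_x (f x * (- t x * n1 x))%R + \int[L2]_x (f x * h1 x)%R)) /\
    (\int[L2]_x (v x * fy x)%R = - (\int[mu]_x (f x * (- t x * n2 x))%R + \int[L2]_x (f x * h2 x)%R)).
  move=> Cf sf; have [cf cfx cfy _] := Cf.
  have s1 : compact_supp Omega (fun x => t x * f x) by exists K; split => //; exact: z.
  have s2 : compact_supp Omega (fun x => t x * g x * f x) by exists K; split => //; exact: (z _ _ (z _ _ t0)).
  have [W1 W2] := W _ _ _ (C1M Ct Cf) s1.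
  have [I1 I2] := int_deriv0 (C1M (C1M Ct Cg) Cf) s2.
  by split; apply: (@product_density K).
have mn1 := intg_meas i1; have mn2 := intg_meas i2.
have mt : measurable_fun setT (t : mplane -> R) by exact: continuous_plane_measurable.
have tb x : `|t x| <= 1 by have /andP[? ?] := t01 x; rewrite ger0_norm.
have ia (n : mplane -> R) : intg mu n -> intg mu (fun x => - t x * n x).
  move=> i_n; apply: (@intgM _ _ _ mu 1 _ (fun x => - t x) _ _ i_n).
  - exact: measurableT_comp.
  - by move=> x; rewrite normrN.
have ih (g' t' : plane -> R) : continuous g' -> continuous t' -> (forall x, ~ K x -> t' x = 0) ->
    intg L2 (fun x => t x * g' x + (g x - u x) * t' x).
  move=> cg' ct' t'0.
  have E1 : (fun x => t x * g' x + (g x - u x) * t' x) =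
     (fun x => 1 * (t x * g' x) + 1 * (t' x * g x) - u x * t' x) by apply/funext => x; ring.
  rewrite [X in intg _ X]E1; apply: intgB; first apply: intgD; apply: ic => //; try exact: cM; exact: z.
have bv : bmeas (v : mplane -> R).
  have [C _ hC] := supp_bounded cK (cM _ _ ct cg) (z _ _ t0).
  have -> : v = (fun x => 1 * (t x * g x) + -1 * (u x * t x)) by apply/funext => x; rewrite /v; ring.
  apply: bmeasD; apply: bmeasZ.
    split; last by exists C.
    by apply: continuous_plane_measurable; exact: cM.
  have [mu' [B uB]] := bu; split; first exact: measurable_funM.
  by exists (B * 1) => x; rewrite normrM ler_pM.
have iv : intg L2 v.
  have -> : v = (fun x => 1 * (t x * g x) - u x * t x) by apply/funext => x; rewrite /v; ring.
  by apply: intgB; apply: ic => //; [exact: cM|exact: z].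
have nO (x : mplane) : ~ Omega x -> [/\ n1 x = 0, n2 x = 0, h1 x = 0 & h2 x = 0].
  move=> Ox; have nK : ~ K x by move=> /KO.
  by rewrite /density1 /density2 indicE memNset// !mul0r /h1 /h2 t0// tx0// ty0// !mul0r !mulr0 addr0.
have ih1 : intg L2 h1 by exact: ih.
have ih2 : intg L2 h2 by exact: ih.
have BVv : BV Omega v.
  split; first by apply: integrableS iv => //.
  have isG := has_density_gradient (ia _ i1) (ia _ i2) ih1 ih2 bv _ hd.
  by eexists; apply: isG => x /nO[-> -> -> ->]; rewrite !mulr0.
have csv : compact_support_in Omega v.
  by exists K; split => //; apply: aeW => x _ nK; rewrite /v t0// mul0r.
have := min v BVv csv; rewrite V.
have ia' (n : mplane -> R) : intg mu n -> intg mu (fun x => (1 - t x) * n x).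
  move=> i_n; apply: (@intgM _ _ _ mu 1 _ (fun x => 1 - t x) _ _ i_n).
  - exact: measurable_funB.
  - by move=> x; have /andP[? ?] := t01 x; rewrite ger0_norm ?subr_ge0// gerBl.
have := @phi_variation_le _ p p1 Omega oO (u \+ v) mu
  (fun x => (1 - t x) * n1 x) (fun x => (1 - t x) * n2 x) h1 h2.
move=> /(_ (bmeasD bu bv) (ia' _ i1) (ia' _ i2) ih1 ih2).
have nO' (x : mplane) : ~ Omega x -> [/\ (1 - t x) * n1 x = 0, (1 - t x) * n2 x = 0, h1 x = 0 & h2 x = 0].
  by move=> /nO[-> -> -> ->]; rewrite !mulr0.
move=> /(_ nO'); have hd' : has_density Omega (u \+ v) mu (fun x => (1 - t x) * n1 x)
    (fun x => (1 - t x) * n2 x) h1 h2.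
  move=> f fx fy Cf sf; have [W1 W2] := W _ _ _ Cf sf; have [V1 V2] := hd _ _ _ Cf sf.
  have [Kf [cKf _ f0]] := sf; have [cf cfx cfy _] := Cf.
  have f0' x := C1_supp0 cKf Cf f0 (x := x).
  have [Cb _ fb] := supp_bounded cKf cf f0.
  have mf : measurable_fun setT (f : mplane -> R) by exact: continuous_plane_measurable.
  have add (n h fi : mplane -> R) : intg mu n -> continuous (fi : plane -> R) ->
      (forall x, ~ Kf x -> fi x = 0) ->
      (\int[L2]_x (u x * fi x)%R = - \int[mu]_x (f x * n x)%R) ->
      (\int[L2]_x (v x * fi x)%R = - (\int[mu]_x (f x * (- t x * n x))%R + \int[L2]_x (f x * h x)%R)) ->
      \int[L2]_x ((u \+ v) x * fi x)%R =
        - (\int[mu]_x (f x * ((1 - t x) * n x))%R + \int[L2]_x (f x * h x)%R).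
    move=> i_n cfi fi0 X Y.
    have -> : \int[L2]_x ((u \+ v) x * fi x)%R = \int[L2]_x (u x * fi x + v x * fi x)%R.
      by apply: eq_Rintegral => x _; rewrite /= mulrDl.
    rewrite RintD; [|exact: (intg_cont_supp cKf)..].
    have -> : \int[mu]_x (f x * ((1 - t x) * n x))%R = \int[mu]_x (f x * n x + f x * (- t x * n x))%R.
      by apply: eq_Rintegral => x _; ring.
    rewrite RintD; [|exact: (intgM mf fb i_n)|exact: (intgM mf fb (ia _ i_n))].
    rewrite X Y; move: (\int[mu]_x _) (\int[mu]_x _) (\int[L2]_x _) => *; ring.
  by split; apply: add => //; move=> x /f0'[].
move=> /(_ hd') h3 h4; have {h3 h4} := le_trans h4 h3; rewrite lee_fin.
have iN : intg mu (fun x => pnorm p (n1 x, n2 x)) by exact: (intg_pnorm p1).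
have iT : intg mu (fun x => t x * pnorm p (n1 x, n2 x)) by exact: (intgM mt tb iN).
have EN : \int[mu]_x pnorm p ((1 - t x) * n1 x, (1 - t x) * n2 x) =
    \int[mu]_x pnorm p (n1 x, n2 x) - \int[mu]_x (t x * pnorm p (n1 x, n2 x)).
  rewrite -(RintB iN iT); apply: eq_Rintegral => x _.
  rewrite -[((1 - t x) * n1 x, (1 - t x) * n2 x)]/((1 - t x) *: (n1 x, n2 x) : plane) pnormZ//.
  by have /andP[? ?] := t01 x; rewrite ger0_norm ?subr_ge0//; ring.
move=> h5; have {}h5 := le_defect EN h5.
apply: (le_trans h5); apply: Rint_le.
- exact: intg_pnorm.
- apply: intgD.
    have [C1 C10 hC1] := supp_bounded cK (cM _ _ ct cgx) (z _ _ t0).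
    have [C2 C20 hC2] := supp_bounded cK (cM _ _ ct cgy) (z _ _ t0).
    have i3 : intg L2 (fun x => pnorm p (t x * gx x, t x * gy x)).
      by apply: (intg_pnorm p1); apply: i1M; apply: ic => //; try exact: cM; exact: z.
    have E3 : (fun x => t x * pnorm p (gx x, gy x)) = (fun x => pnorm p (t x * gx x, t x * gy x)).
      apply/funext => x; rewrite -[(t x * gx x, t x * gy x)]/(t x *: (gx x, gy x) : plane) pnormZ//.
      by have /andP[? ?] := t01 x; rewrite ger0_norm.
    by rewrite [X in intg _ X]E3.
  have i3 : intg L2 (fun x => pnorm p ((u x - g x) * tx x, (u x - g x) * ty x)).
    have E4 (q : plane -> R) : (fun x => (u x - g x) * q x) = (fun x => u x * q x - 1 * (q x * g x)).
      by apply/funext => x; ring.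
    by apply: (intg_pnorm p1); rewrite [X in intg _ X]E4; apply: intgB; apply: ic => //; try exact: cM; exact: z.
  have E3 : (fun x => `|u x - g x| * pnorm p (tx x, ty x)) = (fun x => pnorm p ((u x - g x) * tx x, (u x - g x) * ty x)).
    by apply/funext => x; rewrite -[((u x - g x) * tx x, (u x - g x) * ty x)]/((u x - g x) *: (tx x, ty x) : plane) pnormZ.
  by rewrite [X in intg _ X]E3.
- move=> x.
  have -> : (h1 x, h2 x) = t x *: (gx x, gy x) + (g x - u x) *: (tx x, ty x) :> plane by [].
  apply: (le_trans (pnormD p1 _ _)); rewrite !pnormZ// -(distrC (g x)).
  by have /andP[? ?] := t01 x; rewrite (ger0_norm (x := t x)).
Qed.

End minimality.

(** * Comparison with half planes *)

Section step_function.
Context {R : realType}.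
Local Notation plane := (R * R)%type.

(** A C1 step from 0 to 1 whose derivative [dstep] is the tent on [[0, 1]] with height 2. *)
Definition step (t : R) : R := 2 * possq t - 4 * possq (t - 2^-1) + 2 * possq (t - 1).

Definition dstep (t : R) : R :=
  4 * Num.max t 0 - 8 * Num.max (t - 2^-1) 0 + 4 * Num.max (t - 1) 0.

Lemma step_le0 t : t <= 0 -> step t = 0.
Proof.
move=> t0; rewrite /step /possq !max_r//; first by ring.
- lra.
- lra.
Qed.

Lemma step_ge1 t : 1 <= t -> step t = 1.
Proof.
move=> t1; rewrite /step /possq !max_l//; first by field.
- lra.
- lra.
- lra.
Qed.

Lemma step01 t : 0 <= step t <= 1.
Proof.
have [t0|t0] := leP t 0; first by rewrite step_le0// lexx ler01.
have [t1|t1] := leP 1 t; first by rewrite step_ge1// lexx ler01.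
rewrite /step /possq (max_l (ltW t0)) (@max_r _ _ (t - 1) 0); last lra.
have [h|h] := leP (t - 2^-1) 0; apply/andP; split; nra.
Qed.

Lemma dstep_ge0 t : 0 <= dstep t.
Proof.
rewrite /dstep.
have [h1|h1] := leP t 0; have [h2|h2] := leP (t - 2^-1) 0; have [h3|h3] := leP (t - 1) 0; lra.
Qed.

Lemma dstep_le2 t : dstep t <= 2.
Proof.
rewrite /dstep.
have [h1|h1] := leP t 0; have [h2|h2] := leP (t - 2^-1) 0; have [h3|h3] := leP (t - 1) 0; lra.
Qed.

Lemma dstep_eq0 t : t <= 0 \/ 1 <= t -> dstep t = 0.
Proof.
rewrite /dstep => -[h|h].
  rewrite !max_r; lra.
rewrite !max_l; lra.
Qed.

Lemma continuous_dstep : continuous dstep.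
Proof.
have c (a : R) : continuous (fun t : R => Num.max (t - a) 0).
  move=> x; apply: (@continuous_max _ _ (fun t : R => t - a) (fun=> 0)); last exact: cvg_cst.
  by apply: cvgB; [exact: cvg_id|exact: cvg_cst].
have c0 : continuous (fun t : R => Num.max t 0).
  by move=> x; apply: (@continuous_max _ _ id (fun=> 0)); [exact: cvg_id|exact: cvg_cst].
move=> x; apply: cvgD; [apply: cvgB|]; apply: cvgM; try exact: cvg_cst; [exact: c0|exact: c|exact: c].
Qed.

Lemma is_derive_step (t : R) : is_derive (t : R^o) (1 : R^o) (step : R^o -> R^o) (dstep t).
Proof.
apply: (@is_derive_quad _ _ _ _ _ _ 8) => h.
have -> : h *: (1 : R^o) + t = t + h by rewrite addrC; congr (_ + _); exact: mulr1.
have := possq_quad t h; have := possq_quad (t - 2^-1) h; have := possq_quad (t - 1) h.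
rewrite /step /dstep !(addrAC t _ h).
set a := possq (t + h); set b := possq (t + h - 2^-1); set c := possq (t + h - 1).
set a' := possq t; set b' := possq (t - 2^-1); set c' := possq (t - 1).
move: (Num.max _ _) (Num.max _ _) (Num.max _ _) => x y z.
set h2 := h ^+ 2; rewrite !ler_norml => /andP[? ?] /andP[? ?] /andP[? ?].
by apply/andP; split; lra.
Qed.

Lemma C1_step (a b c : R) :
  let l (x : plane) := a * x.1 + b * x.2 + c in
  C1 (fun x => step (l x)) (fun x => a * dstep (l x)) (fun x => b * dstep (l x)).
Proof.
move=> l.
have H1 := C1Z 2 (C1_possq a b c); have H2 := C1Z 4 (C1_possq a b (c - 2^-1)).
have H3 := C1Z 2 (C1_possq a b (c - 1)).
have := C1D (C1B H1 H2) H3.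
rewrite (_ : (fun x : plane => 2 * possq (a * x.1 + b * x.2 + c) -
  4 * possq (a * x.1 + b * x.2 + (c - 2^-1)) + 2 * possq (a * x.1 + b * x.2 + (c - 1))) =
  (fun x => step (l x))); last by apply/funext => x; rewrite /step /l !addrA.
have E (k : R) : (fun x : plane => 2 * (k * (2 * Num.max (a * x.1 + b * x.2 + c) 0)) -
   4 * (k * (2 * Num.max (a * x.1 + b * x.2 + (c - 2^-1)) 0)) +
   2 * (k * (2 * Num.max (a * x.1 + b * x.2 + (c - 1)) 0))) = (fun x => k * dstep (l x)).
  by apply/funext => x; rewrite /dstep /l !addrA; ring.
by rewrite !E.
Qed.

End step_function.

Lemma half_plane_arith (R : realDomainType) (z1 z2 n a1 a2 b1 b2 u1 u2 d : R) :
  n <= z1 * a1 + z2 * a2 + d -> b1 + a1 = 0 -> b2 + a2 = 0 ->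
  n + z1 * u1 + z2 * u2 <= z1 * u1 + z2 * u2 - z1 * b1 - z2 * b2 + d.
Proof. by move=> h /eqP; rewrite addr_eq0 => /eqP -> /eqP; rewrite addr_eq0 => /eqP ->; lra. Qed.

Lemma ler_cvg_cst (R : realType) (u : nat -> R) (l c : R) :
  u @ \oo --> l -> (forall k, c <= u k) -> c <= l.
Proof.
move=> ul cu; rewrite -(cvg_lim _ ul)//.
by apply: limr_ge; [apply/cvg_ex; eexists; exact: ul|exact: nearW].
Qed.

Lemma norm_sub_unit (R : realDomainType) (a b : R) : 0 <= a <= 1 -> 0 <= b <= 1 -> `|a - b| <= 1.
Proof. by move=> /andP[? ?] /andP[? ?]; rewrite ler_norml; apply/andP; split; lra. Qed.

Lemma le_subst (R : numDomainType) (a a' b b' : R) : a = a' -> b = b' -> a' <= b -> a <= b'.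
Proof. by move=> -> <-. Qed.

Section half_plane_comparison.
Context {R : realType} (p : R).
Hypothesis p1 : 1 < p.
Local Notation plane := (R * R)%type.
Local Notation mplane := (measurableTypeR R * measurableTypeR R)%type.
Local Notation L2 := (@lebesgue2 R).

(** Together with the measurability of [E], this is all that the analysis of the boundary retains of
    minimality; gradients as charges do not reappear before the final assembly. *)
Definition minimal_data (Omega E : set plane) (mu : {finite_measure set mplane -> \bar R})
    (n1 n2 : mplane -> R) :=
  weak_grad Omega (\1_E) mu n1 n2 /\
  forall t tx ty g gx gy : plane -> R, C1 t tx ty -> compact_supp Omega t ->
    (forall x, 0 <= t x <= 1) -> C1 g gx gy -> (forall x, 0 <= g x <= 1) ->
    \int[mu]_x (t x * pnorm p (n1 x, n2 x))%R <=
    \int[L2]_x (t x * pnorm p (gx x, gy x) + `|\1_E x - g x| * pnorm p (tx x, ty x))%R.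

Variables (Omega E : set plane) (mu : {finite_measure set mplane -> \bar R}) (n1 n2 : mplane -> R).
Hypothesis mE : measurable (E : set mplane).
Hypothesis md : minimal_data Omega E mu n1 n2.

(** For [g = step (k * l)] with [l] affine of gradient [n0], the gradient of [g] is a nonnegative
    multiple of [n0], hence its norm is its product with [z]. Integration by parts moves the
    derivative from [g] to [t], and [g] tends to the indicator of [H]. For [n0 = 0] the set [H] is
    the plane or empty. *)
Lemma half_plane_star (t tx ty : plane -> R) (c0 : R) (n0 : plane)
    (z := pdual p n0) (H := [set x : plane | 0 < n0.1 * x.1 + n0.2 * x.2 + c0]) :
  C1 t tx ty -> compact_supp Omega t -> (forall x, 0 <= t x <= 1) ->
  \int[mu]_x (t x * (pnorm p (n1 x, n2 x) - (z.1 * n1 x + z.2 * n2 x)))%R <=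
  \int[L2]_x ((\1_E x - \1_H x) * (z.1 * tx x + z.2 * ty x) +
              `|\1_E x - \1_H x| * pnorm p (tx x, ty x))%R.
Proof.
move=> Ct st t01.
have [[i1 i2 W] S] := md; have [W1 W2] := W _ _ _ Ct st.
have [K [cK KO t0]] := st; have [ct ctx cty _] := Ct.
have z0 x := C1_supp0 cK Ct t0 (x := x).
have tx0 x : ~ K x -> tx x = 0 by move=> /z0[].
have ty0 x : ~ K x -> ty x = 0 by move=> /z0[].
have bu : bmeas (\1_E : mplane -> R) by exact: bmeas_indic.
have mt : measurable_fun setT (t : mplane -> R) by exact: continuous_plane_measurable.
have tb x : `|t x| <= 1 by have /andP[? ?] := t01 x; rewrite ger0_norm.
have iN : intg mu (fun x => pnorm p (n1 x, n2 x)) by exact: (intg_pnorm p1).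
have itN : intg mu (fun x => t x * pnorm p (n1 x, n2 x)) by exact: (intgM mt tb iN).
have it1 : intg mu (fun x => t x * n1 x) by exact: (intgM mt tb i1).
have it2 : intg mu (fun x => t x * n2 x) by exact: (intgM mt tb i2).
have LHS : \int[mu]_x (t x * (pnorm p (n1 x, n2 x) - (z.1 * n1 x + z.2 * n2 x)))%R =
    \int[mu]_x (t x * pnorm p (n1 x, n2 x))%R + z.1 * (\int[L2]_x (\1_E x * tx x)%R)
     + z.2 * (\int[L2]_x (\1_E x * ty x)%R).
  rewrite W1 W2 !mulrN -(RintZ z.1 it1) -(RintZ z.2 it2).
  rewrite -(RintB itN (intgZ z.1 it1)) -(RintB (intgB itN (intgZ z.1 it1)) (intgZ z.2 it2)).
  by apply: eq_Rintegral => x _; ring.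
pose l (x : plane) := n0.1 * x.1 + n0.2 * x.2 + c0.
pose g k (x : plane) := step ((k%:R * n0.1) * x.1 + (k%:R * n0.2) * x.2 + k%:R * c0).
pose gx k (x : plane) := (k%:R * n0.1) * dstep ((k%:R * n0.1) * x.1 + (k%:R * n0.2) * x.2 + k%:R * c0).
pose gy k (x : plane) := (k%:R * n0.2) * dstep ((k%:R * n0.1) * x.1 + (k%:R * n0.2) * x.2 + k%:R * c0).
have Cg k : C1 (g k) (gx k) (gy k) by exact: C1_step.
have lE k x : (k%:R * n0.1) * x.1 + (k%:R * n0.2) * x.2 + k%:R * c0 = k%:R * l x.
  by rewrite /l; ring.
have g01 k x : 0 <= g k x <= 1 by exact: step01.
have bg k : bmeas (g k : mplane -> R).
  have [cg _ _ _] := Cg k; split; first exact: continuous_plane_measurable.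
  by exists 1 => x; have /andP[? ?] := g01 k x; rewrite ger0_norm.
pose q x := z.1 * tx x + z.2 * ty x.
pose N x := pnorm p (tx x, ty x).
have iK (b : mplane -> R) (h : plane -> R) : bmeas b -> continuous h ->
   (forall x, ~ K x -> h x = 0) -> intg L2 (fun x => b x * h x) by move=> *; apply: (intg_cont_supp cK).
have b1 : bmeas ((fun=> 1) : mplane -> R) by exact: bmeas_cst.
have i1x (h : plane -> R) : continuous h -> (forall x, ~ K x -> h x = 0) -> intg L2 h.
  by move=> ch h0; have := iK _ _ b1 ch h0; under eq_fun do rewrite mul1r.
have itx := i1x _ ctx tx0; have ity := i1x _ cty ty0.
have iq : intg L2 q by apply: intgD; exact: intgZ.
have iNN : intg L2 N by exact: (intg_pnorm p1).
pose f_ (d : mplane -> R) x := d x * q x + `|d x| * N x.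
have ifd (d : mplane -> R) : measurable_fun setT d -> (forall x, `|d x| <= 1) -> intg L2 (f_ d).
  move=> md_ d1; apply: intgD; first exact: (intgM md_ d1 iq).
  by apply: (@intgM _ _ _ L2 1 _ (fun x => `|d x|) _ _ iNN); [exact: measurableT_comp|move=> x; rewrite normr_id].
have d1 (h : plane -> R) : (forall x, 0 <= h x <= 1) -> forall x, `|\1_E x - h x| <= 1.
  by move=> h01 x; exact: (norm_sub_unit (indic_bound E x) (h01 x)).
have step_k k : \int[mu]_x (t x * (pnorm p (n1 x, n2 x) - (z.1 * n1 x + z.2 * n2 x)))%R <=
    \int[L2]_x f_ (fun x => \1_E x - g k x) x.
  have [_ cgx cgy _] := Cg k; have [cg _ _ _] := Cg k.
  have cM (f1 f2 : plane -> R) : continuous f1 -> continuous f2 -> continuous (fun x => f1 x * f2 x).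
    by move=> h1 h2 x; apply: cvgM; [exact: h1|exact: h2].
  have zM (q' r : plane -> R) : (forall x, ~ K x -> q' x = 0) -> forall x, ~ K x -> q' x * r x = 0.
    by move=> q0 x /q0 ->; rewrite mul0r.
  have st' : compact_supp Omega (fun x => t x * g k x) by exists K; split => //; exact: zM.
  have [I1 I2] := int_deriv0 (C1M Ct (Cg k)) st'.
  have ia1 := i1x _ (cM _ _ ct cgx) (zM _ _ t0); have ia2 := i1x _ (cM _ _ ct cgy) (zM _ _ t0).
  have ib1 := i1x _ (cM _ _ ctx cg) (zM _ _ tx0); have ib2 := i1x _ (cM _ _ cty cg) (zM _ _ ty0).
  have iu1 := iK _ _ bu ctx tx0; have iu2 := iK _ _ bu cty ty0.
  have mdk : measurable_fun setT ((fun x => \1_E x - g k x) : mplane -> R).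
    by apply: measurable_funB; [case: bu|case: (bg k)].
  have idN : intg L2 (fun x => `|\1_E x - g k x| * N x).
    apply: (@intgM _ _ _ L2 1 _ (fun x => `|\1_E x - g k x|) _ _ iNN); first exact: measurableT_comp.
    by move=> x; rewrite normr_id; exact: d1.
  have P x : t x * pnorm p (gx k x, gy k x) = z.1 * (t x * gx k x) + z.2 * (t x * gy k x).
    rewrite /gx /gy; set s := dstep _.
    have s0 : 0 <= k%:R * s by rewrite mulr_ge0// dstep_ge0.
    have -> : (k%:R * n0.1 * s, k%:R * n0.2 * s) = (k%:R * s) *: n0 :> plane.
      by apply: injective_projections; rewrite /= /GRing.scale/=; ring.
    rewrite pnormZ// ger0_norm// -[pnorm p n0](pdual_dot_self p1) /dot -/z; ring.
  have S1 := S _ _ _ _ _ _ Ct st t01 (Cg k) (g01 k).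
  have E1 : \int[L2]_x (t x * pnorm p (gx k x, gy k x) + `|\1_E x - g k x| * pnorm p (tx x, ty x))%R =
     z.1 * \int[L2]_x (t x * gx k x)%R + z.2 * \int[L2]_x (t x * gy k x)%R +
       \int[L2]_x (`|\1_E x - g k x| * N x)%R.
    rewrite -(RintZ z.1 ia1) -(RintZ z.2 ia2) -(RintD (intgZ z.1 ia1) (intgZ z.2 ia2)).
    rewrite -(RintD (intgD (intgZ z.1 ia1) (intgZ z.2 ia2)) idN).
    by apply: eq_Rintegral => x _; rewrite P.
  have E2 : \int[L2]_x f_ (fun x => \1_E x - g k x) x =
     z.1 * \int[L2]_x (\1_E x * tx x)%R + z.2 * \int[L2]_x (\1_E x * ty x)%R
     - z.1 * \int[L2]_x (tx x * g k x)%R - z.2 * \int[L2]_x (ty x * g k x)%R +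
       \int[L2]_x (`|\1_E x - g k x| * N x)%R.
    rewrite -(RintZ z.1 iu1) -(RintZ z.2 iu2) -(RintZ z.1 ib1) -(RintZ z.2 ib2).
    have j1 := intgD (intgZ z.1 iu1) (intgZ z.2 iu2).
    have j2 := intgB j1 (intgZ z.1 ib1); have j3 := intgB j2 (intgZ z.2 ib2).
    rewrite -(RintD (intgZ z.1 iu1) (intgZ z.2 iu2)) -(RintB j1 (intgZ z.1 ib1)).
    rewrite -(RintB j2 (intgZ z.2 ib2)) -(RintD j3 idN).
    by apply: eq_Rintegral => x _; rewrite /f_ /q; ring.
  have E3 := RintD ib1 ia1; have E4 := RintD ib2 ia2.
  apply: (le_subst LHS (esym E2)).
  have A1 := etrans (esym E3) I1; have A2 := etrans (esym E4) I2.
  have A0 := le_subst (erefl _) E1 S1.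
  exact: (half_plane_arith _ _ A0 A1 A2).
have cvf : (fun k => \int[L2]_x f_ (fun x => \1_E x - g k x) x) @ \oo -->
    \int[L2]_x f_ (fun x => \1_E x - \1_H x) x.
  have mH : measurable (H : set mplane).
    apply: open_plane_measurable; rewrite /H.
    apply: (@open_comp _ _ l [set y | 0 < y]); last exact: open_gt.
    by move=> x _; exact: continuous_affine2.
  have H01 x : 0 <= (\1_H x : R) <= 1 by exact: indic_bound.
  have mfd (d : mplane -> R) : measurable_fun setT d -> (forall x, `|d x| <= 1) -> measurable_fun setT (f_ d).
    by move=> h1 h2; exact: (intg_meas (ifd _ h1 h2)).
  pose F k := f_ (fun x => \1_E x - g k x).
  have D1 k : measurable_fun setT (F k).
    apply: mfd; last exact: d1.
    by apply: measurable_funB; [case: bu|case: (bg k)].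
  have D2 : measurable_fun setT (f_ (fun x => \1_E x - \1_H x)).
    apply: mfd; last exact: d1.
    by apply: measurable_funB; [case: bu|exact: measurable_indic].
  have D3 : {ae L2, forall x, F ^~ x @ \oo --> f_ (fun x => \1_E x - \1_H x) x}.
    apply: aeW => x; apply: cvg_near_cst; rewrite /F /f_.
    suff : \forall k \near \oo, g k x = \1_H x by apply: filterS => k ->.
    rewrite indicE; have [/set_mem Hx|/negP nH] := boolP (x \in H).
      near=> k; rewrite /g lE step_ge1//.
      rewrite -ler_pdivrMr//; near: k; exact: nbhs_infty_ger.
    near=> k; rewrite /g lE step_le0// mulr_ge0_le0// leNgt; apply/negP => h.
    by apply: nH; exact/mem_set.
  have D4 : intg L2 (fun x => `|q x| + N x) by apply: intgD => //; exact: intg_norm.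
  have D5 k x : `|F k x| <= `|q x| + N x.
    rewrite /F /f_; apply: (le_trans (ler_normD _ _)); apply: lerD.
      by rewrite normrM -[leRHS]mul1r ler_wpM2r//; exact: d1.
    rewrite normrM normr_id (ger0_norm (pnorm_ge0 _ _)) -[leRHS]mul1r ler_wpM2r ?pnorm_ge0//.
    exact: d1.
  exact: (Rint_dct D1 D2 D3 D4 D5).2.
exact: (ler_cvg_cst cvf step_k).
Unshelve. all: by end_near. Qed.

End half_plane_comparison.

(** * The pentagon and its geometry *)

Section polygons.
Context {R : realType}.
Local Notation plane := (R * R)%type.
Variable P : nat -> plane.

Definition pedge i : plane := P i.+1 - P i.
(** Twice the area of the triangle spanned by the origin and side [i]: the Jacobian of the
    coordinates [pgauge i], [pcoord i]. *)
Definition pjac i : R := det (P i) (P i.+1).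
(** The linear form equal to 1 on the line through side [i]. With [pcoord i], the position along
    that side, it gives the coordinates of [polygon_decomp]. *)
Definition pgauge i (x : plane) : R := det x (pedge i) / pjac i.
Definition pcoord i (x : plane) : R := det (P i) x / pjac i.

(** After a quarter turn, which preserves the p-norm, [polygon_dual] reads
    [|pgauge i x| <= pnorm p x]: the unit ball lies inside the polygon. [polygon_perimeter] makes
    half the perimeter less than 4. [polygon_dir] is a direction in which the centre can be moved so
    that every corner sweeps an area, and [polygon_fst] serves the change of variables. *)
Record admissible_polygon (p : R) : Prop := AdmissiblePolygon {
  polygon_closed : P 5 = P 0%N;
  polygon_fst : forall i, (i < 5)%N -> (P i).1 != 0;
  polygon_jac : forall i, (i < 5)%N -> 0 < pjac i;
  polygon_in : forall i j, (i < 5)%N -> (j <= 5)%N -> pgauge i (P j) <= 1;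
  polygon_dis : forall i j, (i < 5)%N -> (j < 5)%N -> i != j ->
    pgauge j (P i) + pgauge j (P i.+1) < 2;
  polygon_prev : forall i, (i < 5)%N -> exists2 j, (j < 5)%N &
    pgauge j (P i) = 1 /\ pgauge j (P i.+1) < 1;
  polygon_next : forall i, (i < 5)%N -> exists2 j, (j < 5)%N &
    pgauge j (P i.+1) = 1 /\ pgauge j (P i) < 1;
  polygon_dual : forall i (x : plane), (i < 5)%N -> `|dot (pedge i) x| <= pjac i * pnorm p x;
  polygon_perimeter : \sum_(i < 5) pnorm p (pedge i) < 8;
  polygon_orient : forall a b c, (a <= b)%N -> (b <= c)%N -> (c <= 5)%N ->
    0 <= det (P b - P a) (P c - P a);
  polygon_bounded : forall (x : plane) r, (forall i, (i < 5)%N -> pgauge i x <= r) ->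
    `|x.1| <= r /\ `|x.2| <= r;
  polygon_small : forall i (x : plane), (i < 5)%N -> pgauge i x <= `|x.1| + `|x.2|;
  polygon_le1 : forall i, (i <= 5)%N -> `|(P i).1| <= 1 /\ `|(P i).2| <= 1;
  polygon_inj : forall i j, (i < j)%N -> (j <= 5)%N -> P i = P j -> i = 0%N /\ j = 5;
  polygon_dir : exists2 w : plane, w.1 != 0 & forall i, (i <= 5)%N -> det w (P i) != 0
}.

End polygons.

Section pentagon.
Context {R : realType} (p : R).
Hypothesis p1 : 1 < p.
Local Notation plane := (R * R)%type.
Local Notation s := (pcorner p).

(** Duality with the dual vector of the diagonal [(1, 1)]. *)
Lemma pnorm_l1_le (x : plane) : `|x.1| + `|x.2| <= s * pnorm p x.
Proof.
have [s1 s2] := andP (pcorner_bounds p1).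
have N11 : pnorm p (1, 1) = 2 `^ p^-1.
  by rewrite /pnorm /= normr1 powR1.
have Np : 0 < 2 `^ p^-1 :> R by rewrite powR_gt0.
have q1 : (2 `^ p^-1)^-1 `^ (p - 1) = s^-1 :> R.
  rewrite -!powRN -powRrM; congr (_ `^ _).
  by field; exact: lt0r_neq0 (lt_trans ltr01 p1).
have := pdual_dot_le p1 (1, 1) (`|x.1|, `|x.2|).
rewrite /dot /pdual /= sgr1 !mul1r normr1 N11 div1r q1.
have -> : pnorm p (`|x.1|, `|x.2|) = pnorm p x by rewrite /pnorm /= !normr_id.
by rewrite -mulrDr mulrC ler_pdivrMr; [rewrite mulrC|lra].
Qed.

(* The square [-1, 1]^2 with the corner (1, 1) cut off along the line x.1 + x.2 = s,
   which supports the unit ball of the p-norm; the first vertex is repeated at the end.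
   The sides of the square alone have total length 8, which would not be enough. *)
Definition pentagon (i : nat) : plane :=
  nth 0 [:: (1, -1); (1, s - 1); (s - 1, 1); (-1, 1); (-1, -1); (1, -1)] i.

Lemma pentagon_orient a b c : (a <= b)%N -> (b <= c)%N -> (c <= 5)%N ->
  0 <= det (pentagon b - pentagon a) (pentagon c - pentagon a).
Proof.
have [] := andP (pcorner_bounds p1); rewrite /det /pentagon; move: (s) => t t1 t2.
move=> ab bc c5; have b5 := leq_trans bc c5; have a5 := leq_trans ab b5.
by move: a b c ab bc c5 b5 a5 => [|[|[|[|[|[|//]]]]]] [|[|[|[|[|[|//]]]]]] [|[|[|[|[|[|//]]]]]] //= _ _ _ _ _;
  nra.
Qed.

Lemma pentagon_admissible : admissible_polygon pentagon p.
Proof.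
have [s1 s2] := andP (pcorner_bounds p1).
have s0 : 0 < s by lra.
have s20 : 0 < 2 - s by lra.
have q0 : s * (2 - s) != 0 by rewrite mulf_neq0// gt_eqF.
have J0 : pjac pentagon 0 = s by rewrite /pjac /det /pentagon /=; ring.
have J1 : pjac pentagon 1 = s * (2 - s) by rewrite /pjac /det /pentagon /=; ring.
have J2 : pjac pentagon 2 = s by rewrite /pjac /det /pentagon /=; ring.
have J3 : pjac pentagon 3 = 2 by rewrite /pjac /det /pentagon /=; ring.
have J4 : pjac pentagon 4 = 2 by rewrite /pjac /det /pentagon /=; ring.
have G0 x : pgauge pentagon 0 x = x.1.
  by rewrite /pgauge J0 /det /pedge /pentagon /=; field; lra.
have G1 x : pgauge pentagon 1 x = (x.1 + x.2) / s.
  rewrite /pgauge J1 /det /pedge /pentagon /=; field; apply/andP; split; lra.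
have G2 x : pgauge pentagon 2 x = x.2.
  by rewrite /pgauge J2 /det /pedge /pentagon /=; field; lra.
have G3 x : pgauge pentagon 3 x = - x.1.
  by rewrite /pgauge J3 /det /pedge /pentagon /=; field.
have G4 x : pgauge pentagon 4 x = - x.2.
  by rewrite /pgauge J4 /det /pedge /pentagon /=; field.
have p0 : p != 0 by exact: lt0r_neq0 (lt_trans ltr01 p1).
have axis1 (a : R) : pnorm p (0, a) = `|a|.
  by rewrite /pnorm /= normr0 powR0// add0r (powRK p1).
have axis2 (a : R) : pnorm p (a, 0) = `|a|.
  by rewrite /pnorm /= normr0 powR0// addr0 (powRK p1).
have N11 : pnorm p (-1, 1) = 2 / s.
  rewrite /pnorm /= normrN normr1 powR1 /pcorner.
  apply: (mulIf (lt0r_neq0 s0)); rewrite divfK ?gt_eqF// /pcorner -powRD; last exact/implyP.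
  by rewrite [p^-1 + _]addrC subrK powRr1.
have Ds (a : R) : (a / s < 1) = (a < s) by rewrite ltr_pdivrMr// mul1r.
have Dl (a : R) : (a / s <= 1) = (a <= s) by rewrite ler_pdivrMr// mul1r.
split.
- by [].
- move=> [|[|[|[|[|//]]]]] _; rewrite /pentagon /= ?oner_eq0 ?oppr_eq0 ?oner_eq0// ?gt_eqF//; lra.
- by move=> [|[|[|[|[|//]]]]] _; rewrite ?J0 ?J1 ?J2 ?J3 ?J4// ?mulr_gt0.
- by move=> [|[|[|[|[|//]]]]] [|[|[|[|[|[|//]]]]]] _ _;
    rewrite ?G0 ?G1 ?G2 ?G3 ?G4 ?Dl /pentagon /=;
    clear - s1 s2 s0 s20; lra.
- move=> [|[|[|[|[|//]]]]] [|[|[|[|[|//]]]]] _ _ //= _;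
    rewrite ?G0 ?G1 ?G2 ?G3 ?G4 -?mulrDl /pentagon /=; rewrite ?(ltr_pdivrMr _ _ s0);
    clear - s1 s2 s0 s20; lra.
- move=> [|[|[|[|[|//]]]]] _.
  + by exists 4%N => //; rewrite !G4 /pentagon /=; split; lra.
  + by exists 0%N => //; rewrite !G0 /pentagon /=; split; lra.
  + exists 1%N => //; rewrite !G1 Ds /pentagon /=; split; last lra.
    by field; lra.
  + by exists 2%N => //; rewrite !G2 /pentagon /=; split; lra.
  + by exists 3%N => //; rewrite !G3 /pentagon /=; split; lra.
- move=> [|[|[|[|[|//]]]]] _.
  + exists 1%N => //; rewrite !G1 Ds /pentagon /=; split; last lra.
    by field; lra.
  + by exists 2%N => //; rewrite !G2 /pentagon /=; split; lra.
  + by exists 3%N => //; rewrite !G3 /pentagon /=; split; lra.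
  + by exists 4%N => //; rewrite !G4 /pentagon /=; split; lra.
  + by exists 0%N => //; rewrite !G0 /pentagon /=; split; lra.
- have ax (c a N : R) : 0 <= c -> `|a| <= N -> `|c * a| <= c * N.
    by move=> c0 aN; rewrite normrM ger0_norm// ler_wpM2l.
  move=> i x; have h1 := pnorm_ge1 p1 x; have h2 := pnorm_ge2 p1 x.
  case: i => [|[|[|[|[|//]]]]] _; rewrite ?J0 ?J1 ?J2 ?J3 ?J4.
  + have -> : dot (pedge pentagon 0) x = s * x.2 by rewrite /dot /pedge /pentagon /=; ring.
    exact: (ax _ _ _ (ltW s0) h2).
  + have -> : dot (pedge pentagon 1) x = (2 - s) * (x.2 - x.1) by rewrite /dot /pedge /pentagon /=; ring.
    rewrite [s * _]mulrC -mulrA; apply: (ax _ _ _ (ltW s20)).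
    by apply: le_trans (pnorm_l1_le x); apply: le_trans (ler_normB _ _) _; rewrite addrC.
  + have -> : dot (pedge pentagon 2) x = s * - x.1 by rewrite /dot /pedge /pentagon /=; ring.
    by apply: (ax _ _ _ (ltW s0)); rewrite normrN.
  + have -> : dot (pedge pentagon 3) x = 2 * - x.2 by rewrite /dot /pedge /pentagon /=; ring.
    by apply: (ax _ _ _ (ler0n _ 2)); rewrite normrN.
  + have -> : dot (pedge pentagon 4) x = 2 * x.1 by rewrite /dot /pedge /pentagon /=; ring.
    exact: (ax _ _ _ (ler0n _ 2) h1).
- rewrite !big_ord_recr big_ord0 /= add0r.
  have -> : pedge pentagon 0 = (0, s) by apply: injective_projections; rewrite /pedge /pentagon /=; ring.
  have -> : pedge pentagon 1 = (2 - s) *: (-1, 1).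
    by apply: injective_projections; rewrite /pedge /pentagon /= /GRing.scale/=; ring.
  have -> : pedge pentagon 2 = (- s, 0) by apply: injective_projections; rewrite /pedge /pentagon /=; ring.
  have -> : pedge pentagon 3 = (0, -2) by apply: injective_projections; rewrite /pedge /pentagon /=; ring.
  have -> : pedge pentagon 4 = (2, 0) by apply: injective_projections; rewrite /pedge /pentagon /=; ring.
  rewrite pnormZ// !axis1 !axis2 N11 !normrN !ger0_norm//; try lra.
  (* Cutting the corner replaces the length [2 (2 - s)] by [2 (2 - s) / s], which is shorter since
     [1 < s < 2]. *)
  have -> : s + (2 - s) * (2 / s) + s + 2 + 2 = 8 - 2 * ((2 - s) * (s - 1)) / s.
    by field; lra.
  by rewrite gtrBl divr_gt0// mulr_gt0// mulr_gt0//; lra.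
- exact: pentagon_orient.
- move=> x r h; have := (h 0%N isT, h 2%N isT, h 3%N isT, h 4%N isT); rewrite G0 G2 G3 G4 !ler_norml.
  by move=> [[[a b] c] d]; rewrite a b !(lerNl r) c d.
- move=> i x; have h1 := ler_norm x.1; have h2 := ler_norm x.2.
  have h3 := ler_norm (- x.1); have h4 := ler_norm (- x.2); rewrite !normrN in h3 h4.
  have n1 := normr_ge0 x.1; have n2 := normr_ge0 x.2.
  case: i => [|[|[|[|[|//]]]]] _; rewrite ?G0 ?G1 ?G2 ?G3 ?G4.
  + by apply: (le_trans h1); rewrite lerDl.
  + apply: (@le_trans _ _ ((`|x.1| + `|x.2|) / s)).
      by rewrite ler_wpM2r ?invr_ge0 ?(ltW s0)// lerD.
    by rewrite ler_pdivrMr// ler_peMr ?addr_ge0// ltW.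
  + by apply: (le_trans h2); rewrite lerDr.
  + by apply: (le_trans h3); rewrite lerDl.
  + by apply: (le_trans h4); rewrite lerDr.
- have b : `|s - 1| <= 1 by rewrite ler_norml; apply/andP; split; clear - s1 s2; lra.
  by move=> [|[|[|[|[|[|//]]]]]] _; rewrite /pentagon /= ?normrN ?normr1 ?lexx.
- move=> i j ij j5; have := leq_trans ij j5; case: i ij => [|[|[|[|[|//]]]]];
    case: j j5 => [|[|[|[|[|[|//]]]]]] // _ _ _; rewrite /pentagon /= => -[];
    clear - s1 s2 => *; first [by split|exfalso; lra].
(* This direction is parallel to none of the vertices, whatever [s] between 1 and 2. *)
- exists (-1, 2); first by rewrite /= oppr_eq0 oner_eq0.
  move=> [|[|[|[|[|[|//]]]]]] _; rewrite /det /pentagon /= neq_lt; apply/orP;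
    clear - s1 s2; first [left; lra|right; lra].
Qed.

End pentagon.

Section polygon_geometry.
Context {R : realType} (p : R) (P : nat -> R * R).
Local Notation plane := (R * R)%type.
Hypothesis adm : admissible_polygon P p.
Local Notation gauge := (pgauge P).
Local Notation coord := (pcoord P).
Local Notation edge := (pedge P).
Local Notation jac := (pjac P).

Lemma pgaugeE i x : gauge i x = (edge i).2 / jac i * x.1 + - (edge i).1 / jac i * x.2.
Proof. by rewrite /pgauge /det; ring. Qed.

Lemma pcoordE i x : coord i x = - (P i).2 / jac i * x.1 + (P i).1 / jac i * x.2.
Proof. by rewrite /pcoord /det; ring. Qed.

Lemma pjac_edge i : det (P i) (edge i) = jac i.
Proof. by rewrite /pjac /det /pedge /=; ring. Qed.

Lemma pgaugeD i x y : gauge i (x + y) = gauge i x + gauge i y.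
Proof. by rewrite !pgaugeE /=; ring. Qed.

Lemma pgaugeZ i (a : R) x : gauge i (a *: x) = a * gauge i x.
Proof. by rewrite !pgaugeE /= /GRing.scale/=; ring. Qed.

Lemma pcoordD i x y : coord i (x + y) = coord i x + coord i y.
Proof. by rewrite !pcoordE /=; ring. Qed.

Lemma pcoordZ i (a : R) x : coord i (a *: x) = a * coord i x.
Proof. by rewrite !pcoordE /= /GRing.scale/=; ring. Qed.

Lemma affE (x0 A v : plane) (r y : R) : aff x0 A v r y = x0 + (r *: A + y *: v).
Proof. by rewrite /aff; apply: injective_projections; rewrite /= /GRing.scale/= addrA. Qed.

Section one_side.
Variable i : nat.
Hypothesis i5 : (i < 5)%N.

Let J0 : 0 < jac i. Proof. exact: (polygon_jac adm). Qed.

Lemma pgauge_vertex : gauge i (P i) = 1.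
Proof. by rewrite /pgauge pjac_edge divff// gt_eqF. Qed.

Lemma pgauge_edge : gauge i (edge i) = 0.
Proof. by rewrite /pgauge /det; ring. Qed.

Lemma pcoord_vertex : coord i (P i) = 0.
Proof. by rewrite /pcoord /det; ring. Qed.

Lemma pcoord_edge : coord i (edge i) = 1.
Proof. by rewrite /pcoord pjac_edge divff// gt_eqF. Qed.

Lemma pgauge_aff x0 r y : gauge i (aff x0 (P i) (edge i) r y - x0) = r.
Proof.
by rewrite affE addrC addKr pgaugeD !pgaugeZ pgauge_vertex pgauge_edge mulr1 mulr0 addr0.
Qed.

Lemma pcoord_aff x0 r y : coord i (aff x0 (P i) (edge i) r y - x0) = y.
Proof.
by rewrite affE addrC addKr pcoordD !pcoordZ pcoord_vertex pcoord_edge mulr1 mulr0 add0r.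
Qed.

Lemma polygon_decomp x : x = gauge i x *: P i + coord i x *: edge i.
Proof.
have j0 : jac i != 0 by rewrite gt_eqF.
have E1 : x.1 = (det x (edge i) * (P i).1 + det (P i) x * (edge i).1) / jac i.
  by rewrite -[LHS](mulfK j0) -pjac_edge /det; congr (_ / _); ring.
have E2 : x.2 = (det x (edge i) * (P i).2 + det (P i) x * (edge i).2) / jac i.
  by rewrite -[LHS](mulfK j0) -pjac_edge /det; congr (_ / _); ring.
by apply: injective_projections; [rewrite [LHS]E1|rewrite [LHS]E2]; rewrite /= /GRing.scale/= /pgauge /pcoord; ring.
Qed.

Lemma pgauge_other j x : gauge j x =
  gauge i x * gauge j (P i) + coord i x * (gauge j (P i.+1) - gauge j (P i)).
Proof.
rewrite {1}(polygon_decomp x) pgaugeD !pgaugeZ; congr (_ + _ * _).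
by rewrite /pedge pgaugeD -scaleN1r pgaugeZ mulN1r.
Qed.

(** Within [h] of side [i], the constraints of its two neighbours confine the position along the
    side up to a multiple of [h]. The constant comes from the slopes [1 - a] and [1 - b] of the
    neighbouring gauges along the side. *)
Lemma strip_range : exists2 C : R, 0 < C & forall (x : plane) (r h : R),
  (forall j, (j < 5)%N -> gauge j x < r) -> r - h < gauge i x ->
  - (C * h) < coord i x < gauge i x + C * h.
Proof.
have [j j5 [j1 j2]] := polygon_prev adm i5; have [k k5 [k1 k2]] := polygon_next adm i5.
set a := gauge j (P i.+1) in j2; set b := gauge k (P i) in k2.
have a0 : 0 < 1 - a by rewrite subr_gt0.
have b0 : 0 < 1 - b by rewrite subr_gt0.
exists ((1 - a)^-1 + (1 - b)^-1); first by rewrite addr_gt0// invr_gt0.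
move=> x r h xr rh.
have h0 : 0 < h by have := lt_trans rh (xr i i5); rewrite gtrBl.
have := xr j j5; rewrite (pgauge_other j) j1 mulr1 -/a => hj.
have := xr k k5; rewrite (pgauge_other k) k1 -/b => hk.
move: hj hk rh; set g := gauge i x; set y := coord i x => hj hk rh.
have A : - (h / (1 - a)) < y.
  by rewrite ltrNl ltr_pdivlMr//; nra.
have B : y - g < h / (1 - b) by rewrite ltr_pdivlMr//; nra.
have A1 : 0 < h / (1 - a) by rewrite divr_gt0.
have B1 : 0 < h / (1 - b) by rewrite divr_gt0.
rewrite mulrDl ![_^-1 * h]mulrC.
by apply/andP; split; lra.
Qed.

End one_side.

Lemma strip_range_unif : exists2 C : R, 0 < C & forall i, (i < 5)%N ->
  forall (x : plane) (r h : R), 0 <= h ->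
  (forall j, (j < 5)%N -> gauge j x < r) -> r - h < gauge i x ->
  - (C * h) < coord i x < gauge i x + C * h.
Proof.
have H (i : 'I_5) : exists C : R, 0 < C /\ forall (x : plane) (r h : R),
  (forall j, (j < 5)%N -> gauge j x < r) -> r - h < gauge i x ->
  - (C * h) < coord i x < gauge i x + C * h.
  by have [C C0 HC] := strip_range (ltn_ord i); exists C.
have [f Hf] := fin_all_exists H.
have le_sum (i : 'I_5) : f i <= \sum_j f j.
  by rewrite (bigD1 i)//= lerDl sumr_ge0// => j _; rewrite ltW//; have [] := Hf j.
exists (\sum_i f i).
  by apply: lt_le_trans (le_sum ord0); have [] := Hf ord0.
move=> i i5 x r h h0 xr rh; have [_ /(_ x r h xr rh)] := Hf (Ordinal i5).
have := ler_wpM2r h0 (le_sum (Ordinal i5)) => /= h1 /andP[h2 h3]; apply/andP; split.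
  by apply: le_lt_trans h2; rewrite lerN2.
by apply: (lt_le_trans h3); rewrite lerD2l.
Qed.

(** The open polygon of size [r] centred at [x0]. It is not assumed symmetric, so [pball x0 r x] and
    [pball x r x0] are different statements. *)
Definition pball (x0 : plane) (r : R) : set plane :=
  [set x | forall i, (i < 5)%N -> gauge i (x - x0) < r].

Lemma convex_lt (a b t r : R) : a < r -> b < r -> 0 <= t <= 1 -> a + t * (b - a) < r.
Proof.
move=> ar br /andP[t0 t1]; have [ab|ba] := leP a b.
  by apply: le_lt_trans br; rewrite -lerBrDl ler_piMl ?subr_ge0.
apply: le_lt_trans ar; rewrite gerDl mulr_ge0_le0// subr_le0; exact: ltW.
Qed.

Lemma affine_conv (f : plane -> R) (a b : R) : (forall x, f x = a * x.1 + b * x.2) ->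
  forall x0 x y (t : R), f (x + t *: (y - x) - x0) = f (x - x0) + t * (f (y - x0) - f (x - x0)).
Proof. by move=> fE x0 x y t; rewrite !fE /= /GRing.scale/=; ring. Qed.

Lemma affine_open (f : plane -> R) (a b : R) (x0 : plane) (A : set R) :
  (forall x, f x = a * x.1 + b * x.2) -> open A -> open [set x | A (f (x - x0))].
Proof.
move=> fE oA.
have -> : [set x | A (f (x - x0))] = [set x | A (a * x.1 + b * x.2 + (- a * x0.1 - b * x0.2))].
  by apply/funext => x /=; rewrite fE /=; congr (A _); ring.
apply: (@open_comp _ _ (fun x : plane => a * x.1 + b * x.2 + (- a * x0.1 - b * x0.2)) A) => //.
by move=> x _; exact: continuous_affine2.
Qed.

Lemma pball_convex x0 r : convex_region (pball x0 r).
Proof.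
move=> x y t hx hy t01 i i5; rewrite (affine_conv (pgaugeE i)).
by apply: convex_lt => //; [exact: hx|exact: hy].
Qed.

Lemma pball_open x0 r : open (pball x0 r).
Proof.
suff H n : open [set x | forall i, (i < n)%N -> gauge i (x - x0) < r] by exact: H.
elim: n => [|n ih].
  have -> : [set x | forall i, (i < 0)%N -> gauge i (x - x0) < r] = setT by apply/seteqP; split.
  exact: openT.
have -> : [set x | forall i, (i < n.+1)%N -> gauge i (x - x0) < r] =
   [set x | forall i, (i < n)%N -> gauge i (x - x0) < r] `&` [set x | gauge n (x - x0) < r].
  apply/seteqP; split => x /=.
    by move=> h; split; [move=> i /ltnW; exact: h|exact: h].
  by move=> [h1 h2] i; rewrite ltnS leq_eqVlt => /orP[/eqP ->|/h1].
apply: openI => //.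
by apply: (@affine_open (gauge n) _ _ x0 [set y | y < r]) (@pgaugeE n) _; exact: open_lt.
Qed.

Lemma pball_box x0 r : 0 <= r -> pball x0 r `<=` cbox x0 r.
Proof.
move=> r0 x h; have [] := @polygon_bounded _ _ _ adm (x - x0) r; last by [].
by move=> i i5; rewrite ltW//; exact: h.
Qed.

Lemma subset_pball x0 r r' : r <= r' -> pball x0 r `<=` pball x0 r'.
Proof. by move=> rr x h i i5; apply: lt_le_trans rr; exact: h. Qed.

(** The cone over side [i] inside the polygon: a triangle in the coordinates of that side. *)
Definition psector (x0 : plane) (r : R) (i : nat) : set plane :=
  [set x | [/\ 0 < coord i (x - x0), coord i (x - x0) < gauge i (x - x0) & gauge i (x - x0) < r]].

Lemma psectorE x0 r i : psector x0 r i =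
  [set x | - coord i (x - x0) < 0] `&` [set x | coord i (x - x0) - gauge i (x - x0) < 0] `&`
  [set x | gauge i (x - x0) < r].
Proof.
apply/seteqP; split => x.
  by move=> [h1 h2 h3]; split; [split|]; rewrite /= ?oppr_lt0 ?subr_lt0.
by move=> [[/= h1 h2] h3]; split => //; [rewrite -oppr_lt0|rewrite -subr_lt0].
Qed.

Let mixE i x : coord i x - gauge i x =
  (- (P i).2 / jac i - (edge i).2 / jac i) * x.1 + ((P i).1 / jac i + (edge i).1 / jac i) * x.2.
Proof. by rewrite pcoordE pgaugeE; ring. Qed.

Let oppE i x : - coord i x = (P i).2 / jac i * x.1 + - (P i).1 / jac i * x.2.
Proof. by rewrite pcoordE; ring. Qed.

Lemma psector_open x0 r i : open (psector x0 r i).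
Proof.
rewrite psectorE; apply: openI; first apply: openI.
- by apply: (@affine_open (fun x => - coord i x) _ _ x0 [set y | y < 0]) (@oppE i) _; exact: open_lt.
- by apply: (@affine_open (fun x => coord i x - gauge i x) _ _ x0 [set y | y < 0]) (@mixE i) _; exact: open_lt.
- by apply: (@affine_open (gauge i) _ _ x0 [set y | y < r]) (@pgaugeE i) _; exact: open_lt.
Qed.

Lemma psector_convex x0 r i : convex_region (psector x0 r i).
Proof.
rewrite psectorE => x y t [[hx1 hx2] hx3] [[hy1 hy2] hy3] t01; split; [split|]; rewrite /=.
- by rewrite (affine_conv (f := fun x => - coord i x) (@oppE i)); exact: convex_lt.
- by rewrite (affine_conv (f := fun x => coord i x - gauge i x) (@mixE i)); exact: convex_lt.
- by rewrite (affine_conv (pgaugeE i)); exact: convex_lt.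
Qed.

(** Over side [i] its own gauge dominates: [gauge j] is at most 1 at both ends of the side and, for
    [j] different from [i], less than 1 at one of them. Hence the sectors are disjoint. *)
Lemma psector_gauge x0 r i j x : (i < 5)%N -> (j < 5)%N -> psector x0 r i x ->
  gauge j (x - x0) <= gauge i (x - x0) /\ (i != j -> gauge j (x - x0) < gauge i (x - x0)).
Proof.
move=> i5 j5 [y0 yg gr]; rewrite (pgauge_other i5 j).
have h1 := polygon_in adm j5 (ltnW i5); have h2 := polygon_in adm j5 i5.
have h3 : i != j -> gauge j (P i) + gauge j (P i.+1) < 2 by exact: (polygon_dis adm).
move: h1 h2 h3 y0 yg.
set a := gauge j (P i); set b := gauge j (P i.+1); set g := gauge i _; set y := coord i _.
move=> h1 h2 h3 y0 yg; split; first by nra.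
move=> /h3 h4.
have [a1|a1] := ltP a 1; first by nra.
have b1 : b < 1 by lra.
nra.
Qed.

Lemma psector_sub x0 r i : (i < 5)%N -> psector x0 r i `<=` pball x0 r.
Proof.
move=> i5 x Sx j j5; have [h _] := psector_gauge i5 j5 Sx.
by apply: (le_lt_trans h); case: Sx.
Qed.

Lemma psector_disjoint x0 r i j x : (i < 5)%N -> (j < 5)%N ->
  psector x0 r i x -> psector x0 r j x -> i = j.
Proof.
move=> i5 j5 Si Sj; apply/eqP/negPn/negP => ij.
have [_ /(_ ij) h1] := psector_gauge i5 j5 Si.
have [_] := psector_gauge j5 i5 Sj; rewrite eq_sym => /(_ ij) h2.
by have := lt_trans h1 h2; rewrite ltxx.
Qed.

Lemma psector_aff x0 r i (rho y : R) : (i < 5)%N ->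
  psector x0 r i (aff x0 (P i) (edge i) rho y) <-> [/\ 0 < y, y < rho & rho < r].
Proof. by move=> i5; rewrite /psector /= pgauge_aff// pcoord_aff. Qed.

End polygon_geometry.

(** * Integrals over thin strips along a side *)

Section iterated_integrals.
Context {R : realType}.
Local Notation plane := (R * R)%type.
Local Notation mplane := (measurableTypeR R * measurableTypeR R)%type.
Local Notation leb := (@lebesgue_measure R).
Local Notation L2 := (@lebesgue2 R).
Local Open Scope ereal_scope.

Lemma measurable_inner (f : mplane -> \bar R) : measurable_fun setT f -> (forall z, 0 <= f z) ->
  measurable_fun [set: measurableTypeR R] (fun r => \int[leb]_y f (r, y)).
Proof.
move=> mf f0.
by have := @measurable_fun_fubini_tonelli_F _ _ _ _ _ leb f mf f0.
Qed.

Lemma measurable_inner_aff (x0 P v : plane) (f : mplane -> \bar R) : measurable_fun setT f ->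
  (forall z, 0 <= f z) ->
  measurable_fun [set: measurableTypeR R] (fun r => \int[leb]_y f (aff x0 P v r y)).
Proof.
move=> mf f0; apply: (@measurable_inner (fun z => f (aff x0 P v z.1 z.2))) => //.
by apply: (measurableT_comp mf); exact: measurable_aff.
Qed.

Lemma lebesgue_interval (a b : R) : (a <= b)%R ->
  \int[leb]_y (\1_(`[a, b]%classic : set (measurableTypeR R)) y)%:E = (b - a)%:E.
Proof.
move=> ab; have mI : measurable (`[a, b]%classic : set (measurableTypeR R)) by exact: measurable_itv.
rewrite integral_indic// setIT [LHS]lebesgue_measure_itv/= lte_fin; case: ifPn => // h.
have -> : a = b by apply/eqP; rewrite eq_le ab leNgt h.
by rewrite subrr.
Qed.

End iterated_integrals.

Section strip_estimate.
Context {R : realType} (p : R) (P : nat -> R * R).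
Local Notation plane := (R * R)%type.
Local Notation mplane := (measurableTypeR R * measurableTypeR R)%type.
Local Notation leb := (@lebesgue_measure R).
Local Notation L2 := (@lebesgue2 R).
Hypothesis adm : admissible_polygon P p.
Local Notation gauge := (pgauge P).
Local Notation coord := (pcoord P).
Local Notation edge := (pedge P).
Local Notation jac := (pjac P).

Lemma measurable_gauge i (x0 : plane) : measurable_fun [set: mplane] (fun x : mplane => gauge i (x - x0)).
Proof.
have -> : (fun x : mplane => gauge i (x - x0)) = (fun x : plane => (edge i).2 / jac i * x.1 +
   - (edge i).1 / jac i * x.2 + gauge i (- x0)).
  by apply/funext => x; rewrite pgaugeD pgaugeE.
by apply: continuous_plane_measurable; exact: continuous_affine2.
Qed.

Lemma measurable_pball x0 r : measurable (pball P x0 r : set mplane).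
Proof. by apply: open_plane_measurable; exact: pball_open. Qed.

Lemma polygon_integral i (x0 : plane) (f : mplane -> \bar R) : (i < 5)%N ->
  measurable_fun setT f -> (forall z, (0 <= f z)%E) ->
  (\int[L2]_z f z = (jac i)%:E * \int[leb]_r \int[leb]_y f (aff x0 (P i) (edge i) r y))%E.
Proof.
move=> i5 mf f0; have J0 := polygon_jac adm i5.
rewrite ge0_integral_aff//; [|exact: (polygon_fst adm)|by rewrite pjac_edge gt_eqF].
by rewrite pjac_edge gtr0_norm// muleA -EFinM divff ?gt_eqF// mul1e.
Qed.

(** In the coordinates of side [i], the slice of the strip at height [s] is contained in []0, s[]
    and two overhangs at the corners. Their length is at most [C * h] by [strip_range_unif], and
    there [F] is bounded by [B]. *)
Lemma strip_integral : exists2 C : R, 0 < C & forall i (x0 : plane) (r h B : R)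
    (w : R -> R) (F : mplane -> R), (i < 5)%N -> 0 < h -> 0 <= B ->
  measurable_fun [set: measurableTypeR R] w -> (forall s, 0 <= w s) ->
  (forall s, s <= r - h -> w s = 0) ->
  measurable_fun setT F -> (forall x, 0 <= F x <= B) ->
  (\int[L2]_x (\1_(pball P x0 r) x * (w (gauge i (x - x0)) * F x))%:E <=
   (jac i)%:E * \int[leb]_s ((w s)%:E *
     (\int[leb]_y (\1_(`]0%R, s[%classic : set (measurableTypeR R)) y * F (aff x0 (P i) (edge i) s y))%:E
      + (2 * (B * (C * h)))%:E)))%E.
Proof.
have [C C0 HC] := strip_range_unif adm; exists C => //.
move=> i x0 r h B w F i5 h0 B0 mw w0 wz mF FB.
have J0 := polygon_jac adm i5.
have F0 x : 0 <= F x by have /andP[] := FB x.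
have mf : measurable_fun [set: mplane] (fun x => (\1_(pball P x0 r) x * (w (gauge i (x - x0)) * F x))%:E).
  apply/measurable_EFinP; apply: measurable_funM; first by apply: measurable_indic; exact: measurable_pball.
  by apply: measurable_funM => //; apply: (measurableT_comp mw); exact: measurable_gauge.
have f0 (x : plane) : (0 <= (\1_(pball P x0 r) x * (w (gauge i (x - x0)) * F x))%:E)%E.
  by rewrite lee_fin !mulr_ge0// ; case/andP: (indic_bound (pball P x0 r) x).
rewrite (polygon_integral (i := i) x0 i5 mf f0) lee_pmul2l//.
have Ch : 0 <= C * h by rewrite mulr_ge0// ltW.
pose A s y : R := \1_(`]0%R, s[%classic : set (measurableTypeR R)) y * F (aff x0 (P i) (edge i) s y).
pose D1 y : R := \1_(`[- (C * h), 0]%classic : set (measurableTypeR R)) y.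
pose D2 s y : R := \1_(`[s, s + C * h]%classic : set (measurableTypeR R)) y.
have ind01 (X : set (measurableTypeR R)) y : 0 <= (\1_X y : R) by rewrite indicE; case: (_ \in _).
have mA2 : measurable_fun [set: mplane] (fun z : mplane => A z.1 z.2).
  have mT : measurable ([set z | 0 < z.2 /\ z.2 < z.1] : set mplane).
    apply: open_plane_measurable.
    have -> : [set z : plane | 0 < z.2 /\ z.2 < z.1] = [set z | 0 < z.2] `&` [set z | z.2 - z.1 < 0].
      by apply/seteqP; split => z /= []; rewrite subr_lt0.
    apply: openI.
      apply: (@open_comp _ _ (fun z : plane => z.2) [set y | 0 < y]); last exact: open_gt.
      by move=> z _; exact: cvg_snd.
    apply: (@open_comp _ _ (fun z : plane => z.2 - z.1) [set y | y < 0]); last exact: open_lt.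
    by move=> z _; apply: cvgB; [exact: cvg_snd|exact: cvg_fst].
  have -> : (fun z : mplane => A z.1 z.2) = (fun z => \1_([set z | 0 < z.2 /\ z.2 < z.1] : set mplane) z *
       F (aff x0 (P i) (edge i) z.1 z.2)).
    apply/funext => z; rewrite /A; congr (_ * _); rewrite !indicE; congr ((nat_of_bool _)%:R).
    by apply/idP/idP => [/set_mem|/set_mem /= [a b]]; rewrite ?/= ?in_itv/=; [move=> /andP[a b]|]; apply/mem_set; rewrite /= ?in_itv/= ?a ?b.
  apply: measurable_funM; first exact: measurable_indic.
  by apply: (measurableT_comp mF); exact: measurable_aff.
have mA s : measurable_fun [set: measurableTypeR R] (A s).
  exact: (@measurableT_comp _ _ _ _ _ _ (fun z : mplane => A z.1 z.2) _ (pair s) mA2 (pair1_measurable s)).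
have A0 s y : 0 <= A s y by rewrite mulr_ge0.
have mD1 : measurable_fun [set: measurableTypeR R] D1 by apply: measurable_indic; exact: measurable_itv.
have mD2 s : measurable_fun [set: measurableTypeR R] (D2 s) by apply: measurable_indic; exact: measurable_itv.
apply: ge0_le_integral => //.
- by move=> s _; apply: integral_ge0 => y _; exact: f0.
- exact: (measurable_inner_aff x0 (P i) (edge i) mf f0).
- apply: emeasurable_funM; first exact/measurable_EFinP.
  apply: emeasurable_funD; last exact: measurable_cst.
  by apply: (@measurable_inner _ (fun z => (A z.1 z.2)%:E)) => [|z]; [exact/measurable_EFinP|rewrite lee_fin].
move=> s _.
have [sr|sr] := leP s (r - h).
  rewrite wz// mul0e le_eqVlt; apply/orP; left; apply/eqP; apply: integral0_eq => y _.
  by rewrite (pgauge_aff adm i5) wz// mul0r mulr0.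
pose g y : \bar R := ((D1 y)%:E + (D2 s y)%:E)%E.
have mg : measurable_fun [set: measurableTypeR R] g by apply: emeasurable_funD; exact/measurable_EFinP.
have g0 y : (0 <= g y)%E by rewrite /g -EFinD lee_fin addr_ge0.
have mA' : measurable_fun [set: measurableTypeR R] (fun y => (A s y)%:E) by exact/measurable_EFinP.
have A0' y : (0 <= (A s y)%:E)%E by rewrite lee_fin.
have mBg : measurable_fun [set: measurableTypeR R] (fun y => (B%:E * g y)%E) by exact: emeasurable_funM.
have Bg0 y : (0 <= B%:E * g y)%E by rewrite mule_ge0.
have mABg : measurable_fun [set: measurableTypeR R] (fun y => ((A s y)%:E + B%:E * g y)%E) by exact: emeasurable_funD.
have ABg0 y : (0 <= (A s y)%:E + B%:E * g y)%E by rewrite adde_ge0.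
have mD1' : measurable_fun [set: measurableTypeR R] (fun y => (D1 y)%:E) by exact/measurable_EFinP.
have mD2' : measurable_fun [set: measurableTypeR R] (fun y => (D2 s y)%:E) by exact/measurable_EFinP.
have Ig : (\int[leb]_y g y = (2 * (C * h))%:E)%E.
  have := @ge0_integralD _ _ _ leb setT measurableT (fun y => (D1 y)%:E) (fun y => (D2 s y)%:E)
    (fun y _ => ind01 _ y) mD1' (fun y _ => ind01 _ y) mD2'.
  rewrite lebesgue_interval ?oppr_le0// lebesgue_interval ?lerDl// -EFinD => ->; congr EFin; ring.
have -> : (\int[leb]_y (\1_(`]0%R, s[%classic : set (measurableTypeR R)) y * F (aff x0 (P i) (edge i) s y))%:E
      + (2 * (B * (C * h)))%:E = \int[leb]_y ((A s y)%:E + B%:E * g y))%E.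
  have -> := @ge0_integralD _ _ _ leb setT measurableT _ _ (fun y _ => A0' y) mA' (fun y _ => Bg0 y) mBg.
  have -> := ge0_integralZl_EFin leb measurableT (fun y _ => g0 y) mg B0.
  by rewrite Ig -EFinM; congr (_ + _%:E)%E; ring.
have <- := ge0_integralZl_EFin leb measurableT (fun y _ => ABg0 y) mABg (w0 s).
apply: ge0_le_integral => //.
- apply: (measurableT_comp mf).
  apply: (@measurableT_comp _ _ _ _ _ _ (fun z : mplane => aff x0 (P i) (edge i) z.1 z.2 : mplane) _ (pair s)).
    exact: measurable_aff.
  exact: pair1_measurable.
- exact: emeasurable_funM.
move=> y _; rewrite (pgauge_aff adm i5).
have -> : ((w s)%:E * ((A s y)%:E + B%:E * g y) = (w s * (A s y + B * (D1 y + D2 s y)))%:E)%E by [].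
rewrite lee_fin.
set q := aff x0 (P i) (edge i) s y.
rewrite indicE; case: (boolP (q \in pball P x0 r)) => [/set_mem hq|_]; last first.
  by rewrite mul0r mulr_ge0// addr_ge0// mulr_ge0// addr_ge0.
have := HC i i5 (q - x0) r h (ltW h0) hq; rewrite (pgauge_aff adm i5) (pcoord_aff adm i5) => /(_ sr) /andP[h1 h2].
rewrite mul1r ler_wpM2l// /A -/q.
have FBq : F q <= B by have /andP[] := FB q.
have [y0|y0] := leP y 0.
  have -> : D1 y = 1 by rewrite /D1 indicE mem_set//= in_itv/= y0 ltW.
  apply: (le_trans FBq); apply: ler_wpDl; first by rewrite mulr_ge0.
  by rewrite -[leLHS]mulr1 ler_wpM2l// lerDl.
have [ys|ys] := ltP y s.
  have -> : \1_(`]0%R, s[%classic : set (measurableTypeR R)) y = 1 :> R.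
    by rewrite indicE mem_set//= in_itv/= y0 ys.
  by rewrite mul1r lerDl mulr_ge0// addr_ge0.
have -> : D2 s y = 1 by rewrite /D2 indicE mem_set//= in_itv/= ys ltW.
apply: (le_trans FBq); apply: ler_wpDl; first by rewrite mulr_ge0.
by rewrite -[leLHS]mulr1 ler_wpM2l// lerDr.
Qed.

End strip_estimate.

(** * Polygonal cutoffs, flux through the sides and the energy bound *)

Section cutoff.
Context {R : realType} (p : R) (P : nat -> R * R).
Hypothesis p1 : 1 < p.
Local Notation plane := (R * R)%type.
Local Notation mplane := (measurableTypeR R * measurableTypeR R)%type.
Local Notation leb := (@lebesgue_measure R).
Local Notation L2 := (@lebesgue2 R).
Hypothesis adm : admissible_polygon P p.
Local Notation gauge := (pgauge P).
Local Notation edge := (pedge P).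
Local Notation jac := (pjac P).
Variables (x0 : plane) (r h : R).
Hypothesis h0 : 0 < h.

Definition side_step (i : nat) (x : plane) : R := step ((r - gauge i (x - x0)) / h).
(** Minus the derivative of [side_step] as a function of the gauge: a weight of mass 1 on
    [[r - h, r]]. *)
Definition side_weight (s : R) : R := dstep ((r - s) / h) / h.
(** A product over the sides and not a function of the largest gauge, which would fail to be C1 at
    the corners. *)
Definition cutoff (n : nat) (x : plane) : R := \prod_(i < n) side_step i x.
(** The coefficient of minus the gradient of [gauge i] in the gradient of the product. *)
Definition cutoff_part (n i : nat) (x : plane) : R :=
  (\prod_(j < n) (if j == i :> nat then 1 else side_step j x)) * side_weight (gauge i (x - x0)).

Let ga i : R := (edge i).2 / jac i.
Let gb i : R := - (edge i).1 / jac i.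

Lemma side_weight_ge0 s : 0 <= side_weight s.
Proof. by rewrite /side_weight divr_ge0 ?dstep_ge0// ltW. Qed.

Lemma side_weight_le s : side_weight s <= 2 / h.
Proof. by rewrite /side_weight ler_pM2r ?invr_gt0// dstep_le2. Qed.

Lemma side_weight_eq0 s : s <= r - h \/ r <= s -> side_weight s = 0.
Proof.
move=> H; rewrite /side_weight dstep_eq0 ?mul0r//; case: H => H; [right|left].
  by rewrite ler_pdivlMr// mul1r lerBrDl -lerBrDr.
by rewrite pmulr_lle0 ?invr_gt0// subr_le0.
Qed.

Lemma measurable_side_weight : measurable_fun [set: measurableTypeR R] side_weight.
Proof.
apply: measurable_funM => //; apply: (@measurableT_comp _ _ _ _ _ _ (@dstep R)).
  by apply: continuous_measurable_fun; exact: continuous_dstep.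
by apply: measurable_funM => //; apply: measurable_funB.
Qed.

Lemma measurable_side_weight_gauge i :
  measurable_fun [set: mplane] (fun x : mplane => side_weight (gauge i (x - x0))).
Proof.
apply: (@measurableT_comp _ _ _ _ _ _ side_weight _ (fun x : mplane => gauge i (x - x0))).
  exact: measurable_side_weight.
exact: measurable_gauge.
Qed.

Lemma C1_side i : C1 (side_step i) (fun x => - ga i * side_weight (gauge i (x - x0)))
  (fun x => - gb i * side_weight (gauge i (x - x0))).
Proof.
have H := C1_step (- ga i / h) (- gb i / h) ((r - gauge i (- x0)) / h).
cbv zeta beta in H; move: H.
have E (x : plane) : - ga i / h * x.1 + - gb i / h * x.2 + (r - gauge i (- x0)) / h = (r - gauge i (x - x0)) / h.
  by rewrite pgaugeD (pgaugeE _ _ x) /ga /gb; ring.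
have -> : (fun x : plane => step (- ga i / h * x.1 + - gb i / h * x.2 + (r - gauge i (- x0)) / h)) = side_step i.
  by apply/funext => x; rewrite E.
have E2 (k : R) : (fun x : plane => - k / h * dstep (- ga i / h * x.1 + - gb i / h * x.2 + (r - gauge i (- x0)) / h))
   = (fun x => - k * side_weight (gauge i (x - x0))).
  by apply/funext => x; rewrite E /side_weight; ring.
by rewrite !E2.
Qed.

Lemma C1_cutoff n : C1 (cutoff n) (fun x => \sum_(i < n) - ga i * cutoff_part n i x)
  (fun x => \sum_(i < n) - gb i * cutoff_part n i x).
Proof.
elim: n => [|n ih].
  have -> : cutoff 0 = (fun=> 1) by apply/funext => x; rewrite /cutoff big_ord0.
  have E (k : nat -> R) : (fun x => \sum_(i < 0) - k i * cutoff_part 0 i x) = (fun=> 0).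
    by apply/funext => x; rewrite big_ord0.
  by rewrite !E; exact: C1_cst.
have := C1M ih (C1_side n).
have -> : (fun x => cutoff n x * side_step n x) = cutoff n.+1.
  by apply/funext => x; rewrite /cutoff big_ord_recr.
have E (k : nat -> R) : (fun x => (\sum_(i < n) - k i * cutoff_part n i x) * side_step n x +
     cutoff n x * (- k n * side_weight (gauge n (x - x0)))) =
     (fun x => \sum_(i < n.+1) - k i * cutoff_part n.+1 i x).
  apply/funext => x; rewrite big_ord_recr /= mulr_suml; congr (_ + _).
    apply: eq_bigr => i _; rewrite /cutoff_part big_ord_recr /=.
    by rewrite [n == i]eq_sym ltn_eqF//; ring.
  rewrite /cutoff_part big_ord_recr /= eqxx mulr1 mulrCA /cutoff; congr (_ * (_ * _)).
  by apply: eq_bigr => i _; rewrite ltn_eqF.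
by rewrite (E ga) (E gb).
Qed.

Lemma side_step01 i x : 0 <= side_step i x <= 1. Proof. exact: step01. Qed.

Lemma cutoff01 n x : 0 <= cutoff n x <= 1.
Proof.
rewrite /cutoff prodr_ge0 /=; last by move=> i _; have /andP[] := side_step01 i x.
by apply: prodr_ile1 => i _; exact: side_step01.
Qed.

Lemma side_step_eq0 i x : r <= gauge i (x - x0) -> side_step i x = 0.
Proof. by move=> h1; rewrite /side_step step_le0// pmulr_lle0 ?invr_gt0// subr_le0. Qed.

Lemma cutoff_eq1 x : pball P x0 (r - h) x -> cutoff 5 x = 1.
Proof.
move=> hx; rewrite /cutoff big1// => i _; rewrite /side_step step_ge1//.
by rewrite ler_pdivlMr// mul1r lerBrDl -lerBrDr ltW//; exact: hx.
Qed.

Lemma cutoff_eq0 x : ~ (forall i, (i < 5)%N -> gauge i (x - x0) <= r) -> cutoff 5 x = 0.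
Proof.
move=> hx; suff [i ri] : exists i : 'I_5, r <= gauge i (x - x0).
  by rewrite /cutoff (bigD1 i)//= side_step_eq0// mul0r.
apply: contrapT => /forallNP H; apply: hx => i i5.
by have /negP := H (Ordinal i5); rewrite /= -ltNge => /ltW.
Qed.

Lemma cutoff_part_le i x : (i < 5)%N ->
  0 <= cutoff_part 5 i x <= \1_(pball P x0 r) x * side_weight (gauge i (x - x0)).
Proof.
move=> i5; have w0 := side_weight_ge0 (gauge i (x - x0)).
have b01 (j : 'I_5) : 0 <= (if j == i :> nat then 1 else side_step j x) <= 1.
  by case: ifP; rewrite ?ler01 ?lexx// => _; exact: side_step01.
apply/andP; split.
  by rewrite mulr_ge0// prodr_ge0// => j _; have /andP[] := b01 j.
rewrite /cutoff_part indicE; case: (boolP (x \in _)) => [_|/negP nx].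
  by rewrite ler_wpM2r// prodr_ile1.
rewrite mul0r; suff [j rj] : exists j : 'I_5, r <= gauge j (x - x0).
  have [ji|ji] := eqVneq (j : nat) i.
    by rewrite -ji side_weight_eq0 ?mulr0//; right.
  by rewrite (bigD1 j)//= (negbTE ji) side_step_eq0// !mul0r.
apply: contrapT => /forallNP H; apply: nx; apply/mem_set => j j5.
by have /negP := H (Ordinal j5); rewrite /= -ltNge.
Qed.

Lemma cutoff_supp (Omega : set plane) :
  [set x | forall i, (i < 5)%N -> gauge i (x - x0) <= r] `<=` Omega -> compact_supp Omega (cutoff 5).
Proof.
move=> KO; exists [set x | forall i, (i < 5)%N -> gauge i (x - x0) <= r]; split => //; last first.
  by move=> x; exact: cutoff_eq0.
have cl n : closed [set x : plane | forall i, (i < n)%N -> gauge i (x - x0) <= r].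
  elim: n => [|n ih].
    have -> : [set x : plane | forall i, (i < 0)%N -> gauge i (x - x0) <= r] = setT by apply/seteqP; split.
    exact: closedT.
  have -> : [set x | forall i, (i < n.+1)%N -> gauge i (x - x0) <= r] =
     [set x | forall i, (i < n)%N -> gauge i (x - x0) <= r] `&` ~` [set x | r < gauge n (x - x0)].
    apply/seteqP; split => x /=.
      by move=> H; split; [move=> i /ltnW; exact: H|apply/negP; rewrite -leNgt; exact: H].
    by move=> [h1 /negP]; rewrite -leNgt => h2 i; rewrite ltnS leq_eqVlt => /orP[/eqP ->|/h1].
  apply: closedI => //; apply: open_closedC.
  by apply: (@affine_open _ (gauge n) _ _ x0 [set y | r < y]) (@pgaugeE _ _ n) _; exact: open_gt.
apply: (subclosed_compact (cl 5)); first exact: (@compact_cbox _ x0 r).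
by move=> x H; have [] := polygon_bounded adm H.
Qed.

End cutoff.

Section flux.
Context {R : realType} (p : R) (P : nat -> R * R).
Hypothesis p1 : 1 < p.
Local Notation plane := (R * R)%type.
Local Notation mplane := (measurableTypeR R * measurableTypeR R)%type.
Local Notation leb := (@lebesgue_measure R).
Local Notation L2 := (@lebesgue2 R).
Hypothesis adm : admissible_polygon P p.
Local Notation gauge := (pgauge P).
Local Notation edge := (pedge P).
Local Notation jac := (pjac P).

Lemma pnorm_sum n (c : nat -> R) (v : nat -> plane) :
  pnorm p (\sum_(i < n) c i * (v i).1, \sum_(i < n) c i * (v i).2) <= \sum_(i < n) `|c i| * pnorm p (v i).
Proof.
elim: n => [|n ih]; first by rewrite !big_ord0 -[(0, 0)]/(0 : plane) pnorm0.
rewrite !big_ord_recr /=; set a := \sum_(i < n) _; set b := \sum_(i < n) _.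
have -> : (a + c n * (v n).1, b + c n * (v n).2) = (a, b) + c n *: v n :> plane by [].
by apply: (le_trans (pnormD p1 _ _)); rewrite pnormZ// lerD.
Qed.

Lemma Rint_sum d (T : measurableType d) (m : {measure set T -> \bar R}) n (f : nat -> T -> R) :
  (forall i, (i < n)%N -> intg m (f i)) ->
  intg m (fun x => \sum_(i < n) f i x) /\
  \int[m]_x (\sum_(i < n) f i x) = \sum_(i < n) \int[m]_x f i x.
Proof.
elim: n => [|n ih] H.
  have -> : (fun x => \sum_(i < 0) f i x) = (fun=> 0) by apply/funext => x; rewrite big_ord0.
  by split; [exact: integrable0|rewrite big_ord0 /Rintegral integral0].
have [i1 i2] := ih (fun i ni => H i (ltnW ni)).
have -> : (fun x => \sum_(i < n.+1) f i x) = (fun x => \sum_(i < n) f i x + f n x).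
  by apply/funext => x; rewrite big_ord_recr.
split; first by apply: intgD => //; exact: H.
by rewrite big_ord_recr /= RintD ?i2//; exact: H.
Qed.

Lemma sum_flux n (k : nat -> R) (s : nat -> plane) (z : plane) (d a : R) (N : nat -> R) :
  \sum_(i < n) k i * (a * N i - d * (z.1 * (s i).1 + z.2 * (s i).2)) =
  d * (z.1 * (\sum_(i < n) - k i * (s i).1) + z.2 * (\sum_(i < n) - k i * (s i).2)) +
  a * \sum_(i < n) k i * N i.
Proof.
elim: n => [|n ih]; first by rewrite !big_ord0; ring.
by rewrite !big_ord_recr /= ih; ring.
Qed.

Definition side_grad i : plane := ((edge i).2 / jac i, - (edge i).1 / jac i).

Lemma pnorm_side_grad i : (i < 5)%N -> pnorm p (side_grad i) = pnorm p (edge i) / jac i.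
Proof.
move=> i5; have J0 := polygon_jac adm i5.
have -> : side_grad i = (jac i)^-1 *: ((edge i).2, - (edge i).1) :> plane.
  by apply: injective_projections; rewrite /= /GRing.scale/= mulrC.
have E : pnorm p ((edge i).2, - (edge i).1) = pnorm p (edge i) by rewrite /pnorm /= normrN addrC.
rewrite (pnormZ p1) E ger0_norm; first exact: mulrC.
by rewrite invr_ge0 ltW.
Qed.

(** The cost, through side [i], of a mismatch [d] between [E] and a half plane calibrated by [z].
    Duality makes it nonnegative and bounds it by a multiple of [|d|]. *)
Definition side_flux (z : plane) (d : R) (i : nat) : R :=
  `|d| * pnorm p (side_grad i) - d * (z.1 * (side_grad i).1 + z.2 * (side_grad i).2).

Lemma side_flux_bounds n0 (d : R) i :
  0 <= side_flux (pdual p n0) d i <= 2 * pnorm p (side_grad i) * `|d|.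
Proof.
rewrite /side_flux; set z := pdual p n0; set g := side_grad i.
have h1 : dot z g <= pnorm p g by exact: pdual_dot_le.
have h2 : dot z (- g) <= pnorm p g.
  by apply: (le_trans (pdual_dot_le p1 _ _)); rewrite -scaleN1r pnormZ// normrN1 mul1r.
have h3 : dot z (- g) = - dot z g by rewrite /dot /=; ring.
rewrite h3 in h2; rewrite -/(dot z g).
move: (dot z g) (pnorm p g) h1 h2 => a N {h3} h1 h2.
have : `|d * a| <= `|d| * N by rewrite normrM ler_wpM2l// ler_norml h1 lerNl h2.
by rewrite ler_norml => /andP[h3 h4]; apply/andP; split; lra.
Qed.

Variables (Omega E : set plane) (mu : {finite_measure set mplane -> \bar R}) (n1 n2 : mplane -> R).
Hypothesis mE : measurable (E : set mplane).
Hypothesis md : minimal_data p Omega E mu n1 n2.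

(** The gradient of the cutoff is a combination of the vectors [- side_grad i] with nonnegative
    coefficients, and the triangle inequality splits the right-hand side of [half_plane_star] into
    one flux per side. *)
Lemma flux_bound (x0 : plane) (r h c0 : R) (n0 : plane)
    (z := pdual p n0) (H := [set x : plane | 0 < n0.1 * x.1 + n0.2 * x.2 + c0]) :
  0 < h -> 0 <= r ->
  [set x | forall i, (i < 5)%N -> gauge i (x - x0) <= r] `<=` Omega ->
  ((\int[mu]_x (\1_(pball P x0 (r - h)) x * (pnorm p (n1 x, n2 x) - (z.1 * n1 x + z.2 * n2 x)))%R)%:E <=
  \sum_(i < 5) \int[L2]_x (\1_(pball P x0 r) x * (side_weight r h (gauge i (x - x0)) *
     side_flux z (\1_E x - \1_H x) i))%:E)%E.
Proof.
move=> h0 r0 KO.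
have Ct := C1_cutoff P x0 r h 5; have st := cutoff_supp adm h0 KO.
have t01 := cutoff01 P x0 r h 5.
have [[i1 i2 _] _] := md.
set N := (fun x : mplane => pnorm p (n1 x, n2 x) - (z.1 * n1 x + z.2 * n2 x)).
have N0 x : 0 <= N x.
  by rewrite subr_ge0; exact: (pdual_dot_le p1 n0 (n1 x, n2 x)).
have iN : intg mu N.
  by apply: intgB; [exact: (intg_pnorm p1)|apply: intgD; exact: intgZ].
have star := half_plane_star p1 mE md c0 n0 Ct st t01; rewrite -/z -/H in star.
have mH : measurable (H : set mplane).
  apply: open_plane_measurable; rewrite /H.
  apply: (@open_comp _ _ (fun x : plane => n0.1 * x.1 + n0.2 * x.2 + c0) [set y | 0 < y]); last exact: open_gt.
  by move=> x _; exact: continuous_affine2.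
pose d (x : plane) : R := \1_E x - \1_H x.
have md' : measurable_fun [set: mplane] (d : mplane -> R).
  by apply: measurable_funB; exact: measurable_indic.
have d1 x : `|d x| <= 1 by exact: (norm_sub_unit (indic_bound E x) (indic_bound H x)).
pose f i (x : mplane) : R := \1_(pball P x0 r) x * (side_weight r h (gauge i (x - x0)) * side_flux z (d x) i).
have mf i : measurable_fun setT (f i).
  apply: measurable_funM; first by apply: measurable_indic; exact: measurable_pball.
  apply: (@measurable_funM _ _ _ _ (fun x : mplane => side_weight r h (gauge i (x - x0))) (fun x => side_flux z (d x) i)).
    exact: measurable_side_weight_gauge.
  by apply: measurable_funB; apply: measurable_funM => //; exact: measurableT_comp.
have f0 i x : 0 <= f i x.
  have b0 : 0 <= (\1_(pball P x0 r) x : R) by case/andP: (indic_bound (pball P x0 r) x).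
  have w0 := side_weight_ge0 r h0 (gauge i (x - x0)).
  have g0 : 0 <= side_flux z (d x) i by case/andP: (side_flux_bounds n0 (d x) i).
  exact: mulr_ge0 b0 (mulr_ge0 w0 g0).
have if_ i : intg L2 (f i).
  apply: (@intg_cbox _ _ x0 r (2 / h * (2 * pnorm p (side_grad i)))) => // x.
    rewrite ger0_norm// /f; have /andP[b0 b1] := indic_bound (pball P x0 r) x.
    have /andP[g0 g1] := side_flux_bounds n0 (d x) i; have w0 := side_weight_ge0 r h0 (gauge i (x - x0)).
    apply: (@le_trans _ _ (1 * (side_weight r h (gauge i (x - x0)) * side_flux z (d x) i))).
      by rewrite ler_wpM2r// mulr_ge0.
    rewrite mul1r; apply: ler_pM => //; first exact: side_weight_le.
    by apply: (le_trans g1); rewrite ler_piMr ?mulr_ge0 ?pnorm_ge0.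
  by move=> nx; rewrite /f indicE memNset ?mul0r// => /(pball_box adm r0).
have [iS ES] := Rint_sum (n := 5) (fun i _ => if_ i).
have -> : (\sum_(i < 5) \int[L2]_x (\1_(pball P x0 r) x * (side_weight r h (gauge i (x - x0)) *
     side_flux z (\1_E x - \1_H x) i))%:E = (\sum_(i < 5) \int[L2]_x f i x)%:E)%E.
  by rewrite -sumEFin; apply: eq_bigr => i _; exact: (Rint_EFin (if_ i)).
rewrite lee_fin.
have L1 : \int[mu]_x (\1_(pball P x0 (r - h)) x * N x)%R <= \int[mu]_x (cutoff P x0 r h 5 x * N x)%R.
  apply: Rint_le.
  - apply: (@intgM _ _ _ mu 1 _ (\1_(pball P x0 (r - h)) : mplane -> R)) iN.
      by apply: measurable_indic; exact: measurable_pball.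
    by move=> x; have /andP[? ?] := indic_bound (pball P x0 (r - h)) x; rewrite ger0_norm.
  - apply: (@intgM _ _ _ mu 1 _ (cutoff P x0 r h 5 : mplane -> R)) iN.
      by have [c _ _ _] := Ct; exact: continuous_plane_measurable.
    by move=> x; have /andP[? ?] := t01 x; rewrite ger0_norm.
  - move=> x; rewrite ler_wpM2r// indicE; case: (boolP (x \in _)) => [/set_mem hx|_].
      by rewrite cutoff_eq1.
    by have /andP[] := t01 x.
apply: (le_trans L1); apply: (le_trans star).
apply: (le_subst (erefl _) ES); apply: Rint_le => //.
- have [c cx cy _] := Ct; have [K [cK _ t0]] := st.
  have z0 x := C1_supp0 cK Ct t0 (x := x).
  have itx : intg L2 (fun x => 1 * (\sum_(i < 5) - ((edge i).2 / jac i) * cutoff_part P x0 r h 5 i x)).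
    by apply: (intg_cont_supp cK _ cx) => [|x /z0[]//]; exact: bmeas_cst.
  have ity : intg L2 (fun x => 1 * (\sum_(i < 5) - (- (edge i).1 / jac i) * cutoff_part P x0 r h 5 i x)).
    by apply: (intg_cont_supp cK _ cy) => [|x /z0[]//]; exact: bmeas_cst.
  have E1 (q : mplane -> R) : (fun x => 1 * q x) = q by apply/funext => x; rewrite mul1r.
  rewrite E1 in itx; rewrite E1 in ity.
  apply: intgD.
    by apply: (intgM md' d1); apply: intgD; exact: intgZ.
  apply: (@intgM _ _ _ L2 1 _ (fun x => `|d x|)); [exact: measurableT_comp|by move=> x; rewrite normr_id|].
  exact: (intg_pnorm p1).
move=> x; rewrite -/(d x).
pose k i := cutoff_part P x0 r h 5 i x.
have k0 (i : 'I_5) : 0 <= k i <= \1_(pball P x0 r) x * side_weight r h (gauge i (x - x0)).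
  by apply: cutoff_part_le => //; exact: ltn_ord.
have S1 : \sum_(i < 5) - ((edge i).2 / jac i) * cutoff_part P x0 r h 5 i x =
    \sum_(i < 5) (- k i) * (side_grad i).1.
  by apply: eq_bigr => i _; rewrite /side_grad/= /k mulrC; ring.
have S2 : \sum_(i < 5) - (- (edge i).1 / jac i) * cutoff_part P x0 r h 5 i x =
    \sum_(i < 5) (- k i) * (side_grad i).2.
  by apply: eq_bigr => i _; rewrite /side_grad/= /k mulrC; ring.
rewrite S1 S2.
have h1 := pnorm_sum 5 (fun i => - k i) side_grad.
apply: (@le_trans _ _ (\sum_(i < 5) k i * side_flux z (d x) i)); last first.
  apply: ler_sum => i _; rewrite /f mulrA ler_wpM2r//; first by case/andP: (side_flux_bounds n0 (d x) i).
  by case/andP: (k0 i).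
have -> : \sum_(i < 5) k i * side_flux z (d x) i =
  d x * (z.1 * (\sum_(i < 5) - k i * (side_grad i).1) + z.2 * (\sum_(i < 5) - k i * (side_grad i).2)) +
  `|d x| * \sum_(i < 5) `|- k i| * pnorm p (side_grad i).
  rewrite [LHS](sum_flux 5 k side_grad z (d x) `|d x| (fun i => pnorm p (side_grad i))).
  congr (_ + _ * _); apply: eq_bigr => i _; congr (_ * _).
  by rewrite normrN ger0_norm//; case/andP: (k0 i).
by rewrite lerD2l ler_wpM2l.
Qed.

End flux.

Lemma strip_arith1 (R : realFieldType) (B s x r : R) :
  B * s <= B * r -> B * s + 2 * (B * x) <= B * (r + 2 * x).
Proof. by move=> ?; nra. Qed.

Lemma strip_arith2 (R : realFieldType) (B x r : R) : 0 <= B * r -> 2 * (B * x) <= B * (r + 2 * x).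
Proof. by move=> ?; nra. Qed.

Lemma half_sum (R : realFieldType) (I S r C h e : R) :
  I + I <= S * (r + 2 * (C * h)) -> S * C * h <= S * C * e -> I <= 2^-1 * S * r + S * C * e.
Proof. by move=> ? ?; nra. Qed.

Lemma eq_le_tr d (T : porderType d) (a b c : T) : a = b -> (b <= c)%O -> (a <= c)%O.
Proof. by move=> ->. Qed.

Section nonneg_integrals.
Context d (T : measurableType d) (R : realType) (m : {measure set T -> \bar R}).
Implicit Types f g : T -> R.

Lemma nint_le f g : measurable_fun setT f -> measurable_fun setT g -> (forall x, 0 <= f x) ->
  (forall x, f x <= g x) -> (\int[m]_x (f x)%:E <= \int[m]_x (g x)%:E)%E.
Proof.
move=> mf mg f0 fg; apply: ge0_le_integral => //.
- by move=> x _; rewrite lee_fin.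
- exact/measurable_EFinP.
- exact/measurable_EFinP.
- by move=> x _; rewrite lee_fin.
Qed.

Lemma nintD f g : measurable_fun setT f -> measurable_fun setT g -> (forall x, 0 <= f x) ->
  (forall x, 0 <= g x) -> (\int[m]_x (f x + g x)%:E = \int[m]_x (f x)%:E + \int[m]_x (g x)%:E)%E.
Proof.
move=> mf mg f0 g0; under eq_integral do rewrite EFinD.
apply: ge0_integralD => //.
- by move=> x _; rewrite lee_fin.
- exact/measurable_EFinP.
- by move=> x _; rewrite lee_fin.
- exact/measurable_EFinP.
Qed.

Lemma nintZ (c : R) f : measurable_fun setT f -> (forall x, 0 <= f x) -> 0 <= c ->
  (\int[m]_x (c * f x)%:E = c%:E * \int[m]_x (f x)%:E)%E.
Proof.
move=> mf f0 c0; under eq_integral do rewrite EFinM.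
apply: ge0_integralZl_EFin => //.
- by move=> x _; rewrite lee_fin.
- exact/measurable_EFinP.
Qed.

End nonneg_integrals.

Section weight.
Context {R : realType}.
Local Notation leb := (@lebesgue_measure R).

Lemma measurable_dstep : measurable_fun [set: measurableTypeR R] (@dstep R).
Proof. by apply: continuous_measurable_fun; exact: continuous_dstep. Qed.

Lemma dstep_integral : (\int[leb]_s (dstep s)%:E = 1)%E.
Proof.
have ds (t : R) := is_derive_step t.
have cs : continuous (@step R : R^o -> R^o).
  by move=> t; apply: differentiable_continuous; apply/derivable1_diffP; have [] := ds t.
have := @continuous_FTC2 R dstep (@step R : R^o -> R^o) 0 1 ltr01.
have -> : step 0 = 0 :> R by apply: step_le0.
have -> : step 1 = 1 :> R by apply: step_ge1.
rewrite sube0 => <-.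
- rewrite [RHS]integral_mkcond; apply: eq_integral => s _; rewrite patchE.
  case: ifPn => // /negP hs; rewrite dstep_eq0//.
  have [s0|s0] := leP s 0; [by left|right]; rewrite leNgt; apply/negP => s1.
  by apply: hs; apply/mem_set; rewrite /= in_itv/= !ltW.
- by apply: continuous_subspaceT; exact: continuous_dstep.
- split.
  + by move=> x _; have [] := ds x.
  + by apply: cvg_at_right_filter; exact: cs.
  + by apply: cvg_at_left_filter; exact: cs.
- by move=> x _; rewrite derive1E; have [_ ->] := ds x.
Qed.

Lemma weight_integral (r h : R) : 0 < h -> (\int[leb]_s (side_weight r h s)%:E = 1)%E.
Proof.
move=> h0.
have E : (\int[leb]_s (side_weight r h s)%:E = \int[leb]_s ((h^-1)%:E * (dstep (- h^-1 * s + r / h))%:E))%E.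
  apply: eq_integral => s _; rewrite /side_weight -EFinM; congr (_%:E).
  by rewrite mulrC; congr (_ * dstep _); ring.
rewrite E.
have m1 : measurable_fun [set: measurableTypeR R] (fun s => dstep (- h^-1 * s + r / h)).
  apply: (measurableT_comp measurable_dstep); apply: measurable_funD => //; exact: measurable_funM.
rewrite ge0_integralZl_EFin//; last 3 first.
- by move=> s _; rewrite lee_fin dstep_ge0.
- exact/measurable_EFinP.
- by rewrite invr_ge0 ltW.
rewrite (@ge0_integral_affine1 _ (- h^-1) (r / h) (fun s => (dstep s)%:E)).
- rewrite dstep_integral mule1 -EFinM normrN normfV gtr0_norm// invrK mulVf//; exact: lt0r_neq0.
- by rewrite oppr_eq0 invr_eq0; exact: lt0r_neq0.
- by apply/measurable_EFinP; exact: measurable_dstep.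
- by move=> t; rewrite lee_fin dstep_ge0.
Qed.

End weight.

Section energy.
Context {R : realType} (p : R) (P : nat -> R * R).
Hypothesis p1 : 1 < p.
Local Notation plane := (R * R)%type.
Local Notation mplane := (measurableTypeR R * measurableTypeR R)%type.
Local Notation leb := (@lebesgue_measure R).
Local Notation L2 := (@lebesgue2 R).
Hypothesis adm : admissible_polygon P p.
Local Notation gauge := (pgauge P).
Local Notation edge := (pedge P).
Local Notation jac := (pjac P).
Variables (Omega E : set plane) (mu : {finite_measure set mplane -> \bar R}) (n1 n2 : mplane -> R).
Hypothesis mE : measurable (E : set mplane).
Hypothesis md : minimal_data p Omega E mu n1 n2.

Lemma strip_const : exists2 C : R, 0 < C & forall i (x0 : plane) (r h B : R),
  (i < 5)%N -> 0 < h -> 0 <= r -> 0 <= B ->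
  (\int[L2]_x (\1_(pball P x0 r) x * (side_weight r h (gauge i (x - x0)) * B))%:E <=
   (jac i * (B * (r + 2 * (C * h))))%:E)%E.
Proof.
have [C C0 HC] := strip_integral adm; exists C => // i x0 r h B i5 h0 r0 B0.
have J0 := polygon_jac adm i5.
have wz s : s <= r - h -> side_weight r h s = 0 by move=> hs; apply: side_weight_eq0 => //; left.
have cB (x : mplane) : 0 <= B <= B by rewrite B0 lexx.
have := HC i x0 r h B (side_weight r h) (fun=> B) i5 h0 B0 (measurable_side_weight r h)
  (side_weight_ge0 r h0) wz (measurable_cst B) cB.
move=> /le_trans; apply.
rewrite [leRHS]EFinM lee_pmul2l// -[leRHS]mule1 -(weight_integral r h0).
rewrite -ge0_integralZl_EFin//; last 3 first.
- by move=> s _; rewrite lee_fin side_weight_ge0.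
- by apply/measurable_EFinP; exact: measurable_side_weight.
- by rewrite mulr_ge0// addr_ge0// !mulr_ge0// ltW.
have Ch : 0 <= 2 * (B * (C * h)) by rewrite !mulr_ge0// ltW.
have inner (s : R) : 0 <= s -> (\int[leb]_y (\1_(`]0%R, s[%classic : set (measurableTypeR R)) y * B)%:E = (B * s)%:E)%E.
  move=> s0; under eq_integral do rewrite mulrC.
  have mi : measurable (`]0, s[%classic : set (measurableTypeR R)) by exact: measurable_itv.
  have i0 (y : measurableTypeR R) : 0 <= (\1_(`]0, s[%classic : set (measurableTypeR R)) y : R) by rewrite indicE.
  rewrite (nintZ leb (measurable_indic mi) i0 B0).
  rewrite integral_indic// setIT EFinM; congr (_ * _)%E.
  rewrite [LHS]lebesgue_measure_itv/= lte_fin; case: ifPn => [_|]; first by rewrite sube0.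
  by rewrite -leNgt => s0'; congr EFin; apply/eqP; rewrite eq_le s0 s0'.
have mw := measurable_side_weight r h.
apply: ge0_le_integral => //.
- move=> s _; rewrite mule_ge0 ?lee_fin ?side_weight_ge0// adde_ge0 ?lee_fin//.
  by apply: integral_ge0 => y _; rewrite lee_fin mulr_ge0// indicE; case: (_ \in _).
- apply: emeasurable_funM; first exact/measurable_EFinP.
  apply: emeasurable_funD; last exact: measurable_cst.
  have mT : measurable ([set z | 0 < z.2 /\ z.2 < z.1] : set mplane).
    apply: open_plane_measurable.
    have -> : [set z : plane | 0 < z.2 /\ z.2 < z.1] = [set z | 0 < z.2] `&` [set z | z.2 - z.1 < 0].
      by apply/seteqP; split => z /= []; rewrite subr_lt0.
    apply: openI.
      apply: (@open_comp _ _ (fun z : plane => z.2) [set y | 0 < y]); last exact: open_gt.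
      by move=> z _; exact: cvg_snd.
    apply: (@open_comp _ _ (fun z : plane => z.2 - z.1) [set y | y < 0]); last exact: open_lt.
    by move=> z _; apply: cvgB; [exact: cvg_snd|exact: cvg_fst].
  have -> : (fun s : R => \int[leb]_y (\1_(`]0%R, s[%classic : set (measurableTypeR R)) y * B)%:E)%E =
     (fun s : R => \int[leb]_y (fun z : mplane => (\1_([set z | 0 < z.2 /\ z.2 < z.1] : set mplane) z * B)%:E) (s, y))%E.
    apply/funext => s; apply: eq_integral => y _; congr ((_ * _)%:E); rewrite !indicE; congr ((nat_of_bool _)%:R).
    by apply/idP/idP => [/set_mem|/set_mem /= [a b]]; rewrite ?/= ?in_itv/=; [move=> /andP[a b]|]; apply/mem_set; rewrite /= ?in_itv/= ?a ?b.
  apply: (@measurable_inner _ (fun z : mplane => (\1_([set z | 0 < z.2 /\ z.2 < z.1] : set mplane) z * B)%:E)).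
    by apply/measurable_EFinP; apply: measurable_funM => //; exact: measurable_indic.
  by move=> z; rewrite lee_fin mulr_ge0// indicE; case: (_ \in _).
- by apply: emeasurable_funM => //; exact/measurable_EFinP.
move=> s _; rewrite muleC; have [rs|sr] := leP r s.
  by rewrite side_weight_eq0 ?mule0//; right.
have [s0|s0] := leP 0 s.
  rewrite inner// -EFinD -!EFinM lee_fin ler_wpM2r ?side_weight_ge0//.
  have h1 : B * s <= B * r by rewrite ler_wpM2l// ltW.
  exact: strip_arith1.
have -> : (\int[leb]_y (\1_(`]0%R, s[%classic : set (measurableTypeR R)) y * B)%:E = 0)%E.
  apply: integral0_eq => y _; rewrite indicE memNset ?mul0r//= in_itv/= => /andP[a b].
  by have := lt_trans (lt_trans a b) s0; rewrite ltxx.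
rewrite add0e -!EFinM lee_fin ler_wpM2r ?side_weight_ge0//.
exact: (strip_arith2 _ (mulr_ge0 B0 r0)).
Qed.

(** For [n0 = 0] the half plane is the whole plane if [c0 = 1] and empty if [c0 = 0]. The two
    mismatches [|u - 1|] and [|u|] add up to 1, so the sum of the two flux bounds is the perimeter
    up to corner errors; half of it bounds the energy. *)
Lemma energy_bound (x0 : plane) (r r' : R) : 0 < r -> r' < r ->
  [set x | forall i, (i < 5)%N -> gauge i (x - x0) <= r] `<=` Omega ->
  \int[mu]_x (\1_(pball P x0 r') x * pnorm p (n1 x, n2 x))%R <=
    2^-1 * (\sum_(i < 5) pnorm p (edge i)) * r.
Proof.
move=> r0 rr KO; have [C C0 HC] := strip_const.
have [[i1 i2 _] _] := md.
have iN : intg mu (fun x => pnorm p (n1 x, n2 x)) by exact: (intg_pnorm p1).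
set S := \sum_(i < 5) _.
have S0 : 0 <= S by apply: sumr_ge0 => i _; exact: pnorm_ge0.
apply: (@eps_le _ _ _ (S * C)); first by rewrite mulr_ge0// ltW.
move=> e e0; pose h := Num.min e (r - r').
have h0 : 0 < h by rewrite lt_min e0 subr_gt0.
have he : h <= e by rewrite ge_min lexx.
have hr : h <= r - r' by rewrite ge_min lexx orbT.
have F1 := flux_bound p1 adm mE md 1 (0, 0) h0 (ltW r0) KO.
have F0 := flux_bound p1 adm mE md 0 (0, 0) h0 (ltW r0) KO.
have z0 : pdual p (0, 0) = 0 by exact: pdual0.
pose I := \int[mu]_x (\1_(pball P x0 (r - h)) x * pnorm p (n1 x, n2 x))%R.
have mi : measurable_fun setT (\1_(pball P x0 (r - h)) : mplane -> R).
  by apply: measurable_indic; exact: measurable_pball.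
have mi' : measurable_fun setT (\1_(pball P x0 r') : mplane -> R).
  by apply: measurable_indic; exact: measurable_pball.
have b1 (A : set plane) x : `|\1_A x : R| <= 1.
  by have /andP[? ?] := indic_bound A x; rewrite ger0_norm.
have L1 : \int[mu]_x (\1_(pball P x0 r') x * pnorm p (n1 x, n2 x))%R <= I.
  apply: Rint_le; [exact: (intgM mi' (b1 _) iN)|exact: (intgM mi (b1 _) iN)|].
  move=> x; rewrite ler_wpM2r ?pnorm_ge0// !indicE.
  case: (boolP (x \in pball P x0 r')) => [/set_mem hx|_]; last by rewrite ler0n.
  by rewrite mem_set//; apply: subset_pball hx; lra.
have EI : \int[mu]_x (\1_(pball P x0 (r - h)) x * (pnorm p (n1 x, n2 x) -
    ((pdual p (0, 0)).1 * n1 x + (pdual p (0, 0)).2 * n2 x)))%R = I.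
  by apply: eq_Rintegral => x _; rewrite z0 /= !mul0r addr0 subr0.
have {}F1 := eq_le_tr (congr1 EFin (esym EI)) F1.
have {}F0 := eq_le_tr (congr1 EFin (esym EI)) F0.
have Hs : (I%:E + I%:E <= (\sum_(i < 5) pnorm p (edge i) * (r + 2 * (C * h)))%:E)%E.
  apply: (le_trans (leeD F1 F0)); rewrite -big_split/= -sumEFin; apply: lee_sum => i _.
  have i5 := ltn_ord i; have J0 := polygon_jac adm i5.
  have G0 := pnorm_ge0 p (side_grad P i).
  have := HC i x0 r h _ i5 h0 (ltW r0) G0.
  rewrite mulrA (pnorm_side_grad p1 adm i5) [jac i * _]mulrC divfK ?lt0r_neq0// => /(le_trans _); apply.
  set A := side_weight r h.
  have side0 c i' : side_flux p P (pdual p (0, 0)) c i' = `|c| * pnorm p (side_grad P i').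
    by rewrite /side_flux z0 /= !mul0r addr0 mulr0 subr0.
  have mf (c : mplane -> R) : measurable_fun setT c -> measurable_fun setT (fun x : mplane => \1_(pball P x0 r) x * (A (gauge i (x - x0)) * side_flux p P (pdual p (0, 0)) (c x) i)).
    move=> mc; under eq_fun do rewrite side0; apply: measurable_funM.
      by apply: measurable_indic; exact: measurable_pball.
    apply: (@measurable_funM _ _ _ _ (fun x : mplane => A (gauge i (x - x0))) (fun x => `|c x| * pnorm p (side_grad P i))).
      exact: measurable_side_weight_gauge.
    by apply: measurable_funM => //; exact: measurableT_comp.
  have f0 c x : 0 <= \1_(pball P x0 r) x * (A (gauge i (x - x0)) * side_flux p P (pdual p (0, 0)) c i).
    rewrite side0; apply: mulr_ge0; first by case/andP: (indic_bound (pball P x0 r) x).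
    by apply: mulr_ge0; [exact: side_weight_ge0|rewrite mulr_ge0].
  have mI (c0 : R) : measurable_fun setT ((fun x => \1_E x - \1_([set x : plane | 0 < ((0, 0) : plane).1 * x.1 + ((0, 0) : plane).2 * x.2 + c0]) x) : mplane -> R).
    apply: measurable_funB; first exact: measurable_indic.
    apply: measurable_indic; apply: open_plane_measurable.
    apply: (@open_comp _ _ (fun x : plane => 0 * x.1 + 0 * x.2 + c0) [set y | 0 < y]); last exact: open_gt.
    by move=> x _; exact: continuous_affine2.
  rewrite -(nintD L2 (mf _ (mI 1)) (mf _ (mI 0)) (fun x => f0 _ x) (fun x => f0 _ x)).
  rewrite le_eqVlt; apply/orP; left; apply/eqP; apply: eq_integral => x _.
  rewrite -mulrDr -mulrDr !side0 -mulrDl -(pnorm_side_grad p1 adm i5); congr ((_ * (_ * _))%:E).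
  have -> : \1_[set x : plane | 0 < ((0, 0) : plane).1 * x.1 + ((0, 0) : plane).2 * x.2 + 1] x = 1 :> R.
    by rewrite indicE mem_set//= !mul0r !add0r ltr01.
  have -> : \1_[set x : plane | 0 < ((0, 0) : plane).1 * x.1 + ((0, 0) : plane).2 * x.2 + 0] x = 0 :> R.
    by rewrite indicE memNset//= !mul0r !add0r ltxx.
  by rewrite indicE; case: (_ \in _); rewrite /= ?subrr ?sub0r ?subr0 ?normr0 ?normrN1 ?normr1 ?add0r ?addr0 ?mul1r.
move: Hs; rewrite -EFinD lee_fin -mulr_suml -/S => Hs.
apply: (le_trans L1).
have Sh : S * C * h <= S * C * e by rewrite ler_wpM2l// mulr_ge0// ltW.
exact: half_sum Hs Sh.
Qed.

End energy.

(** * Dyadic averages and traces from inside *)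

Section averages.
Context {R : realType}.
Local Notation plane := (R * R)%type.
Local Notation mplane := (measurableTypeR R * measurableTypeR R)%type.
Local Notation leb := (@lebesgue_measure R).
Local Notation L2 := (@lebesgue2 R).

(** Dyadic scales of total sum 1, in the form expected by [epsilon_trick0]. *)
Definition hk (k : nat) : R := ((2 ^ k.+1)%:R)^-1.

Lemma hk_gt0 k : 0 < hk k. Proof. by rewrite invr_gt0 ltr0n expn_gt0. Qed.

Lemma hk_small (e : R) : 0 < e -> \forall k \near \oo, hk k < e.
Proof.
move=> e0; near=> k; rewrite /hk invf_plt ?posrE ?ltr0n ?expn_gt0//.
apply: (@lt_trans _ _ k%:R); first by near: k; exact: nbhs_infty_gtr.
rewrite ltr_nat; exact: (ltn_trans (ltnSn k) (ltn_expl k.+1 (ltnSn 1))).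
Unshelve. all: by end_near. Qed.

Definition avg (k : nat) (g : R -> R) : \bar R :=
  (\int[leb]_t ((hk k)^-1 * (\1_(`]0%R, hk k[%classic : set (measurableTypeR R)) t * g t))%:E)%E.

Lemma indic_itv01 (X : set (measurableTypeR R)) t : 0 <= (\1_X t : R) <= 1.
Proof. by rewrite indicE; case: (_ \in _); rewrite /= ?lexx ?ler01. Qed.

Lemma measurable_avg_fun k (g : R -> R) : measurable_fun [set: measurableTypeR R] g ->
  measurable_fun [set: measurableTypeR R]
    (fun t => (hk k)^-1 * (\1_(`]0%R, hk k[%classic : set (measurableTypeR R)) t * g t)).
Proof.
by move=> mg; apply: measurable_funM => //; apply: measurable_funM.
Qed.

Lemma avg_fun_ge0 k (g : R -> R) t : 0 <= g t ->
  0 <= (hk k)^-1 * (\1_(`]0%R, hk k[%classic : set (measurableTypeR R)) t * g t).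
Proof.
move=> g0; apply: mulr_ge0; first by rewrite invr_ge0 ltW// hk_gt0.
by apply: mulr_ge0 => //; case/andP: (indic_itv01 (`]0%R, hk k[%classic) t).
Qed.

Lemma avg_ge0 k (g : R -> R) : (forall t, 0 <= g t) -> (0 <= avg k g)%E.
Proof. by move=> g0; apply: integral_ge0 => t _; rewrite lee_fin; exact: avg_fun_ge0. Qed.

Lemma avg_le k (g g' : R -> R) : measurable_fun [set: measurableTypeR R] g ->
  measurable_fun [set: measurableTypeR R] g' -> (forall t, 0 <= g t) ->
  (forall t, 0 < t < hk k -> g t <= g' t) -> (avg k g <= avg k g')%E.
Proof.
move=> mg mg' g0 gg; apply: nint_le; try exact: measurable_avg_fun.
  by move=> t; exact: avg_fun_ge0.
move=> t; rewrite ler_wpM2l// ?invr_ge0 ?(ltW (hk_gt0 k))// indicE.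
case: (boolP (t \in _)) => [/set_mem /=|_]; last by rewrite !mul0r.
by rewrite in_itv/= => /gg; rewrite !mul1r.
Qed.

Lemma avgD k (g g' : R -> R) : measurable_fun [set: measurableTypeR R] g ->
  measurable_fun [set: measurableTypeR R] g' -> (forall t, 0 <= g t) -> (forall t, 0 <= g' t) ->
  (avg k (fun t => g t + g' t)%R = avg k g + avg k g')%E.
Proof.
move=> mg mg' g0 g0'; rewrite /avg -nintD; try exact: measurable_avg_fun.
- by apply: eq_integral => t _; rewrite !mulrDr.
- by move=> t; exact: avg_fun_ge0.
- by move=> t; exact: avg_fun_ge0.
Qed.

Lemma avg_cst k (c : R) : 0 <= c -> avg k (fun=> c) = c%:E.
Proof.
move=> c0; rewrite /avg.
have mi : measurable (`]0%R, hk k[%classic : set (measurableTypeR R)) by exact: measurable_itv.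
have E : (\int[leb]_t ((hk k)^-1 * (\1_(`]0%R, hk k[%classic : set (measurableTypeR R)) t * c))%:E =
   \int[leb]_t (((hk k)^-1 * c) * \1_(`]0%R, hk k[%classic : set (measurableTypeR R)) t)%:E)%E.
  by apply: eq_integral => t _; congr EFin; ring.
rewrite E (nintZ leb (measurable_indic mi)); last 2 first.
- by move=> t; case/andP: (indic_itv01 (`]0%R, hk k[%classic) t).
- by rewrite mulr_ge0// invr_ge0 ltW// hk_gt0.
rewrite integral_indic// setIT.
have L : leb (`]0%R, hk k[%classic : set (measurableTypeR R)) = (hk k)%:E.
  by rewrite [LHS]lebesgue_measure_itv/= lte_fin hk_gt0 sube0.
apply: (etrans (congr1 (fun v => ((hk k)^-1 * c)%:E * v)%E L)).
by rewrite -EFinM; congr EFin; rewrite mulrAC mulVf ?mul1r// lt0r_neq0// hk_gt0.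
Qed.

End averages.

Section flux_limit.
Context {R : realType} (p : R) (P : nat -> R * R).
Hypothesis p1 : 1 < p.
Local Notation plane := (R * R)%type.
Local Notation mplane := (measurableTypeR R * measurableTypeR R)%type.
Local Notation leb := (@lebesgue_measure R).
Local Notation L2 := (@lebesgue2 R).
Hypothesis adm : admissible_polygon P p.
Local Notation gauge := (pgauge P).
Local Notation edge := (pedge P).
Local Notation jac := (pjac P).
Variables (Omega E : set plane) (mu : {finite_measure set mplane -> \bar R}) (n1 n2 : mplane -> R).
Hypothesis mE : measurable (E : set mplane).
Hypothesis md : minimal_data p Omega E mu n1 n2.

Definition halfplane (n0 : plane) (c0 : R) : set plane :=
  [set x : plane | 0 < n0.1 * x.1 + n0.2 * x.2 + c0].

Lemma measurable_halfplane n0 c0 : measurable (halfplane n0 c0 : set mplane).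
Proof.
apply: open_plane_measurable; rewrite /halfplane.
apply: (@open_comp _ _ (fun x : plane => n0.1 * x.1 + n0.2 * x.2 + c0) [set y | 0 < y]); last exact: open_gt.
by move=> x _; exact: continuous_affine2.
Qed.

(** The mean of [|d|] over the inner strip of width [hk k] along side [i]. Its convergence to 0 says
    that [d] has trace 0 on the side, seen from inside. *)
Definition trace_gap (x0 : plane) (r : R) (i k : nat) (d : plane -> R) : \bar R :=
  (\int[leb]_y avg k (fun t => \1_(`]0%R, r[%classic : set (measurableTypeR R)) y *
     `|d (aff x0 (P i) (edge i) (r - t) y)|)%R)%E.

(** The weight is at most [2 / hk k], twice the uniform density of the strip, and [F] is at most
    [2 * G * |d|]; hence the constant [4 * G]. The other term comes from the corners. *)
Lemma strip_trace : exists2 C : R, 0 < C & forall i (x0 : plane) (r G : R) (k : nat)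
    (d F : mplane -> R), (i < 5)%N -> 0 <= G ->
  measurable_fun setT d -> (forall x, `|d x| <= 1) ->
  measurable_fun setT F -> (forall x, 0 <= F x <= 2 * G * `|d x|) ->
  (\int[L2]_x (\1_(pball P x0 r) x * (side_weight r (hk k) (gauge i (x - x0)) * F x))%:E <=
   (jac i)%:E * ((4 * G)%:E * trace_gap x0 r i k d + (4 * G * C * hk k)%:E))%E.
Proof.
have [C C0 HC] := strip_integral adm; exists C => //.
move=> i x0 r G k d F i5 G0 md' d1 mF FB; set h := hk k; have h0 : 0 < h by exact: hk_gt0.
have J0 := polygon_jac adm i5.
have wz s : s <= r - h -> side_weight r h s = 0 by move=> hs; apply: side_weight_eq0 => //; left.
have F2 x : 0 <= F x <= 2 * G.
  have /andP[f0 f1] := FB x; rewrite f0/=; apply: (le_trans f1).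
  by rewrite ler_piMr// mulr_ge0.
have G2 : 0 <= 2 * G by rewrite mulr_ge0.
have := HC i x0 r h (2 * G) (side_weight r h) F i5 h0 G2 (measurable_side_weight r h)
  (side_weight_ge0 r h0) wz mF F2.
move=> /le_trans; apply; rewrite lee_pmul2l//.
have mw := measurable_side_weight r h.
pose I s := (\int[leb]_y (\1_(`]0%R, s[%classic : set (measurableTypeR R)) y * F (aff x0 (P i) (edge i) s y))%:E)%E.
have F0 x : 0 <= F x by case/andP: (FB x).
have ind0 (X : set (measurableTypeR R)) t : 0 <= (\1_X t : R) by case/andP: (indic_itv01 X t).
have I0 s : (0 <= I s)%E by apply: integral_ge0 => y _; rewrite lee_fin mulr_ge0.
have mtri : measurable ([set z | 0 < z.2 /\ z.2 < z.1] : set mplane).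
  apply: open_plane_measurable.
  have -> : [set z : plane | 0 < z.2 /\ z.2 < z.1] = [set z | 0 < z.2] `&` [set z | z.2 - z.1 < 0].
    by apply/seteqP; split => z /= []; rewrite subr_lt0.
  apply: openI.
    apply: (@open_comp _ _ (fun z : plane => z.2) [set y | 0 < y]); last exact: open_gt.
    by move=> z _; exact: cvg_snd.
  apply: (@open_comp _ _ (fun z : plane => z.2 - z.1) [set y | y < 0]); last exact: open_lt.
  by move=> z _; apply: cvgB; [exact: cvg_snd|exact: cvg_fst].
have triE s y : \1_(`]0%R, s[%classic : set (measurableTypeR R)) y =
    \1_([set z | 0 < z.2 /\ z.2 < z.1] : set mplane) (s, y) :> R.
  rewrite !indicE; congr ((nat_of_bool _)%:R).
  by apply/idP/idP => [/set_mem|/set_mem /= [a b]]; rewrite ?/= ?in_itv/=; [move=> /andP[a b]|]; apply/mem_set; rewrite /= ?in_itv/= ?a ?b.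
have mFa : measurable_fun [set: mplane] (fun z : mplane => F (aff x0 (P i) (edge i) z.1 z.2)).
  by apply: (measurableT_comp mF); exact: measurable_aff.
have mda : measurable_fun [set: mplane] (fun z : mplane => `|d (aff x0 (P i) (edge i) z.1 z.2)|).
  by apply: measurableT_comp => //; apply: (measurableT_comp md'); exact: measurable_aff.
pose f1 (z : mplane) : R := \1_([set z | 0 < z.2 /\ z.2 < z.1] : set mplane) z * F (aff x0 (P i) (edge i) z.1 z.2).
have mf1 : measurable_fun setT f1 by apply: measurable_funM => //; exact: measurable_indic.
have f10 z : 0 <= f1 z by rewrite mulr_ge0//; case/andP: (indic_bound ([set z : plane | 0 < z.2 /\ z.2 < z.1]) z).
have IE s : I s = (\int[leb]_y (f1 (s, y))%:E)%E.
  by apply: eq_integral => y _; rewrite triE.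
have mI : measurable_fun [set: measurableTypeR R] I.
  have -> : I = (fun s => \int[leb]_y (f1 (s, y))%:E)%E by apply/funext => s; exact: IE.
  by apply: (@measurable_inner _ (fun z => (f1 z)%:E)) => [|z]; [exact/measurable_EFinP|rewrite lee_fin].
have c0 : 0 <= 2 * (2 * G * (C * h)) by rewrite !mulr_ge0// ltW.
have -> : (\int[leb]_s ((side_weight r h s)%:E * (I s + (2 * (2 * G * (C * h)))%:E)) =
    \int[leb]_s ((side_weight r h s)%:E * I s) + (4 * G * C * h)%:E)%E.
  have EE : (\int[leb]_s ((side_weight r h s)%:E * (I s + (2 * (2 * G * (C * h)))%:E)) =
    \int[leb]_s ((side_weight r h s)%:E * I s + (2 * (2 * G * (C * h)) * side_weight r h s)%:E))%E.
    by apply: eq_integral => s _; rewrite ge0_muleDr ?lee_fin// EFinM [X in (_ + X)%E]muleC.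
  have s0 s : 0 <= side_weight r h s := side_weight_ge0 r h0 s.
  have mwI : measurable_fun [set: measurableTypeR R] (fun s => (side_weight r h s)%:E * I s)%E.
    by apply: emeasurable_funM => //; exact/measurable_EFinP.
  rewrite EE ge0_integralD//; last 3 first.
  - by move=> s _; rewrite mule_ge0 ?lee_fin.
  - by move=> s _; rewrite lee_fin mulr_ge0.
  - by apply/measurable_EFinP; apply: measurable_funM.
  congr (_ + _)%E; rewrite (nintZ leb mw s0 c0) weight_integral// mule1; congr EFin; ring.
rewrite leeD2r//.
pose Phi (z : mplane) : R := h^-1 * (\1_(`]r - h, r[%classic : set (measurableTypeR R)) z.1 *
   (\1_(`]0%R, r[%classic : set (measurableTypeR R)) z.2 * `|d (aff x0 (P i) (edge i) z.1 z.2)|)).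
have mi (a b : R) : measurable_fun [set: measurableTypeR R] (\1_(`]a, b[%classic : set (measurableTypeR R)) : _ -> R).
  by apply: measurable_indic; exact: measurable_itv.
have mPhi : measurable_fun setT Phi.
  apply: measurable_funM => //; apply: measurable_funM.
    exact: (measurableT_comp (mi _ _) measurable_fst).
  by apply: measurable_funM => //; exact: (measurableT_comp (mi _ _) measurable_snd).
have Phi0 z : 0 <= Phi z.
  by rewrite mulr_ge0 ?invr_ge0 ?(ltW h0)// mulr_ge0 ?mulr_ge0.
(* Fubini and the substitution [s = r - t] write the gap in the coordinates of the side. *)
have TE : (trace_gap x0 r i k d = \int[leb]_s \int[leb]_y (Phi (s, y))%:E)%E.
  have mPE : measurable_fun setT (fun z => (Phi z)%:E) by exact/measurable_EFinP.
  have PE0 z : (0 <= (Phi z)%:E)%E by rewrite lee_fin.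
  rewrite (@fubini_tonelli _ _ _ _ _ leb leb (fun z => (Phi z)%:E) mPE PE0).
  apply: eq_integral => y _.
  have m2 : measurable_fun [set: measurableTypeR R] (fun s => (Phi (s, y))%:E).
    apply: (measurableT_comp mPE); exact: measurable_pair_plane.
  have nz1 : (-1 : R) != 0 by rewrite oppr_eq0 oner_eq0.
  have A := @ge0_integral_affine1 _ (-1) r (fun s => (Phi (s, y))%:E) nz1 m2 (fun s => PE0 (s, y)).
  rewrite normrN1 invr1 mul1e in A; rewrite -A.
  apply: eq_integral => t _; congr EFin; rewrite /Phi /=.
  have -> : -1 * t + r = r - t by ring.
  congr (_ * (_ * _)); rewrite !indicE; congr ((nat_of_bool _)%:R).
  have E1 : (t \in (`]0%R, hk k[%classic : set (measurableTypeR R))) = (0 < t < h).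
    by apply/idP/idP => [/set_mem|h1]; [|apply/mem_set]; rewrite /= in_itv.
  have E2 : (r - t \in (`]r - h, r[%classic : set (measurableTypeR R))) = (0 < t < h).
    apply/idP/idP => [/set_mem|h1]; [|apply/mem_set]; rewrite /= in_itv/=.
      by rewrite ltrD2l ltrN2 gtrBl andbC.
    by rewrite ltrD2l ltrN2 gtrBl andbC.
  by rewrite E1 E2.
have G4 : 0 <= 4 * G by rewrite mulr_ge0.
have mPin : measurable_fun [set: measurableTypeR R] (fun s => \int[leb]_y (Phi (s, y))%:E)%E.
  by apply: (@measurable_inner _ (fun z => (Phi z)%:E)) => [|z]; [exact/measurable_EFinP|rewrite lee_fin].
have Pin0 s : (0 <= \int[leb]_y (Phi (s, y))%:E)%E by apply: integral_ge0 => y _; rewrite lee_fin.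
rewrite TE -(ge0_integralZl_EFin leb measurableT (fun s _ => Pin0 s) mPin G4).
have mw' : measurable_fun [set: measurableTypeR R] (fun s => (side_weight r h s)%:E) by exact/measurable_EFinP.
apply: (@ge0_le_integral _ _ _ leb _ measurableT).
- by move=> s _; apply: mule_ge0; [rewrite lee_fin; exact: side_weight_ge0|exact: I0].
- exact: (emeasurable_funM mw' mI).
- by apply: emeasurable_funM; [exact: measurable_cst|exact: mPin].
move=> s _.
have mf1s : measurable_fun [set: measurableTypeR R] (fun y => f1 (s, y)).
  by apply: (measurableT_comp mf1); exact: measurable_pair_plane.
have mPs : measurable_fun [set: measurableTypeR R] (fun y => Phi (s, y)).
  by apply: (measurableT_comp mPhi); exact: measurable_pair_plane.
rewrite IE -(nintZ leb mf1s (fun y => f10 _) (side_weight_ge0 r h0 s)) -(nintZ leb mPs (fun y => Phi0 _) G4).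
apply: nint_le.
- by apply: measurable_funM.
- by apply: measurable_funM.
- by move=> y; exact: (mulr_ge0 (side_weight_ge0 r h0 s) (f10 (s, y))).
move=> y; rewrite /f1 -triE /Phi /=.
have [sr|sr] := leP s (r - h); first by rewrite (wz _ sr) mul0r; exact: (mulr_ge0 G4 (Phi0 (s, y))).
have [rs|rs] := leP r s.
  have w0 : side_weight r h s = 0 by exact: (side_weight_eq0 h0 (or_intror rs)).
  by rewrite w0 mul0r; exact: (mulr_ge0 G4 (Phi0 (s, y))).
have -> : \1_(`]r - h, r[%classic : set (measurableTypeR R)) s = 1 :> R.
  by clear - sr rs; rewrite indicE mem_set//= in_itv/= sr rs.
rewrite mul1r.
rewrite indicE; case: (boolP (y \in _)) => [/set_mem /=|_]; last first.
  by rewrite mul0r mulr0 mulr_ge0// mulr_ge0 ?invr_ge0 ?(ltW h0)// mulr_ge0.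
rewrite in_itv/= => /andP[y0 ys]; rewrite mul1r.
have -> : \1_(`]0%R, r[%classic : set (measurableTypeR R)) y = 1 :> R.
  by clear - y0 ys rs; rewrite indicE mem_set//= in_itv/= y0 (lt_trans ys).
rewrite mul1r; set q := aff _ _ _ _ _.
have /andP[_ hF] := FB q; have := ler_pM (side_weight_ge0 r h0 s) (F0 q) (side_weight_le r h0 s) hF.
by move=> /le_trans; apply; rewrite le_eqVlt; apply/orP; left; apply/eqP; ring.
Qed.

(** Cutoffs of width [hk k] are used: each of the five fluxes is either identically 0 or controlled
    by a trace gap tending to 0, while the left-hand side only increases with the inner polygon. *)
Lemma flux_vanish (x0 : plane) (r r' : R) (n0 : plane) (c0 : R) : 0 < r -> r' < r ->
  [set x | forall i, (i < 5)%N -> gauge i (x - x0) <= r] `<=` Omega ->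
  (forall i, (i < 5)%N ->
    (forall x, pball P x0 r x -> side_flux p P (pdual p n0) (\1_E x - \1_(halfplane n0 c0) x) i = 0) \/
    (forall e : R, 0 < e -> \forall k \near \oo,
       (trace_gap x0 r i k (fun x => \1_E x - \1_(halfplane n0 c0) x)%R < e%:E)%E)) ->
  \int[mu]_x (\1_(pball P x0 r') x * (pnorm p (n1 x, n2 x) -
     ((pdual p n0).1 * n1 x + (pdual p n0).2 * n2 x)))%R <= 0.
Proof.
move=> r0 rr KO side; have [C C0 HC] := strip_trace.
have [[i1 i2 _] _] := md.
set z := pdual p n0 in side *.
pose d (x : mplane) : R := \1_E x - \1_(halfplane n0 c0) x.
have mdd : measurable_fun setT d.
  by apply: measurable_funB; apply: measurable_indic => //; exact: measurable_halfplane.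
have d1 x : `|d x| <= 1 by exact: (norm_sub_unit (indic_bound E x) (indic_bound (halfplane n0 c0) x)).
pose T i k := (\int[L2]_x (\1_(pball P x0 r) x * (side_weight r (hk k) (gauge i (x - x0)) *
     side_flux p P z (d x) i))%:E)%E.
have TS i : (i < 5)%N -> forall e : R, 0 < e -> \forall k \near \oo, (T i k <= e%:E)%E.
  move=> i5 e e0; have J0 := polygon_jac adm i5; case: (side i i5) => [sz|tg].
    apply: nearW => k; rewrite /T integral0_eq ?lee_fin ?ltW// => x _.
    rewrite indicE; case: (boolP (x \in _)) => [/set_mem hx|_]; last by rewrite mul0r.
    by rewrite /d sz// !mulr0.
  set G := pnorm p (side_grad P i); have G0 : 0 <= G by exact: pnorm_ge0.
  pose K := jac i * (4 * G * (1 + C)).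
  have K0 : 0 <= K by rewrite mulr_ge0 ?(ltW J0)// mulr_ge0 ?addr_ge0 ?ler01 ?(ltW C0)// mulr_ge0.
  pose e' := e / (K + 1).
  have e'0 : 0 < e' by rewrite divr_gt0// ltr_wpDl.
  near=> k.
  have h1 : (trace_gap x0 r i k (fun x => \1_E x - \1_(halfplane n0 c0) x)%R < e'%:E)%E.
    by near: k; exact: tg.
  have h2 : hk k < e' by near: k; exact: hk_small.
  have mF : measurable_fun setT (fun x : mplane => side_flux p P z (d x) i).
    by apply: measurable_funB; apply: measurable_funM => //; exact: measurableT_comp.
  have := HC i x0 r G k d (fun x => side_flux p P z (d x) i) i5 G0 mdd d1 mF
    (fun x => side_flux_bounds P p1 n0 (d x) i).
  move=> /le_trans; apply.
  apply: (@le_trans _ _ ((jac i)%:E * ((4 * G)%:E * e'%:E + (4 * G * C * e')%:E)))%E.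
    rewrite lee_pmul2l//; apply: leeD.
      by rewrite lee_wpmul2l ?lee_fin ?mulr_ge0// ltW.
    by rewrite lee_fin ler_wpM2l ?(ltW h2)// !mulr_ge0// ltW.
  have -> : ((jac i)%:E * ((4 * G)%:E * e'%:E + (4 * G * C * e')%:E) =
    (jac i * (4 * G * e' + 4 * G * C * e'))%:E)%E by [].
  rewrite lee_fin.
  have -> : jac i * (4 * G * e' + 4 * G * C * e') = K * e' by rewrite /K; ring.
  by rewrite /e' mulrA ler_pdivrMr ?ltr_wpDl// mulrC ler_wpM2l ?(ltW e0)// lerDl.
apply: (@eps_le _ _ _ 5) => // e e0.
have : \forall k \near \oo, (forall i : 'I_5, (T i k <= e%:E)%E) /\ hk k < r - r'.
  have AL : \forall k \near \oo, forall i : 'I_5, (T i k <= e%:E)%E.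
    by apply: filter_forall => i; apply: TS; [exact: ltn_ord|].
  near=> k; split; first by near: k; exact: AL.
  by near: k; apply: hk_small; rewrite subr_gt0.
move=> [N _ HN]; have [Ti hr] := HN N (leqnn N).
have FB := flux_bound p1 adm mE md c0 n0 (hk_gt0 N) (ltW r0) KO.
have S5 : (\sum_(i < 5) T i N <= (\sum_(i < 5) e)%:E)%E.
  by rewrite -sumEFin; apply: lee_sum => i _; exact: Ti.
have := le_trans FB S5; rewrite lee_fin sumr_const card_ord => F5.
rewrite add0r; have -> : 5 * e = e *+ 5 by rewrite mulr_natl.
apply: le_trans F5.
have iN : intg mu (fun x => pnorm p (n1 x, n2 x) - (z.1 * n1 x + z.2 * n2 x)).
  by apply: intgB; [exact: (intg_pnorm p1)|apply: intgD; exact: intgZ].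
have mi (s : R) : measurable_fun setT (\1_(pball P x0 s) : mplane -> R).
  by apply: measurable_indic; exact: measurable_pball.
have b1 (A : set plane) x : `|\1_A x : R| <= 1.
  by have /andP[? ?] := indic_bound A x; rewrite ger0_norm.
apply: Rint_le; [exact: (intgM (mi r') (b1 _) iN)|exact: (intgM (mi (r - hk N)) (b1 _) iN)|].
move=> x; rewrite ler_wpM2r//; first by rewrite subr_ge0; exact: (pdual_dot_le p1 n0 (n1 x, n2 x)).
rewrite !indicE; case: (boolP (x \in pball P x0 r')) => [/set_mem hx|_]; last by rewrite ler0n.
by rewrite mem_set//; apply: subset_pball hx; rewrite lerBrDr addrC -lerBrDr ltW.
Unshelve. all: by end_near. Qed.

End flux_limit.

(** * Dyadic series of translation differences *)

Section directional_sums.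
Context {R : realType}.
Local Notation plane := (R * R)%type.
Local Notation mplane := (measurableTypeR R * measurableTypeR R)%type.
Local Notation leb := (@lebesgue_measure R).
Local Notation L2 := (@lebesgue2 R).
Variables (Omega E : set plane) (mu : {finite_measure set mplane -> \bar R}) (n1 n2 : mplane -> R).
Hypothesis mE : measurable (E : set mplane).

Definition udiff (v : plane) (x : plane) : R := `|\1_E (x + v) - \1_E x|.

Lemma udiff_ge0 v x : 0 <= udiff v x. Proof. exact: normr_ge0. Qed.

Lemma udiff_le1 v x : udiff v x <= 1.
Proof. exact: (norm_sub_unit (indic_bound E (x + v)) (indic_bound E x)). Qed.

Lemma measurable_udiff_comp d (T : measurableType d) (v f : T -> mplane) :
  measurable_fun setT v -> measurable_fun setT f -> measurable_fun setT (fun z => udiff (v z) (f z)).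
Proof.
move=> mv mf; have mI : measurable_fun setT (\1_E : mplane -> R) by exact: measurable_indic.
have m1 : measurable_fun setT (fun z => (f z + v z : mplane)).
  apply: (@measurable_pair_plane _ _ _ (fun z => (f z).1 + (v z).1) (fun z => (f z).2 + (v z).2)).
    apply: measurable_funD; [exact: (measurableT_comp measurable_fst mf)|exact: (measurableT_comp measurable_fst mv)].
  by apply: measurable_funD; [exact: (measurableT_comp measurable_snd mf)|exact: (measurableT_comp measurable_snd mv)].
apply: measurableT_comp => //; apply: measurable_funB.
  exact: (measurableT_comp mI m1).
exact: (measurableT_comp mI mf).
Qed.

Lemma measurable_scale d (T : measurableType d) (s : T -> R) (e : plane) :
  measurable_fun setT s -> measurable_fun setT (fun z => (s z *: e : mplane)).
Proof.
move=> ms; apply: (@measurable_pair_plane _ _ _ (fun z => s z * e.1) (fun z => s z * e.2)).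
  exact: measurable_funM.
exact: measurable_funM.
Qed.

Definition ray_avg (e : plane) (k : nat) (x : plane) : \bar R := avg k (fun t => udiff (t *: e) x).

(** Where it is finite, the averages of [|1_E(x + t e) - 1_E(x)|] over []0, hk k[] tend to 0: a
    pointwise substitute for a one-sided trace at [x] in the direction [e]. *)
Definition dsum (e : plane) (x : plane) : \bar R := (\sum_(0 <= k <oo) ray_avg e k x)%E.

Lemma ray_avg_ge0 e k x : (0 <= ray_avg e k x)%E.
Proof. by apply: avg_ge0 => t; exact: udiff_ge0. Qed.

Lemma dsum_ge0 e x : (0 <= dsum e x)%E.
Proof. by apply: nneseries_ge0 => k _ _; exact: ray_avg_ge0. Qed.

Let F (e : plane) k (z : mplane * measurableTypeR R) : R :=
  (hk k)^-1 * (\1_(`]0%R, hk k[%classic : set (measurableTypeR R)) z.2 * udiff (z.2 *: e) z.1).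

Let mF e k : measurable_fun setT (F e k).
Proof.
apply: measurable_funM => //; apply: measurable_funM.
  have mi : measurable_fun setT (\1_(`]0%R, hk k[%classic : set (measurableTypeR R)) : _ -> R).
    by apply: measurable_indic; exact: measurable_itv.
  exact: (measurableT_comp mi measurable_snd).
apply: measurable_udiff_comp; last exact: measurable_fst.
by apply: measurable_scale; exact: measurable_snd.
Qed.

Let F0 e k z : 0 <= F e k z.
Proof. exact: (@avg_fun_ge0 _ k (fun t => udiff (t *: e) z.1) z.2 (udiff_ge0 _ _)). Qed.

Lemma measurable_ray_avg e k : measurable_fun setT (ray_avg e k : mplane -> \bar R).
Proof.
have m1 : measurable_fun setT (fun z => (F e k z)%:E) by apply/measurable_EFinP; exact: mF.
have m0 z : (0 <= (F e k z)%:E)%E by rewrite lee_fin; exact: F0.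
exact: (@measurable_fun_fubini_tonelli_F _ _ mplane (measurableTypeR R) R leb _ m1 m0).
Qed.

Lemma measurable_dsum e : measurable_fun setT (dsum e : mplane -> \bar R).
Proof.
apply: ge0_emeasurable_sum => //; first by move=> k x _ _; exact: ray_avg_ge0.
by move=> k _; exact: measurable_ray_avg.
Qed.

Hypothesis W : weak_grad Omega (\1_E) mu n1 n2.
Variables (S : set plane) (c : plane) (rho : R).
Hypotheses (oS : open S) (cS : convex_region S) (SO : S `<=` Omega).
Hypotheses (rho0 : 0 <= rho) (SB : S `<=` cbox c rho).

Lemma bv_nint (A : set plane) (v : plane) : measurable (A : set mplane) ->
  A `<=` S -> (forall x, A x -> S (x + v)) ->
  (\int[L2]_x (\1_A x * udiff v x)%:E <= (\int[mu]_x (\1_S x * `|v.1 * n1 x + v.2 * n2 x|)%R)%:E)%E.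
Proof.
move=> mA AS ASv.
have mS : measurable (S : set mplane) by exact: open_plane_measurable.
have mu_ : measurable_fun setT (udiff v : mplane -> R).
  by apply: (@measurable_udiff_comp _ _ (fun=> v) id) => //; exact: measurable_id.
have ind01 (X : set plane) x : 0 <= (\1_X x : R) by case/andP: (indic_bound X x).
have iA : intg L2 (fun x => \1_A x * udiff v x).
  apply: (@intg_cbox _ _ c rho 1) => //.
  - by apply: measurable_funM => //; exact: measurable_indic.
  - move=> x; rewrite ger0_norm ?mulr_ge0 ?udiff_ge0//.
    by rewrite mulr_ile1 ?udiff_ge0 ?udiff_le1//; case/andP: (indic_bound A x).
  - by move=> x nx; rewrite indicE memNset ?mul0r// => /AS/SB.
rewrite (Rint_EFin iA) lee_fin.
have := bv_difference_le v W mE oS cS SO rho0 SB; apply: le_trans.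
pose Q := S `&` [set x | S (x + v)].
have oQ : open Q.
  apply: openI => //; have cs : continuous (fun x : plane => (x + v : plane)).
    by move=> x; apply: cvgD; [exact: cvg_id|exact: cvg_cst].
  by move/continuousP : cs; apply.
have mQ : measurable (Q : set mplane) by exact: open_plane_measurable.
apply: Rint_le => //.
  apply: (@intg_cbox _ _ c rho 1) => //.
  - by apply: measurable_funM => //; exact: measurable_indic.
  - move=> x; rewrite ger0_norm ?mulr_ge0 ?udiff_ge0//.
    by rewrite mulr_ile1 ?udiff_ge0 ?udiff_le1//; case/andP: (indic_bound Q x).
  - by move=> x nx; rewrite indicE memNset ?mul0r// => -[/SB].
move=> x; rewrite ler_wpM2r ?udiff_ge0// !indicE.
case: (boolP (x \in A)) => [/set_mem Ax|_]; last by rewrite ler0n.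
by rewrite mem_set//; split; [exact: AS|exact: ASv].
Qed.

(** A translation by [t *: e] costs at most [t] times the directional variation, so the integral of
    the [k]-th average is at most a multiple of [hk k], and these scales are summable. *)
Lemma dsum_integral (B : set plane) (e : plane) (t0 : R) : measurable (B : set mplane) ->
  0 < t0 -> B `<=` S -> (forall x t, B x -> 0 < t < t0 -> S (x + t *: e)) ->
  (\int[L2]_x ((\1_B x)%:E * dsum e x) < +oo)%E.
Proof.
move=> mB t00 BS BSt.
have [i1 i2 _] := W.
have mS : measurable (S : set mplane) by exact: open_plane_measurable.
have ind01 (X : set plane) x : 0 <= (\1_X x : R) by case/andP: (indic_bound X x).
have mB1 : measurable_fun setT (\1_B : mplane -> R) by exact: measurable_indic.
pose M1 := \int[mu]_x (\1_S x * `|e.1 * n1 x + e.2 * n2 x|)%R.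
have ien : intg mu (fun x => `|e.1 * n1 x + e.2 * n2 x|).
  by apply: intg_norm; apply: intgD; exact: intgZ.
have bS1 x : `|\1_S x : R| <= 1 by rewrite ger0_norm//; case/andP: (indic_bound S x).
have mS1 : measurable_fun setT (\1_S : mplane -> R) by exact: measurable_indic.
have iSen : intg mu (fun x => \1_S x * `|e.1 * n1 x + e.2 * n2 x|) by exact: (intgM mS1 bS1 ien).
have M10 : 0 <= M1 by apply: Rintegral_ge0 => x _; rewrite mulr_ge0.
pose b := (2 * rho) ^+ 2.
have b0 : 0 <= b by exact: sqr_ge0.
pose M := M1 + b / t0.
have bt0 : 0 <= b / t0 by rewrite divr_ge0// ltW.
have M0 : 0 <= M by rewrite addr_ge0.
have mud v : measurable_fun setT (udiff v : mplane -> R).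
  by apply: (@measurable_udiff_comp _ _ (fun=> v) id) => //; exact: measurable_id.
have key k t : 0 < t < hk k -> (\int[L2]_x (\1_B x * udiff (t *: e) x)%:E <= (M * hk k)%:E)%E.
  move=> /andP[t_0 th]; have hk0 := @hk_gt0 R k.
  (* At small scales the translates stay in [S]. At the remaining ones the area [b] of the box is a
     trivial bound, and it is at most [b / t0 * hk k]. *)
  have [ht|ht] := ltP (hk k) t0.
    apply: (le_trans (@bv_nint B (t *: e) mB BS _)).
      by move=> x Bx; apply: BSt => //; rewrite t_0 (lt_trans th).
    rewrite lee_fin; have -> : \int[mu]_x (\1_S x * `|(t *: e).1 * n1 x + (t *: e).2 * n2 x|)%R = t * M1.
      rewrite -(RintZ t iSen); apply: eq_Rintegral => x _.
      rewrite /= /GRing.scale/= -!mulrA -mulrDr normrM (gtr0_norm t_0); ring.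
    rewrite mulrC; apply: ler_pM => //; [exact: ltW|by rewrite lerDl|exact: ltW].
  apply: (@le_trans _ _ (\int[L2]_x (\1_(cbox c rho) x)%:E)%E).
    have mc : measurable (cbox c rho : set mplane) by exact: measurable_cbox.
    apply: nint_le.
    - exact: measurable_funM.
    - exact: measurable_indic.
    - by move=> x; rewrite mulr_ge0// udiff_ge0.
    - move=> x; rewrite !indicE; case: (boolP (x \in B)) => [/set_mem Bx|_]; last by rewrite mul0r ler0n.
      by rewrite mul1r mem_set ?udiff_le1//; apply/SB/BS.
  have mc : measurable (cbox c rho : set mplane) by exact: measurable_cbox.
  rewrite integral_indic// setIT lebesgue2_cbox// lee_fin -/b.
  apply: (@le_trans _ _ (b / t0 * hk k)); last by rewrite ler_wpM2r ?(ltW hk0)// lerDr.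
  by rewrite -mulrA ler_peMr// mulrC ler_pdivlMr// mul1r.
have step k : (\int[L2]_x ((\1_B x)%:E * ray_avg e k x) <= (M * hk k)%:E)%E.
  pose G (z : mplane * measurableTypeR R) : \bar R := (\1_B z.1 * F e k z)%:E.
  have mG : measurable_fun setT G.
    apply/measurable_EFinP; apply: measurable_funM => //.
    exact: (measurableT_comp mB1 measurable_fst).
  have G0 z : (0 <= G z)%E by rewrite lee_fin; exact: (mulr_ge0 (ind01 B z.1) (F0 e k z)).
  have mFx (x : mplane) : measurable_fun setT (fun t => F e k (x, t)).
    exact: (measurableT_comp (mF e k) (pair1_measurable x)).
  have -> : (\int[L2]_x ((\1_B x)%:E * ray_avg e k x) = \int[L2]_x \int[leb]_t G (x, t))%E.
    apply: eq_integral => x _.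
    by rewrite -[RHS]/(\int[leb]_t (\1_B x * F e k (x, t))%:E)%E (nintZ leb (mFx x) (fun t => F0 _ _ _) (ind01 B x)).
  rewrite (@fubini_tonelli _ _ _ _ _ (@sfleb2 R) leb G mG G0).
  rewrite -(avg_cst k (mulr_ge0 M0 (ltW (hk_gt0 k)))).
  have mGt : measurable_fun [set: measurableTypeR R] (fun t => \int[sfleb2]_x G (x, t))%E.
    exact: (@measurable_fun_fubini_tonelli_G _ _ _ _ _ (@sfleb2 R) G mG G0).
  apply: (@ge0_le_integral _ _ _ leb _ measurableT).
  - by move=> t _; apply: integral_ge0 => x _; exact: G0.
  - exact: mGt.
  - by apply/measurable_EFinP; apply: measurable_avg_fun; exact: measurable_cst.
  move=> t _.
  pose a : R := (hk k)^-1 * \1_(`]0%R, hk k[%classic : set (measurableTypeR R)) t.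
  have a0 : 0 <= a by rewrite mulr_ge0 ?invr_ge0 ?(ltW (hk_gt0 k))//; case/andP: (indic_itv01 (`]0%R, hk k[%classic) t).
  have mBu : measurable_fun setT (fun x : mplane => \1_B x * udiff (t *: e) x).
    exact: measurable_funM.
  have -> : (\int[sfleb2]_x G (x, t) = a%:E * \int[L2]_x (\1_B x * udiff (t *: e) x)%:E)%E.
    rewrite -(nintZ L2 mBu (fun x => mulr_ge0 (ind01 B x) (udiff_ge0 _ x)) a0).
    by apply: eq_integral => x _; rewrite /G /F /a /=; congr EFin; ring.
  have -> : ((hk k)^-1 * (\1_(`]0%R, hk k[%classic : set (measurableTypeR R)) t * (M * hk k)))%:E =
    (a%:E * (M * hk k)%:E)%E by rewrite -EFinM mulrA.
  rewrite /a indicE; case: (boolP (t \in _)) => [/set_mem /=|_]; last by rewrite mulr0 !mul0e.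
  rewrite in_itv/= => /key ht; apply: lee_wpmul2l => //.
  by rewrite lee_fin mulr1 invr_ge0 ltW// hk_gt0.
have -> : (\int[L2]_x ((\1_B x)%:E * dsum e x) = \sum_(0 <= k <oo) \int[L2]_x ((\1_B x)%:E * ray_avg e k x))%E.
  rewrite -integral_nneseries//.
  - apply: eq_integral => x _; rewrite /dsum nneseriesZl//; first by move=> k _; exact: ray_avg_ge0.
  - by move=> k; apply: emeasurable_funM; [exact/measurable_EFinP|exact: measurable_ray_avg].
  - by move=> k x _; rewrite mule_ge0 ?lee_fin ?ray_avg_ge0.
apply: (@le_lt_trans _ _ M%:E); last exact: ltry.
apply: (le_trans _ (epsilon_trick0 xpredT M0)).
apply: lee_nneseries => [k _ _|k _]; last exact: step.
by apply: integral_ge0 => x _; rewrite mule_ge0 ?lee_fin ?ray_avg_ge0.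
Qed.

End directional_sums.

(** * Choice of a generic pentagon with few jumps *)

Lemma mid_lt (R : realFieldType) (a m : R) : a < m -> (a + m) / 2 < m.
Proof. by move=> h; lra. Qed.

Lemma lt_mid (R : realFieldType) (a m : R) : a < m -> a < (a + m) / 2.
Proof. by move=> h; lra. Qed.

Lemma cvg_ler_cst (R : realType) (u : nat -> R) (l c : R) :
  u @ \oo --> l -> (forall k, u k <= c) -> l <= c.
Proof.
move=> ul cu; rewrite -(cvg_lim _ ul)//.
by apply: limr_le; [apply/cvg_ex; eexists; exact: ul|exact: nearW].
Qed.

Section almost_everywhere_tools.
Context {R : realType}.
Local Notation leb := (@lebesgue_measure R).

Lemma nint_fin_ae d (T : measurableType d) (m : {measure set T -> \bar R}) (f : T -> \bar R) :
  measurable_fun setT f -> (forall x, (0 <= f x)%E) -> (\int[m]_x f x < +oo)%E ->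
  {ae m, forall x, (f x < +oo)%E}.
Proof.
move=> mf f0 If.
have fi : m.-integrable setT f.
  apply/integrableP; split => //.
  by rewrite (eq_integral f)// => x _; rewrite gee0_abs.
have := integrable_ae measurableT fi; apply: filterS => x /(_ I).
by rewrite ge0_fin_numE.
Qed.

Lemma ae_pick (Q : R -> Prop) (a b : R) : a < b -> {ae leb, forall x, Q x} ->
  exists2 x, a < x < b & Q x.
Proof.
move=> ab [N [mN N0 HN]]; apply: contrapT => H.
have sub : `]a, b[%classic `<=` N.
  move=> x /=; rewrite in_itv/= => xab; apply: HN => Qx; apply: H; by exists x.
have : (leb (`]a, b[%classic : set (measurableTypeR R)) <= leb N)%E.
  by apply: le_measure => //; rewrite inE//; exact: measurable_itv.
rewrite N0 [X in (X <= _)%E]lebesgue_measure_itv/= lte_fin ab -EFinB lee_fin subr_le0 leNgt.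
by rewrite ab.
Qed.

End almost_everywhere_tools.

Section generic_radius.
Context {R : realType} (p : R) (P : nat -> R * R).
Hypothesis p1 : 1 < p.
Local Notation plane := (R * R)%type.
Local Notation mplane := (measurableTypeR R * measurableTypeR R)%type.
Local Notation leb := (@lebesgue_measure R).
Local Notation L2 := (@lebesgue2 R).
Hypothesis adm : admissible_polygon P p.
Local Notation gauge := (pgauge P).
Local Notation coord := (pcoord P).
Local Notation edge := (pedge P).
Local Notation jac := (pjac P).
Variables (Omega E : set plane) (mu : {finite_measure set mplane -> \bar R}) (n1 n2 : mplane -> R).
Hypothesis mE : measurable (E : set mplane).
Hypothesis W : weak_grad Omega (\1_E) mu n1 n2.
Local Notation udiff := (udiff E).
Local Notation dsum := (dsum E).

(** The variation of the trace along side [i], measured by difference quotients at scale [hk k];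
    stopping at [r - hk k] keeps both points on the side. *)
Definition side_var (x0 : plane) (i k : nat) (r : R) : \bar R :=
  (\int[leb]_y ((hk k)^-1 * (\1_(`]0%R, (r - hk k)%R[%classic : set (measurableTypeR R)) y *
     udiff (hk k *: edge i) (aff x0 (P i) (edge i) r y)))%:E)%E.

Definition Nvar (x0 : plane) (k : nat) (r : R) : \bar R := (\sum_(i < 5) side_var x0 i k r)%E.

Let shrunk (x0 : plane) (r0 : R) i k : set plane :=
  psector P x0 r0 i `&` [set x | psector P x0 r0 i (x + hk k *: edge i)].

Let shrunk_aff x0 r0 i k (r y : R) : (i < 5)%N ->
  shrunk x0 r0 i k (aff x0 (P i) (edge i) r y) <-> (0 < y < r - hk k) /\ r < r0.
Proof.
move=> i5; have h0 := @hk_gt0 R k.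
have -> : shrunk x0 r0 i k (aff x0 (P i) (edge i) r y) <->
    psector P x0 r0 i (aff x0 (P i) (edge i) r y) /\ psector P x0 r0 i (aff x0 (P i) (edge i) r (y + hk k)).
  rewrite /shrunk /=; have -> // : aff x0 (P i) (edge i) r y + hk k *: edge i = aff x0 (P i) (edge i) r (y + hk k).
  by rewrite !affE -!addrA scalerDl.
rewrite !(psector_aff adm x0 r0 r _ i5); split.
  by move=> [[a b c] [d e f]]; rewrite a -ltrBrDr in e *.
move=> [/andP[a b] c]; do !split => //; first by rewrite (lt_trans b)// gtrBl.
  by rewrite addr_gt0.
by rewrite -ltrBrDr.
Qed.

Let m_shrunk x0 r0 i k : measurable (shrunk x0 r0 i k : set mplane).
Proof.
apply: open_plane_measurable; apply: openI; first exact: psector_open.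
have cs : continuous (fun x : plane => (x + hk k *: edge i : plane)).
  by move=> x; apply: cvgD; [exact: cvg_id|exact: cvg_cst].
by move/continuousP : cs; apply; exact: psector_open.
Qed.

Let Fs x0 r0 i k (x : mplane) : R :=
  (hk k)^-1 * (\1_(shrunk x0 r0 i k) x * udiff (hk k *: edge i) x).

Let mFs x0 r0 i k : measurable_fun setT (Fs x0 r0 i k).
Proof.
apply: measurable_funM => //; apply: measurable_funM.
  by apply: measurable_indic; exact: m_shrunk.
by apply: (@measurable_udiff_comp _ E mE _ _ (fun=> hk k *: edge i) id) => //; exact: measurable_id.
Qed.

Let Fs0 x0 r0 i k x : 0 <= Fs x0 r0 i k x.
Proof.
by rewrite mulr_ge0 ?invr_ge0 ?(ltW (hk_gt0 k))// mulr_ge0 ?udiff_ge0.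
Qed.

Lemma side_varE x0 r0 i k r : (i < 5)%N -> r < r0 ->
  side_var x0 i k r = (\int[leb]_y (Fs x0 r0 i k (aff x0 (P i) (edge i) r y))%:E)%E.
Proof.
move=> i5 rr; apply: eq_integral => y _; congr EFin; congr (_ * (_ * _)).
rewrite !indicE; congr ((nat_of_bool _)%:R); apply/idP/idP => /set_mem.
  by rewrite /= in_itv/= => h; apply/mem_set/(shrunk_aff x0 r0 k r y i5).
by move=> /(shrunk_aff x0 r0 k r y i5)[h _]; apply/mem_set; rewrite /= in_itv.
Qed.

Let msv x0 r0 i k : measurable_fun [set: measurableTypeR R]
  (fun r => \int[leb]_y (Fs x0 r0 i k (aff x0 (P i) (edge i) r y))%:E)%E.
Proof.
apply: (@measurable_inner_aff _ x0 (P i) (edge i) (fun z => (Fs x0 r0 i k z)%:E)).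
  exact/measurable_EFinP.
by move=> z; rewrite lee_fin; exact: Fs0.
Qed.

Let Ntil x0 r0 k r : \bar R := (\sum_(i < 5) \int[leb]_y (Fs x0 r0 i k (aff x0 (P i) (edge i) r y))%:E)%E.

Let NtilE x0 r0 k r : r < r0 -> Nvar x0 k r = Ntil x0 r0 k r.
Proof. by move=> rr; apply: eq_bigr => i _; apply: side_varE => //; exact: ltn_ord. Qed.

Let Ntil0 x0 r0 k r : (0 <= Ntil x0 r0 k r)%E.
Proof. by apply: sume_ge0 => i _; apply: integral_ge0 => y _; rewrite lee_fin; exact: Fs0. Qed.

Let mNtil x0 r0 k : measurable_fun [set: measurableTypeR R] (Ntil x0 r0 k).
Proof. by apply: emeasurable_sum => i _; exact: msv. Qed.

(** In sector [i], differences along the side see the density only through its product with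
    [edge i], which [polygon_dual] bounds by [jac i * pnorm p n]. The factor [jac i] is also the
    Jacobian of the slicing and cancels; the sectors being disjoint, the constant is 1. *)
Lemma variation_bound (x0 : plane) (r0 : R) k : 0 < r0 -> pball P x0 r0 `<=` Omega ->
  (\int[leb]_r Ntil x0 r0 k r <= (\int[mu]_x (\1_(pball P x0 r0) x * pnorm p (n1 x, n2 x))%R)%:E)%E.
Proof.
move=> r00 BO; have [i1 i2 _] := W; have h0 := @hk_gt0 R k.
have iN : intg mu (fun x => pnorm p (n1 x, n2 x)) by exact: (intg_pnorm p1).
have mi (A : set plane) : open A -> measurable_fun setT (\1_A : mplane -> R).
  by move=> oA; apply: measurable_indic; exact: open_plane_measurable.
have b1 (A : set plane) x : `|\1_A x : R| <= 1.
  by have /andP[? ?] := indic_bound A x; rewrite ger0_norm.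
have iS i : intg mu (fun x : mplane => \1_(psector P x0 r0 i) x * pnorm p (n1 x, n2 x)).
  exact: (@intgM _ _ _ mu 1 _ (\1_(psector P x0 r0 i) : mplane -> R) (mi _ (@psector_open R P x0 r0 i)) (b1 _) iN).
have Fs0' (i : 'I_5) r y : (0 <= (Fs x0 r0 i k (aff x0 (P i) (edge i) r y))%:E)%E by rewrite lee_fin; exact: Fs0.
have side (i : 'I_5) : (\int[leb]_r \int[leb]_y (Fs x0 r0 i k (aff x0 (P i) (edge i) r y))%:E <=
   (\int[mu]_x (\1_(psector P x0 r0 i) x * pnorm p (n1 x, n2 x))%R)%:E)%E.
  have i5 := ltn_ord i; have J0 := polygon_jac adm i5.
  have mFE : measurable_fun setT (fun x => (Fs x0 r0 i k x)%:E) by exact/measurable_EFinP.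
  have FE0 x : (0 <= (Fs x0 r0 i k x)%:E)%E by rewrite lee_fin; exact: Fs0.
  have PI := polygon_integral adm x0 i5 mFE FE0.
  rewrite -(lee_pmul2l _ (x := (jac i)%:E))// -PI -EFinM.
  have mu_ : measurable_fun setT (fun x : mplane => \1_(shrunk x0 r0 i k) x * udiff (hk k *: edge i) x).
    apply: measurable_funM; first by apply: measurable_indic; exact: m_shrunk.
    by apply: (@measurable_udiff_comp _ E mE _ _ (fun=> hk k *: edge i) id) => //; exact: measurable_id.
  have u0 (x : mplane) : 0 <= \1_(shrunk x0 r0 i k) x * udiff (hk k *: edge i) x.
    by rewrite mulr_ge0 ?udiff_ge0//; case/andP: (indic_bound (shrunk x0 r0 i k) x).
  have hi0 : 0 <= (@hk R k)^-1 by rewrite invr_ge0 ltW.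
  rewrite (nintZ L2 mu_ u0 hi0).
  have SO : psector P x0 r0 i `<=` Omega by move=> x /(psector_sub adm i5)/BO.
  have SB : psector P x0 r0 i `<=` cbox x0 r0.
    by move=> x /(psector_sub adm i5); exact: (pball_box adm (ltW r00)).
  have := bv_nint mE W (@psector_open R P x0 r0 i) (@psector_convex R P x0 r0 i) SO (ltW r00) SB
    (v := hk k *: edge i) (m_shrunk x0 r0 i k).
  move=> /(_ (fun x h => h.1) (fun x h => h.2)) H.
  apply: (@le_trans _ _ ((hk k)^-1%:E * (\int[mu]_x (\1_(psector P x0 r0 i) x *
     `|(hk k *: edge i).1 * n1 x + (hk k *: edge i).2 * n2 x|)%R)%:E))%E.
    by rewrite lee_wpmul2l// lee_fin.
  rewrite -EFinM lee_fin -ler_pdivlMl ?invr_gt0// invrK mulrA.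
  have c0 : 0 <= hk k * jac i by rewrite mulr_ge0// ltW.
  rewrite -(RintZ (hk k * jac i) (iS i)).
  apply: Rint_le; [|exact: intgZ|].
    apply: (@intgM _ _ _ mu 1 _ (\1_(psector P x0 r0 i) : mplane -> R) (mi _ (@psector_open R P x0 r0 i)) (b1 _)).
    by apply: intg_norm; apply: intgD; exact: intgZ.
  move=> x; rewrite mulrCA ler_wpM2l//.
  have := polygon_dual adm (n1 x, n2 x) i5; rewrite /dot /= => hd.
  rewrite /GRing.scale/= -!mulrA -mulrDr normrM (gtr0_norm h0) ler_wpM2l ?(ltW h0)//.
have in0 (i : 'I_5) (r : measurableTypeR R) :
    (0 <= \int[leb]_y (Fs x0 r0 i k (aff x0 (P i) (edge i) r y))%:E)%E.
  by apply: integral_ge0 => y _; exact: Fs0'.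
have E0 := @ge0_integral_sum _ _ _ leb _ measurableT _ _ (fun i : 'I_5 => msv x0 r0 i k)
  (fun i r _ => in0 i r) (index_enum _).
apply: (eq_le_tr E0); apply: (le_trans (lee_sum _ (fun i _ => side i))).
have [iSum ESum] := Rint_sum (n := 5) (fun i _ => iS i).
rewrite sumEFin lee_fin; apply: (le_subst (esym ESum) (erefl _)).
apply: Rint_le => //; first exact: (@intgM _ _ _ mu 1 _ (\1_(pball P x0 r0) : mplane -> R) (mi _ (@pball_open R P x0 r0)) (b1 _) iN).
move=> x; rewrite -mulr_suml ler_wpM2r ?pnorm_ge0//.
have [[i Si]|none] := pselect (exists i : 'I_5, psector P x0 r0 i x).
  rewrite (bigD1 i)//= big1 ?addr0; last first.
    move=> j ji; rewrite indicE memNset// => Sj; move: ji; rewrite -val_eqE /=.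
    by rewrite (psector_disjoint adm (ltn_ord j) (ltn_ord i) Sj Si) eqxx.
  by rewrite !indicE mem_set// mem_set//; exact: (psector_sub adm (ltn_ord i)).
rewrite big1; first by case/andP: (indic_bound (pball P x0 r0) x).
by move=> i _; rewrite indicE memNset// => Si; apply: none; exists i.
Qed.

(** Let [m'] lie strictly between the mean energy and [m]. If the claim fails, for almost every
    radius the count exceeds [m'] at all small scales, so the counts truncated at [m'] converge to
    [m']. Dominated convergence then makes the energy at least [m' * (r0 - r1)]. *)
Lemma few_jumps (x0 : plane) (r1 r0 m : R) (Q : R -> Prop) : 0 <= r1 -> r1 < r0 ->
  pball P x0 r0 `<=` Omega ->
  \int[mu]_x (\1_(pball P x0 r0) x * pnorm p (n1 x, n2 x))%R < m * (r0 - r1) ->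
  {ae leb, forall r, r < r0 -> Q r} ->
  exists r, [/\ r1 < r < r0, Q r &
    exists2 m', m' < m & forall K, exists2 k, (K <= k)%N & (Nvar x0 k r <= m'%:E)%E].
Proof.
move=> r10 r1r0 BO small aeQ; apply: contrapT => none.
have r00 : 0 < r0 by exact: le_lt_trans r1r0.
set lam := \int[mu]_x _ in small.
have d0 : 0 < r0 - r1 by rewrite subr_gt0.
have lam0 : 0 <= lam.
  by apply: Rintegral_ge0 => x _; rewrite mulr_ge0 ?pnorm_ge0//; case/andP: (indic_bound (pball P x0 r0) x).
pose m' := (lam / (r0 - r1) + m) / 2.
have lm : lam / (r0 - r1) < m by rewrite ltr_pdivrMr.
have m'm : m' < m by exact: mid_lt.
have lm' : lam < m' * (r0 - r1) by rewrite -ltr_pdivrMr//; exact: lt_mid.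
have m'0 : 0 <= m' by rewrite divr_ge0// addr_ge0 ?divr_ge0 ?(ltW d0)// (le_trans _ (ltW lm))// divr_ge0// ltW.
pose I := `]r1, r0[%classic : set (measurableTypeR R).
have mI : measurable I by exact: measurable_itv.
pose f k (r : measurableTypeR R) : R := \1_I r * fine (Order.min (Ntil x0 r0 k r) m'%:E).
have minfin k r : Order.min (Ntil x0 r0 k r) m'%:E \is a fin_num.
  rewrite ge0_fin_numE; last by rewrite le_min Ntil0 lee_fin.
  by rewrite gt_min ltry orbT.
have fine0 k r : 0 <= fine (Order.min (Ntil x0 r0 k r) m'%:E).
  by rewrite fine_ge0// le_min Ntil0 lee_fin.
have finem k r : fine (Order.min (Ntil x0 r0 k r) m'%:E) <= m'.
  by rewrite -lee_fin fineK// ge_min lexx orbT.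
have mI1 : measurable_fun setT (\1_I : measurableTypeR R -> R) by exact: measurable_indic.
have I01 r : 0 <= (\1_I r : R) <= 1 by exact: indic_itv01.
have mf k : measurable_fun setT (f k).
  apply: measurable_funM => //; apply: (measurableT_comp (@fine_measurable _ setT measurableT)).
  by apply: measurable_mine => //; exact: mNtil.
have LI : leb I = (r0 - r1)%:E by rewrite /I [LHS]lebesgue_measure_itv/= lte_fin r1r0.
have II : (\int[leb]_r (\1_I r)%:E = (r0 - r1)%:E)%E by rewrite integral_indic// setIT.
have iI : intg leb (fun r => m' * \1_I r).
  apply: intgZ; apply: (intg_ge0 mI1); first by move=> r; case/andP: (I01 r).
  by rewrite II ltry.
have cv : {ae leb, forall r, f ^~ r @ \oo --> m' * \1_I r}.
  have [N [mN N0 HN]] := aeQ; exists N; split => // r /= ncv; apply: HN => Qr; apply: ncv.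
  apply: cvg_near_cst.
  rewrite /f indicE; case: (boolP (r \in I)) => [/set_mem|_]; last by apply: nearW => k; rewrite mul0r mulr0.
  rewrite /I /= in_itv/= => /andP[h1 h2].
  have /existsNP[K HK] : ~ (forall K, exists2 k, (K <= k)%N & (Nvar x0 k r <= m'%:E)%E).
    by move=> H; apply: none; exists r; split; [rewrite h1 h2|exact: Qr|exists m'].
  near=> k; rewrite mul1r mulr1 min_r//= ltW// -NtilE// ltNge; apply/negP => le.
  by apply: HK; exists k => //; near: k; exact: nbhs_infty_ge.
have bnd k r : `|f k r| <= m' * \1_I r.
  have /andP[a b] := I01 r.
  by rewrite /f ger0_norm ?mulr_ge0// mulrC ler_wpM2r.
have m'I : measurable_fun setT (fun r : measurableTypeR R => m' * \1_I r) by exact: measurable_funM.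
have [_ lim] := Rint_dct mf m'I cv iI bnd.
have le_lam k : \int[leb]_r f k r <= lam.
  have i_f : intg leb (f k) by exact: (intg_le (mf k) (bnd k) iI).
  rewrite -lee_fin -(Rint_EFin i_f); apply: (le_trans _ (variation_bound k r00 BO)).
  apply: (@ge0_le_integral _ _ _ leb _ measurableT).
  - by move=> r _; rewrite lee_fin mulr_ge0//; case/andP: (I01 r).
  - exact/measurable_EFinP.
  - exact: mNtil.
  move=> r _; have /andP[a b] := I01 r.
  apply: (@le_trans _ _ (fine (Order.min (Ntil x0 r0 k r) m'%:E))%:E).
    by rewrite lee_fin ler_piMl.
  by rewrite fineK// ge_min lexx.
have : \int[leb]_r (m' * \1_I r) <= lam.
  exact: (cvg_ler_cst lim).
have -> : \int[leb]_r (m' * \1_I r) = m' * (r0 - r1).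
  apply: EFin_inj; rewrite -(Rint_EFin iI) (nintZ leb mI1 _ m'0); last by move=> r; case/andP: (I01 r).
  by rewrite II.
by rewrite leNgt lm'.
Unshelve. all: by end_near. Qed.

Definition side_regular (x0 : plane) (r : R) (i : nat) (e : plane) : Prop :=
  (\int[leb]_y ((\1_(`]0%R, r[%classic : set (measurableTypeR R)) y)%:E *
     dsum e (aff x0 (P i) (edge i) r y)) < +oo)%E.

Lemma pball_shift (x0 x e : plane) (r0 r1 t : R) : pball P x0 r0 x ->
  0 < t < (r1 - r0) / (`|e.1| + `|e.2| + 1) -> pball P x0 r1 (x + t *: e).
Proof.
move=> hx /andP[t0 ht] j j5; rewrite addrAC pgaugeD pgaugeZ.
have h1 := hx j j5; have h2 := polygon_small adm e j5.
have D0 : 0 < `|e.1| + `|e.2| + 1 by rewrite ltr_wpDl.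
rewrite ltr_pdivlMr// in ht.
apply: (@lt_le_trans _ _ (r0 + t * (`|e.1| + `|e.2| + 1))); last by rewrite -lerBrDl ltW.
apply: ltr_leD => //; rewrite ler_wpM2l ?(ltW t0)//.
by apply: (le_trans h2); rewrite lerDl.
Qed.

Lemma dsum_pball (x0 : plane) (r0 r1 : R) (B : set plane) (e : plane) : 0 < r0 -> r0 < r1 ->
  pball P x0 r1 `<=` Omega -> measurable (B : set mplane) -> B `<=` pball P x0 r0 ->
  (\int[L2]_x ((\1_B x)%:E * dsum e x) < +oo)%E.
Proof.
move=> r00 r01 BO mB Bs; have r10 : 0 <= r1 by rewrite ltW// (lt_trans r00).
have t0 : 0 < (r1 - r0) / (`|e.1| + `|e.2| + 1) by rewrite divr_gt0 ?subr_gt0// ltr_wpDl.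
have BS : B `<=` pball P x0 r1 by move=> x /Bs; apply: subset_pball; exact: ltW.
have BSt x t : B x -> 0 < t < (r1 - r0) / (`|e.1| + `|e.2| + 1) -> pball P x0 r1 (x + t *: e).
  by move=> /Bs hx ht; exact: (pball_shift hx ht).
have D := dsum_integral mE W (@pball_open R P x0 r1) (@pball_convex R P x0 r1) BO r10 (pball_box adm r10)
  mB t0 BS BSt.
exact: D.
Qed.

Lemma ae_side_regular (x0 : plane) (r0 r1 : R) i e : 0 < r0 -> r0 < r1 ->
  pball P x0 r1 `<=` Omega -> (i < 5)%N ->
  {ae leb, forall r, r < r0 -> side_regular x0 r i e}.
Proof.
move=> r00 r01 BO i5; have J0 := polygon_jac adm i5.
have mS : measurable (psector P x0 r0 i : set mplane).
  by apply: open_plane_measurable; exact: psector_open.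
have fin := dsum_pball e r00 r01 BO mS (psector_sub adm i5).
pose f (x : mplane) := ((\1_(psector P x0 r0 i) x)%:E * dsum e x)%E.
have f0 x : (0 <= f x)%E.
  by rewrite mule_ge0 ?dsum_ge0// lee_fin; case/andP: (indic_bound (psector P x0 r0 i) x).
have mf : measurable_fun setT f.
  by apply: emeasurable_funM; [apply/measurable_EFinP; exact: measurable_indic|exact: measurable_dsum].
have PI := polygon_integral adm x0 i5 mf f0.
have fin2 : (\int[leb]_r \int[leb]_y f (aff x0 (P i) (edge i) r y) < +oo)%E.
  have := fin; rewrite PI; case: (\int[leb]_r _)%E => [s| |].
  - by move=> _; exact: ltry.
  - by rewrite gt0_muley ?lte_fin.
  - by move=> _; exact: ltNye.
have := nint_fin_ae (measurable_inner_aff x0 (P i) (edge i) mf f0) (fun r => integral_ge0 _ (fun y _ => f0 _)) fin2.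
apply: filterS => r h rr; apply: le_lt_trans h; rewrite le_eqVlt; apply/orP; left; apply/eqP.
apply: eq_integral => y _; rewrite /f; congr ((_%:E) * _)%E; rewrite !indicE; congr ((nat_of_bool _)%:R).
apply/idP/idP => /set_mem.
  by rewrite /= in_itv/= => /andP[a b]; apply/mem_set/(psector_aff adm x0 r0 r y i5).
by move=> /(psector_aff adm x0 r0 r y i5)[a b c]; apply/mem_set; rewrite /= in_itv/= a b.
Qed.

(** For a fixed centre a corner moves on a ray, a null set. With the centre also moving along [w],
    which is not parallel to [P i], it sweeps an area to which Fubini applies. *)
Lemma ae_corner_regular (x0 w : plane) (r0 r1 : R) i e : 0 < r0 -> r0 < r1 ->
  pball P x0 r1 `<=` Omega -> w.1 != 0 -> det w (P i) != 0 ->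
  {ae leb, forall s, {ae leb, forall r, pball P x0 r0 (aff x0 w (P i) s r) ->
     (dsum e (aff x0 w (P i) s r) < +oo)%E}}.
Proof.
move=> r00 r01 BO w0 dw.
have mB := @measurable_pball _ P x0 r0.
have fin := dsum_pball e r00 r01 BO mB (fun x h => h).
pose f (x : mplane) := ((\1_(pball P x0 r0) x)%:E * dsum e x)%E.
have f0 x : (0 <= f x)%E.
  by rewrite mule_ge0 ?dsum_ge0// lee_fin; case/andP: (indic_bound (pball P x0 r0) x).
have mf : measurable_fun setT f.
  by apply: emeasurable_funM; [apply/measurable_EFinP; exact: measurable_indic|exact: measurable_dsum].
have PI := ge0_integral_aff x0 w0 dw mf f0.
have fin2 : (\int[leb]_s \int[leb]_r f (aff x0 w (P i) s r) < +oo)%E.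
  by rewrite PI; apply: lte_mul_pinfty => //; rewrite lee_fin invr_ge0.
have := nint_fin_ae (measurable_inner_aff x0 w (P i) mf f0) (fun r => integral_ge0 _ (fun y _ => f0 _)) fin2.
apply: filterS => s hs.
have mfs : measurable_fun [set: measurableTypeR R] (fun r => f (aff x0 w (P i) s r)).
  apply: (measurableT_comp mf).
  apply: (@measurableT_comp _ _ _ _ _ _ (fun z : mplane => aff x0 w (P i) z.1 z.2 : mplane) _ (pair s)).
    exact: measurable_aff.
  exact: pair1_measurable.
have := nint_fin_ae mfs (fun r => f0 _) hs.
by apply: filterS => r h hr; move: h; rewrite /f indicE mem_set// mul1e.
Qed.

End generic_radius.

Section almost_everywhere_logic.
Context d (T : measurableType d) (R : realType) (m : {measure set T -> \bar R}).

Lemma ae_imp (A B : T -> Prop) : (forall x, A x -> B x) ->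
  {ae m, forall x, A x} -> {ae m, forall x, B x}.
Proof. by move=> AB [N [mN N0 HN]]; exists N; split => // x /= nB; apply: HN => /AB. Qed.

Lemma ae_and (A B : T -> Prop) : {ae m, forall x, A x} -> {ae m, forall x, B x} ->
  {ae m, forall x, A x /\ B x}.
Proof.
move=> [N [mN N0 HN]] [K [mK K0 HK]]; exists (N `|` K); split.
- exact: measurableU.
- by rewrite -[LHS]/(m _); apply: null_set_setU.
- move=> x /= nAB; apply: contrapT => /not_orP[nN nK]; apply: nAB; split; apply: contrapT => h.
    by apply: nN; apply: HN.
  by apply: nK; apply: HK.
Qed.

Lemma ae_forall n (A : 'I_n -> T -> Prop) : (forall i, {ae m, forall x, A i x}) ->
  {ae m, forall x, forall i, A i x}.
Proof.
move=> H; suff K k : {ae m, forall x, forall i : 'I_n, (i < k)%N -> A i x}.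
  by apply: (ae_imp _ (K n)) => x h i; apply: h.
elim: k => [|k ih]; first by exists set0; split => // x /= [].
have [kn|kn] := ltnP k n; last first.
  by apply: (ae_imp _ ih) => x h i _; apply: h; exact: leq_trans kn.
apply: (ae_imp _ (ae_and ih (H (Ordinal kn)))) => x [h1 h2] i.
rewrite ltnS leq_eqVlt => /orP[/eqP ik|/h1//].
by have -> : i = Ordinal kn by exact: val_inj.
Qed.

End almost_everywhere_logic.

Section generic_polygon.
Context {R : realType} (p : R) (P : nat -> R * R).
Hypothesis p1 : 1 < p.
Local Notation plane := (R * R)%type.
Local Notation mplane := (measurableTypeR R * measurableTypeR R)%type.
Local Notation leb := (@lebesgue_measure R).
Hypothesis adm : admissible_polygon P p.
Local Notation gauge := (pgauge P).
Local Notation edge := (pedge P).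
Variables (Omega E : set plane) (mu : {finite_measure set mplane -> \bar R}) (n1 n2 : mplane -> R).
Hypothesis mE : measurable (E : set mplane).
Hypothesis W : weak_grad Omega (\1_E) mu n1 n2.

Definition corner (x : plane) (r : R) (i : nat) : plane := x + r *: P i.

(** On each side, regularity along the side and towards the inside, the direction [- P i]; at each
    corner, regularity along the two sides that meet there. *)
Definition generic_pair (x : plane) (r : R) : Prop :=
  (forall i, (i < 5)%N -> side_regular P E x r i (edge i) /\ side_regular P E x r i (- P i)) /\
  (forall i, (i < 5)%N -> (dsum E (edge i) (corner x r i) < +oo)%E /\
     (dsum E (- edge i)%R (corner x r i.+1) < +oo)%E).

(** The centre is chosen first, for the corners; almost every radius is then generic, and
    [few_jumps] selects one of them. *)
Lemma generic_polygon (x0 : plane) (rho eta m : R) : 0 < rho -> 0 < eta -> 3 * eta < 1 ->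
  pball P x0 rho `<=` Omega ->
  (forall x, pball P x0 (eta * rho) x ->
    \int[mu]_y (\1_(pball P x ((1 - 2 * eta) * rho)) y * pnorm p (n1 y, n2 y))%R <
      m * ((1 - 2 * eta) * rho - eta * rho)) ->
  exists x r, [/\ pball P x0 (eta * rho) x, pball P x (eta * rho) x0,
    eta * rho < r < (1 - 2 * eta) * rho, generic_pair x r &
    exists2 m', m' < m & forall K, exists2 k, (K <= k)%N & (Nvar P E x k r <= m'%:E)%E].
Proof.
move=> rho0 eta0 eta3 BO small.
have [w w0 wP] := polygon_dir adm.
have er0 : 0 < eta * rho by rewrite mulr_gt0.
pose D := `|w.1| + `|w.2| + 1.
have D0 : 0 < D by rewrite ltr_wpDl.
have d0 : 0 < eta * rho / D by rewrite divr_gt0.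
pose r0 := (1 - eta) * rho.
have r00 : 0 < r0 by rewrite mulr_gt0//; lra.
have r0rho : r0 < rho by rewrite /r0 -[ltRHS]mul1r ltr_pM2r//; lra.
have AC i e : (i <= 5)%N -> {ae leb, forall s, {ae leb, forall r, pball P x0 r0 (aff x0 w (P i) s r) ->
     (dsum E e (aff x0 w (P i) s r) < +oo)%E}}.
  by move=> i5; exact: (ae_corner_regular adm mE W e r00 r0rho BO w0 (wP i i5)).
have AA : {ae leb, forall s, forall i : 'I_5,
    {ae leb, forall r, pball P x0 r0 (aff x0 w (P i) s r) -> (dsum E (edge i) (aff x0 w (P i) s r) < +oo)%E} /\
    {ae leb, forall r, pball P x0 r0 (aff x0 w (P i.+1) s r) -> (dsum E (- edge i)%R (aff x0 w (P i.+1) s r) < +oo)%E}}.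
  apply: ae_forall => i.
  have h1 := AC i (edge i) (ltnW (ltn_ord i)); have h2 := AC i.+1 (- edge i) (ltn_ord i).
  exact: (ae_and h1 h2).
have [s /andP[s0 sd] Hs] := ae_pick d0 AA.
pose x := x0 + s *: w.
have gw (z : plane) j : (j < 5)%N -> `|z.1| = `|w.1| -> `|z.2| = `|w.2| -> gauge j (s *: z) < eta * rho.
  move=> j5 z1 z2; rewrite pgaugeZ; have hz := polygon_small adm z j5; rewrite z1 z2 in hz.
  rewrite ltr_pdivlMr// in sd; apply: le_lt_trans sd; rewrite ler_wpM2l ?(ltW s0)//.
  by apply: (le_trans hz); rewrite lerDl.
have xx0 : pball P x0 (eta * rho) x.
  by move=> j j5; rewrite /x addrC addKr; exact: gw.
have x0x : pball P x (eta * rho) x0.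
  move=> j j5; have -> : x0 - x = s *: (- w) by rewrite /x opprD addrA subrr add0r scalerN.
  by apply: gw => //=; rewrite normrN.
have BxO : pball P x r0 `<=` Omega.
  move=> y hy; apply: BO => j j5.
  have -> : y - x0 = (y - x) + (x - x0) by rewrite addrA subrK.
  rewrite pgaugeD; have := ltrD (hy j j5) (xx0 j j5).
  by have -> : r0 + eta * rho = rho by rewrite /r0; ring.
(* One [eta] pays for the displacement of the centre, the other leaves room for the translations
   behind the regularity of sides and corners. *)
pose r2 := (1 - 2 * eta) * rho.
have r20 : 0 < r2 by rewrite mulr_gt0//; lra.
have r2r0 : r2 < r0 by rewrite /r2 /r0 ltr_pM2r//; lra.
have B2O : pball P x r2 `<=` Omega by move=> y hy; apply: BxO; exact: subset_pball (ltW r2r0) _ hy.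
have r12 : eta * rho < r2 by rewrite /r2 ltr_pM2r//; lra.
have cornerE i r : aff x0 w (P i) s r = corner x r i by rewrite affE /corner /x addrA.
have corner_in i r : (i <= 5)%N -> 0 < r -> r < r2 -> pball P x0 r0 (corner x r i).
  move=> i5 rp rr j j5; rewrite /corner addrAC pgaugeD.
  have h1 := xx0 j j5; have h2 := polygon_in adm j5 i5.
  have h3 : gauge j (r *: P i) <= r by rewrite pgaugeZ ler_piMr// ltW.
  have -> : r0 = eta * rho + r2 by rewrite /r0 /r2; ring.
  by apply: ltrD => //; exact: (le_lt_trans h3).
have aeQ : {ae leb, forall r, r < r2 -> 0 < r -> generic_pair x r}.
  have S1 : {ae leb, forall r, forall i : 'I_5, r < r2 -> side_regular P E x r i (edge i) /\ side_regular P E x r i (- P i)}.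
    apply: ae_forall => i.
    have h1 := ae_side_regular adm mE W (edge i) r20 r2r0 BxO (ltn_ord i).
    have h2 := ae_side_regular adm mE W (- P i) r20 r2r0 BxO (ltn_ord i).
    by apply: (ae_imp _ (ae_and h1 h2)) => r [a b] rr; split; [exact: a|exact: b].
  have S2 : {ae leb, forall r, forall i : 'I_5, r < r2 -> 0 < r -> (dsum E (edge i) (corner x r i) < +oo)%E /\
     (dsum E (- edge i)%R (corner x r i.+1) < +oo)%E}.
    apply: ae_forall => i; have [h1 h2] := Hs i.
    apply: (ae_imp _ (ae_and h1 h2)) => r [a b] rr rp; rewrite !cornerE in a b; split.
      by apply: a; apply: corner_in => //; exact: ltnW (ltn_ord i).
    by apply: b; apply: corner_in => //; exact: ltn_ord i.
  apply: (ae_imp _ (ae_and S1 S2)) => r [a b] rr rp; split => i i5; first exact: (a (Ordinal i5)).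
  exact: (b (Ordinal i5)).
have [r [rb Qr jumps]] := few_jumps p1 adm mE W (ltW er0) r12 B2O (small x xx0) aeQ.
exists x, r; split => //; apply: Qr; have /andP[h _] := rb; exact: lt_trans h.
Qed.

End generic_polygon.

(** * Jumps of the trace along the boundary curve *)

Lemma jump_arith (R : realDomainType) (ca cb A B x y D : R) :
  `|ca - A| <= x -> `|cb - B| <= y -> `|B - A| <= D -> `|cb - ca| <= D + x + y.
Proof.
move=> h1 h2 h3; have -> : cb - ca = (cb - B) + (B - A) - (ca - A) by ring.
apply: (le_trans (ler_normB _ _)); rewrite [leRHS]addrAC lerD//.
by apply: (le_trans (ler_normD _ _)); rewrite [D + y]addrC lerD.
Qed.

Section one_dimensional_jumps.
Context {R : realType}.
Local Notation leb := (@lebesgue_measure R).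
Local Notation mR := (measurableTypeR R).

Definition cavg (h : R) (g : R -> R) : R :=
  \int[leb]_t (h^-1 * (\1_(`[0%R, h]%classic : set mR) t * g t)).

Lemma intg_itv (a b : R) : intg leb (\1_(`[a, b]%classic : set mR) : mR -> R).
Proof.
have mi : measurable (`[a, b]%classic : set mR) by exact: measurable_itv.
apply: intg_ge0; [exact: measurable_indic|by move=> t; case/andP: (indic_itv01 (`[a, b]%classic) t)|].
rewrite integral_indic// setIT [X in (X < _)%E]lebesgue_measure_itv/=.
by case: ifP => _; rewrite ?ltry// -EFinB ltry.
Qed.

Lemma intg_on_itv (a b : R) (I : set mR) (g : mR -> R) (C : R) : measurable I ->
  I `<=` `[a, b]%classic -> measurable_fun setT g -> (forall t, `|g t| <= C) ->
  intg leb (fun t => \1_I t * g t).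
Proof.
move=> mI Iab mg gC; have C0 : 0 <= C by exact: le_trans (gC 0).
apply: (@intg_le _ _ _ _ _ (fun t => C * \1_(`[a, b]%classic : set mR) t)).
- by apply: measurable_funM => //; exact: measurable_indic.
- move=> t; rewrite normrM mulrC !indicE; case: (boolP (t \in I)) => [/set_mem It|_].
    by rewrite mem_set ?normr1 ?mulr1//; exact: Iab.
  by rewrite normr0 mulr0 mulr_ge0.
- by apply: intgZ; exact: intg_itv.
Qed.

Lemma Rint_affine (a b : R) (f : mR -> R) : a != 0 -> measurable_fun setT f -> (forall t, 0 <= f t) ->
  (\int[leb]_t (f (a * t + b))%:E = (`|a|^-1)%:E * \int[leb]_t (f t)%:E)%E.
Proof.
move=> a0 mf f0; by apply: (@ge0_integral_affine1 _ a b (fun t => (f t)%:E)) => //; exact/measurable_EFinP.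
Qed.

Lemma Rint_shift1 (b : R) (f : mR -> R) : measurable_fun setT f -> (forall t, 0 <= f t) ->
  \int[leb]_t f (t + b) = \int[leb]_t f t.
Proof.
move=> mf f0; rewrite /Rintegral; congr fine.
have := Rint_affine b (oner_neq0 R) mf f0; rewrite normr1 invr1 mul1e => <-.
by apply: eq_integral => t _; rewrite mul1r.
Qed.

Lemma Rint_reflect1 (b : R) (f : mR -> R) : measurable_fun setT f -> (forall t, 0 <= f t) ->
  \int[leb]_t f (b - t) = \int[leb]_t f t.
Proof.
move=> mf f0; rewrite /Rintegral; congr fine.
have n1 : (-1 : R) != 0 by rewrite oppr_eq0 oner_eq0.
have := Rint_affine b n1 mf f0; rewrite normrN1 invr1 mul1e => <-.
by apply: eq_integral => t _; congr ((f _)%:E); ring.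
Qed.

Lemma indic_itvE (b1 b2 : bool) (x y t : R) :
  \1_([set` Interval (BSide b1 x) (BSide b2 y)] : set mR) t =
  (((x < t ?<= if b1) && (t < y ?<= if ~~ b2))%:R : R).
Proof.
by rewrite indicE; congr ((nat_of_bool _)%:R); apply/idP/idP => [/set_mem|h]; [|apply/mem_set]; rewrite /= in_itv.
Qed.

Lemma itv_mass (a h : R) : 0 < h -> \int[leb]_t \1_(`[a, a + h]%classic : set mR) t = h.
Proof.
move=> h0; have mi : measurable (`[a, a + h]%classic : set mR) by exact: measurable_itv.
apply: EFin_inj; rewrite -(Rint_EFin (intg_itv _ _)) integral_indic// setIT.
by rewrite [LHS]lebesgue_measure_itv/= lte_fin ltrDl h0 -EFinB addrAC subrr add0r.
Qed.

Lemma cavg_shift (V : mR -> R) (a c h : R) : 0 < h -> measurable_fun setT V -> (forall t, 0 <= V t <= 1) ->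
  0 <= c <= 1 ->
  cavg h (fun t => `|V (a + t) - c|) =
  h^-1 * \int[leb]_t (\1_(`[a, a + h]%classic : set mR) t * `|V t - c|).
Proof.
move=> h0 mV V01 c01.
have mVc : measurable_fun setT (fun t => `|V t - c|).
  by apply: measurableT_comp => //; apply: measurable_funB.
have b1 t : `| `|V t - c| | <= 1 by rewrite normr_id; exact: norm_sub_unit.
have mi : measurable (`[a, a + h]%classic : set mR) by exact: measurable_itv.
have ii := intg_on_itv (a := a) (b := a + h) mi (fun x h => h) mVc b1.
have f0 t : 0 <= h^-1 * (\1_(`[a, a + h]%classic : set mR) t * `|V t - c|).
  rewrite mulr_ge0 ?invr_ge0 ?(ltW h0)// mulr_ge0//; by case/andP: (indic_itv01 (`[a, a + h]%classic) t).
have mf : measurable_fun setT (fun t => h^-1 * (\1_(`[a, a + h]%classic : set mR) t * `|V t - c|)).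
  by apply: measurable_funM => //; exact: (intg_meas ii).
rewrite -(RintZ h^-1 ii) -(Rint_shift1 a mf f0) /cavg; apply: eq_Rintegral => t _.
rewrite [t + a]addrC; congr (_ * (_ * _)); rewrite !indic_itvE /=.
by rewrite lerDl lerD2l.
Qed.

(** [J] is the interval up to a null set: below it is half-open, whereas [cavg] uses the closed
    one. *)
Lemma mean_gap (V : mR -> R) (a c h : R) (J : set mR) : 0 < h -> measurable_fun setT V ->
  (forall t, 0 <= V t <= 1) -> 0 <= c <= 1 -> measurable J -> J `<=` `[a, a + h]%classic ->
  leb (`[a, a + h]%classic `\` J) = 0%E ->
  `|c - h^-1 * \int[leb]_t (\1_J t * V t)| <= cavg h (fun t => `|V (a + t) - c|).
Proof.
move=> h0 mV V01 c01 mJ JI null; rewrite cavg_shift//.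
pose I : set mR := `[a, a + h]%classic.
have mi : measurable I by exact: measurable_itv.
have bV t : `|V t| <= 1 by have /andP[? ?] := V01 t; rewrite ger0_norm.
have iJ := intg_on_itv (a := a) (b := a + h) mJ JI mV bV.
have iI := intg_on_itv (a := a) (b := a + h) mi (fun x h => h) mV bV.
have aeJ : {ae leb, forall t, \1_I t * V t = \1_J t * V t}.
  exists (I `\` J); split => //; first exact: measurableD.
  move=> t /= ne; apply: contrapT => nIJ; apply: ne; congr (_ * _); rewrite !indicE; congr ((nat_of_bool _)%:R).
  apply/idP/idP => /set_mem; last by move=> /JI It; exact/mem_set.
  by move=> It; apply/mem_set; apply: contrapT => nJ; apply: nIJ.
have EJ : \int[leb]_t (\1_J t * V t) = \int[leb]_t (\1_I t * V t).
  rewrite /Rintegral; congr fine; apply: ae_eq_integral => //.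
  - by apply/measurable_EFinP; exact: (intg_meas iJ).
  - by apply/measurable_EFinP; exact: (intg_meas iI).
  - by move: aeJ; apply: filterS => t /= ->.
rewrite EJ.
have ic := intgZ c (intg_itv a (a + h)).
have hV : c = h^-1 * \int[leb]_t (c * \1_I t).
  by rewrite (RintZ c (intg_itv a (a + h))) itv_mass// mulrCA mulVf ?mulr1// lt0r_neq0.
rewrite {1}hV -mulrBr normrM ger0_norm ?invr_ge0 ?(ltW h0)// ler_wpM2l ?invr_ge0 ?(ltW h0)//.
rewrite -(RintB ic iI); apply: (le_trans (le_normr_Rintegral measurableT (intgB ic iI))).
rewrite le_eqVlt; apply/orP; left; apply/eqP; apply: eq_Rintegral => t _.
have /andP[i0 _] := indic_itv01 I t.
by rewrite [c * _]mulrC -mulrBr normrM (ger0_norm i0) distrC.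
Qed.

(** The integral of [V (t + h) - V t] over []a, b[] telescopes to the integral of [V] over the
    window of length [h] after [b] minus that after [a]. The means of [V] over these windows are
    close to [cb] and [ca]. *)
Lemma jump_le (V : mR -> R) (a b ca cb h : R) : 0 < h -> a + h <= b -> measurable_fun setT V ->
  (forall t, 0 <= V t <= 1) -> 0 <= ca <= 1 -> 0 <= cb <= 1 ->
  `|cb - ca| <= \int[leb]_t (\1_(`]a, b[%classic : set mR) t * (h^-1 * `|V (t + h) - V t|)) +
     cavg h (fun t => `|V (a + t) - ca|) + cavg h (fun t => `|V (b + t) - cb|).
Proof.
move=> h0 ab mV V01 ca01 cb01.
(* Half-open windows make the identity between indicators behind [E2] hold at every point. *)
pose Ja : set mR := `]a, a + h]%classic; pose Jb : set mR := `[b, b + h[%classic.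
have mJa : measurable Ja by exact: measurable_itv.
have mJb : measurable Jb by exact: measurable_itv.
have sub (x y : R) (b1 b2 : bool) : [set` Interval (BSide b1 x) (BSide b2 y)] `<=` (`[x, y]%classic : set mR).
  by move=> t /=; rewrite !in_itv/= => /andP[h1 h2]; rewrite (lteifW h1) (lteifW h2).
have Ga : `|ca - h^-1 * \int[leb]_t (\1_Ja t * V t)| <= cavg h (fun t => `|V (a + t) - ca|).
  apply: mean_gap => //; first exact: sub.
  have -> : `[a, a + h]%classic `\` Ja = [set a].
    apply/seteqP; split => t /=; rewrite /Ja /= !in_itv/=.
      by move=> [/andP[h1 h2]] /negP; rewrite h2 andbT -leNgt => h3; apply/eqP; rewrite eq_le h1 h3.
    by move=> ->; rewrite lexx lerDl (ltW h0) ltxx.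
  exact: lebesgue_measure_set1.
have Gb : `|cb - h^-1 * \int[leb]_t (\1_Jb t * V t)| <= cavg h (fun t => `|V (b + t) - cb|).
  apply: mean_gap => //; first exact: sub.
  have -> : `[b, b + h]%classic `\` Jb = [set b + h].
    apply/seteqP; split => t /=; rewrite /Jb /= !in_itv/=.
      by move=> [/andP[h1 h2]] /negP; rewrite h1 /= -leNgt => h3; apply/eqP; rewrite eq_le h2 h3.
    by move=> ->; rewrite lexx lerDl (ltW h0) ltxx.
  exact: lebesgue_measure_set1.
have bV t : `|V t| <= 1 by have /andP[? ?] := V01 t; rewrite ger0_norm.
have iJa := intg_on_itv mJa (@sub _ _ _ _) mV bV.
have iJb := intg_on_itv mJb (@sub _ _ _ _) mV bV.
pose I1 : set mR := `]a + h, b + h[%classic; pose I0 : set mR := `]a, b[%classic.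
have mI1 : measurable I1 by exact: measurable_itv.
have mI0 : measurable I0 by exact: measurable_itv.
have i1 := intg_on_itv mI1 (@sub _ _ _ _) mV bV.
have i0 := intg_on_itv mI0 (@sub _ _ _ _) mV bV.
have mVh : measurable_fun setT (fun t : mR => V (t + h)).
  by apply: (measurableT_comp mV); apply: measurable_funD.
have iVh := intg_on_itv mI0 (@sub _ _ _ _) mVh (fun t => bV _).
have E1 : \int[leb]_t (\1_I1 t * V t) = \int[leb]_t (\1_I0 t * V (t + h)).
  have f0 t : 0 <= \1_I1 t * V t.
    by rewrite mulr_ge0//; case/andP: (V01 t).
  rewrite -(Rint_shift1 h (intg_meas i1) f0); apply: eq_Rintegral => t _; congr (_ * _).
  by rewrite /I1 /I0 !indic_itvE /= !ltrD2r.
have E2 : \int[leb]_t (\1_Jb t * V t) - \int[leb]_t (\1_Ja t * V t) =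
    \int[leb]_t (\1_I0 t * (V (t + h) - V t)).
  have -> : \int[leb]_t (\1_I0 t * (V (t + h) - V t)) =
      \int[leb]_t (\1_I0 t * V (t + h)) - \int[leb]_t (\1_I0 t * V t).
    by rewrite -(RintB iVh i0); apply: eq_Rintegral => t _; rewrite mulrBr.
  rewrite -E1 -(RintB iJb iJa) -(RintB i1 i0); apply: eq_Rintegral => t _.
  rewrite -!mulrBl; congr (_ * _); rewrite /Jb /Ja /I1 /I0 !indic_itvE /=.
  have [t1|t1] := leP t (a + h); have [t2|t2] := ltP a t; have [t3|t3] := ltP t b; have [t4|t4] := ltP t (b + h);
    rewrite /= ?subrr ?subr0 ?sub0r//; lra.
have iD : intg leb (fun t => \1_I0 t * (h^-1 * `|V (t + h) - V t|)).
  apply: (intg_on_itv mI0 (@sub _ _ _ _) (C := h^-1)).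
    by apply: measurable_funM => //; apply: measurableT_comp => //; apply: measurable_funB.
  move=> t; rewrite normrM normr_id ger0_norm ?invr_ge0 ?(ltW h0)// ler_piMr ?invr_ge0 ?(ltW h0)//.
  exact: norm_sub_unit.
have iD' : intg leb (fun t => \1_I0 t * (V (t + h) - V t)).
  apply: (intg_on_itv mI0 (@sub _ _ _ _) (C := 1)); first by apply: measurable_funB.
  by move=> t; exact: norm_sub_unit.
have D1 : `|h^-1 * \int[leb]_t (\1_Jb t * V t) - h^-1 * \int[leb]_t (\1_Ja t * V t)| <=
    \int[leb]_t (\1_I0 t * (h^-1 * `|V (t + h) - V t|)).
  rewrite -mulrBr E2 -(RintZ h^-1 iD').
  apply: (le_trans (le_normr_Rintegral measurableT (intgZ _ iD'))).
  rewrite le_eqVlt; apply/orP; left; apply/eqP; apply: eq_Rintegral => t _.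
  have /andP[j0 _] := indic_itv01 I0 t.
  by rewrite !normrM (ger0_norm j0) ger0_norm ?invr_ge0 ?(ltW h0)// mulrCA.
exact: (jump_arith Ga Gb D1).
Qed.

End one_dimensional_jumps.

Lemma four_intervals (R : realDomainType) (a b c L s : R) : 0 < a -> a < b -> b < c -> c < L ->
  ((0 < s < a)%R + (a < s < b)%R + (b < s < c)%R + (c < s < L)%R <= (0 < s < L)%R)%N.
Proof.
move=> a0 ab bc cL.
have [s0|s0] := ltP 0 s; last first.
  have H (t : R) : 0 < t -> (t < s) = false by move=> t0; apply/negbTE; rewrite -leNgt (le_trans s0)// ltW.
  by rewrite !H// ?(lt_trans a0)// (lt_trans _ bc)// (lt_trans a0).
have [sa|sa] := ltP s a.
  have H (t : R) : a <= t -> (t < s) = false by move=> h; apply/negbTE; rewrite -leNgt (le_trans (ltW sa)).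
  by rewrite !H ?lexx ?(ltW ab)// ?(ltW (lt_trans ab bc))//= (lt_trans sa)// (lt_trans ab)// (lt_trans bc).
have [sb|sb] := ltP s b.
  have H (t : R) : b <= t -> (t < s) = false by move=> h; apply/negbTE; rewrite -leNgt (le_trans (ltW sb)).
  have -> : s < L by rewrite (lt_trans sb)// (lt_trans bc).
  by rewrite (H b (lexx _)) (H c (ltW bc)) /=; case: (a < s).
have [sc|sc] := ltP s c.
  have H : (c < s) = false by apply/negbTE; rewrite -leNgt ltW.
  by rewrite H !andbF /= andbT !addn0 !add0n (lt_trans sc)//; case: (b < s).
by rewrite !andbF !add0n; case: (c < s); case: (s < L).
Qed.

Lemma alternation_arith (R : realFieldType) (j1 j2 j3 j4 i1 i2 i3 i4 T m S e d0 da db dc d5 : R) :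
  j1 <= i1 + d0 + da -> j2 <= i2 + da + db -> j3 <= i3 + db + dc -> j4 <= i4 + dc + d5 ->
  i1 + i2 + i3 + i4 <= T -> T <= m + S -> S <= 4 * e ->
  d0 <= e -> da <= e -> db <= e -> dc <= e -> d5 <= e -> j1 + j2 + j3 + j4 <= m + 12 * e.
Proof. by move=> *; lra. Qed.

Lemma lt_half_sub (R : realFieldType) (x y : R) : x < y / 2 -> x < y - x.
Proof. by move=> h; lra. Qed.

Section averages_along_rays.
Context {R : realType}.
Local Notation plane := (R * R)%type.
Local Notation mplane := (measurableTypeR R * measurableTypeR R)%type.
Local Notation leb := (@lebesgue_measure R).
Local Notation mR := (measurableTypeR R).
Variable E : set plane.
Hypothesis mE : measurable (E : set mplane).

Lemma series_small (a : nat -> \bar R) : (forall k, (0 <= a k)%E) ->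
  (\sum_(0 <= k <oo) a k < +oo)%E -> forall e : R, 0 < e -> \forall k \near \oo, (a k < e%:E)%E.
Proof.
move=> a0 fin e e0; have := nneseries_tail_cvg fin (fun k _ => a0 k).
move=> /fine_cvgP[tf /cvgrPdist_lt /(_ e e0)].
move: tf => [N1 _ H1] [N2 _ H2]; exists (maxn N1 N2) => // k /=; rewrite geq_max => /andP[k1 k2].
have := H2 k k2; rewrite /= sub0r normrN => h; have f1 := H1 k k1.
apply: (@le_lt_trans _ _ (\sum_(k <= i <oo) a i)%E).
  rewrite (nneseries_split _ 1); last by move=> i _; exact: a0.
  by rewrite addn1 big_nat1 leeDl// nneseries_ge0.
rewrite -(fineK f1) lte_fin; exact: le_lt_trans (ler_norm _) h.
Qed.

Lemma hkS k : (@hk R k.+1)^-1 = 2 * (hk k)^-1.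
Proof. by rewrite /hk !invrK -natrM -expnS. Qed.

Lemma hkS_lt k : @hk R k.+1 < hk k.
Proof.
by rewrite /hk ltf_pV2 ?posrE ?ltr0n ?expn_gt0// ltr_nat ltn_exp2l.
Qed.

(** One dyadic step is given up: apart from 0, where [f] vanishes, the closed interval of length
    [hk k.+1] lies in the open one of length [hk k], and the normalisations differ by the factor
    2. *)
Lemma cavg_of_dsum (z e : plane) (f : mR -> R) (dl : R) : (dsum E e z < +oo)%E -> 0 < dl ->
  measurable_fun setT f -> (forall t, 0 <= f t <= 1) ->
  (forall t, 0 <= t <= dl -> f t = udiff E (t *: e) z) ->
  forall eps : R, 0 < eps -> \forall k \near \oo, cavg (hk k) f < eps.
Proof.
move=> fin dl0 mf f01 fE eps eps0.
have e2 : 0 < eps / 2 by rewrite divr_gt0.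
have [N1 _ H1] := series_small (fun k => ray_avg_ge0 E e k z) fin e2.
have [N2 _ H2] := @hk_small R dl dl0.
exists (maxn N1 N2).+1 => // -[//|k] /=; rewrite ltnS geq_max => /andP[k1 k2].
have h1 := H1 k k1; have h2 := H2 k k2; have hk0 := @hk_gt0 R k; have hS0 := @hk_gt0 R k.+1.
have hS := hkS_lt k.
have mfd : measurable_fun [set: mR] (fun t => udiff E (t *: e) z).
  apply: (@measurable_udiff_comp _ E mE _ _ (fun t : mR => t *: e) (fun=> z)) => //.
  exact: measurable_scale.
have mi : measurable (`[0%R, hk k.+1]%classic : set mR) by exact: measurable_itv.
have bf t : `|f t| <= 1 by have /andP[? ?] := f01 t; rewrite ger0_norm.
have ii := intg_on_itv (a := 0) (b := hk k.+1) mi (fun x h => h) mf bf.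
rewrite -lte_fin /cavg -(Rint_EFin (intgZ _ ii)).
apply: (@le_lt_trans _ _ (2%:E * ray_avg E e k z))%E; last first.
  move: h1; rewrite /ray_avg; have := avg_ge0 k (fun t => udiff_ge0 E (t *: e) z).
  case: (avg _ _) => [s| |]//; rewrite -EFinM lee_fin !lte_fin => _ h; lra.
rewrite /ray_avg /avg -nintZ//; last 2 first.
- exact: measurable_avg_fun.
- by move=> t; apply: (@avg_fun_ge0 _ k (fun t => udiff E (t *: e) z)); exact: udiff_ge0.
apply: nint_le.
- by apply: measurable_funM => //; exact: (intg_meas ii).
- by apply: measurable_funM => //; exact: measurable_avg_fun.
- move=> t; rewrite mulr_ge0 ?invr_ge0 ?(ltW hS0)// mulr_ge0//.
  by case/andP: (f01 t).
- move=> t; rewrite hkS -mulrA ler_wpM2l// ler_wpM2l ?invr_ge0 ?(ltW hk0)//.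
  rewrite !indic_itvE /=; have u0 := udiff_ge0 E (t *: e) z.
  have [t0|t0|<-] := ltgtP 0 t; last 2 first.
  + by rewrite /= !mul0r.
  + have -> : f 0 = 0 by rewrite fE ?lexx ?ltW// scale0r /udiff addr0 subrr normr0.
    by rewrite mulr0 /= ?ltxx ?mul0r.
  rewrite /=; have [th|th] := leP t (hk k.+1); last by rewrite mul0r mulr_ge0.
  rewrite (le_lt_trans th hS) !mul1r fE// (ltW t0)/=.
  by apply: ltW; apply: le_lt_trans th (lt_trans hS h2).
Qed.

End averages_along_rays.

Section boundary_curve.
Context {R : realType} (p : R) (P : nat -> R * R).
Local Notation plane := (R * R)%type.
Local Notation mplane := (measurableTypeR R * measurableTypeR R)%type.
Local Notation leb := (@lebesgue_measure R).
Local Notation mR := (measurableTypeR R).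
Hypothesis adm : admissible_polygon P p.
Local Notation edge := (pedge P).
Variables (E : set plane) (x : plane) (r : R).
Hypothesis mE : measurable (E : set mplane).
Hypothesis r0 : 0 < r.

Definition clamp (s : R) : R := Num.min (Num.max s 0) r.

(** The boundary run through with one side per parameter interval of length [r]. The clamped term
    [j] is 0 before side [j] and complete after it, which gives one measurable formula without
    cases. *)
Definition curve (s : R) : plane :=
  (x.1 + r * (P 0%N).1 + \sum_(j < 5) clamp (s - j%:R * r) * (edge j).1,
   x.2 + r * (P 0%N).2 + \sum_(j < 5) clamp (s - j%:R * r) * (edge j).2).

Lemma curve_side i (y : R) : (i < 5)%N -> 0 <= y <= r ->
  curve (i%:R * r + y) = aff x (P i) (edge i) r y.
Proof.
move=> i5 /andP[y0 yr].
have cl_lt j : (j < i)%N -> clamp (i%:R * r + y - j%:R * r) = r.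
  move=> ji; rewrite /clamp; have h : r <= i%:R * r + y - j%:R * r.
    have : j.+1%:R * r <= i%:R * r by rewrite ler_pM2r// ler_nat.
    by rewrite -natr1 mulrDl mul1r; lra.
  by rewrite max_l ?min_r// (le_trans (ltW r0)).
have cl_gt j : (i < j)%N -> clamp (i%:R * r + y - j%:R * r) = 0.
  move=> ij; rewrite /clamp; have h : i%:R * r + y - j%:R * r <= 0.
    have : i.+1%:R * r <= j%:R * r by rewrite ler_pM2r// ler_nat.
    by rewrite -natr1 mulrDl mul1r; lra.
  by rewrite max_r// min_l// ltW.
have cl_eq : clamp (i%:R * r + y - i%:R * r) = y.
  by rewrite addrAC subrr add0r /clamp max_l// min_l.
have S (c : plane -> R) (cP : forall a b, c (a - b) = c a - c b) n : (n <= i)%N ->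
   \sum_(j < n) clamp (i%:R * r + y - j%:R * r) * c (edge j) = r * (c (P n) - c (P 0%N)).
  elim: n => [|n ih] ni; first by rewrite big_ord0 subrr mulr0.
  rewrite big_ord_recr /= ih ?(ltnW ni)// cl_lt// /pedge cP; ring.
have S2 (c : plane -> R) (cP : forall a b, c (a - b) = c a - c b) n : (i < n)%N ->
   \sum_(j < n) clamp (i%:R * r + y - j%:R * r) * c (edge j) =
     r * (c (P i) - c (P 0%N)) + y * c (edge i).
  elim: n => [//|n ih]; rewrite ltnS leq_eqVlt => /orP[/eqP <-|ni].
    by rewrite big_ord_recr /= S// cl_eq.
  by rewrite big_ord_recr /= ih// cl_gt// mul0r addr0.
apply: injective_projections.
  change (x.1 + r * (P 0%N).1 + \sum_(j < 5) clamp (i%:R * r + y - j%:R * r) * (edge j).1 =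
    x.1 + r * (P i).1 + y * (edge i).1).
  by rewrite (S2 (fun z => z.1))//; cbv beta; ring.
change (x.2 + r * (P 0%N).2 + \sum_(j < 5) clamp (i%:R * r + y - j%:R * r) * (edge j).2 =
  x.2 + r * (P i).2 + y * (edge i).2).
by rewrite (S2 (fun z => z.2))//; cbv beta; ring.
Qed.

Definition trace (s : R) : R := \1_E (curve s).

Lemma trace01 s : 0 <= trace s <= 1. Proof. exact: indic_bound. Qed.

Lemma measurable_curve : measurable_fun [set: mR] (curve : mR -> mplane).
Proof.
have mcl (j : 'I_5) : measurable_fun [set: mR] (fun s : mR => clamp (s - j%:R * r)).
  apply: measurable_minr => //; apply: measurable_maxr => //.
  exact: measurable_funB.
apply: (@measurable_pair_plane _ _ _ (fun s => (curve s).1) (fun s => (curve s).2)).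
  by apply: measurable_funD => //; apply: measurable_sum => j; apply: measurable_funM; [exact: mcl|exact: measurable_cst].
by apply: measurable_funD => //; apply: measurable_sum => j; apply: measurable_funM; [exact: mcl|exact: measurable_cst].
Qed.

Lemma measurable_trace : measurable_fun [set: mR] trace.
Proof.
have m1 : measurable_fun setT (\1_E : mplane -> R) by exact: measurable_indic.
exact: (measurableT_comp m1 measurable_curve).
Qed.

Definition good (s : R) : Prop := exists i y, [/\ (i < 5)%N, 0 < y < r, s = i%:R * r + y &
  (dsum E (edge i) (aff x (P i) (edge i) r y) < +oo)%E].

Let meas_gap (f : mR -> mR) c : measurable_fun setT f ->
  measurable_fun [set: mR] (fun t => `|trace (f t) - c|).
Proof.
move=> mf; apply: measurableT_comp => //; apply: measurable_funB => //.
exact: (measurableT_comp measurable_trace mf).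
Qed.

Let gap01 (f : R -> R) c : 0 <= c <= 1 -> forall t, 0 <= `|trace (f t) - c| <= 1.
Proof. by move=> c01 t; rewrite normr_ge0/=; exact: (norm_sub_unit (trace01 _)). Qed.

Lemma right_regular i y : (i < 5)%N -> 0 <= y < r ->
  (dsum E (edge i) (aff x (P i) (edge i) r y) < +oo)%E ->
  forall e : R, 0 < e -> \forall k \near \oo,
    cavg (hk k) (fun t => `|trace (i%:R * r + y + t) - trace (i%:R * r + y)|) < e.
Proof.
move=> i5 /andP[y0 yr] fin.
apply: (cavg_of_dsum mE (dl := r - y) fin); rewrite ?subr_gt0//.
- by apply: (meas_gap (f := fun t : mR => i%:R * r + y + t)); apply: measurable_funD.
- exact: (gap01 (fun t => i%:R * r + y + t) (trace01 _)).
move=> t /andP[t0 ty]; rewrite /trace /udiff -addrA !curve_side// ?y0 ?(ltW yr)//; last first.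
  by rewrite addr_ge0//= -lerBrDl.
by congr (`|\1_E _ - _|); rewrite !affE scalerDl !addrA.
Qed.

Lemma left_regular i : (i < 5)%N -> (dsum E (- edge i)%R (corner P x r i.+1) < +oo)%E ->
  forall e : R, 0 < e -> \forall k \near \oo,
    cavg (hk k) (fun t => `|trace (i.+1%:R * r - t) - trace (i.+1%:R * r)|) < e.
Proof.
move=> i5 fin.
apply: (cavg_of_dsum mE (dl := r) fin) => //.
- by apply: (meas_gap (f := fun t : mR => i.+1%:R * r - t)); apply: measurable_funB.
- exact: (gap01 (fun t => i.+1%:R * r - t) (trace01 _)).
have ci : curve (i.+1%:R * r) = corner P x r i.+1.
  rewrite -natr1 mulrDl mul1r curve_side ?lexx ?(ltW r0)// affE /corner; congr (_ + _).
  by rewrite -scalerDr /pedge addrC subrK.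
move=> t /andP[t0 tr]; rewrite /trace /udiff ci.
have -> : i.+1%:R * r - t = i%:R * r + (r - t) by rewrite -natr1; ring.
rewrite curve_side//; last by rewrite subr_ge0 tr gerBl.
congr (`|\1_E _ - _|); rewrite affE /corner -addrA; congr (_ + _).
rewrite scalerBl addrA -scalerDr /pedge [P i + _]addrC subrK.
by rewrite scalerN.
Qed.

Let g (h s : R) : R := h^-1 * `|trace (s + h) - trace s|.

(** A window from [s] to [s + h] either stays inside one side or meets one of the inner corners. *)
Lemma curve_cover n (h s : R) : 0 < s < n%:R * r - h -> 0 < h ->
  (exists2 i, (i < n)%N & i%:R * r < s < i%:R * r + r - h) \/
  (exists2 i, (i.+1 < n)%N & i.+1%:R * r - h <= s <= i.+1%:R * r).
Proof.
move=> sb h0; elim: n sb => [|n ih] /andP[s0 sn].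
  by rewrite mul0r sub0r in sn; have := lt_trans s0 sn; rewrite oppr_gt0 ltNge (ltW h0).
have [sn'|sn'] := ltP s (n%:R * r - h).
  case: ih => [|[i i1 i2]|[i i1 i2]]; first by rewrite s0.
    by left; exists i => //; exact: ltnW.
  by right; exists i => //; exact: ltnW.
have [sn2|sn2] := leP s (n%:R * r).
  case: n {ih} sn sn' sn2 => [|n] sn sn' sn2; first by move: s0; rewrite ltNge; rewrite mul0r in sn2; rewrite sn2.
  by right; exists n => //; rewrite sn' sn2.
left; exists n => //; rewrite sn2 /=; move: sn; rewrite -natr1 mulrDl mul1r; lra.
Qed.

Hypothesis gp : generic_pair P E x r.

Let mg h : measurable_fun [set: mR] (g h).
Proof.
apply: measurable_funM => //; apply: measurableT_comp => //; apply: measurable_funB.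
  by apply: (measurableT_comp measurable_trace); apply: measurable_funD.
exact: measurable_trace.
Qed.

Let g_bound h : 0 < h -> forall s, `|g h s| <= h^-1.
Proof.
move=> h0 s; have hi : 0 <= h^-1 by rewrite invr_ge0 ltW.
rewrite /g normrM normr_id ger0_norm// ler_piMr//.
exact: norm_sub_unit (trace01 _) (trace01 _).
Qed.

Let g_ge0 h s : 0 < h -> 0 <= g h s.
Proof. by move=> h0; rewrite mulr_ge0 ?invr_ge0 ?(ltW h0). Qed.

Let itvS (b1 b2 : bool) (a b a' b' : R) : a' <= a -> b <= b' ->
  [set` Interval (BSide b1 a) (BSide b2 b)] `<=` (`[a', b']%classic : set mR).
Proof.
move=> aa bb t /=; rewrite !in_itv/= => /andP[h1 h2].
by rewrite (le_trans aa (lteifW h1)) (le_trans (lteifW h2) bb).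
Qed.

Let ig (b1 b2 : bool) (a b h : R) : 0 < h ->
  intg leb (fun s => \1_([set` Interval (BSide b1 a) (BSide b2 b)] : set mR) s * g h s).
Proof.
move=> h0; apply: (@intg_on_itv _ a b _ (g h) h^-1).
- exact: measurable_itv.
- exact: itvS.
- exact: mg.
- exact: g_bound.
Qed.

Lemma side_varE2 i k : (i < 5)%N ->
  (\int[leb]_s (\1_(`]i%:R * r, (i%:R * r + r - hk k)%R[%classic : set mR) s * g (hk k) s)%:E =
   side_var P E x i k r)%E.
Proof.
move=> i5; have h0 := @hk_gt0 R k.
have f0 s : 0 <= \1_(`]i%:R * r, (i%:R * r + r - hk k)%R[%classic : set mR) s * g (hk k) s.
  by rewrite mulr_ge0 ?g_ge0//; case/andP: (indic_itv01 (`]i%:R * r, (i%:R * r + r - hk k)%R[%classic) s).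
have mf := intg_meas (@ig false true (i%:R * r) (i%:R * r + r - hk k) _ h0).
have := Rint_affine (i%:R * r) (oner_neq0 R) mf f0; rewrite normr1 invr1 mul1e => <-.
apply: eq_integral => y _; congr EFin; rewrite mul1r [y + _]addrC !indic_itvE /=.
rewrite ltrDl -addrA ltrD2l /g; case: (ltP 0 y) => y0; last by rewrite /= !mul0r mulr0.
case: (ltP y (r - hk k)) => yr; last by rewrite /= !mul0r mulr0.
rewrite /= !mul1r; congr (_ * _); rewrite /trace /udiff -addrA.
have y1 : y <= r by rewrite (le_trans (ltW yr))// gerBl ltW.
have y2 : y + hk k <= r by rewrite -lerBrDr ltW.
rewrite !curve_side ?(ltW y0)//; last by rewrite y2 addr_ge0// ltW.
by rewrite !affE scalerDl !addrA.
Qed.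

(** For a window across a corner, the difference is compared with the value at the corner itself,
    which leaves the averages on the two sides of it. *)
Lemma corner_gap i (h : R) : 0 < h ->
  \int[leb]_s (\1_(`[(i.+1%:R * r - h)%R, i.+1%:R * r]%classic : set mR) s * g h s) <=
  cavg h (fun t => `|trace (i.+1%:R * r - t) - trace (i.+1%:R * r)|) +
  cavg h (fun t => `|trace (i.+1%:R * r + t) - trace (i.+1%:R * r)|).
Proof.
move=> h0; set b := i.+1%:R * r; set c := trace b; have c01 : 0 <= c <= 1 := trace01 b.
pose I : set mR := `[(b - h)%R, b]%classic.
have mI : measurable I by exact: measurable_itv.
have hi : 0 <= h^-1 by rewrite invr_ge0 ltW.
have I0 t : 0 <= (\1_I t : R) by case/andP: (indic_itv01 I t).
have mA : measurable_fun setT (fun s : mR => h^-1 * `|trace s - c|).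
  by apply: measurable_funM => //; apply: (meas_gap (f := id)); exact: measurable_id.
have mB : measurable_fun setT (fun s : mR => h^-1 * `|trace (s + h) - c|).
  by apply: measurable_funM => //; apply: (meas_gap (f := fun s : mR => s + h)); apply: measurable_funD.
have bA s : `|h^-1 * `|trace s - c| | <= h^-1.
  by rewrite normrM normr_id ger0_norm// ler_piMr//; exact: norm_sub_unit (trace01 _) c01.
have iA := intg_on_itv mI (@itvS true false _ _ _ _ (lexx _) (lexx _)) mA bA.
have iB := intg_on_itv mI (@itvS true false _ _ _ _ (lexx _) (lexx _)) mB (fun s => bA (s + h)).
have -> : cavg h (fun t => `|trace (b - t) - c|) = \int[leb]_s (\1_I s * (h^-1 * `|trace s - c|)).
  rewrite -(Rint_reflect1 b (intg_meas iA)); last by move=> s; rewrite !mulr_ge0.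
  apply: eq_Rintegral => t _; rewrite [RHS]mulrCA; congr (_ * (_ * _)); rewrite /I !indic_itvE /=.
  by rewrite lerD2l lerN2 gerBl andbC.
have -> : cavg h (fun t => `|trace (b + t) - c|) = \int[leb]_s (\1_I s * (h^-1 * `|trace (s + h) - c|)).
  rewrite -(Rint_shift1 (b - h) (intg_meas iB)); last by move=> s; rewrite !mulr_ge0.
  apply: eq_Rintegral => t _; rewrite [RHS]mulrCA; congr (_ * (_ * _)).
    by rewrite /I !indic_itvE /= lerDr -lerBrDr opprB addrC subrK.
  by congr (`|trace _ - _|); ring.
rewrite -(RintD iA iB); apply: Rint_le; [exact: (@ig true false)|exact: intgD|].
move=> s; rewrite -mulrDr ler_wpM2l// /g -mulrDr ler_wpM2l//.
by rewrite [leRHS]addrC (distrC (trace s) c); exact: ler_distD.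
Qed.

Lemma total_variation_le (k : nat) (m' : R) : hk k < r -> (Nvar P E x k r <= m'%:E)%E ->
  \int[leb]_s (\1_(`]0%R, (5%:R * r - hk k)%R[%classic : set mR) s * g (hk k) s) <=
  m' + \sum_(i < 4) (cavg (hk k) (fun t => `|trace (i.+1%:R * r - t) - trace (i.+1%:R * r)|) +
     cavg (hk k) (fun t => `|trace (i.+1%:R * r + t) - trace (i.+1%:R * r)|)).
Proof.
move=> hr Nm; set h := hk k; have h0 : 0 < h by exact: hk_gt0.
pose S i : set mR := `]i%:R * r, (i%:R * r + r - h)%R[%classic.
pose C i : set mR := `[(i.+1%:R * r - h)%R, i.+1%:R * r]%classic.
have iS i : intg leb (fun s => \1_(S i) s * g h s) by exact: ig.
have iC i : intg leb (fun s => \1_(C i) s * g h s) by exact: ig.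
have [iSS ESS] := Rint_sum (n := 5) (fun i _ => iS i).
have [iCC ECC] := Rint_sum (n := 4) (fun i _ => iC i).
apply: (@le_trans _ _ (\int[leb]_s ((\sum_(i < 5) \1_(S i) s * g h s) + (\sum_(i < 4) \1_(C i) s * g h s)))).
  apply: Rint_le; [exact: ig|exact: intgD|].
  move=> s; have g0 := g_ge0 s h0.
  have ind0 (X : set mR) : 0 <= (\1_X s : R) by case/andP: (indic_itv01 X s).
  rewrite -!mulr_suml -mulrDl ler_wpM2r// indicE.
  have s50 : 0 <= \sum_(i < 5) (\1_(S i) s : R) by apply: sumr_ge0.
  have s40 : 0 <= \sum_(i < 4) (\1_(C i) s : R) by apply: sumr_ge0.
  case: (boolP (s \in _)) => [/set_mem /=|_]; last by rewrite addr_ge0.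
  rewrite in_itv/= => /curve_cover /(_ h0) [[i i5 hi]|[i i5 hi]].
    apply: ler_wpDr => //; rewrite (bigD1 (Ordinal i5))//=.
    have -> : \1_(S i) s = 1 :> R by rewrite indicE mem_set//= in_itv.
    by rewrite lerDl sumr_ge0.
  apply: ler_wpDl => //; rewrite (bigD1 (Ordinal (i5 : (i < 4)%N)))//=.
  have -> : \1_(C i) s = 1 :> R by rewrite indicE mem_set//= in_itv.
  by rewrite lerDl sumr_ge0.
rewrite (RintD iSS iCC) ESS ECC; apply: lerD; last first.
  by apply: ler_sum => i _; exact: corner_gap.
rewrite -lee_fin; apply: le_trans Nm; rewrite -sumEFin le_eqVlt; apply/orP; left; apply/eqP.
by apply: eq_bigr => i _; rewrite -(Rint_EFin (iS i)); apply: side_varE2; exact: ltn_ord.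
Qed.

Lemma good_regular s : good s -> forall e : R, 0 < e -> \forall k \near \oo,
  cavg (hk k) (fun t => `|trace (s + t) - trace s|) < e.
Proof. by move=> [i [y [i5 /andP[y0 yr] -> fin]]]; apply: right_regular; rewrite // (ltW y0) yr. Qed.

Lemma trace_closed : trace (5%:R * r) = trace 0.
Proof.
have e0 : curve (0%:R * r + 0) = corner P x r 0.
  by rewrite curve_side ?lexx ?(ltW r0)// affE scale0r addr0.
have e5 : curve (4%:R * r + r) = corner P x r 5.
  rewrite curve_side ?lexx ?(ltW r0)// affE /corner; congr (_ + _).
  by rewrite -scalerDr /pedge addrC subrK.
have -> : 5%:R * r = 4%:R * r + r by rewrite -natr1 mulrDl mul1r.
rewrite /trace e5 /corner (polygon_closed adm) -/(corner P x r 0) -e0.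
by rewrite mul0r addr0.
Qed.

(** [jump_le] on the four intervals cut out by 0, [a], [b], [c] and [5 * r], the last point being
    corner 0 again. The four inner corners contribute 4 errors; the means contribute 8, two at each
    of [a], [b], [c] and one at each end: hence 12. *)
Lemma alternation_bound (m' a b c : R) : (forall K, exists2 k, (K <= k)%N & (Nvar P E x k r <= m'%:E)%E) ->
  0 < a -> a < b -> b < c -> c < 5%:R * r -> good a -> good b -> good c ->
  `|trace a - trace 0| + `|trace b - trace a| + `|trace c - trace b| + `|trace 0 - trace c| <= m'.
Proof.
move=> jumps a0 ab bc cL ga gb gc.
have [_ gpc] := gp.
have c0reg : forall e : R, 0 < e -> \forall k \near \oo, cavg (hk k) (fun t => `|trace (0 + t) - trace 0|) < e.
  have f0 : (dsum E (edge 0%N) (aff x (P 0%N) (edge 0%N) r 0) < +oo)%E.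
    by have [+ _] := gpc 0%N isT; rewrite /corner affE scale0r addr0.
  have z00 : (0 : R) <= 0 < r by rewrite lexx.
  by have := right_regular (isT : (0 < 5)%N) z00 f0; rewrite mul0r addr0.
have lastreg : forall e : R, 0 < e -> \forall k \near \oo, cavg (hk k) (fun t => `|trace (5%:R * r - t) - trace 0|) < e.
  by have [_ f1] := gpc 4%N isT; have := left_regular (i := 4) isT f1; rewrite trace_closed.
have cornreg : forall e : R, 0 < e -> \forall k \near \oo, forall i : 'I_4,
    cavg (hk k) (fun t => `|trace (i.+1%:R * r - t) - trace (i.+1%:R * r)|) +
     cavg (hk k) (fun t => `|trace (i.+1%:R * r + t) - trace (i.+1%:R * r)|) < e.
  move=> e e0; apply: filter_forall => i; have e2 : 0 < e / 2 by rewrite divr_gt0.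
  have [_ f1] := gpc i (ltn_trans (ltn_ord i) (ltnSn 4)).
  have L := left_regular (ltn_trans (ltn_ord i) (ltnSn 4)) f1 e2.
  have [f2 _] := gpc i.+1 (ltn_ord i).
  have f2' : (dsum E (edge i.+1) (aff x (P i.+1) (edge i.+1) r 0) < +oo)%E.
    by move: f2; rewrite /corner affE scale0r addr0.
  have z00 : (0 : R) <= 0 < r by rewrite lexx.
  have := right_regular (ltn_ord i : (i.+1 < 5)%N) z00 f2' e2; rewrite addr0 => Rr.
  by near=> k; rewrite [e]splitr; apply: ltrD; near: k.
apply: (@eps_le _ _ _ 12) => // e e0.
have : \forall k \near \oo, [/\ hk k < r, hk k < a, hk k < b - a, hk k < c - b & hk k < 5%:R * r - c - hk k] /\
  [/\ cavg (hk k) (fun t => `|trace (0 + t) - trace 0|) < e,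
    cavg (hk k) (fun t => `|trace (a + t) - trace a|) < e,
    cavg (hk k) (fun t => `|trace (b + t) - trace b|) < e,
    cavg (hk k) (fun t => `|trace (c + t) - trace c|) < e &
    cavg (hk k) (fun t => `|trace (5%:R * r - t) - trace 0|) < e] /\
  (forall i : 'I_4, cavg (hk k) (fun t => `|trace (i.+1%:R * r - t) - trace (i.+1%:R * r)|) +
     cavg (hk k) (fun t => `|trace (i.+1%:R * r + t) - trace (i.+1%:R * r)|) < e).
  have hm : 0 < (5%:R * r - c) / 2 by rewrite divr_gt0// subr_gt0.
  near=> k; split; [split|split; [split|]]; near: k.
  - exact: hk_small.
  - exact: hk_small.
  - by apply: hk_small; rewrite subr_gt0.
  - by apply: hk_small; rewrite subr_gt0.
  - by apply: filterS (hk_small hm) => k; exact: lt_half_sub.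
  - exact: c0reg.
  - exact: good_regular.
  - exact: good_regular.
  - exact: good_regular.
  - exact: lastreg.
  - exact: cornreg.
move=> [K _ HK]; have [k Kk Nm] := jumps K.
have [[h1 h2 h3 h4 h5] [[d0 da db dc d5] dcorn]] := HK k Kk.
set h := hk k in h1 h2 h3 h4 h5 d0 da db dc d5 dcorn *; have h0 : 0 < h by exact: hk_gt0.
have TV := total_variation_le h1 Nm; rewrite -/h in TV.
have mt := measurable_trace.
have J1 := jump_le h0 (_ : 0 + h <= a) mt trace01 (trace01 0) (trace01 a).
have J2 := jump_le h0 (_ : a + h <= b) mt trace01 (trace01 a) (trace01 b).
have J3 := jump_le h0 (_ : b + h <= c) mt trace01 (trace01 b) (trace01 c).
have J4 := jump_le h0 (_ : c + h <= 5%:R * r - h) mt trace01 (trace01 c) (trace01 0).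
have {}J1 := J1 ltac:(by rewrite add0r ltW).
have {}J2 := J2 ltac:(by rewrite addrC -lerBrDr ltW).
have {}J3 := J3 ltac:(by rewrite addrC -lerBrDr ltW).
have {}J4 := J4 ltac:(by rewrite addrC -lerBrDr addrAC ltW).
(* The last window is [[5 r - h, 5 r]], so at the closing corner regularity from the left is used,
   after a reflection. *)
have E5 : cavg h (fun t => `|trace (5%:R * r - h + t) - trace 0|) = cavg h (fun t => `|trace (5%:R * r - t) - trace 0|).
  have mG : measurable_fun setT (fun t : mR => `|trace (5%:R * r - t) - trace 0|).
    by apply: (meas_gap (f := fun t : mR => 5%:R * r - t)); apply: measurable_funB.
  have bG (t : mR) : `| `|trace (5%:R * r - t) - trace 0| | <= 1.
    by rewrite normr_id; exact: norm_sub_unit (trace01 _) (trace01 _).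
  have mi : measurable (`[0%R, h]%classic : set mR) by exact: measurable_itv.
  have i1 := intgZ h^-1 (intg_on_itv mi (@itvS true false _ _ _ _ (lexx _) (lexx _)) mG bG).
  rewrite {2}/cavg -(Rint_reflect1 h (intg_meas i1)); last first.
    by move=> t; rewrite mulr_ge0 ?invr_ge0 ?(ltW h0)// mulr_ge0.
  apply: eq_Rintegral => t _; congr (_ * (_ * _)).
    by rewrite !indic_itvE /= subr_ge0 gerBl andbC.
  by congr (`|trace _ - _|); ring.
rewrite E5 in J4.
pose I1 : set mR := `]0%R, a[%classic; pose I2 : set mR := `]a, b[%classic.
pose I3 : set mR := `]b, c[%classic; pose I4 : set mR := `]c, (5%:R * r - h)%R[%classic.
have i1 : intg leb (fun s => \1_I1 s * g h s) by exact: ig.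
have i2 : intg leb (fun s => \1_I2 s * g h s) by exact: ig.
have i3 : intg leb (fun s => \1_I3 s * g h s) by exact: ig.
have i4 : intg leb (fun s => \1_I4 s * g h s) by exact: ig.
have ic4 : c < 5%:R * r - h by rewrite ltrBrDr addrC -ltrBrDr (lt_trans h5)// gtrBl.
have Sum : \int[leb]_s (\1_I1 s * g h s) + \int[leb]_s (\1_I2 s * g h s) +
    \int[leb]_s (\1_I3 s * g h s) + \int[leb]_s (\1_I4 s * g h s) <=
    \int[leb]_s (\1_(`]0%R, (5%:R * r - h)%R[%classic : set mR) s * g h s).
  rewrite -(RintD i1 i2) -(RintD (intgD i1 i2) i3) -(RintD (intgD (intgD i1 i2) i3) i4).
  apply: Rint_le; [by do 3 (apply: intgD => //)|exact: ig|].
  move=> s; rewrite -!mulrDl ler_wpM2r ?g_ge0// /I1 /I2 /I3 /I4 !indic_itvE /= -!natrD ler_nat.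
  exact: four_intervals.
have Scorn : \sum_(i < 4) (cavg h (fun t => `|trace (i.+1%:R * r - t) - trace (i.+1%:R * r)|) +
     cavg h (fun t => `|trace (i.+1%:R * r + t) - trace (i.+1%:R * r)|)) <= 4 * e.
  apply: (@le_trans _ _ (\sum_(i < 4) e)); last by rewrite sumr_const card_ord mulr_natl.
  by apply: ler_sum => i _; rewrite ltW.
exact: (alternation_arith J1 J2 J3 J4 Sum TV Scorn (ltW d0) (ltW da) (ltW db) (ltW dc) (ltW d5)).
Unshelve. all: by end_near. Qed.

End boundary_curve.

(** * Convex position of the boundary curve *)

Section curve_geometry.
Context {R : realType} (p : R) (P : nat -> R * R).
Local Notation plane := (R * R)%type.
Hypothesis adm : admissible_polygon P p.
Local Notation gauge := (pgauge P).
Local Notation coord := (pcoord P).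
Local Notation edge := (pedge P).
Local Notation jac := (pjac P).
Variables (x : plane) (r : R).
Hypothesis r0 : 0 < r.
Local Notation Gamma := (curve P x r).

Lemma curve_param (s : R) : 0 <= s <= 5%:R * r -> exists i y,
  [/\ (i < 5)%N, 0 <= y <= r, s = i%:R * r + y & y < r \/ i = 4%N].
Proof.
move=> /andP[s0 s5].
have H n : s < n%:R * r -> exists i y, [/\ (i < n)%N, 0 <= y < r & s = i%:R * r + y].
  elim: n => [|n ih sn]; first by rewrite mul0r ltNge s0.
  have [/ih[i [y [i1 i2 i3]]]|ns] := ltP s (n%:R * r).
    by exists i, y; split => //; exact: ltnW.
  exists n, (s - n%:R * r); split => //; last by rewrite addrC subrK.
  by rewrite subr_ge0 ns ltrBlDr; move: sn; rewrite -natr1 mulrDl mul1r addrC.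
have [/H[i [y [i1 /andP[i2 i3] i4]]]|s5'] := ltP s (5%:R * r).
  by exists i, y; split => //; [rewrite i2 ltW|left].
exists 4%N, r; split => //; [by rewrite ltW//= lexx| |by right].
have sE : s = 5%:R * r by apply/eqP; rewrite eq_le s5.
have E5 : (5%:R : R) = 4%:R + 1 by rewrite natr1.
by rewrite sE E5 mulrDl mul1r.
Qed.

Lemma curve_combo i y : (i < 5)%N -> 0 <= y <= r ->
  Gamma (i%:R * r + y) = x + ((r - y) *: P i + y *: P i.+1).
Proof.
move=> i5 yr; rewrite curve_side// affE /pedge; congr (_ + _).
by rewrite scalerBr scalerBl addrA addrAC.
Qed.

Lemma side_det_ge0 i k y : (i < 5)%N -> (k < 5)%N -> 0 <= y <= r ->
  0 <= det (edge i) ((r - y) *: P k + y *: P k.+1 - r *: P i).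
Proof.
move=> i5 k5 /andP[y0 yr]; have J0 := polygon_jac adm i5.
set z := (r - y) *: P k + y *: P k.+1.
have gz : gauge i z <= r.
  rewrite /z pgaugeD !pgaugeZ.
  have h1 := polygon_in adm i5 (ltnW k5); have h2 := polygon_in adm i5 k5.
  have h3 : (r - y) * gauge i (P k) <= r - y by rewrite ler_piMr// subr_ge0.
  have h4 : y * gauge i (P k.+1) <= y by rewrite ler_piMr.
  by apply: (le_trans (lerD h3 h4)); rewrite subrK.
have -> : det (edge i) (z - r *: P i) = r * det (P i) (edge i) - det z (edge i).
  by rewrite /det /= /GRing.scale/=; ring.
by rewrite pjac_edge subr_ge0 -ler_pdivrMr//.
Qed.

(** The orientation of three points is affine in each of them; with each point on a segment between
    two vertices it is a combination, with nonnegative weights, of the orientations of eight triples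
    of vertices. *)
Lemma orient8 (A A' B B' C C' : plane) (a b c : R) :
  r * det ((r - b) *: B + b *: B' - ((r - a) *: A + a *: A')) ((r - c) *: C + c *: C' - ((r - a) *: A + a *: A')) =
  (r - a) * (r - b) * (r - c) * det (B - A) (C - A) + (r - a) * (r - b) * c * det (B - A) (C' - A) +
  (r - a) * b * (r - c) * det (B' - A) (C - A) + (r - a) * b * c * det (B' - A) (C' - A) +
  a * (r - b) * (r - c) * det (B - A') (C - A') + a * (r - b) * c * det (B - A') (C' - A') +
  a * b * (r - c) * det (B' - A') (C - A') + a * b * c * det (B' - A') (C' - A').
Proof. by rewrite /det /= /GRing.scale/=; ring. Qed.

(** On three different sides, [orient8] reduces the claim to vertices. There the end of one side may
    be the start of the next, which is why [polygon_orient] admits equal indices. Two points on one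
    side are handled by [side_det_ge0]. *)
Lemma orient_curve (a b c : R) : 0 <= a -> a <= b -> b <= c -> c <= 5%:R * r ->
  0 <= det (Gamma b - Gamma a) (Gamma c - Gamma a).
Proof.
move=> a0 ab bc c5.
have idx (s t : R) i y j w : s <= t -> (i < 5)%N -> 0 <= y <= r -> s = i%:R * r + y ->
    (j < 5)%N -> 0 <= w <= r -> t = j%:R * r + w -> w < r \/ j = 4%N -> (i <= j)%N.
  move=> st i5 /andP[y0 yr] sE j5 /andP[w0 wr] tE [wlt|->]; last by rewrite -ltnS.
  rewrite leqNgt; apply/negP => ji.
  have : j.+1%:R * r <= i%:R * r by rewrite ler_pM2r// ler_nat.
  by rewrite -natr1 mulrDl mul1r; move: st; rewrite sE tE; lra.
have [i [y [i5 yr aE _]]] := curve_param (s := a) ltac:(by rewrite a0 (le_trans ab)// (le_trans bc)).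
have [j [w [j5 wr bE bj]]] := curve_param (s := b) ltac:(by rewrite (le_trans a0)// (le_trans bc)).
have [k [v [k5 vr cE ck]]] := curve_param (s := c) ltac:(by rewrite (le_trans a0 (le_trans ab bc)) c5).
have ij := idx _ _ _ _ _ _ ab i5 yr aE j5 wr bE bj.
have jk := idx _ _ _ _ _ _ bc j5 wr bE k5 vr cE ck.
rewrite aE bE cE !curve_combo//.
have sh (A B : plane) : (x + B) - (x + A) = B - A by rewrite opprD addrACA subrr add0r.
rewrite !sh.
have /andP[y0 yr'] := yr; have /andP[w0 wr'] := wr; have /andP[v0 vr'] := vr.
have [ijE|ijN] := eqVneq i j.
  rewrite -ijE; rewrite -ijE in bE.
  have yw : 0 <= w - y by rewrite subr_ge0; move: ab; rewrite aE bE lerD2l.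
  have -> : det ((r - w) *: P i + w *: P i.+1 - ((r - y) *: P i + y *: P i.+1))
      ((r - v) *: P k + v *: P k.+1 - ((r - y) *: P i + y *: P i.+1)) =
      (w - y) * det (edge i) ((r - v) *: P k + v *: P k.+1 - r *: P i).
    by rewrite /det /pedge /= /GRing.scale/=; ring.
  by apply: mulr_ge0 => //; exact: side_det_ge0.
have [jkE|jkN] := eqVneq j k.
  rewrite -jkE; rewrite -jkE in cE.
  have wv : 0 <= v - w by rewrite subr_ge0; move: bc; rewrite bE cE lerD2l.
  have -> : det ((r - w) *: P j + w *: P j.+1 - ((r - y) *: P i + y *: P i.+1))
      ((r - v) *: P j + v *: P j.+1 - ((r - y) *: P i + y *: P i.+1)) =
      (v - w) * det (edge j) ((r - y) *: P i + y *: P i.+1 - r *: P j).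
    by rewrite /det /pedge /= /GRing.scale/=; ring.
  by apply: mulr_ge0 => //; exact: side_det_ge0.
have ijl : (i < j)%N by rewrite ltn_neqAle ijN.
have jkl : (j < k)%N by rewrite ltn_neqAle jkN.
have ry : 0 <= r - y by rewrite subr_ge0.
have rw : 0 <= r - w by rewrite subr_ge0.
have rv : 0 <= r - v by rewrite subr_ge0.
have O a' b' c' := polygon_orient adm (a := a') (b := b') (c := c').
rewrite -(pmulr_rge0 _ r0) orient8.
have i1 : (i <= j.+1)%N by exact: leq_trans ij (leqnSn j).
have j1 : (j <= k.+1)%N by exact: leq_trans jk (leqnSn k).
have k1 : (k <= 5)%N by exact: ltnW.
by repeat (apply: addr_ge0); apply: mulr_ge0; try (by apply: mulr_ge0 => //; exact: mulr_ge0); apply: O => //; rewrite ltnS.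
Qed.

Lemma pgauge_combo_lt i j y : (i < 5)%N -> (j < 5)%N -> i != j -> 0 < y < r ->
  gauge j ((r - y) *: P i + y *: P i.+1) < r.
Proof.
move=> i5 j5 ij /andP[y0 yr]; rewrite pgaugeD !pgaugeZ.
have h1 := polygon_in adm j5 (ltnW i5); have h2 := polygon_in adm j5 i5.
have h3 := polygon_dis adm i5 j5 ij.
have yr' : 0 < r - y by rewrite subr_gt0.
have H1 : (r - y) * gauge j (P i) <= r - y by rewrite ler_piMr// ltW.
have H2 : y * gauge j (P i.+1) <= y by rewrite ler_piMr// ltW.
have [u1|u1] := ltP (gauge j (P i)) 1.
  have : (r - y) * gauge j (P i) < r - y by rewrite gtr_pMr.
  by move=> /(ltr_leD)/(_ H2); rewrite subrK.
have v1 : gauge j (P i.+1) < 1 by clear - h3 u1; lra.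
have : y * gauge j (P i.+1) < y by rewrite gtr_pMr.
by move=> /(ler_ltD H1); rewrite subrK.
Qed.

(** In the interior of side [i] every other gauge is less than [r], so points on different sides can
    only coincide at corners, where [polygon_inj] decides. *)
Lemma curve_inj (a b : R) : 0 <= a -> a < b -> b <= 5%:R * r -> Gamma a = Gamma b ->
  a = 0 /\ b = 5%:R * r.
Proof.
move=> a0 ab b5 E.
have [i [y [i5 yr aE _]]] := curve_param (s := a) ltac:(by rewrite a0 (le_trans (ltW ab))).
have [j [w [j5 wr bE _]]] := curve_param (s := b) ltac:(by rewrite (le_trans a0 (ltW ab)) b5).
have Eo := E; rewrite aE bE !curve_combo// in Eo; move/addrI : Eo => Eo.
have onside k t : (k < 5)%N -> gauge k ((r - t) *: P k + t *: P k.+1) = r.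
  move=> k5; have -> : (r - t) *: P k + t *: P k.+1 = r *: P k + t *: edge k.
    by rewrite /pedge scalerBr scalerBl addrA addrAC.
  by rewrite pgaugeD !pgaugeZ (pgauge_vertex adm k5) pgauge_edge mulr1 mulr0 addr0.
have oncoord k t : (k < 5)%N -> coord k ((r - t) *: P k + t *: P k.+1) = t.
  move=> k5; have -> : (r - t) *: P k + t *: P k.+1 = r *: P k + t *: edge k.
    by rewrite /pedge scalerBr scalerBl addrA addrAC.
  by rewrite pcoordD !pcoordZ pcoord_vertex (pcoord_edge adm k5) mulr1 mulr0 add0r.
have nij : i != j.
  apply/eqP => ij; move: Eo; rewrite -ij => /(congr1 (coord i)); rewrite !oncoord// => yw.
  by move: ab; rewrite aE bE -ij yw ltxx.
have corner_of k t : (k < 5)%N -> 0 <= t <= r -> ~ (0 < t < r) ->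
    exists2 k', (k' <= 5)%N & k%:R * r + t = k'%:R * r /\ (r - t) *: P k + t *: P k.+1 = r *: P k'.
  move=> k5 /andP[t0 tr] nt; have [t00|t00] := eqVneq t 0.
    by exists k; [exact: ltnW|rewrite t00 addr0 subr0 scale0r addr0].
  have -> : t = r.
    apply/eqP; rewrite eq_le tr leNgt; apply/negP => tr'; apply: nt.
    by rewrite lt0r t00 t0 tr'.
  by exists k.+1 => //; rewrite subrr scale0r add0r -natr1 mulrDl mul1r.
have ny : ~ (0 < y < r).
  move=> hy; have := pgauge_combo_lt i5 j5 nij hy; rewrite Eo onside// ltxx.
  by [].
have nw : ~ (0 < w < r).
  move=> hw; rewrite eq_sym in nij; have := pgauge_combo_lt j5 i5 nij hw; rewrite -Eo onside// ltxx.
  by [].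
have [i' i'5 [ai Pi]] := corner_of i y i5 yr ny.
have [j' j'5 [bj Pj]] := corner_of j w j5 wr nw.
rewrite Pi Pj in Eo.
have PP : P i' = P j' by apply: (scalerI (lt0r_neq0 r0)).
have lt : (i' < j')%N by move: ab; rewrite aE bE ai bj ltr_pM2r// ltr_nat.
have [i0' j5'] := polygon_inj adm lt j'5 PP.
by rewrite aE bE ai bj i0' j5' mul0r.
Qed.

End curve_geometry.

(** * Agreement of traces with a half plane *)

Lemma same_sign (R : realDomainType) (u w m : R) : `|w - u| <= m -> m < `|u| -> (0 < u) = (0 < w).
Proof.
rewrite ler_norml lter_normr => /andP[h1 h2] /orP[h3|h3]; apply/idP/idP => h4; lra.
Qed.

Lemma indic_oo_le_cc (R : realType) (a b t : R) :
  (\1_(`]a, b[%classic : set (measurableTypeR R)) t : R) <= \1_(`[a, b]%classic : set (measurableTypeR R)) t.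
Proof.
by rewrite !indic_itvE ler_nat /=; case: (boolP (_ && _)) => // /andP[/ltW -> /ltW ->].
Qed.

Section side_traces.
Context {R : realType} (p : R) (P : nat -> R * R).
Hypothesis p1 : 1 < p.
Local Notation plane := (R * R)%type.
Local Notation mplane := (measurableTypeR R * measurableTypeR R)%type.
Local Notation leb := (@lebesgue_measure R).
Local Notation mR := (measurableTypeR R).
Hypothesis adm : admissible_polygon P p.
Local Notation gauge := (pgauge P).
Local Notation coord := (pcoord P).
Local Notation edge := (pedge P).
Local Notation jac := (pjac P).
Variables (E : set plane) (x : plane) (r : R).
Hypothesis mE : measurable (E : set mplane).
Variables (n0 : plane) (c0 : R).
Let l (z : plane) : R := n0.1 * z.1 + n0.2 * z.2 + c0.
Local Notation H := (halfplane n0 c0).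
Variable i : nat.
Hypothesis i5 : (i < 5)%N.
Let z (y : R) : plane := aff x (P i) (edge i) r y.

Let side_gradE (v : plane) : v.1 * (side_grad P i).1 + v.2 * (side_grad P i).2 = gauge i v.
Proof. by rewrite /side_grad /pgauge /det /=; ring. Qed.

(* The normal [n0] is then the multiple [n0.P_i] of the normal of the side. *)
Lemma side_flux_eq0 : n0 != 0 -> (forall y, l (z y) = 0) ->
  forall q, pball P x r q -> side_flux p P (pdual p n0) (\1_E q - \1_H q) i = 0.
Proof.
move=> n00 lz q hq; have J0 := polygon_jac adm i5.
set g := side_grad P i; set c := n0.1 * (P i).1 + n0.2 * (P i).2.
have ne : n0.1 * (edge i).1 + n0.2 * (edge i).2 = 0.
  have -> : n0.1 * (edge i).1 + n0.2 * (edge i).2 = l (z 1) - l (z 0) by rewrite /l /z /aff /=; ring.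
  by rewrite !lz subrr.
have nv (v : plane) : n0.1 * v.1 + n0.2 * v.2 = c * gauge i v.
  rewrite {1 2}(polygon_decomp adm i5 v) /= /GRing.scale/=.
  transitivity (gauge i v * c + coord i v * (n0.1 * (edge i).1 + n0.2 * (edge i).2)); first by rewrite /c /pedge /=; ring.
  by rewrite ne mulr0 addr0 mulrC.
have n0E : n0 = c *: g.
  apply: injective_projections.
    by have := nv (1, 0); rewrite -side_gradE /= /GRing.scale/= !mul1r !mul0r !mulr1 !mulr0 !addr0.
  by have := nv (0, 1); rewrite -side_gradE /= /GRing.scale/= !mul1r !mul0r !mulr1 !mulr0 !add0r.
have c_0 : c != 0 by apply: contra n00 => /eqP c_0; rewrite n0E c_0 scale0r.
have lq : l q = c * (gauge i (q - x) - r).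
  rewrite mulrBr -nv; have := lz 0; rewrite /l /z /aff => h.
  apply/eqP; rewrite -subr_eq0 -[X in _ == X]h; apply/eqP; rewrite /c /=; ring.
have gq : gauge i (q - x) - r < 0 by rewrite subr_lt0; exact: hq.
have dn : c * ((pdual p n0).1 * g.1 + (pdual p n0).2 * g.2) = `|c| * pnorm p g.
  rewrite -(pnormZ p1) -n0E -(pdual_dot_self p1) /dot n0E /= /GRing.scale/=; ring.
rewrite /side_flux -/g; set D := (pdual p n0).1 * g.1 + _ in dn *.
have e01 := indic_bound E q.
move: c_0; rewrite neq_lt => /orP[cn|cp].
- have -> : \1_H q = 1 :> R by rewrite indicE mem_set// /halfplane /= -/(l q) lq nmulr_lgt0.
  have DE : D = - pnorm p g.
    by apply: (mulfI (ltr0_neq0 cn)); rewrite dn ltr0_norm// mulNr mulrN.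
  have e1 : \1_E q - 1 <= 0 :> R by rewrite subr_le0; case/andP: e01.
  by rewrite DE (ler0_norm e1); ring.
- have -> : \1_H q = 0 :> R.
    rewrite indicE memNset//; rewrite /halfplane /= -/(l q) lq; apply/negP; rewrite -leNgt.
    by rewrite pmulr_rle0// ltW.
  have DE : D = pnorm p g.
    by apply: (mulfI (lt0r_neq0 cp)); rewrite dn gtr0_norm.
  rewrite subr0; have -> : `|\1_E q| = \1_E q :> R by rewrite ger0_norm//; case/andP: e01.
  by rewrite DE subrr.
Qed.

Let M : R := `|n0.1| + `|n0.2| + 1.

Let M0 : 0 < M. Proof. by rewrite /M ltr_pwDr// addr_ge0. Qed.

(** An inward displacement by less than [h] changes [l] by at most [M * h], so it can change the
    indicator of the half plane only in this band around the boundary line. *)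
Let band (h : R) : set mplane := [set q | `|l q| <= M * h].

Let ml : measurable_fun [set: mplane] l.
Proof. by apply: continuous_plane_measurable => q; exact: continuous_affine2. Qed.

Let mz : measurable_fun [set: mR] (z : mR -> mplane).
Proof.
by apply: (measurableT_comp (@measurable_aff _ x (P i) (edge i)) (_ : measurable_fun _ (fun y : mR => (r, y)))); exact: measurable_pair_plane.
Qed.

Let mband h : measurable (band h).
Proof.
have -> : band h = (fun q => `|l q|) @^-1` `]-oo, M * h].
  by apply/seteqP; split => q; rewrite /band /= in_itv.
rewrite -[X in measurable X]setTI.
have mn : measurable_fun [set: mplane] (fun q => `|l q|) by apply: measurableT_comp.
by apply: mn => //; exact: measurable_itv.
Qed.

Let affB (t y : R) : aff x (P i) (edge i) (r - t) y = z y + t *: - P i.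
Proof. by rewrite /z !affE; apply: injective_projections; rewrite /= /GRing.scale/=; ring. Qed.

Let lB (q : plane) (t h : R) : 0 < t < h -> `|l (q + t *: - P i) - l q| <= M * h.
Proof.
move=> /andP[t0 th]; have [P1 P2] := polygon_le1 adm (ltnW i5).
have -> : l (q + t *: - P i) - l q = - (t * (n0.1 * (P i).1 + n0.2 * (P i).2)).
  by rewrite /l /= /GRing.scale/=; ring.
rewrite normrN normrM (gtr0_norm t0) mulrC; apply: ler_pM => //; [exact: ltW| |exact: ltW].
apply: (le_trans (ler_normD _ _)); rewrite !normrM /M.
apply: (@le_trans _ _ (`|n0.1| + `|n0.2|)); last by rewrite lerDl.
by apply: lerD; rewrite ler_piMr.
Qed.

Let halfB (q : plane) (t h : R) : 0 < t < h ->
  `|\1_H q - \1_H (q + t *: - P i)| <= \1_(band h) q :> R.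
Proof.
move=> th; have hl := lB q th.
have HE (w : plane) : \1_H w = (0 < l w)%R%:R :> R.
  by rewrite indicE; congr ((nat_of_bool _)%:R); apply/idP/idP => [/set_mem|h0]; [|apply/mem_set].
have [b|b] := boolP (q \in band h).
  rewrite [leRHS]indicE b; exact: norm_sub_unit (indic_bound _ _) (indic_bound _ _).
have nb : M * h < `|l q| by rewrite ltNge; apply: contra b => b; exact/mem_set.
rewrite !HE; suff -> : (0 < l q) = (0 < l (q + t *: - P i)) by rewrite subrr normr0.
exact: same_sign hl nb.
Qed.

Let ind : mR -> R := \1_(`]0%R, r[%classic : set mR).

Let d (q : plane) : R := \1_E q - \1_H q.

Let avg_gap k y : (avg k (fun t => ind y * `|d (aff x (P i) (edge i) (r - t) y)|)%R <=
  (ind y)%:E * ray_avg E (- P i)%R k (z y) + (ind y * (`|d (z y)| + \1_(band (hk k)) (z y)))%:E)%E.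
Proof.
have mI (A : set plane) : measurable (A : set mplane) -> measurable_fun [set: mplane] (\1_A : mplane -> R).
  by move=> mA; exact: measurable_indic.
have md : measurable_fun [set: mplane] d.
  by apply: measurable_funB; apply: mI => //; exact: measurable_halfplane.
have mt : measurable_fun [set: mR] (fun t => `|d (aff x (P i) (edge i) (r - t) y)|).
  apply: measurableT_comp => //; apply: (measurableT_comp md).
  apply: (measurableT_comp (@measurable_aff _ x (P i) (edge i)) (_ : measurable_fun _ (fun t : mR => (r - t, y)))).
  by apply: measurable_pair_plane => //; exact: measurable_funB.
have mu : measurable_fun [set: mR] (fun t : mR => udiff E (t *: - P i) (z y)).
  by apply: (@measurable_udiff_comp _ E mE _ _ (fun t : mR => t *: - P i) (fun=> z y)) => //; exact: measurable_scale.
have [y1|y0] := boolP (y \in (`]0%R, r[%classic : set mR)); last first.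
  rewrite /ind indicE (negbTE y0) mul0e mul0r adde0.
  by under eq_fun do rewrite mul0r; rewrite avg_cst.
have -> : ind y = 1 by rewrite /ind indicE y1.
have c0' : 0 <= `|d (z y)| + \1_(band (hk k)) (z y) by rewrite addr_ge0//; case/andP: (indic_bound (band (hk k)) (z y)).
under eq_fun do rewrite mul1r.
rewrite mul1e mul1r -(avg_cst k c0') /ray_avg.
rewrite -(avgD k mu (measurable_cst _) (fun t => udiff_ge0 _ _ _) (fun=> c0')).
apply: avg_le => //; first by apply: measurable_funD.
move=> t th; rewrite affB; set q := z y; set q' := q + _.
have -> : d q' = (\1_E q' - \1_E q) + ((\1_E q - \1_H q) + (\1_H q - \1_H q')) by rewrite /d; ring.
apply: (le_trans (ler_normD _ _)); rewrite lerD2l.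
by apply: (le_trans (ler_normD _ _)); rewrite lerD2l; exact: halfB.
Qed.

Hypothesis reg : side_regular P E x r i (- P i).
Hypothesis agree : {ae leb, forall y, 0 < y < r -> \1_E (z y) = \1_H (z y) :> R}.

(** On the side [l] is affine and not identically 0, so it vanishes at one point at most, and the
    bands shrink to a null set. *)
Let band_small : (exists y, l (z y) != 0) ->
  forall e : R, 0 < e -> \forall k \near \oo, \int[leb]_y (ind y * \1_(band (hk k)) (z y)) < e.
Proof.
move=> [y1 ly1] e e0.
have ly y : l (z y) = l (z 0) + y * (l (z 1) - l (z 0)) by rewrite /l /z /aff /=; ring.
have null : {ae leb, forall y, l (z y) != 0}.
  have [B0|B0] := eqVneq (l (z 1) - l (z 0)) 0.
    by apply: aeW => y; move: ly1; rewrite (ly y1) (ly y) B0 !mulr0 !addr0.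
  exists ([set - l (z 0) / (l (z 1) - l (z 0))] : set mR); split => //.
    by rewrite lebesgue_measure_set1.
  move=> y /= /negP; rewrite negbK (ly y) => /eqP h.
  by apply: (mulIf B0); rewrite divfK//; apply/eqP; rewrite -subr_eq0 opprK addrC h.
have mi : measurable (`]0%R, r[%classic : set mR) by exact: measurable_itv.
have mind : measurable_fun [set: mR] ind by exact: measurable_indic.
have b01 k y : 0 <= (\1_(band (hk k)) (z y) : R) <= 1 by exact: indic_bound.
have mb k : measurable_fun [set: mR] (fun y => \1_(band (hk k)) (z y) : R).
  by apply: (measurableT_comp (_ : measurable_fun [set: mplane] (\1_(band (hk k)) : mplane -> R)) mz); exact: measurable_indic.
have ind01 y : 0 <= ind y <= 1 := indic_itv01 _ y.
have ii : intg leb ind.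
  apply: (@intg_le _ _ _ _ _ (\1_(`[0%R, r]%classic : set mR))) => //; last exact: intg_itv.
  move=> y; rewrite ger0_norm; last by case/andP: (ind01 y).
  exact: indic_oo_le_cc.
have cv : {ae leb, forall y, (fun k => ind y * \1_(band (hk k)) (z y)) @ \oo --> (0 : R)}.
  apply: (ae_imp _ null) => y ny; apply: cvg_near_cst.
  have lM : 0 < `|l (z y)| / M by rewrite divr_gt0// normr_gt0.
  have := @hk_small R _ lM; apply: filterS => k.
  rewrite ltr_pdivlMr// mulrC => hk1; rewrite indicE memNset ?mulr0//.
  by rewrite /band /=; apply/negP; rewrite -ltNge.
have [_] := @Rint_dct _ _ _ leb (fun k y => ind y * \1_(band (hk k)) (z y)) (fun=> 0) ind
  (fun k => measurable_funM mind (mb k)) (measurable_cst _)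
  cv ii
  ltac:(move=> k y; have /andP[a1 a2] := ind01 y; have /andP[a3 a4] := b01 k y;
    rewrite ger0_norm ?mulr_ge0// ler_piMr//).
have -> : \int[leb]_y (fun=> 0 : R) y = 0 by rewrite /Rintegral integral0.
move=> /cvgrPdist_lt /(_ e e0); apply: filterS => k.
rewrite sub0r normrN; apply: le_lt_trans; exact: ler_norm.
Qed.

(** From the side to an interior point, the mismatch [d] changes by a difference of [1_E], small by
    [reg], and a difference of [1_H], small by [band_small]; on the side itself it is 0 almost
    everywhere by [agree]. *)
Lemma trace_gap_small : (exists y, l (z y) != 0) -> forall e : R, 0 < e -> \forall k \near \oo,
  (trace_gap P x r i k d < e%:E)%E.
Proof.
move=> nl e e0; have e2 : 0 < e / 2 by rewrite divr_gt0.
have mi : measurable (`]0%R, r[%classic : set mR) by exact: measurable_itv.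
have mind : measurable_fun [set: mR] ind by exact: measurable_indic.
have ind01 y : 0 <= ind y <= 1 := indic_itv01 _ y.
have ind0 y : 0 <= ind y by case/andP: (ind01 y).
have mI (A : set plane) : measurable (A : set mplane) -> measurable_fun [set: mplane] (\1_A : mplane -> R).
  by move=> mA; exact: measurable_indic.
have md : measurable_fun [set: mplane] d.
  by apply: measurable_funB; apply: mI => //; exact: measurable_halfplane.
have mdz : measurable_fun [set: mR] (fun y => `|d (z y)|).
  by apply: measurableT_comp => //; exact: (measurableT_comp md mz).
have mb k : measurable_fun [set: mR] (fun y => \1_(band (hk k)) (z y) : R).
  by apply: (measurableT_comp (mI _ (mband _)) mz).
have b0 k y : 0 <= (\1_(band (hk k)) (z y) : R) by case/andP: (indic_bound (band (hk k)) (z y)).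
have mr k : measurable_fun [set: mR] (fun y => ray_avg E (- P i)%R k (z y)).
  exact: (measurableT_comp (measurable_ray_avg mE (- P i) k) mz).
pose A k : \bar R := (\int[leb]_y ((ind y)%:E * ray_avg E (- P i)%R k (z y)))%E.
have A0 k : (0 <= A k)%E.
  by apply: integral_ge0 => y _; rewrite mule_ge0 ?lee_fin ?ray_avg_ge0.
have As : (\sum_(0 <= k <oo) A k < +oo)%E.
  rewrite -integral_nneseries//.
  - apply: le_lt_trans reg; rewrite le_eqVlt; apply/orP; left; apply/eqP.
    by apply: eq_integral => y _; rewrite /dsum nneseriesZl//; move=> k _; exact: ray_avg_ge0.
  - by move=> k; apply: emeasurable_funM => //; exact/measurable_EFinP.
  - by move=> k y _; rewrite mule_ge0 ?lee_fin ?ray_avg_ge0.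
have [N1 _ H1] := series_small A0 As e2.
have [N2 _ H2] := band_small nl e2.
exists (maxn N1 N2) => // k /=; rewrite geq_max => /andP[/H1 h1 /H2 h2].
have ibd : intg leb (fun y => ind y * \1_(band (hk k)) (z y)).
  apply: (@intg_le _ _ _ _ _ (\1_(`[0%R, r]%classic : set mR))); last exact: intg_itv.
    exact: measurable_funM.
  move=> y; rewrite ger0_norm; last exact: mulr_ge0.
  apply: (@le_trans _ _ (ind y)).
    by rewrite ler_piMr//; case/andP: (indic_bound (band (hk k)) (z y)).
  exact: indic_oo_le_cc.
have zero : (\int[leb]_y (ind y * `|d (z y)|)%:E = 0)%E.
  apply: etrans (integral0 leb setT).
  apply: ae_eq_integral => //.
    by apply/measurable_EFinP; exact: measurable_funM.
  apply: (ae_imp _ agree) => y hy _; rewrite /cst /=; congr EFin.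
  rewrite /ind indic_itvE /=; have [y0|y0] := ltP 0 y; last by rewrite mul0r.
  have [yr|yr] := ltP y r; last by rewrite mul0r.
  by rewrite /d hy ?y0// subrr normr0 mulr0.
have mbd : measurable_fun [set: mR] (fun y => ind y * (`|d (z y)| + \1_(band (hk k)) (z y))).
  by apply: measurable_funM => //; exact: measurable_funD.
pose Phi (w : mR * mR) : R := (hk k)^-1 * (\1_(`]0%R, hk k[%classic : set mR) w.2 *
   (ind w.1 * `|d (aff x (P i) (edge i) (r - w.2) w.1)|)).
have mPhi : measurable_fun setT Phi.
  apply: measurable_funM => //; apply: measurable_funM.
    by apply: (measurableT_comp (_ : measurable_fun _ (\1_(`]0%R, hk k[%classic : set mR) : mR -> R)) measurable_snd);
       apply: measurable_indic; exact: measurable_itv.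
  apply: measurable_funM; first exact: (measurableT_comp mind measurable_fst).
  apply: measurableT_comp => //; apply: (measurableT_comp md).
  apply: (measurableT_comp (@measurable_aff _ x (P i) (edge i)) (_ : measurable_fun _ (fun w : mR * mR => (r - w.2, w.1)))).
  by apply: measurable_pair_plane => //; exact: measurable_funB.
have Phi0 w : 0 <= Phi w.
  apply: (@avg_fun_ge0 _ k (fun t => ind w.1 * `|d (aff x (P i) (edge i) (r - t) w.1)|)).
  exact: mulr_ge0.
have m1 : measurable_fun [set: mR] (fun y => avg k (fun t => ind y * `|d (aff x (P i) (edge i) (r - t) y)|)%R).
  by apply: (@measurable_inner _ (fun w => (Phi w)%:E)) => [|w]; [exact/measurable_EFinP|rewrite lee_fin].
have mA1 : measurable_fun [set: mR] (fun y => (ind y)%:E * ray_avg E (- P i)%R k (z y))%E.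
  by apply: emeasurable_funM; [exact/measurable_EFinP|exact: mr].
have mbd' : measurable_fun [set: mR] (fun y => (ind y * (`|d (z y)| + \1_(band (hk k)) (z y)))%:E).
  exact/measurable_EFinP.
apply: (@le_lt_trans _ _ (A k + \int[leb]_y (ind y * (`|d (z y)| + \1_(band (hk k)) (z y)))%:E))%E.
  have A1 y : (0 <= (ind y)%:E * ray_avg E (- P i)%R k (z y))%E by rewrite mule_ge0 ?lee_fin ?ray_avg_ge0.
  have B1 y : (0 <= (ind y * (`|d (z y)| + \1_(band (hk k)) (z y)))%:E)%E.
    by rewrite lee_fin mulr_ge0// addr_ge0.
  rewrite /A -(@ge0_integralD _ _ _ leb setT measurableT _ _ (fun y _ => A1 y) mA1 (fun y _ => B1 y) mbd').
  apply: (@ge0_le_integral _ _ _ leb _ measurableT).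
  - by move=> y _; apply: avg_ge0 => t; exact: mulr_ge0.
  - exact: m1.
  - exact: emeasurable_funD.
  - by move=> y _; exact: avg_gap.
have -> : (\int[leb]_y (ind y * (`|d (z y)| + \1_(band (hk k)) (z y)))%:E =
    \int[leb]_y (ind y * `|d (z y)|)%:E + \int[leb]_y (ind y * \1_(band (hk k)) (z y))%:E)%E.
  rewrite -nintD//; first by apply: eq_integral => y _; rewrite mulrDr.
  - exact: measurable_funM.
  - exact: measurable_funM.
  - by move=> y; exact: mulr_ge0.
  - by move=> y; exact: mulr_ge0.
rewrite zero add0e (Rint_EFin ibd).
have := A0 k; move: h1 h2; rewrite -/(A k); case: (A k) => [a| |]//.
rewrite -EFinD !lte_fin => h1 h2 _; by rewrite [e]splitr ltrD.
Qed.

End side_traces.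

(** * From few jumps to a half plane *)

Lemma lt_last_side (R : realDomainType) (y r : R) : 4%:R * r + y < 5%:R * r -> y < r.
Proof. by move=> h; lra. Qed.

Lemma not_all_alternating (R : realDomainType) (V : R -> R) (v0 a s b m' : R) :
  `|V a - v0| + `|V s - V a| + `|V b - V s| + `|v0 - V b| <= m' -> m' < 4%:R ->
  `|V a - v0| = 1 -> `|V b - v0| = 1 -> V s = v0 -> False.
Proof.
move=> h m4 ha hb hs; move: h; rewrite hs (distrC v0 (V a)) (distrC v0 (V b)) ha hb.
by move=> /le_lt_trans /(_ m4) h; clear - h; lra.
Qed.

Lemma two_jumps (R : realDomainType) (V : R -> R) (v0 a s b m' : R) :
  `|V a - v0| + `|V s - V a| + `|V b - V s| + `|v0 - V b| <= m' -> m' < 2%:R -> `|V s - v0| = 1 -> False.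
Proof.
move=> h m2 hs; have h1 := ler_distD (V a) (V s) v0; have h2 := ler_distD (V b) (V s) v0.
move: h1 h2 h; rewrite hs (distrC v0 (V b)) (distrC (V s) (V b)) => h1 h2 h; lra.
Qed.

Section arcs.
Context {R : realType} (p : R) (P : nat -> R * R).
Local Notation plane := (R * R)%type.
Local Notation mplane := (measurableTypeR R * measurableTypeR R)%type.
Local Notation leb := (@lebesgue_measure R).
Local Notation mR := (measurableTypeR R).
Hypothesis adm : admissible_polygon P p.
Local Notation edge := (pedge P).
Variables (E : set plane) (x : plane) (r : R).
Hypothesis mE : measurable (E : set mplane).
Hypothesis r0 : 0 < r.
Hypothesis gp : generic_pair P E x r.
Local Notation V := (trace P E x r).
Local Notation good := (good P E x r).

Lemma good_bounds s : good s -> 0 < s < 5%:R * r.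
Proof.
move=> [i [y [i5 /andP[y0 yr] -> _]]]; apply/andP; split.
  by rewrite ltr_wpDl// mulr_ge0// ltW.
apply: (@lt_le_trans _ _ (i%:R * r + r)); first by rewrite ltrD2l.
by rewrite -[X in _ + X]mul1r -mulrDl natr1 ler_pM2r// ler_nat.
Qed.

Lemma ae_good i : (i < 5)%N -> {ae leb, forall y, 0 < y < r -> good (i%:R * r + y)}.
Proof.
move=> i5; have [+ _] := gp => /(_ i i5)[reg _].
have mz : measurable_fun [set: mR] (fun y => aff x (P i) (edge i) r y : mplane).
  by apply: (measurableT_comp (@measurable_aff _ x (P i) (edge i)) (_ : measurable_fun _ (fun y : mR => (r, y)))); exact: measurable_pair_plane.
have mi : measurable_fun [set: mR] (\1_(`]0%R, r[%classic : set mR) : mR -> R).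
  by apply: measurable_indic; exact: measurable_itv.
have mf : measurable_fun [set: mR] (fun y => (\1_(`]0%R, r[%classic : set mR) y)%:E * dsum E (edge i) (aff x (P i) (edge i) r y))%E.
  apply: emeasurable_funM; first exact/measurable_EFinP.
  exact: (measurableT_comp (measurable_dsum mE (edge i)) mz).
apply: (ae_imp _ (nint_fin_ae mf _ reg)).
  move=> y hy y0r; exists i, y; split => //; move: hy.
  by rewrite indicE mem_set ?mul1e//= in_itv.
by move=> y; rewrite mule_ge0 ?dsum_ge0// lee_fin; case/andP: (indic_itv01 (`]0%R, r[%classic) y).
Qed.

Lemma good_dense a b : 0 <= a -> a < b -> b <= 5%:R * r -> exists2 s, a < s < b & good s.
Proof.
move=> a0 ab b5.
have [i [y [i5 /andP[y0 yr] aE yi]]] := curve_param (s := a) r0 ltac:(by rewrite a0 (le_trans (ltW ab))).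
have yr' : y < r.
  case: yi => // i4; have := lt_le_trans ab b5; rewrite aE i4; exact: lt_last_side.
have lt : y < Num.min r (y + (b - a)) by rewrite lt_min yr' ltrDl subr_gt0.
have [w /andP[yw]] := ae_pick lt (ae_good i5).
rewrite lt_min => /andP[wr wb] /(_ _); rewrite wr (le_lt_trans y0 yw) => /(_ isT) g.
exists (i%:R * r + w) => //; apply/andP; split; first by rewrite aE ltrD2l.
apply: (@lt_le_trans _ _ (i%:R * r + (y + (b - a)))); first by rewrite ltrD2l.
by rewrite addrA -aE addrC subrK.
Qed.

(** [a] and [b] are the infimum and supremum of the good points whose value differs from that at 0.
    A good point between them with the value at 0 would produce four jumps; if [m' < 2], not even
    one such differing point exists, as it would produce two. *)
Lemma arc_exists m' : (forall K, exists2 k, (K <= k)%N & (Nvar P E x k r <= m'%:E)%E) -> m' < 4 ->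
  exists a b, [/\ 0 <= a, a <= b, b <= 5%:R * r,
    forall s, good s -> (a < s < b -> `|V s - V 0| = 1) /\ (s < a \/ b < s -> V s = V 0) &
    m' < 2 -> a = b].
Proof.
move=> jumps m4.
have V01 s : V s = 0 \/ V s = 1 by rewrite /trace indicE; case: (_ \in _); [right|left].
have gap s : `|V s - V 0| = 1 \/ V s = V 0.
  by case: (V01 s) => ->; case: (V01 0) => ->; rewrite ?subrr ?subr0 ?sub0r ?normrN ?normr1; [right|left|left|right].
pose S := [set s | good s /\ `|V s - V 0| = 1].
have Sb s : S s -> 0 < s < 5%:R * r by move=> [/good_bounds].
have L0 : 0 < 5%:R * r by rewrite mulr_gt0.
have [S0|/set0P Sn] := eqVneq S set0.
  exists 0, 0; split => //; first exact: ltW.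
  move=> s gs; split; first by move=> /andP[h1 h2]; move: (lt_trans h1 h2); rewrite ltxx.
  by case: (gap s) => // h; have : S s by []; rewrite S0.
have lbS : has_lbound S by exists 0 => s /Sb/andP[/ltW].
have ubS : has_ubound S by exists (5%:R * r) => s /Sb/andP[_ /ltW].
have [s1 Ss1] := Sn.
exists (inf S), (sup S); split.
- by apply: lb_le_inf => // s /Sb/andP[/ltW].
- by apply: (@le_trans _ _ s1); [exact: ge_inf|exact: ub_le_sup].
- by apply: ge_sup => // s /Sb/andP[_ /ltW].
- move=> s gs; split; last first.
    move=> h; case: (gap s) => // hs; have Ss : S s by [].
    by case: h; rewrite ltNge; [rewrite ge_inf|rewrite ub_le_sup].
  move=> /andP[h1 h2]; case: (gap s) => // hs; exfalso.
  have [a [ga Va] sa] := inf_lt Sn h1.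
  have [b [gb Vb] sb] := sup_gt Sn h2.
  have /andP[a0 _] := good_bounds ga; have /andP[_ b5] := good_bounds gb.
  exact: (not_all_alternating (alternation_bound adm mE r0 gp jumps a0 sa sb b5 ga gs gb) m4 Va Vb hs).
- move=> m2; exfalso; have [gs Vs] := Ss1; have /andP[s10 s15] := good_bounds gs.
  have [a /andP[a0 as1] ga] := good_dense (lexx 0) s10 (ltW s15).
  have [b /andP[bs1 b5] gb] := good_dense (ltW s10) s15 (lexx _).
  exact: (two_jumps (alternation_bound adm mE r0 gp jumps a0 as1 bs1 b5 ga gs gb) m2 Vs).
Qed.

End arcs.

Section half_plane_traces.
Context {R : realType} (p : R) (P : nat -> R * R).
Hypothesis p1 : 1 < p.
Local Notation plane := (R * R)%type.
Local Notation mplane := (measurableTypeR R * measurableTypeR R)%type.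
Local Notation leb := (@lebesgue_measure R).
Local Notation mR := (measurableTypeR R).
Hypothesis adm : admissible_polygon P p.
Local Notation edge := (pedge P).
Local Notation gauge := (pgauge P).
Variables (Omega E : set plane) (mu : {finite_measure set mplane -> \bar R}) (n1 n2 : mplane -> R).
Hypothesis mE : measurable (E : set mplane).
Hypothesis md : minimal_data p Omega E mu n1 n2.
Variables (x : plane) (r : R).
Hypothesis r0 : 0 < r.
Hypothesis gp : generic_pair P E x r.
Hypothesis KO : [set y | forall i, (i < 5)%N -> gauge i (y - x) <= r] `<=` Omega.
Local Notation V := (trace P E x r).
Local Notation good := (good P E x r).
Local Notation Gamma := (curve P x r).

Let ae_neq (c : R) : {ae leb, forall y : R, y != c}.
Proof.
exists ([set c] : set mR); split => //; first by rewrite lebesgue_measure_set1.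
by move=> y /= /negP; rewrite negbK => /eqP.
Qed.

(* Off the sides on which the affine function vanishes identically it is enough
   to compare the trace with the sign of that function at good points where the
   latter does not vanish. *)
Lemma trace_halfplane (n0 : plane) (c0 a b : R) (l := fun z : plane => n0.1 * z.1 + n0.2 * z.2 + c0) :
  (forall i, (i < 5)%N -> (forall y, l (aff x (P i) (edge i) r y) = 0) -> n0 != 0) ->
  (forall s, good s -> s != a -> s != b -> l (Gamma s) != 0 -> V s = (0 < l (Gamma s))%R%:R) ->
  forall r', r' < r ->
  \int[mu]_y (\1_(pball P x r') y * (pnorm p (n1 y, n2 y) -
     ((pdual p n0).1 * n1 y + (pdual p n0).2 * n2 y)))%R <= 0.
Proof.
move=> n0P agree r' rr.
apply: (flux_vanish p1 adm mE md (c0 := c0) r0 rr KO) => i i5.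
have [lz|] := pselect (forall y, l (aff x (P i) (edge i) r y) = 0).
  by left; apply: (side_flux_eq0 p1 adm E i5) => //; exact: (n0P i i5 lz).
move=> /existsNP[y1 /eqP ly1]; right.
have [reg _] := gp; have [_ regP] := reg i i5.
apply: (trace_gap_small adm mE i5 regP); last by exists y1.
have ly y : l (aff x (P i) (edge i) r y) =
    l (aff x (P i) (edge i) r 0) + y * (l (aff x (P i) (edge i) r 1) - l (aff x (P i) (edge i) r 0)).
  by rewrite /l /aff /=; ring.
set A := l (aff _ _ _ _ 0) in ly; set B := l _ - A in ly.
have nz : {ae leb, forall y : R, l (aff x (P i) (edge i) r y) != 0}.
  have [B0|B0] := eqVneq B 0.
    by apply: aeW => y; move: ly1; rewrite (ly y1) (ly y) B0 !mulr0 !addr0.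
  apply: (ae_imp _ (ae_neq (- A / B))) => y; rewrite (ly y); apply: contra => /eqP h.
  by apply/eqP/(mulIf B0); rewrite divfK//; apply/eqP; rewrite -subr_eq0 opprK addrC h.
apply: (ae_imp _ (ae_and (ae_good mE gp i5) (ae_and nz (ae_and (ae_neq (a - i%:R * r)) (ae_neq (b - i%:R * r)))))).
move=> y [g [lny [ya yb]]] yr; have yr' : 0 <= y <= r by case/andP: yr => /ltW -> /ltW ->.
have EG : aff x (P i) (edge i) r y = Gamma (i%:R * r + y) by rewrite curve_side.
rewrite EG; rewrite EG in lny.
have := agree _ (g yr); rewrite -![i%:R * r + y == _]subr_eq0 => /(_ _ _ lny).
rewrite /trace => ->; last 2 first.
- by apply: contra ya; rewrite subr_eq0 => /eqP <-; rewrite [i%:R * r + y]addrC addrK.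
- by apply: contra yb; rewrite subr_eq0 => /eqP <-; rewrite [i%:R * r + y]addrC addrK.
rewrite indicE; congr ((nat_of_bool _)%:R).
by apply/idP/idP => [h0|/set_mem]; [apply/mem_set|].
Qed.

(** A constant trace is that of the plane or of the empty set, obtained with [n0 = 0]. Otherwise the
    half plane is bounded by the chord between the ends of the arc, and [sg] selects its side. *)
Theorem half_plane_polygon m' :
  (forall K, exists2 k, (K <= k)%N & (Nvar P E x k r <= m'%:E)%E) -> m' < 4 ->
  exists n0 : plane, (m' < 2 -> n0 = 0) /\ forall r', r' < r ->
  \int[mu]_y (\1_(pball P x r') y * (pnorm p (n1 y, n2 y) -
     ((pdual p n0).1 * n1 y + (pdual p n0).2 * n2 y)))%R <= 0.
Proof.
move=> jumps m4; have [a [b [a0 ab b5 arc m2]]] := arc_exists adm mE r0 gp jumps m4.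
have V01 s : V s = 0 \/ V s = 1 by rewrite /trace indicE; case: (_ \in _); [right|left].
have cst (c : R) : c != 0 -> (forall s, good s -> s != a -> s != b -> V s = (0 < c)%R%:R) ->
    forall r', r' < r -> \int[mu]_y (\1_(pball P x r') y * (pnorm p (n1 y, n2 y) -
      ((pdual p (0, 0)).1 * n1 y + (pdual p (0, 0)).2 * n2 y)))%R <= 0.
  move=> c0 Vc; apply: (trace_halfplane (n0 := (0, 0)) (c0 := c) (a := a) (b := b)).
    by move=> i i5 /(_ 0); rewrite /= !mul0r !add0r => c00; rewrite c00 eqxx in c0.
  by move=> s gs sa sb _; rewrite /= !mul0r !add0r; exact: Vc.
(* The constant [2 v - 1] is positive exactly for [v = 1], so the corresponding half plane has
   constant trace [v]. *)
have sgn v : v = 0 \/ v = 1 -> (0 < v *+ 2 - 1)%R%:R = v :> R.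
  by case=> ->; [rewrite mul0rn sub0r oppr_gt0 ltNge ler01|rewrite mulr2n addrK ltr01].
have sgn0 v : v = 0 \/ v = 1 -> v *+ 2 - 1 != 0 :> R.
  by case=> ->; rewrite ?mul0rn ?sub0r ?oppr_eq0 ?oner_eq0// mulr2n addrK oner_eq0.
have VC : V 0 = 0 /\ 1 - V 0 = 1 \/ V 0 = 1 /\ 1 - V 0 = 0.
  by case: (V01 0) => ->; [left|right]; rewrite ?subr0 ?subrr.
have VN s : `|V s - V 0| = 1 -> V s = 1 - V 0.
  case: (V01 s) => ->; case: (V01 0) => ->; rewrite ?subrr ?subr0//.
  - by rewrite normr0 => /esym/eqP; rewrite oner_eq0.
  - by rewrite normr0 => /esym/eqP; rewrite oner_eq0.
have [abE|abN] := eqVneq a b.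
  exists (0, 0); split => //; apply: (cst (V 0 *+ 2 - 1)); first exact: sgn0.
  move=> s gs sa _; rewrite sgn//; have [_ +] := arc s gs; apply.
  by move: sa; rewrite neq_lt => /orP[|]; [left|rewrite -abE; right].
have altb : a < b by rewrite lt_neqAle abN.
(* Here the chord degenerates because the curve is closed; the trace has the same value at all good
   points, though not at corner 0. *)
have [[a00 b55]|full] := pselect (a = 0 /\ b = 5%:R * r).
  exists (0, 0); split => // ; apply: (cst ((1 - V 0) *+ 2 - 1)).
    by apply: sgn0; case: VC => -[_ ->]; [right|left].
  move=> s gs sa sb; rewrite sgn; last by case: VC => -[_ ->]; [right|left].
  by apply: VN; have [+ _] := arc s gs; apply; rewrite a00 b55; exact: good_bounds gs.
pose w := Gamma b - Gamma a.
have w0 : w != 0.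
  rewrite subr_eq0; apply/eqP => wE; apply: full.
  by apply: (curve_inj adm r0 a0 altb b5 (esym wE)).
pose sg : R := (1 - V 0) *+ 2 - 1.
have sgE : sg = 1 /\ V 0 = 0 \/ sg = -1 /\ V 0 = 1.
  by rewrite /sg; case: VC => -[-> ->]; [left|right]; rewrite ?mul0rn ?sub0r ?mulr2n ?addrK.
exists (sg *: (w.2, - w.1)); split; first by move=> /m2 abE; rewrite abE eqxx in abN.
apply: (trace_halfplane (c0 := sg * (w.1 * (Gamma a).2 - w.2 * (Gamma a).1)) (a := a) (b := b)).
  move=> i i5 _; apply: contra w0 => /eqP[/eqP h1 /eqP h2].
  have sg0 : sg != 0 by case: sgE => -[-> _]; rewrite ?oppr_eq0 oner_eq0.
  move: h1 h2; rewrite /GRing.scale/= !mulf_eq0 (negbTE sg0)/= oppr_eq0 => /eqP h1 /eqP h2.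
  by apply/eqP/injective_projections.
move=> s gs sa sb; have /andP[s0 s5] := good_bounds r0 gs.
set z := Gamma s.
have lE : (sg *: (w.2, - w.1)).1 * z.1 + (sg *: (w.2, - w.1)).2 * z.2 +
    sg * (w.1 * (Gamma a).2 - w.2 * (Gamma a).1) = sg * - det w (z - Gamma a).
  by rewrite /det /= /GRing.scale/=; ring.
rewrite lE => lnz; have [inside outside] := arc s gs.
have dnz : det w (z - Gamma a) != 0 by apply: contra lnz => /eqP ->; rewrite oppr0 mulr0.
(* By [orient_curve] the arc lies weakly to the right of the chord and the rest weakly to the left;
   [lnz] excludes the points on the line of the chord. *)
have key : (a < s < b /\ det w (z - Gamma a) < 0) \/ ((s < a \/ b < s) /\ 0 < det w (z - Gamma a)).
  have [sa'|sa'|sE] := ltgtP s a; last by rewrite sE eqxx in sa.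
    right; split; first by left.
    rewrite lt_neqAle eq_sym dnz/=.
    have := orient_curve adm x r0 (ltW s0) (ltW sa') ab b5.
    by have -> : det (Gamma a - Gamma s) (Gamma b - Gamma s) = det w (z - Gamma a) by rewrite /w /z /det /=; ring.
  have [sb'|sb'|sE] := ltgtP s b; last by rewrite sE eqxx in sb.
    left; split => //; rewrite lt_neqAle dnz/=.
    have := orient_curve adm x r0 a0 (ltW sa') (ltW sb') b5.
    have -> : det (Gamma s - Gamma a) (Gamma b - Gamma a) = - det w (z - Gamma a) by rewrite /w /z /det /=; ring.
    by rewrite oppr_ge0.
  right; split; first by right.
  by rewrite lt_neqAle eq_sym dnz/=; exact: (orient_curve adm x r0 a0 ab (ltW sb') (ltW s5)).
case: key => -[h1 h2].
  rewrite (VN _ (inside h1)); case: sgE => -[-> ->].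
    by rewrite mul1r oppr_gt0 h2 subr0.
  by rewrite mulN1r opprK ltNge (ltW h2) subrr.
rewrite (outside h1); case: sgE => -[-> ->].
  by rewrite mul1r oppr_gt0 ltNge (ltW h2).
by rewrite mulN1r opprK h2.
Qed.

End half_plane_traces.

(** * Local structure of the boundary *)

Section radius_arithmetic.
Variable R : realFieldType.
Implicit Types e q r k : R.

Lemma radius_sum e q r : 0 < e * q -> r < (1 - 2 * e) * q -> e * q + r <= q.
Proof.
have -> : (1 - 2 * e) * q = q - 2 * (e * q) by ring.
by move=> h1 h2; lra.
Qed.

Lemma radius_third k : 0 <= k -> 3 * ((4 - k) / 16) < 1.
Proof. by move=> h; lra. Qed.

Lemma radius_order e : 0 < e -> 3 * e < 1 -> 0 < 1 - e /\ 1 - 2 * e < 1 - e.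
Proof. by move=> h1 h2; split; lra. Qed.

Lemma radius_energy k e : 0 <= k -> 0 < e -> 4 - k = 16 * e -> k * (1 - e) < 4 * (1 - 2 * e - e).
Proof.
move=> k0 e0 h; have ke : 0 <= k * e by rewrite mulr_ge0// ltW.
have -> : k * (1 - e) = k - k * e by ring.
by lra.
Qed.

End radius_arithmetic.

Section measure_boundary.
Context {R : realType}.
Local Notation plane := (R * R)%type.
Local Notation mplane := (measurableTypeR R * measurableTypeR R)%type.
Local Notation L2 := (@lebesgue2 R).
Implicit Types (U E Omega : set plane) (y : plane).

Lemma abs_le_enorm (z : plane) : `|z.1| <= enorm z /\ `|z.2| <= enorm z.
Proof.
by split; rewrite -sqrtr_sqr ler_sqrt ?addr_ge0 ?sqr_ge0// ?lerDl ?lerDr sqr_ge0.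
Qed.

Lemma open_square U y : open U -> U y -> exists2 e : R, 0 < e &
  forall z : plane, `|z.1 - y.1| < e -> `|z.2 - y.2| < e -> U z.
Proof.
rewrite openE => oU /oU /nbhs_ballP[e /= e0 eU]; exists e => // z h1 h2.
by apply: eU; split; rewrite /ball /= distrC.
Qed.

Lemma open_eball y (e : R) : open (eball y e).
Proof.
rewrite /eball; apply: (@open_comp _ _ (fun z : plane => enorm (z - y)) [set t | t < e]); last exact: open_lt.
move=> z _; rewrite /enorm; apply: continuous_comp; last exact: sqrt_continuous.
have c1 : {for z, continuous (fun z : plane => z.1 - y.1)} by apply: cvgB; [exact: cvg_fst|exact: cvg_cst].
have c2 : {for z, continuous (fun z : plane => z.2 - y.2)} by apply: cvgB; [exact: cvg_snd|exact: cvg_cst].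
by apply: cvgD; apply: cvgM.
Qed.

Lemma open_pos U y : open U -> U y -> (0 < L2 U)%E.
Proof.
move=> oU Uy; have [e e0 eU] := open_square oU Uy.
have h0 : 0 <= e / 2 by rewrite divr_ge0// ltW.
apply: (@lt_le_trans _ _ (L2 (cbox y (e / 2)))).
  by rewrite lebesgue2_cbox// lte_fin exprn_gt0// mulr_gt0// divr_gt0.
have lt : e / 2 < e by rewrite ltr_pdivrMr// ltr_pMr// ltr1n.
apply: le_measure; rewrite ?inE; [exact: measurable_cbox|exact: open_plane_measurable|].
by move=> z [z1 z2]; apply: eU; [exact: le_lt_trans lt|exact: le_lt_trans lt].
Qed.

Lemma null_subset (A B : set mplane) : measurable A -> measurable B -> A `<=` B ->
  L2 B = 0%E -> L2 A = 0%E.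
Proof.
move=> mA mB AB B0; apply/eqP; rewrite eq_le measure_ge0 andbT -B0.
by apply: le_measure; rewrite ?inE.
Qed.

Lemma lebesgue2_split E U : measurable (E : set mplane) -> measurable (U : set mplane) ->
  (L2 U = L2 (E `&` U) + L2 (U `\` E))%E.
Proof. by move=> mE mU; rewrite addeC (setIC E); exact: measureDI. Qed.

Lemma eball_fin y (e : R) : (L2 (eball y e) < +oo)%E.
Proof.
have e0 : 0 <= `|e| by [].
apply: (@le_lt_trans _ _ (L2 (cbox y `|e|))); last by rewrite lebesgue2_cbox// ltry.
apply: le_measure; rewrite ?inE; [apply: open_plane_measurable; exact: open_eball|exact: measurable_cbox|].
move=> z; rewrite /eball /= => h; have [h1 h2] := abs_le_enorm (z - y).
have le := le_trans (ltW h) (ler_norm e).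
by split; [exact: le_trans le|exact: le_trans le].
Qed.

(** By monotonicity of the measure, round neighbourhoods may be replaced by arbitrary open ones, in
    particular by parts of polygons cut off by lines. *)
Lemma measure_boundaryP Omega E y : measurable (E : set mplane) ->
  measure_boundary_in Omega E y <->
  Omega y /\ forall U, open U -> U y -> (0 < L2 (E `&` U))%E /\ (0 < L2 (U `\` E))%E.
Proof.
move=> mE.
have mb e := open_plane_measurable (@open_eball y e).
split => [[Oy H]|[Oy H]]; split => //.
  move=> U oU Uy; have [e e0 eU] := open_square oU Uy.
  have [e' [e'0 e'e [H1 H2]]] : exists e', [/\ 0 < e', e' < e & (0 < L2 (E `&` eball y e'))%E /\
      (L2 (E `&` eball y e') < L2 (eball y e'))%E].
    have [e' [[h1 h2] h3]] := @filter_ex _ _ _ _ (filterI (filterI (nbhs_right_gt (0 : R)) (nbhs_right_lt e0)) H).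
    by exists e'.
  have sub : eball y e' `<=` U.
    move=> z; rewrite /eball /= => h; have [h1 h2] := abs_le_enorm (z - y).
    by apply: eU; [exact: le_lt_trans (lt_trans h e'e)|exact: le_lt_trans (lt_trans h e'e)].
  have mU := open_plane_measurable oU.
  split.
    apply: (lt_le_trans H1); apply: le_measure; rewrite ?inE; [exact: measurableI|exact: measurableI|].
    exact: setIS.
  apply: (@lt_le_trans _ _ (L2 (eball y e' `\` E))); last first.
    apply: le_measure; rewrite ?inE; [exact: measurableD|exact: measurableD|].
    exact: setSD.
  rewrite lt0e measure_ge0 andbT; apply/eqP => z0.
  by move: H2; rewrite [X in (_ < X)%E](lebesgue2_split mE (mb e')) z0 adde0 ltxx.
apply: filterS (nbhs_right_gt (0 : R)) => e' e0.
have ye : eball y e' y by rewrite /eball /= subrr enorm0.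
have [h1 h2] := H _ (@open_eball y e') ye; split; first exact: h1.
rewrite [X in (_ < X)%E](lebesgue2_split mE (mb e')) lteDl//.
have mEI : measurable (E `&` eball y e' : set mplane) by exact: measurableI.
rewrite ge0_fin_numE ?measure_ge0//; apply: le_lt_trans (eball_fin y e').
by apply: le_measure; rewrite ?inE.
Qed.

End measure_boundary.

Section local_regularity.
Context {R : realType} (p : R) (P : nat -> R * R).
Hypothesis p1 : 1 < p.
Local Notation plane := (R * R)%type.
Local Notation mplane := (measurableTypeR R * measurableTypeR R)%type.
Local Notation leb := (@lebesgue_measure R).
Local Notation L2 := (@lebesgue2 R).
Hypothesis adm : admissible_polygon P p.
Local Notation edge := (pedge P).
Local Notation gauge := (pgauge P).
Variables (Omega E : set plane) (mu : {finite_measure set mplane -> \bar R}) (n1 n2 : mplane -> R).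
Hypothesis mE : measurable (E : set mplane).
Hypothesis md : minimal_data p Omega E mu n1 n2.
Local Notation bd := (measure_boundary_in Omega E).

Let pn_meas : intg mu (fun y => pnorm p (n1 y, n2 y)).
Proof. by have [[i1 i2 _] _] := md; exact: (intg_pnorm p1). Qed.

(** The defect is nonnegative at every point, so a nonpositive integral puts almost every point in
    the equality case of [pdual_dot]. *)
Lemma direction_ae (x : plane) (r : R) (n0 : plane) :
  \int[mu]_y (\1_(pball P x r) y * (pnorm p (n1 y, n2 y) -
     ((pdual p n0).1 * n1 y + (pdual p n0).2 * n2 y)))%R <= 0 ->
  {ae mu, forall y, pball P x r y -> exists2 c : R, 0 <= c & (n1 y, n2 y) = c *: n0 }.
Proof.
move=> I0; have [[i1 i2 _] _] := md; set z := pdual p n0 in I0.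
pose f y := \1_(pball P x r) y * (pnorm p (n1 y, n2 y) - (z.1 * n1 y + z.2 * n2 y)).
have mB : measurable (pball P x r : set mplane) by exact: measurable_pball.
have iI : intg mu f.
  apply: (@intgM _ _ _ _ 1); first exact: measurable_indic.
    by move=> y; rewrite ger0_norm; case/andP: (indic_bound (pball P x r) y).
  by apply: intgB => //; apply: intgD; exact: intgZ.
have f0 y : 0 <= f y.
  rewrite mulr_ge0//.
  by rewrite subr_ge0; exact: (pdual_dot_le p1 n0 (n1 y, n2 y)).
have If : (\int[mu]_y `|(f y)%:E| = 0)%E.
  have -> : (\int[mu]_y `|(f y)%:E| = \int[mu]_y (f y)%:E)%E.
    by apply: eq_integral => y _; rewrite gee0_abs// lee_fin.
  rewrite (Rint_EFin iI); congr EFin; apply/eqP; rewrite eq_le; apply/andP; split; first exact: I0.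
  by apply: Rintegral_ge0 => y _; exact: f0.
have mf : measurable_fun setT (fun y => (f y)%:E) by apply/measurable_EFinP; exact: (intg_meas iI).
have := (ae_eq_integral_abs mu measurableT mf).1 If.
apply: ae_imp => y h By; have := h I; rewrite /= /f => -[].
rewrite indicE mem_set// mul1r => /eqP; rewrite subr_eq0 => /eqP pz.
have [n00|n00] := eqVneq n0 0.
  exists 0 => //; rewrite scale0r; apply: (pnorm_eq0 p1).
  by rewrite pz n00 /= sgr0 !mul0r addr0.
by have [_ /(_ n00 (esym pz))] := pdual_dot p1 n0 (n1 y, n2 y).
Qed.

Section half_plane_ball.
Variables (x : plane) (r : R) (n0 : plane).
Hypothesis r0 : 0 < r.
Local Notation S := (pball P x r).
Hypothesis SO : S `<=` Omega.
Hypothesis dir : {ae mu, forall y, S y -> exists2 c : R, 0 <= c & (n1 y, n2 y) = c *: n0 }.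
Let dt (y : plane) : R := n0.1 * y.1 + n0.2 * y.2.

(** By [pos_shift] some translation carries a part of [E] of positive measure from [A] into [B]
    outside [E]. It does not decrease [dt], hence [bv_monotone] forbids it. *)
Lemma ordered_sets (A B : set plane) : measurable (A : set mplane) -> measurable (B : set mplane) ->
  A `<=` S -> B `<=` S -> (forall a b, A a -> B b -> 0 <= dt (b - a)) ->
  (0 < L2 (E `&` A))%E -> (0 < L2 (B `\` E))%E -> False.
Proof.
move=> mA mB AS BS AB EA EB.
have mEA : measurable (E `&` A : set mplane) by exact: measurableI.
have mEB : measurable (B `\` E : set mplane) by exact: measurableD.
have [v vpos] := pos_shift mEA mEB EA EB.
have [[q [[Eq Aq] [Bq nEq]]]|none] := pselect (exists q, (E `&` A) q /\ (B `\` E) (v + q)); last first.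
  move: vpos; rewrite [X in L2 X](_ : _ = set0) ?measure0 ?ltxx//.
  by apply/seteqP; split => // q [h1 h2]; apply: none; exists q.
have v0 : 0 <= dt v by have := AB _ _ Aq Bq; rewrite addrK.
have sub : (E `&` A) `&` [set q | (B `\` E) (v + q)] `<=` E `&` S `&` [set q | S (q + v) /\ ~ E (q + v)].
  by move=> w [[Ew /AS Sw] [/= /BS Sv nE]]; split; [split|rewrite addrC].
have null : L2 (E `&` S `&` [set q | S (q + v) /\ ~ E (q + v)]) = 0%E.
  have [Wg _] := md.
  apply: (bv_monotone Wg mE (@pball_open _ _ _ _) (@pball_convex _ _ _ _) SO (ltW r0) (pball_box adm (ltW r0))).
  apply: (ae_imp _ dir) => y h /h[c c0 [-> ->]].
  by rewrite mulrCA [v.2 * _]mulrCA -mulrDr mulr_ge0// mulrC [v.2 * _]mulrC.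
move: vpos; rewrite lt0e => /andP[/eqP + _]; apply.
have mS : measurable (S : set mplane) by exact: measurable_pball.
have msh (C : set plane) : measurable (C : set mplane) -> measurable ([set q | C (v + q)] : set mplane).
  move=> mC; rewrite -[X in measurable X]setTI.
  apply: (_ : measurable_fun setT (fun q : mplane => (v + q : mplane))) => //.
  by apply: measurable_pair_plane; exact: measurable_funD.
apply: (null_subset _ _ sub null).
  by apply: measurableI => //; exact: msh.
apply: measurableI; first exact: measurableI.
have -> : [set q | S (q + v) /\ ~ E (q + v)] = [set q | (S `\` E) (v + q)] by apply/seteqP; split => w /=; rewrite addrC.
by apply: msh; exact: measurableD.
Qed.

Let dtD a b : dt (a - b) = dt a - dt b. Proof. by rewrite /dt /=; ring. Qed.

Let o_lt (t : R) : open [set y | dt y < t].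
Proof.
apply: (@open_comp _ _ (fun y : plane => dt y) [set s | s < t]); last exact: open_lt.
move=> y _; have := @continuous_affine2 R n0.1 n0.2 0 y; rewrite /dt.
by under eq_fun do rewrite addr0.
Qed.

Let o_gt (t : R) : open [set y | t < dt y].
Proof.
apply: (@open_comp _ _ (fun y : plane => dt y) [set s | t < s]); last exact: open_gt.
move=> y _; have := @continuous_affine2 R n0.1 n0.2 0 y; rewrite /dt.
by under eq_fun do rewrite addr0.
Qed.

Let oS : open S. Proof. exact: pball_open. Qed.

Lemma no_boundary_point y : n0 = 0 -> S y -> ~ bd y.
Proof.
move=> n00 Sy /(measure_boundaryP _ _ mE)[_ /(_ S oS Sy)[h1 h2]].
have mS : measurable (S : set mplane) by exact: measurable_pball.
apply: (ordered_sets mS mS _ _ _ h1 h2) => // a b _ _.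
by rewrite /dt n00 /= !mul0r addr0.
Qed.

Let separated (U W : set plane) (t : R) : open U -> open W -> U `<=` S -> W `<=` S ->
  (forall a, U a -> dt a < t) -> (forall b, W b -> t < dt b) ->
  (0 < L2 (E `&` U))%E -> (0 < L2 (W `\` E))%E -> False.
Proof.
move=> oU oW US WS Ut Wt; apply: ordered_sets => //; try exact: open_plane_measurable.
by move=> a b /Ut h1 /Wt h2; rewrite dtD subr_ge0 ltW// (lt_trans h1).
Qed.

Let same_level a b : S a -> S b -> bd a -> bd b -> dt a < dt b -> False.
Proof.
move=> Sa Sb /(measure_boundaryP _ _ mE)[_ ba] /(measure_boundaryP _ _ mE)[_ bb] ab.
have [h1 h2] := midf_lt ab; set t := (dt a + dt b) / 2 in h1 h2.
have [e1 _] := ba _ (openI oS (@o_lt t)) (conj Sa h1).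
have [_ e2] := bb _ (openI oS (@o_gt t)) (conj Sb h2).
exact: (separated (openI oS (@o_lt t)) (openI oS (@o_gt t)) (fun q h => proj1 h) (fun q h => proj1 h) (fun q h => proj2 h) (fun q h => proj2 h) e1 e2).
Qed.

(** Inside the ball [E] can only be entered in the direction [n0], so two boundary points cannot lie
    on different levels. Conversely, let [y] be on the level of [x0]. If [E] were null near [y], its
    complement slightly above [y] and [E] slightly lower near [x0] would contradict [ordered_sets];
    symmetrically for the complement. *)
Lemma boundary_line x0 y : n0 != 0 -> S x0 -> bd x0 -> S y -> bd y <-> dt (y - x0) = 0.
Proof.
move=> n00 Sx0 bx0 Sy; split.
  move=> by_; rewrite dtD; apply/eqP; rewrite subr_eq0.
  have [h|h|//] := ltgtP (dt y) (dt x0).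
    by case: (same_level Sy Sx0 by_ bx0 h).
  by case: (same_level Sx0 Sy bx0 by_ h).
rewrite dtD => /eqP; rewrite subr_eq0 => /eqP yx.
apply/(measure_boundaryP _ _ mE); split; first exact: SO.
have [_ bx] := (measure_boundaryP Omega x0 mE).1 bx0.
have n0n : 0 < dt n0.
  have -> : dt n0 = n0.1 ^+ 2 + n0.2 ^+ 2 by rewrite /dt !expr2.
  rewrite lt0r addr_ge0 ?sqr_ge0// andbT.
  apply: contra n00; rewrite paddr_eq0 ?sqr_ge0// !sqrf_eq0 => /andP[/eqP h1 /eqP h2].
  by apply/eqP/injective_projections.
have push (U : set plane) (s : R) : open U -> U y -> s != 0 -> exists2 w, U w /\ S w & (exists2 t : R, 0 < t & dt w = dt y + s * t).
  move=> oU Uy s0; have [e e0 eU] := open_square (openI oU oS) (conj Uy Sy).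
  have D0 : 0 < `|s| * (`|n0.1| + `|n0.2|) + 1 by rewrite ltr_wpDl// mulr_ge0// addr_ge0.
  pose t := e / (`|s| * (`|n0.1| + `|n0.2|) + 1).
  have t0 : 0 < t by rewrite divr_gt0.
  have bnd c : c <= `|n0.1| + `|n0.2| -> `|s| * c * t < e.
    move=> hc; rewrite /t mulrA ltr_pdivrMr// mulrC ltr_pM2l//.
    by apply: (@le_lt_trans _ _ (`|s| * (`|n0.1| + `|n0.2|))); [rewrite ler_wpM2l|rewrite ltrDl].
  exists (y + (s * t) *: n0).
    clearbody t.
    have E1 : (y + (s * t) *: n0).1 - y.1 = s * n0.1 * t by rewrite /= /GRing.scale/=; ring.
    have E2 : (y + (s * t) *: n0).2 - y.2 = s * n0.2 * t by rewrite /= /GRing.scale/=; ring.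
    apply: eU; rewrite ?E1 ?E2 !normrM (gtr0_norm t0); apply: bnd.
      by rewrite lerDl.
    by rewrite lerDr.
  exists (t * dt n0); first exact: mulr_gt0.
  by rewrite /dt /= /GRing.scale/=; ring.
move=> U oU Uy; have mU := open_plane_measurable oU.
split; rewrite lt0e measure_ge0 andbT; apply/eqP => null.
- have [w [Uw Sw] [t t0 wE]] := push U 1 oU Uy (oner_neq0 _).
  have lt : dt x0 < dt w by rewrite wE -yx ltrDl mul1r.
  have [h1 h2] := midf_lt lt; set m := (dt x0 + dt w) / 2 in h1 h2.
  have [e1 _] := bx _ (openI oS (@o_lt m)) (conj Sx0 h1).
  have oW := openI (openI oU oS) (@o_gt m).
  apply: (separated (openI oS (@o_lt m)) oW (fun q h => proj1 h) (fun q h => proj2 (proj1 h)) (fun q h => proj2 h) (fun q h => proj2 h) e1).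
  set W := (U `&` S) `&` _; have Wpos : (0 < L2 W)%E by exact: (open_pos (y := w) oW).
  have mW := open_plane_measurable oW.
  rewrite lt0e measure_ge0 andbT; apply/eqP => null'.
  have EW : L2 (E `&` W) = 0%E.
    apply: (null_subset _ _ _ null); [exact: measurableI|exact: measurableI|].
    by move=> q [Eq [[Uq _] _]].
  by move: Wpos; rewrite (lebesgue2_split mE mW) EW null' adde0 ltxx.
- have sn : (-1 : R) != 0 by rewrite oppr_eq0 oner_eq0.
  have [w [Uw Sw] [t t0 wE]] := push U (-1) oU Uy sn.
  have lt : dt w < dt x0 by rewrite wE -yx mulN1r gtrBl.
  have [h1 h2] := midf_lt lt; set m := (dt w + dt x0) / 2 in h1 h2.
  have [_ e1] := bx _ (openI oS (@o_gt m)) (conj Sx0 h2).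
  have oW := openI (openI oU oS) (@o_lt m).
  apply: (separated oW (openI oS (@o_gt m)) (fun q h => proj2 (proj1 h)) (fun q h => proj1 h) (fun q h => proj2 h) (fun q h => proj2 h) _ e1).
  set W := (U `&` S) `&` _; have Wpos : (0 < L2 W)%E by exact: (open_pos (y := w) oW).
  have mW := open_plane_measurable oW.
  rewrite lt0e measure_ge0 andbT; apply/eqP => null'.
  have EW : L2 (W `\` E) = 0%E.
    apply: (null_subset _ _ _ null); [exact: measurableD|exact: measurableD|].
    by move=> q [[[Uq _] _] nE].
  by move: Wpos; rewrite (lebesgue2_split mE mW) null' EW adde0 ltxx.
Qed.

End half_plane_ball.

Local Notation energy x r := (\int[mu]_y (\1_(pball P x r) y * pnorm p (n1 y, n2 y))%R).

Lemma pball_in (x0 x : plane) (a b c : R) : pball P x0 a x -> a + b <= c ->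
  forall y, (forall i, (i < 5)%N -> gauge i (y - x) <= b) -> pball P x0 c y.
Proof.
move=> hx abc y hy i i5; have -> : y - x0 = (y - x) + (x - x0) by rewrite addrA subrK.
rewrite pgaugeD; apply: lt_le_trans abc; rewrite addrC.
by apply: ltr_leD; [exact: hx|exact: hy].
Qed.

Lemma energy_le x r x' r' : pball P x r `<=` pball P x' r' -> energy x r <= energy x' r'.
Proof.
move=> sub; have ii y s : intg mu (fun z => \1_(pball P y s) z * pnorm p (n1 z, n2 z)).
  apply: (@intgM _ _ _ _ 1) => //; first by apply: measurable_indic; exact: measurable_pball.
  by move=> z; rewrite ger0_norm; case/andP: (indic_bound (pball P y s) z).
apply: Rint_le => // y; apply: ler_wpM2r; first exact: pnorm_ge0.
rewrite !indicE; case: (boolP (y \in pball P x r)) => [/set_mem/sub h|_]; last by rewrite ler0n.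
by rewrite mem_set.
Qed.

(** Used twice: with [m = 4] for the regularity of the boundary, and with [m = 2], where the normal
    is 0, for the lower density bound. *)
Lemma generic_half_plane (x0 : plane) (rho eta m : R) : 0 < rho -> 0 < eta -> 3 * eta < 1 -> m <= 4 ->
  pball P x0 rho `<=` Omega ->
  (forall x, pball P x0 (eta * rho) x ->
    energy x ((1 - 2 * eta) * rho) < m * ((1 - 2 * eta) * rho - eta * rho)) ->
  exists x n0, [/\ pball P x (eta * rho) x0, pball P x (eta * rho) `<=` Omega, m <= 2 -> n0 = 0 &
    {ae mu, forall y, pball P x (eta * rho) y -> exists2 c : R, 0 <= c & (n1 y, n2 y) = c *: n0}].
Proof.
move=> rho0 eta0 eta3 m4 BO small; have [Wg _] := md.
have [x [r [xb x0b /andP[r1 r2] gp [m' mm jumps]]]] := generic_polygon p1 adm mE Wg rho0 eta0 eta3 BO small.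
have er0 : 0 < eta * rho by exact: mulr_gt0.
have r0 : 0 < r by exact: lt_trans r1.
have sum_le : eta * rho + r <= rho by exact: radius_sum.
have KO : [set y | forall i, (i < 5)%N -> gauge i (y - x) <= r] `<=` Omega.
  by move=> y hy; apply: BO; exact: (pball_in xb sum_le hy).
have m'4 : m' < 4 by exact: lt_le_trans m4.
have [n0 [n0P I0]] := half_plane_polygon p1 adm mE md r0 gp KO jumps m'4.
exists x, n0; split => //.
- by move=> y hy; apply: KO => i i5; apply: ltW; exact: lt_trans (hy i i5) r1.
- by move=> m2; apply: n0P; exact: lt_le_trans m2.
- by apply: direction_ae; exact: I0.
Qed.

Theorem boundary_regular (x0 : plane) (rho : R) : 0 < rho -> pball P x0 rho `<=` Omega -> bd x0 ->
  exists n0 U, [/\ n0 != 0, open U, U x0 &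
    forall y, U y -> bd y <-> n0.1 * (y - x0).1 + n0.2 * (y - x0).2 = 0].
Proof.
move=> rho0 BO b0; set k := 2^-1 * \sum_(i < 5) pnorm p (edge i).
have k4 : k < 4.
  have := polygon_perimeter adm; rewrite /k => h.
  have -> : (4 : R) = 2^-1 * 8 by field.
  by rewrite ltr_pM2l// invr_gt0.
have k0 : 0 <= k by rewrite mulr_ge0 ?invr_ge0// sumr_ge0// => i _; exact: pnorm_ge0.
(* [energy_bound] at radius [(1 - eta) * rho] gives [k * (1 - eta) * rho], which has to be less than
   [4 * (1 - 3 * eta) * rho]; this holds since [4 - k = 16 * eta > 12 * eta]. *)
pose eta := (4 - k) / 16.
have eta0 : 0 < eta by rewrite divr_gt0// subr_gt0.
have eta3 : 3 * eta < 1 by exact: radius_third.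
have etaE : 4 - k = 16 * eta by rewrite /eta; field.
have er0 : 0 < eta * rho by exact: mulr_gt0.
have small x : pball P x0 (eta * rho) x ->
    energy x ((1 - 2 * eta) * rho) < 4 * ((1 - 2 * eta) * rho - eta * rho).
  move=> hx; have KO : [set y | forall i, (i < 5)%N -> gauge i (y - x) <= (1 - eta) * rho] `<=` Omega.
    move=> y hy; apply: BO; apply: (pball_in hx _ hy).
    by rewrite -mulrDl addrCA subrr addr0 mul1r.
  have r1 : 0 < (1 - eta) * rho by rewrite mulr_gt0//; case: (radius_order eta0 eta3).
  have r2 : (1 - 2 * eta) * rho < (1 - eta) * rho by rewrite ltr_pM2r//; case: (radius_order eta0 eta3).
  apply: (le_lt_trans (energy_bound p1 adm mE md r1 r2 KO)); rewrite -/k -mulrBl mulrA [ltRHS]mulrA ltr_pM2r//.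
  exact: radius_energy.
have [x [n0 [Sx0 SO _ dir]]] := generic_half_plane rho0 eta0 eta3 (lexx _) BO small.
have n00 : n0 != 0 by apply/eqP => n00; exact: (no_boundary_point er0 SO dir n00 Sx0 b0).
exists n0, (pball P x (eta * rho)); split.
- exact: n00.
- exact: pball_open.
- exact: Sx0.
- by move=> y Sy; exact: (boundary_line er0 SO dir n00 Sx0 b0 Sy).
Qed.

Theorem lower_density (x0 : plane) (rho : R) : 0 < rho -> pball P x0 rho `<=` Omega -> bd x0 ->
  rho <= energy x0 rho.
Proof.
move=> rho0 BO b0; rewrite leNgt; apply/negP => lt.
(* Chosen so that [2 * ((1 - 2 * eta) - eta) = 1]. *)
pose eta : R := 6^-1.
have eta0 : 0 < eta by rewrite invr_gt0.
have eta3 : 3 * eta < 1 by rewrite /eta; lra.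
have er0 : 0 < eta * rho by exact: mulr_gt0.
have small x : pball P x0 (eta * rho) x ->
    energy x ((1 - 2 * eta) * rho) < 2 * ((1 - 2 * eta) * rho - eta * rho).
  move=> hx; apply: (@le_lt_trans _ _ (energy x0 rho)).
    apply: energy_le => y hy; apply: (pball_in hx (b := (1 - 2 * eta) * rho)).
      have -> : eta * rho + (1 - 2 * eta) * rho = rho - eta * rho by ring.
      by rewrite gerBl ltW.
    by move=> i i5; rewrite ltW//; exact: hy.
  have -> : 2 * ((1 - 2 * eta) * rho - eta * rho) = rho by rewrite /eta; field.
  exact: lt.
have m24 : (2 : R) <= 4 by rewrite ler_nat.
have [x [n0 [Sx0 SO n0P dir]]] := generic_half_plane rho0 eta0 eta3 m24 BO small.
exact: (no_boundary_point er0 SO dir (n0P (lexx _)) Sx0 b0).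
Qed.

End local_regularity.

(** * Absence of rays in the boundary *)

Section rays.
Context {R : realType} (p : R) (P : nat -> R * R).
Hypothesis p1 : 1 < p.
Local Notation plane := (R * R)%type.
Local Notation mplane := (measurableTypeR R * measurableTypeR R)%type.
Hypothesis adm : admissible_polygon P p.
Variables (Omega E : set plane) (mu : {finite_measure set mplane -> \bar R}) (n1 n2 : mplane -> R).
Hypothesis mE : measurable (E : set mplane).
Hypothesis md : minimal_data p Omega E mu n1 n2.
Hypotheses (oO : open Omega) (cO : convex_region Omega).
Local Notation energy x r := (\int[mu]_y (\1_(pball P x r) y * pnorm p (n1 y, n2 y))%R).

(* Along a ray in the boundary the distance to the complement of [Omega] does not
   decrease, so the ray carries infinitely many disjoint balls of equal size. *)
Lemma no_boundary_ray (x v : plane) : v != 0 ->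
  (forall t, 0 <= t -> measure_boundary_in Omega E (x + t *: v)) -> False.
Proof.
move=> v0 ray.
have Ox : Omega x by have [+ _] := ray 0 (lexx _); rewrite scale0r addr0.
have [e e0 eO] := open_square oO Ox.
pose rho := e / 4; have rho0 : 0 < rho by rewrite divr_gt0.
have rho2 : 2 * rho < e by rewrite /rho; lra.
have BO t : 0 <= t -> pball P (x + t *: v) rho `<=` Omega.
  move=> t0 z /(pball_box adm (ltW rho0))[z1 z2].
  (* [z] is the midpoint of a point near [x] and the point of the ray with parameter [2 * t]. The
     displacement from [x] is doubled, whence [2 * rho < e]. *)
  have -> : z = (x + 2 *: (z - (x + t *: v))) + 2^-1 *: ((x + (2 * t) *: v) - (x + 2 *: (z - (x + t *: v)))).
    by apply: injective_projections; rewrite /= /GRing.scale/=; field.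
  apply: cO.
  - have scale2 (a : R) : `|a| <= rho -> `|2 * a| < e.
      by move=> h; rewrite normrM ger0_norm//; apply: le_lt_trans rho2; rewrite ler_pM2l.
    by apply: eO; rewrite addrAC subrr add0r; exact: scale2.
  - by have [+ _] := ray (2 * t) ltac:(by rewrite mulr_ge0).
  - by rewrite invr_ge0 ler0n invf_le1// ler1n.
have low t : 0 <= t -> rho <= energy (x + t *: v) rho.
  by move=> t0; apply: (lower_density p1 adm mE md rho0 (BO t t0)); exact: ray.
have nv : 0 < `|v.1| + `|v.2|.
  rewrite lt0r addr_ge0// andbT; apply: contra v0; rewrite paddr_eq0// !normr_eq0 => /andP[/eqP h1 /eqP h2].
  by apply/eqP/injective_projections.
(* If two balls meet, their centres differ by at most [2 * rho] in each coordinate; with this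
   spacing the two differences add up to more than [4 * rho]. *)
pose D := (4 * rho + 1) / (`|v.1| + `|v.2|).
have D0 : 0 < D by rewrite divr_gt0// ltr_wpDl// mulr_ge0// ltW.
have DE : D * (`|v.1| + `|v.2|) = 4 * rho + 1 by rewrite /D divfK ?gt_eqF.
clearbody D.
pose c (k : nat) := x + (k%:R * D) *: v.
have disj j k z : (j < k)%N -> pball P (c j) rho z -> pball P (c k) rho z -> False.
  move=> jk /(pball_box adm (ltW rho0))[a1 a2] /(pball_box adm (ltW rho0))[b1 b2].
  have far (zi ji ki vi : R) : `|zi - ji| <= rho -> `|zi - ki| <= rho -> ki - ji = (k%:R - j%:R) * (D * vi) ->
      D * `|vi| <= 2 * rho.
    move=> h1 h2 kE; apply: (@le_trans _ _ ((k%:R - j%:R) * (D * `|vi|))).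
      have kj : 1 <= k%:R - j%:R :> R by rewrite lerBrDl natr1 ler_nat.
      by apply: ler_peMl => //; rewrite mulr_ge0// ltW.
    have kj0 : 0 <= k%:R - j%:R :> R by rewrite subr_ge0 ler_nat ltnW.
    have -> : (k%:R - j%:R) * (D * `|vi|) = `|ki - ji|.
      by rewrite kE !normrM (ger0_norm kj0) (gtr0_norm D0).
    by have := ler_distD zi ki ji; rewrite (distrC ki zi) => h; lra.
  have f1 := far z.1 (c j).1 (c k).1 v.1 a1 b1 ltac:(rewrite /c /= /GRing.scale/=; ring).
  have f2 := far z.2 (c j).2 (c k).2 v.2 a2 b2 ltac:(rewrite /c /= /GRing.scale/=; ring).
  have : D * (`|v.1| + `|v.2|) <= 4 * rho by rewrite mulrDr; lra.
  by rewrite DE; apply/negP; rewrite -ltNge ltrDl.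
have ipn : intg mu (fun y => pnorm p (n1 y, n2 y)).
  by have [[i1 i2 _] _] := md; exact: (intg_pnorm p1).
pose M := \int[mu]_y pnorm p (n1 y, n2 y).
have total N : N%:R * rho <= M.
  have ik k : (k < N)%N -> intg mu (fun y => \1_(pball P (c k) rho) y * pnorm p (n1 y, n2 y)).
    move=> _; apply: (@intgM _ _ _ _ 1) => //; first by apply: measurable_indic; exact: measurable_pball.
    by move=> z; rewrite ger0_norm; case/andP: (indic_bound (pball P (c k) rho) z).
  have [isum sumE] := Rint_sum ik.
  apply: (@le_trans _ _ (\sum_(k < N) energy (c k) rho)).
    rewrite mulr_natl -{1}(card_ord N) -sumr_const; apply: ler_sum => k _; apply: low.
    by rewrite mulr_ge0// ltW.
  apply: (le_subst (esym sumE) (erefl M)); apply: (Rint_le isum ipn) => y.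
  rewrite -mulr_suml ler_piMl ?pnorm_ge0//.
  have [[k ky]|none] := pselect (exists k : 'I_N, pball P (c k) rho y).
    rewrite (bigD1 k)//= big1 ?addr0; first by case/andP: (indic_bound (pball P (c k) rho) y).
    move=> j jk; rewrite indicE memNset// => jy.
    move: jk; rewrite neq_ltn => /orP[lt|lt]; first exact: (disj j k y lt jy ky).
    exact: (disj k j y lt ky jy).
  by rewrite big1// => k _; rewrite indicE memNset// => ky; apply: none; exists k.
have := Num.Theory.truncnS_gt (M / rho); rewrite ltr_pdivrMr//.
by rewrite ltNge total.
Qed.

End rays.

(** * Components of a relatively closed set that is locally a line *)

Section local_lines.
Context {R : realType}.
Local Notation plane := (R * R)%type.
Variables (Omega Gam : set plane).
Hypotheses (oO : open Omega) (cO : convex_region Omega).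
Hypothesis GO : Gam `<=` Omega.
Hypothesis closedG : forall y, Omega y -> closure Gam y -> Gam y.
Hypothesis localG : forall x0, Gam x0 -> exists n0 U, [/\ n0 != 0, open U, U x0 &
  forall y, U y -> Gam y <-> n0.1 * (y - x0).1 + n0.2 * (y - x0).2 = 0].
Hypothesis no_ray : forall x v : plane, v != 0 -> (forall t, 0 <= t -> Gam (x + t *: v)) -> False.

Section component.
Variables (x0 n : plane).
Hypotheses (Gx0 : Gam x0) (n_neq0 : n != 0).
Let dt (y : plane) : R := n.1 * y.1 + n.2 * y.2.
Variable U0 : set plane.
Hypotheses (oU0 : open U0) (U0x : U0 x0) (U0G : forall y, U0 y -> Gam y <-> dt (y - x0) = 0).
Let w : plane := (- n.2, n.1).
Let line (t : R) : plane := x0 + t *: w.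
Let I : set R := [set t | Omega (line t)].

Let nn0 : n.1 ^+ 2 + n.2 ^+ 2 != 0.
Proof.
apply: contra n_neq0; rewrite paddr_eq0 ?sqr_ge0// !sqrf_eq0 => /andP[/eqP h1 /eqP h2].
by apply/eqP/injective_projections.
Qed.

Let w_neq0 : w != 0.
Proof.
apply: contra nn0; rewrite /w => /eqP[/eqP + /eqP]; rewrite oppr_eq0 => /eqP -> /eqP ->.
by rewrite expr0n/= addr0.
Qed.

Let lineK y : dt (y - x0) = 0 -> exists t, y = line t.
Proof.
move=> h; exists (((y - x0).2 * n.1 - (y - x0).1 * n.2) / (n.1 ^+ 2 + n.2 ^+ 2)).
have h' : n.1 * (y.1 - x0.1) + n.2 * (y.2 - x0.2) = 0 by [].
apply: injective_projections; rewrite /line /w /= /GRing.scale/=.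
  have : n.1 * (n.1 * (y.1 - x0.1) + n.2 * (y.2 - x0.2)) = 0 by rewrite h' mulr0.
  move=> h1; apply: (mulfI nn0); rewrite mulrDr.
  have -> : (n.1 ^+ 2 + n.2 ^+ 2) * (((y.2 - x0.2) * n.1 - (y.1 - x0.1) * n.2) / (n.1 ^+ 2 + n.2 ^+ 2) * - n.2) =
    ((y.2 - x0.2) * n.1 - (y.1 - x0.1) * n.2) * - n.2 by field.
  by apply/eqP; rewrite -subr_eq0 -[X in _ == X]h1; apply/eqP; ring.
have : n.2 * (n.1 * (y.1 - x0.1) + n.2 * (y.2 - x0.2)) = 0 by rewrite h' mulr0.
move=> h1; apply: (mulfI nn0); rewrite mulrDr.
have -> : (n.1 ^+ 2 + n.2 ^+ 2) * (((y.2 - x0.2) * n.1 - (y.1 - x0.1) * n.2) / (n.1 ^+ 2 + n.2 ^+ 2) * n.1) =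
  ((y.2 - x0.2) * n.1 - (y.1 - x0.1) * n.2) * n.1 by field.
by apply/eqP; rewrite -subr_eq0 -[X in _ == X]h1; apply/eqP; ring.
Qed.

Let dt_line y t : dt (y - line t) = dt (y - x0).
Proof. by rewrite /dt /line /w /= /GRing.scale/=; ring. Qed.

Let dt_line0 t : dt (line t - x0) = 0.
Proof. by rewrite /dt /line /w /= /GRing.scale/=; ring. Qed.

Let cline : continuous line.
Proof.
move=> t; have -> : line = (fun t => (x0.1 + t * w.1, x0.2 + t * w.2)) by apply/funext => s.
have c (a b : R) : (fun t => a + t * b) @ t --> a + t * b.
  by apply: cvgD; [exact: cvg_cst|apply: cvgM; [exact: cvg_id|exact: cvg_cst]].
exact: (cvg_pair (c _ _) (c _ _)).
Qed.

Let oI : open I.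
Proof. by apply: open_comp => // t _; exact: cline. Qed.

Let I0 : I 0.
Proof. by rewrite /I /line /= scale0r addr0; exact: GO. Qed.

Let intI : is_interval I.
Proof.
move=> a b Ia Ib z /andP[az zb]; have [ab|ab] := eqVneq a b.
  by have -> : z = a by apply/eqP; rewrite eq_le az ab zb.
have ltab : 0 < b - a by rewrite subr_gt0 lt_neqAle ab (le_trans az).
rewrite /I /=; have -> : line z = line a + ((z - a) / (b - a)) *: (line b - line a).
  have -> : line b - line a = (b - a) *: w by rewrite /line opprD addrACA subrr add0r scalerBl.
  by rewrite scalerA divfK ?gt_eqF// /line -addrA -scalerDl addrCA subrr addr0.
apply: cO => //; rewrite divr_ge0 ?subr_ge0//=; last exact: (le_trans az).
by rewrite ler_pdivrMr// mul1r lerB.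
Qed.

Let tangent (y : plane) := exists U, [/\ open U, U y & forall z, U z -> Gam z <-> dt (z - x0) = 0].

Let open_tangent : open [set y | tangent y].
Proof.
rewrite openE => y [U [oU Uy UG]]; apply: (@filterS _ _ _ U); last exact: open_nbhs_nbhs.
by move=> z Uz; exists U.
Qed.

(** The parameters near whose points [Gam] is this same line form an open and closed part of the
    interval [I]. At a limit parameter [Gam] is locally some line, and it shares with the given one
    a second point nearby. *)
Let tangent_line t : I t -> tangent (line t).
Proof.
pose A := [set t | I t /\ tangent (line t)].
suff <- : A = I by case.
apply: (connected_intervalP I).2 => //.
- exists 0; split; first exact: I0.
  exists U0; split; [exact: oU0|by rewrite /line scale0r addr0|exact: U0G].
- exists [set t | tangent (line t)]; last by apply/seteqP; split.
  by apply: open_comp open_tangent => s _; exact: cline.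
exists (closure A); first exact: closed_closure.
apply/seteqP; split => s; first by move=> As; split; [case: As|exact: subset_closure].
move=> [Is cA]; split => //.
have GA r : A r -> Gam (line r) by move=> [_ [U [oU Ur UG]]]; apply/(UG _ Ur).
have Gs : Gam (line s).
  apply: closedG => // V /cline /cA[r [Ar Vr]]; exists (line r); split => //.
  exact: GA.
have [m [U [m0 oU Us UG]]] := localG Gs.
have [r [Ar Ur]] : (A `&` (line @^-1` U)) !=set0.
  by apply: cA; apply: cline; exact: open_nbhs_nbhs.
have [rs|rs] := eqVneq r s; first by rewrite -rs; case: Ar.
(* Two distinct points common to both lines make their normals [m] and [n] parallel. *)
have mw : m.1 * n.2 - m.2 * n.1 = 0.
  have := (UG _ Ur).1 (GA _ Ar); rewrite /line /w /= /GRing.scale/= => h.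
  apply: (mulfI (_ : s - r != 0)); first by rewrite subr_eq0 eq_sym.
  by rewrite mulr0 -[RHS]h; ring.
have mn : m.1 * n.1 + m.2 * n.2 != 0.
  apply/eqP => mn; move: m0 => /negP; apply; apply/eqP/injective_projections; apply: (mulfI nn0); rewrite mulr0.
    have -> : (n.1 ^+ 2 + n.2 ^+ 2) * m.1 = (m.1 * n.1 + m.2 * n.2) * n.1 + (m.1 * n.2 - m.2 * n.1) * n.2 by ring.
    by rewrite mn mw !mul0r addr0.
  have -> : (n.1 ^+ 2 + n.2 ^+ 2) * m.2 = (m.1 * n.1 + m.2 * n.2) * n.2 - (m.1 * n.2 - m.2 * n.1) * n.1 by ring.
  by rewrite mn mw !mul0r subr0.
have prop (z : plane) : (n.1 ^+ 2 + n.2 ^+ 2) * (m.1 * z.1 + m.2 * z.2) = (m.1 * n.1 + m.2 * n.2) * dt z.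
  have -> : (n.1 ^+ 2 + n.2 ^+ 2) * (m.1 * z.1 + m.2 * z.2) =
    (m.1 * n.1 + m.2 * n.2) * dt z + (m.1 * n.2 - m.2 * n.1) * (n.2 * z.1 - n.1 * z.2) by rewrite /dt; ring.
  by rewrite mw mul0r addr0.
exists U; split => // z Uz; apply: (iff_trans (UG z Uz)); rewrite -(dt_line z s); have hz := prop (z - line s).
split => h; move: hz; rewrite h mulr0.
  by move/esym/eqP; rewrite mulf_eq0 (negbTE mn)/= => /eqP.
by move/eqP; rewrite mulf_eq0 (negbTE nn0)/= => /eqP.
Qed.

Let Gline t : I t -> Gam (line t).
Proof. by move=> /tangent_line[U [_ Ut UG]]; apply/(UG _ Ut). Qed.

(** The points of the component on the line form a closed part of it, and an open one because near
    each of them [Gam] is that line; connectedness does the rest. *)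
Let componentE : connected_component Gam x0 = line @` I.
Proof.
have Kx0 : (line @` I) x0 by exists 0 => //; rewrite /line scale0r addr0.
apply/seteqP; split; last first.
  apply: connected_component_max => //; first by move=> _ [t It <-]; exact: Gline.
  apply: connected_continuous_connected; first by apply: (connected_intervalP I).2; exact: intI.
  by apply: continuous_subspaceT; exact: cline.
set C := connected_component Gam x0.
have CG : C `<=` Gam := @connected_component_sub _ _ _.
have inK y : C y -> dt (y - x0) = 0 -> exists2 t, I t & line t = y.
  by move=> Cy /lineK[t yE]; exists t; rewrite -?yE// /I /= -yE; exact/GO/CG.
suff CE : C `&` [set y | dt (y - x0) = 0] = C by move=> y; rewrite -CE => -[Cy /(inK _ Cy)[t It tE]]; exists t.
apply: component_connected.
- exists x0; split; first exact: connected_component_refl.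
  by rewrite /= /dt subrr /= !mulr0 addr0.
- exists [set y | tangent y] => //; apply/seteqP; split => y [Cy h]; split => //.
    by have [t It <-] := inK _ Cy h; exact: tangent_line.
  by case: h => U [_ Uy UG]; apply/(UG _ Uy); exact: CG.
- exists [set y | dt (y - x0) = 0] => //.
  have cd : continuous (fun y : plane => dt (y - x0)).
    have -> : (fun y : plane => dt (y - x0)) = (fun y : plane => n.1 * y.1 + n.2 * y.2 + dt (- x0)).
      by apply/funext => y; rewrite /dt /=; ring.
    exact: continuous_affine2.
  by apply: (@closed_comp _ _ (fun y : plane => dt (y - x0)) [set 0]) => // y _; exact: cd.
Qed.

(** If [I] were unbounded in the direction [s], being an interval containing 0 it would give a ray
    in [Gam]. *)
Let bounded_above (s : R) : s = 1 \/ s = -1 -> exists M, forall t, I t -> s * t <= M.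
Proof.
move=> s1; have s0 : s != 0 by case: s1 => ->; rewrite ?oppr_eq0 oner_eq0.
have ss : s * s = 1 by case: s1 => ->; rewrite ?mulrNN mulr1.
apply: contrapT => H; apply: (no_ray (x := x0) (v := s *: w)); first by rewrite scaler_eq0 negb_or s0.
move=> t t0; rewrite scalerA [t * s]mulrC; apply: Gline.
have [t' It' tt'] : exists2 t', I t' & t < s * t'.
  apply: contrapT => N; apply: H; exists t => t' It'; rewrite leNgt; apply/negP => tt'.
  by apply: N; exists t'.
case: s1 => sE; move: tt'; rewrite sE ?mulN1r ?mul1r => tt'.
  by apply: (intI I0 It'); rewrite t0 ltW.
by apply: (intI It' I0); rewrite oppr_le0 t0 andbT lerNr ltW.
Qed.

(** [I] is a bounded open interval; its infimum and supremum are the parameters of the two ends. *)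
Lemma component_segment : line_segment (connected_component Gam x0).
Proof.
have [M1 hM1] := bounded_above (or_introl erefl).
have [M2 hM2] := bounded_above (or_intror erefl).
have ub : has_ubound I by exists M1 => t /hM1; rewrite mul1r.
have lb : has_lbound I by exists (- M2) => t /hM2; rewrite mulN1r lerNl.
have In : I !=set0 by exists 0.
have ltab : inf I < sup I.
  have /nbhs_ballP[e /= e0 eI] : nbhs (0 : R) I by exact: open_nbhs_nbhs.
  have Ie : I (e / 2).
    by apply: eI; rewrite /ball /= sub0r normrN gtr0_norm ?divr_gt0// ltr_pdivrMr// ltr_pMr// ltr1n.
  apply: (@le_lt_trans _ _ 0); first exact: ge_inf.
  by apply: (@lt_le_trans _ _ (e / 2)); [exact: divr_gt0|exact: ub_le_sup].
have mix a b t : (1 - t) *: line a + t *: line b = line ((1 - t) * a + t * b).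
  by apply: injective_projections; rewrite /line /= /GRing.scale/=; ring.
rewrite componentE; exists (line (inf I)), (line (sup I)); split.
- rewrite /line -subr_eq0 opprD addrACA subrr add0r -scalerBl scaler_eq0 negb_or w_neq0 andbT.
  by rewrite subr_eq0 lt_eqF.
- move=> _ [t /= + <-]; rewrite in_itv/= => /andP[t0 t1]; rewrite mix.
  have E1 : (1 - t) * inf I + t * sup I = inf I + t * (sup I - inf I) by ring.
  have E2 : (1 - t) * inf I + t * sup I = sup I - (1 - t) * (sup I - inf I) by ring.
  have d0 : 0 < sup I - inf I by rewrite subr_gt0.
  have [i1 Ii1 h1] : exists2 i, I i & i < (1 - t) * inf I + t * sup I.
    by apply: inf_lt => //; rewrite E1 ltrDl mulr_gt0.
  have [i2 Ii2 h2] : exists2 i, I i & (1 - t) * inf I + t * sup I < i.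
    by apply: sup_gt => //; rewrite E2 gtrBl mulr_gt0// subr_gt0.
  by eexists; last reflexivity; apply: (intI Ii1 Ii2); rewrite !ltW.
- move=> _ [s Is <-]; have d0 : sup I - inf I != 0 by rewrite subr_eq0 gt_eqF.
  have h1 : inf I <= s by exact: ge_inf.
  have h2 : s <= sup I by exact: ub_le_sup.
  exists ((s - inf I) / (sup I - inf I)).
    rewrite /= in_itv/= divr_ge0 ?subr_ge0 ?(ltW ltab)//=.
    by rewrite ler_pdivrMr ?subr_gt0// mul1r lerB.
  by rewrite mix; congr line; field.
Qed.

End component.

Lemma line_segment_component x0 : Gam x0 -> line_segment (connected_component Gam x0).
Proof.
move=> Gx0; have [n [U [n0 oU Ux UG]]] := localG Gx0.
exact: (component_segment Gx0 n0 oU Ux UG).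
Qed.

End local_lines.

Lemma convex_set_region (R : realType) (Omega : set (R * R)) :
  @convex_set R (R * R)%type Omega -> convex_region Omega.
Proof.
move=> cO x y t Ox Oy /andP[t0 t1].
have -> : x + t *: (y - x) = t *: y + (1 - t) *: x.
  by apply: injective_projections; rewrite /= /GRing.scale/=; ring.
exact: set_mem (cO y x (Itv01 t0 t1) (mem_set Oy) (mem_set Ox)).
Qed.

Theorem theorem1p3 (R : realType) (Omega : set (R * R)) (p : R) (E : set (R * R))
  (openOmega : open Omega) (convexOmega : convex_set Omega)
  (p_gt1 : 1 < p)
  (mE : measurable E)
  (reprE : boundary_in Omega E = measure_boundary_in Omega E)
  (minE : minimal_set (fun _ xi => pnorm p xi) Omega E) :
  forall x, boundary_in Omega E x ->
    line_segment (connected_component (boundary_in Omega E) x).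
Proof.
have [bvE _] := minE.
have md : minimal_data p Omega E (gradient_variation Omega (\1_E : R * R -> R))
    (density1 Omega (\1_E : R * R -> R)) (density2 Omega (\1_E : R * R -> R)).
  split; first by have [] := indic_weak_grad p_gt1 openOmega mE bvE.
  by move=> t tx ty g gx gy Ct st t01 Cg _; exact: (minimal_star p_gt1 openOmega mE minE).
have adm := pentagon_admissible p_gt1.
have cO := convex_set_region convexOmega.
apply: (line_segment_component openOmega cO).
- by move=> y [[]].
- move=> y Oy cy.
  have cl (X : set (R * R)) : boundary_in Omega E `<=` closure X -> closure X y.
    move=> BX; rewrite ((closure_id (closure X)).1 (@closed_closure _ X)); exact: closureS BX _ cy.
  by split; [split => //; apply: cl => z [[]]|apply: cl => z []].
- rewrite reprE => x0 bx; have [Ox _] := bx; have [e e0 eO] := open_square openOmega Ox.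
  have e2 : 0 < e / 2 by rewrite divr_gt0.
  have lt : e / 2 < e by rewrite ltr_pdivrMr// ltr_pMr// ltr1n.
  apply: (boundary_regular p_gt1 adm mE md e2 _ bx) => z /(pball_box adm (ltW e2))[z1 z2].
  by apply: eO; [exact: le_lt_trans lt|exact: le_lt_trans lt].
- by rewrite reprE => x v v0; exact: (no_boundary_ray p_gt1 adm mE md openOmega cO v0).
Qed.
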